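(* Let $n\ge 3$ be odd and let $d_1,\dots,d_n$ be positive integers with $\sum_{i=1}^n1/d_i<1$. Let $s>0$ and $c_1=(d_{\max}^2s)^{1/d_1}$, $c_i=s^{1/d_i}c_{i-1}$ for $2\le i\le n-1$. If $s>0$ is small enough, there exist numbers $S_n,T_n$ such that the Julia set of $R_{d_1,\dots,d_n}$ is a Cantor set of circles and $R_{d_1,\dots,d_n}$ has a parabolic periodic orbit of period two (with multiplier $1$) and two simply connected periodic parabolic Fatou components of period two.
   Context: $d_{\max}:=\max_i d_i$, $D_i:=d_i+d_{i+1}$. $R_{d_1,\dots,d_n}(z)=\frac{S_n}{z^{d_n}}\prod_{i=1}^{n-1}(z^{D_i}-c_i^{D_i})^{(-1)^i}+T_n$. A Cantor set of circles is a subset of $\widehat{\mathbb{C}}$ homeomorphic to $\mathcal{C}\times\mathbb{S}^1$, $\mathcal{C}$ the middle-third Cantor set. *)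

(* Defs.v *)
From Stdlib Require Import Reals Lra Lia.
Open Scope R_scope.

Definition Cx := (R * R)%type.
Definition C0 : Cx := (0, 0).
Definition C1 : Cx := (1, 0).
Definition RtoC (x : R) : Cx := (x, 0).
Definition Cadd (z w : Cx) : Cx := (fst z + fst w, snd z + snd w).
Definition Copp (z : Cx) : Cx := (- fst z, - snd z).
Definition Csub (z w : Cx) : Cx := Cadd z (Copp w).
Definition Cmul (z w : Cx) : Cx :=
  (fst z * fst w - snd z * snd w, fst z * snd w + snd z * fst w).
Definition Cnorm2 (z : Cx) : R := fst z ^ 2 + snd z ^ 2.
Definition Cnorm (z : Cx) : R := sqrt (Cnorm2 z).
Definition Cinv (z : Cx) : Cx := (fst z / Cnorm2 z, - snd z / Cnorm2 z).
Definition Cdiv (z w : Cx) : Cx := Cmul z (Cinv w).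
Fixpoint Cpow (z : Cx) (k : nat) : Cx :=
  match k with O => C1 | S k' => Cmul z (Cpow z k') end.

Definition Ceq_dec (z w : Cx) : {z = w} + {z <> w}.
Proof.
  destruct z as [a b], w as [c d].
  destruct (Req_dec_T a c) as [H1|H1]; [destruct (Req_dec_T b d) as [H2|H2]|].
  - left; subst; reflexivity.
  - right; intros H; inversion H; contradiction.
  - right; intros H; inversion H; contradiction.
Defined.

(* ---------- the Riemann sphere: None = infinity, chordal metric ---------- *)
Definition sphere := option Cx.
Definition chordal (p q : sphere) : R :=
  match p, q with
  | Some z, Some w => 2 * Cnorm (Csub z w) / sqrt ((1 + Cnorm2 z) * (1 + Cnorm2 w))
  | Some z, None => 2 / sqrt (1 + Cnorm2 z)
  | None, Some w => 2 / sqrt (1 + Cnorm2 w)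
  | None, None => 0
  end.

Fixpoint sum_upto (f : nat -> R) (m : nat) : R :=
  match m with O => 0 | S m' => sum_upto f m' + f (S m') end.
Fixpoint Cprod_upto (f : nat -> Cx) (m : nat) : Cx :=
  match m with O => C1 | S m' => Cmul (Cprod_upto f m') (f (S m')) end.
Fixpoint max_upto (f : nat -> nat) (m : nat) : nat :=
  match m with O => O | S m' => Nat.max (max_upto f m') (f (S m')) end.

Definition dmax (n : nat) (d : nat -> nat) : nat := max_upto d n.
Definition Dd (d : nat -> nat) (i : nat) : nat := (d i + d (S i))%nat.

Fixpoint cseq (n : nat) (d : nat -> nat) (s : R) (i : nat) : R :=
  match i with
  | O => 0
  | S O => Rpower (INR (dmax n d) ^ 2 * s) (/ INR (d 1%nat))
  | S (S _ as j) => Rpower s (/ INR (d i)) * cseq n d s j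
  end.

Definition Rfactor n d s (z : Cx) (i : nat) : Cx :=
  Csub (Cpow z (Dd d i)) (RtoC (cseq n d s i ^ Dd d i)).

(* factors with exponent (-1)^i = +1 (i even) go to the numerator,
   those with exponent -1 (i odd) and z^{d_n} go to the denominator *)
Definition Rnum n d s (Sn : Cx) (z : Cx) : Cx :=
  Cmul Sn (Cprod_upto (fun i => if Nat.even i then Rfactor n d s z i else C1) (n - 1)).
Definition Rden n d s (z : Cx) : Cx :=
  Cmul (Cpow z (d n))
       (Cprod_upto (fun i => if Nat.even i then C1 else Rfactor n d s z i) (n - 1)).

(* R_{d_1..d_n} as a self-map of the sphere: poles go to infinity, and
   (n odd: deg den = deg num + d_1 > deg num) infinity goes to T_n *)
Definition Rmap n d s (Sn Tn : Cx) (p : sphere) : sphere :=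
  match p with
  | None => Some Tn
  | Some z =>
      if Ceq_dec (Rden n d s z) C0 then None
      else Some (Cadd (Cdiv (Rnum n d s Sn z) (Rden n d s z)) Tn)
  end.

Fixpoint iter (F : sphere -> sphere) (k : nat) (p : sphere) : sphere :=
  match k with O => p | S k' => F (iter F k' p) end.

Definition ball (p : sphere) (r : R) : sphere -> Prop := fun q => chordal p q < r.

Definition open_set (U : sphere -> Prop) : Prop :=
  forall p, U p -> exists r, 0 < r /\ forall q, chordal p q < r -> U q.

Definition lu_conv (G : nat -> sphere -> sphere) (g : sphere -> sphere)
  (U : sphere -> Prop) : Prop :=
  forall p, U p -> exists r, 0 < r /\ (forall q, chordal p q < r -> U q) /\
    forall eps, 0 < eps -> exists N, forall j, (N <= j)%nat ->
      forall q, chordal p q < r -> chordal (G j q) (g q) < eps.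

Definition normal_iter (F : sphere -> sphere) (U : sphere -> Prop) : Prop :=
  forall m : nat -> nat, exists phi : nat -> nat,
    (forall j, (phi j < phi (S j))%nat) /\
    exists g, lu_conv (fun j => iter F (m (phi j))) g U.

Definition Fatou (F : sphere -> sphere) (p : sphere) : Prop :=
  exists r, 0 < r /\ normal_iter F (ball p r).
Definition Julia (F : sphere -> sphere) (p : sphere) : Prop := ~ Fatou F p.

Definition cantor (x : R) : Prop :=
  exists a : nat -> bool,
    infinite_sum (fun k => (if a k then 2 else 0) / 3 ^ (S k)) x.
Definition circle (u : R * R) : Prop := fst u ^ 2 + snd u ^ 2 = 1.
Definition CxS1 (p : R * (R * R)) : Prop := cantor (fst p) /\ circle (snd p).
Definition dist3 (p q : R * (R * R)) : R :=
  sqrt ((fst p - fst q) ^ 2 + (fst (snd p) - fst (snd q)) ^ 2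
        + (snd (snd p) - snd (snd q)) ^ 2).

Definition cantor_circles (J : sphere -> Prop) : Prop :=
  exists h : R * (R * R) -> sphere,
    (forall p, CxS1 p -> J (h p)) /\
    (forall y, J y -> exists p, CxS1 p /\ h p = y) /\
    (forall p q, CxS1 p -> CxS1 q -> h p = h q -> p = q) /\
    (forall p, CxS1 p -> forall eps, 0 < eps -> exists delta, 0 < delta /\
        forall q, CxS1 q -> dist3 p q < delta -> chordal (h p) (h q) < eps) /\
    (forall p, CxS1 p -> forall eps, 0 < eps -> exists delta, 0 < delta /\
        forall q, CxS1 q -> chordal (h p) (h q) < delta -> dist3 p q < eps).

Definition loc (p x : sphere) : Cx :=
  match p, x with
  | Some a, Some z => Csub z a
  | None, Some z => Cinv z
  | _, None => C0
  end.
Definition chart (p : sphere) (w : Cx) : sphere :=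
  match p with
  | Some a => Some (Cadd a w)
  | None => if Ceq_dec w C0 then None else Some (Cinv w)
  end.
Definition multiplier (G : sphere -> sphere) (p : sphere) (lam : Cx) : Prop :=
  G p = p /\
  forall eps, 0 < eps -> exists delta, 0 < delta /\
    forall w, 0 < Cnorm w < delta ->
      Cnorm (Csub (loc p (G (chart p w))) (Cmul lam w)) <= eps * Cnorm w.

Definition parabolic_2orbit (F : sphere -> sphere) : Prop :=
  exists p0 p1, p0 <> p1 /\ F p0 = p1 /\ F p1 = p0 /\ multiplier (iter F 2) p0 C1.

Definition set_eq (A B : sphere -> Prop) : Prop := forall p, A p <-> B p.
Definition image (F : sphere -> sphere) (A : sphere -> Prop) : sphere -> Prop :=
  fun q => exists p, A p /\ F p = q.

Definition connected (A : sphere -> Prop) : Prop :=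
  ~ exists O1 O2, open_set O1 /\ open_set O2 /\
      (forall p, A p -> O1 p \/ O2 p) /\
      (exists p, A p /\ O1 p) /\ (exists p, A p /\ O2 p) /\
      (forall p, A p -> O1 p -> O2 p -> False).

Definition Fatou_component (F : sphere -> sphere) (U : sphere -> Prop) : Prop :=
  (exists p, U p) /\ (forall p, U p -> Fatou F p) /\ connected U /\
  forall A, connected A -> (forall p, A p -> Fatou F p) ->
    (exists p, A p /\ U p) -> forall p, A p -> U p.

Definition period_two_comp (F : sphere -> sphere) (U : sphere -> Prop) : Prop :=
  set_eq (image F (image F U)) U /\ ~ set_eq (image F U) U.

Definition boundary (U : sphere -> Prop) (q : sphere) : Prop :=
  ~ U q /\ forall r, 0 < r -> exists p, U p /\ chordal q p < r.

Definition parabolic_comp2 (F : sphere -> sphere) (U : sphere -> Prop) : Prop :=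
  exists q, boundary U q /\ multiplier (iter F 2) q C1 /\
    lu_conv (fun k => iter F (2 * k)) (fun _ => q) U.

Definition path_cont (g : R -> sphere) : Prop :=
  forall t, 0 <= t <= 1 -> forall eps, 0 < eps -> exists delta, 0 < delta /\
    forall t', 0 <= t' <= 1 -> Rabs (t - t') < delta -> chordal (g t) (g t') < eps.
Definition homot_cont (H : R -> R -> sphere) : Prop :=
  forall s t, 0 <= s <= 1 -> 0 <= t <= 1 -> forall eps, 0 < eps ->
    exists delta, 0 < delta /\
    forall s' t', 0 <= s' <= 1 -> 0 <= t' <= 1 ->
      Rabs (s - s') < delta -> Rabs (t - t') < delta ->
      chordal (H s t) (H s' t') < eps.

Definition simply_connected (U : sphere -> Prop) : Prop :=
  connected U /\
  forall g : R -> sphere,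
    (forall t, 0 <= t <= 1 -> U (g t)) -> path_cont g -> g 0 = g 1 ->
    exists H : R -> R -> sphere,
      (forall s t, 0 <= s <= 1 -> 0 <= t <= 1 -> U (H s t)) /\
      homot_cont H /\
      (forall t, 0 <= t <= 1 -> H 0 t = g t) /\
      (forall s, 0 <= s <= 1 -> H s 0 = H s 1) /\
      (forall t, 0 <= t <= 1 -> H 1 t = H 1 0).

(* Main.v *)
(** Write [w = exp z]. Away from [n - 1] gaps of bounded width around the circles [|w| = c_i], the map
 is [exp z |-> T + exp (m_i z + kap_i + eps_i z)] on the [i]-th strip, where [|m_i| = d_i] and [eps_i] is tiny
 together with its derivative. The constants [S] and [T] are found by the intermediate value theorem so
 that two real points [exp x], [exp y] form a 2-cycle of multiplier 1.

 A union of two slightly tilted discs through [exp x], invariant under the second iterate, is absorbed by the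
 parabolic point, and every gap is mapped into it within two steps. On the complement [Om] of the
 petals (in the coordinate [z]) the [n] inverse branches have disjoint images and are eventually contracting
 for the Euclidean metric [rho] of the coordinate [log (w - T)]; the contraction degenerates only at the
 parabolic point. Infinite words in [n] letters thus code closed curves, the word and
 the angle give a homeomorphism from (Cantor set) x (circle) onto the set of points staying in [Om], and
 this set is the Julia set, since angles are multiplied by at least 2 at each step.

 The periodic components consist of the basin points alternating between the disc around 0 and the disc
 around infinity. They are exhausted by iterated preimages of the closed petal; the radial retraction onto
 the petal lifts through the inverse branches and contracts every loop. *)

(* The condition on the sum of the reciprocals leaves room, on the scale of logarithms of moduli,
   for a cycle with [exp x] well inside all the circles and [exp y] well outside them. With
   [y = w/exp x], the second iterate near the inner point is a tiny perturbation of
   [y |-> (1-th)+th*y^N], where [N = d_1 d_n] and [th] is close to [1/N]. The obstacle is the lack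
   of expansion at the fixed point 1. In the coordinate [log (w-T)] the branches are affine up to
   exponentially small errors, so the balance is explicit: passing from [log w] to [log (w-T)] costs
   up to about [1/th], while a pair of steps gains about [N], and the two balance only at the
   parabolic point. What remains is a gain quadratic in the distance. It has no geometric rate, but
   it brings any two points of bounded distance together, uniformly in the word. The tilt of the
   discs makes this gain linear in the distance to the parabolic point, so that it outweighs the
   errors. Their size [exp (-gam)] is fixed from the degrees alone, before [s] is chosen. *)
From Stdlib Require Import Reals Lra Lia ZArith ClassicalEpsilon FunctionalExtensionality Ranalysis5 Bool.
Require Import Defs.
From Coquelicot Require Import Rcomplements Complex.
Open Scope R_scope.

Tactic Notation "have" simple_intropattern(p) ":=" lconstr(t) := pose proof t as p.
Tactic Notation "have" ":=" lconstr(t) := pose proof t.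
Tactic Notation "have" simple_intropattern(p) ":" lconstr(t) "by" tactic3(tac) := assert t as p by tac.
Tactic Notation "have" simple_intropattern(p) ":" lconstr(t) := assert t as p.
Tactic Notation "have" ":" lconstr(t) "by" tactic3(tac) := assert t by tac.
Tactic Notation "have" ":" lconstr(t) := assert t.
Tactic Notation "le_trans" open_constr(t) := eapply Rle_trans; [apply t|].
Ltac mono := first [apply Rmult_le_compat_l; lra|apply Rmult_le_compat_r; lra].
Arguments Cmod _%_C_scope.
Arguments Re _%_C_scope.
Arguments Im _%_C_scope.

Lemma lt_min_l {a b c : R} : a < Rmin b c -> a < b.
Proof. intros H. exact (Rlt_le_trans _ _ _ H (Rmin_l _ _)). Qed.

Lemma lt_min_r {a b c : R} : a < Rmin b c -> a < c.
Proof. intros H. exact (Rlt_le_trans _ _ _ H (Rmin_r _ _)). Qed.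

Lemma fun_choice {A B : Type} (P : A -> B -> Prop) : (forall a, exists b, P a b) -> exists f, forall a, P a (f a).
Proof.
 intros H. exists (fun a => proj1_sig (constructive_indefinite_description _ (H a))). intros a. apply proj2_sig.
Qed.

(** * Complex exponential and differentiability *)

Lemma C_ext z w : Re z = Re w -> Im z = Im w -> z = w.
Proof. destruct z, w; simpl; intros; subst; auto. Qed.

Lemma Cmod_minus_le a b : Cmod (a-b) <= Cmod a+Cmod b.
Proof. rewrite <- (Cmod_opp b). apply Cmod_triangle. Qed.

Lemma Cmod_sym a b : Cmod (a-b) = Cmod (b-a).
Proof. rewrite <- Cmod_opp. f_equal. ring. Qed.

Lemma Cmod_dist_triangle a b c : Cmod (a-c) <= Cmod (a-b)+Cmod (b-c).
Proof. replace (a-c)%C with ((a-b)+(b-c))%C by ring. apply Cmod_triangle. Qed.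

Lemma Cmod_reverse a b : Cmod a-Cmod b <= Cmod (a-b).
Proof.
 have H := Cmod_triangle (a-b)%C b. replace (a-b+b)%C with a in H by ring. lra.
Qed.

Lemma Cmod_Im_le c : Rabs (Im c) <= Cmod c.
Proof.
 eapply Rle_trans; [|apply (Rmax_Cmod c)]. apply Rmax_r.
Qed.

Lemma Cmod_le_Re_Im c : Cmod c <= Rabs (Re c)+Rabs (Im c).
Proof.
 destruct c as [a b]. replace ((a, b) : C) with (a+Ci*b)%C by (apply C_ext; simpl; ring).
 le_trans Cmod_triangle. rewrite Cmod_mult, Cmod_Ci, !Cmod_R. simpl.
 replace (a+(0*b-1*0)) with a by ring. replace (0+(0*0+1*b)) with b by ring. lra.
Qed.

Lemma Cmod_sqr c : Cmod c*Cmod c = Re c*Re c+Im c*Im c.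
Proof.
 unfold Cmod. rewrite sqrt_sqrt; [unfold Re, Im; ring|nra].
Qed.

Lemma Cmod_le_sqr c r : 0 <= r -> Re c*Re c+Im c*Im c <= r*r -> Cmod c <= r.
Proof.
 intros Hr H. rewrite <- Cmod_sqr in H. nra.
Qed.

Lemma Cmod_pos_R x : 0 <= x -> Cmod (RtoC x) = x.
Proof. intros. rewrite Cmod_R. apply Rabs_pos_eq; trivial. Qed.

Lemma Cmod_zero_eq a b : Cmod (a-b) <= 0 -> a = b.
Proof.
 intros H. apply Ceq_minus, Cmod_eq_0. have := Cmod_ge_0 (a-b)%C. lra.
Qed.

Lemma exists_INR_gt M : exists n : nat, M < INR n.
Proof.
 destruct (INR_unbounded M) as [n Hn]. exists n. auto.
Qed.

Definition iI (y: R) : C := (0, y).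
Notation turn k := (iI (2*PI*IZR k)).
Definition Cexp (z: C) : C := (exp (Re z)*cos (Im z), exp (Re z)*sin (Im z)).

Lemma Cexp_0 : Cexp 0 = 1.
Proof. apply C_ext; unfold Re, Im; simpl; rewrite exp_0, ?cos_0, ?sin_0; ring.
Qed.

Lemma Cexp_plus z w : Cexp (z+w) = (Cexp z*Cexp w)%C.
Proof.
 unfold Cexp. apply C_ext; unfold Re, Im; simpl; rewrite exp_plus, ?cos_plus, ?sin_plus; ring.
Qed.

Lemma Cmod_Cexp z : Cmod (Cexp z) = exp (Re z).
Proof.
 unfold Cmod, Cexp; simpl fst; simpl snd. replace ((exp (Re z)*cos (Im z))^2+(exp (Re z)*sin (Im z))^2)
  with (Rsqr (exp (Re z))).
 - apply sqrt_Rsqr. left; apply exp_pos.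
 - have := sin2_cos2 (Im z). unfold Rsqr in *.
  transitivity (exp (Re z)*exp (Re z)*(sin (Im z)*sin (Im z)+cos (Im z)*cos (Im z))); [rewrite H|]; ring.
Qed.

Lemma Cexp_neq0 z : Cexp z <> 0.
Proof.
 apply Cmod_gt_0. rewrite Cmod_Cexp. apply exp_pos.
Qed.

Lemma Cexp_opp z : Cexp (- z) = (/ Cexp z)%C.
Proof.
 have H: (Cexp z*Cexp (- z) = 1)%C.
 { rewrite <- Cexp_plus, Cplus_opp_r. apply Cexp_0. }
 have := Cexp_neq0 z. replace (Cexp (-z)) with (/ Cexp z*(Cexp z*Cexp (-z)))%C by (field; auto).
 rewrite H. field; auto.
Qed.

Lemma Cexp_minus z w : Cexp (z-w) = (Cexp z/Cexp w)%C.
Proof. unfold Cminus. rewrite Cexp_plus, Cexp_opp. auto. Qed.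

Lemma Cexp_R x : Cexp (RtoC x) = RtoC (exp x).
Proof. apply C_ext; unfold Re, Im; simpl; rewrite ?cos_0, ?sin_0; ring. Qed.

Lemma cos_sin_Zperiod x k : cos (x+2*PI*IZR k) = cos x /\ sin (x+2*PI*IZR k) = sin x.
Proof.
 have Hn: forall (n: nat) y, cos (y+2*PI*INR n) = cos y /\ sin (y+2*PI*INR n) = sin y.
 { intros n y. replace (2*PI*INR n) with (2*INR n*PI) by ring. split; [apply cos_period|apply sin_period]. }
 destruct (Z_le_gt_dec 0 k) as [H|H].
 - rewrite <- (Z2Nat.id k) by lia. rewrite <- INR_IZR_INZ. apply Hn.
 - destruct (Hn (Z.to_nat (-k)) (x+2*PI*IZR k)) as [H1 H2]. rewrite INR_IZR_INZ, Z2Nat.id, opp_IZR in H1, H2 by lia.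
  replace (x+2*PI*IZR k+2*PI * - IZR k) with x in H1, H2 by ring. split; symmetry; auto.
Qed.

Lemma Cexp_period z k : Cexp (z+turn k) = Cexp z.
Proof.
 destruct (cos_sin_Zperiod (Im z) k) as [H1 H2]. unfold Im in H1, H2.
 apply C_ext; unfold Re, Im; simpl; rewrite ?H1, ?H2, ?Rplus_0_r; auto.
Qed.

Lemma Cexp_eq_1 z : Cexp z = 1 -> exists k : Z, z = turn k.
Proof.
 intros H. have Hr: exp (Re z) = 1.
 { rewrite <- Cmod_Cexp, H. apply Cmod_1. }
 have Ha: Re z = 0.
 { apply exp_inv. rewrite Hr, exp_0. auto. }
 unfold Cexp in H. rewrite Hr in H. injection H; intros Hs Hc. rewrite Rmult_1_l in Hs, Hc.
 destruct (sin_eq_0_0 _ Hs) as [k Hk]. destruct (Z.Even_or_Odd k) as [[j Hj]|[j Hj]].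
 - exists j. apply C_ext; simpl; [auto|]. rewrite Hk, Hj, mult_IZR. ring.
 - rewrite Hk, Hj, plus_IZR, mult_IZR in Hc. replace ((2*IZR j+1)*PI) with (PI+2*PI*IZR j) in Hc by ring.
  rewrite (proj1 (cos_sin_Zperiod PI j)), cos_PI in Hc. lra.
Qed.

Lemma Cexp_eq z w : Cexp z = Cexp w -> exists k : Z, z = (w+turn k)%C.
Proof.
 intros H. destruct (Cexp_eq_1 (z-w)) as [k Hk].
 - rewrite Cexp_minus, H. field. apply Cexp_neq0.
 - exists k. rewrite <- Hk. ring.
Qed.

Lemma circle_angle a b : a*a+b*b = 1 -> exists t, a = cos t /\ b = sin t.
Proof.
 intros H. have Ha: -1 <= a <= 1 by (split; nra). destruct (Rle_dec 0 b) as [Hb|Hb].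
 - exists (acos a). rewrite cos_acos, sin_acos by lra. split; [auto|].
  replace (1-a²) with (b²) by (unfold Rsqr; lra). rewrite sqrt_Rsqr; lra.
 - exists (- acos a). rewrite cos_neg, sin_neg, cos_acos, sin_acos by lra. split; [auto|].
  replace (1-a²) with ((-b)²) by (unfold Rsqr; lra). rewrite sqrt_Rsqr; lra.
Qed.

Lemma Cexp_surj (z: C) : z <> 0 -> exists w, Cexp w = z.
Proof.
 intros Hz. have H := proj1 (Cmod_gt_0 z) Hz. destruct (circle_angle (Re z/Cmod z) (Im z/Cmod z)) as (t&H1&H2).
 - have := Cmod_sqr z. field_simplify; [|lra]. replace (Re z^2+Im z^2) with (Cmod z^2) by (simpl; nra). field. lra.
 - exists (ln (Cmod z), t). unfold Cexp. simpl. rewrite exp_ln by auto.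
  rewrite <- H1, <- H2. apply C_ext; simpl; unfold Re, Im; field; lra.
Qed.

Lemma Cexp_INR_mult n z : Cexp (RtoC (INR n)*z) = (Cexp z^n)%C.
Proof.
 induction n as [|n IH].
 - rewrite Cmult_0_l. apply Cexp_0.
 - rewrite S_INR, RtoC_plus. replace ((RtoC (INR n)+1%R)*z)%C with (z+RtoC (INR n)*z)%C by ring.
  rewrite Cexp_plus, IH. auto.
Qed.

Lemma abs_sin_le x : Rabs (sin x) <= Rabs x.
Proof.
 destruct (Rtotal_order x 0) as [H|[H|H]].
 - have := sin_gt_x x H. have := SIN_bound x. rewrite (Rabs_left x H). apply Rabs_le. split; [lra|].
  have := sin_lt_0_var x. have := PI2_1. lra.
 - subst. rewrite sin_0. lra.
 - have := sin_lt_x x H. have := SIN_bound x. rewrite (Rabs_right x) by lra. apply Rabs_le. split; [|lra].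
  have := sin_gt_0 x. have := PI2_1. lra.
Qed.

Lemma one_minus_cos_bound x : 0 <= 1-cos x <= x*x/2.
Proof. replace (cos x) with (cos (2*(x/2))) by (f_equal; lra). rewrite cos_2a_sin.
 have Hs := abs_sin_le (x/2). apply Rsqr_le_abs_1 in Hs. unfold Rsqr in Hs. nra.
Qed.

Lemma sin_minus_bound x : Rabs (sin x-x) <= Rabs x*(x*x).
Proof.
 destruct (MVT_abs (fun t => sin t-t) (fun t => cos t-1) 0 x) as (c&Hc&Hr).
 - intros c _. apply derivable_pt_lim_minus; [apply derivable_pt_lim_sin|apply derivable_pt_lim_id].
 - rewrite sin_0, !Rminus_0_r in Hc. rewrite Hc. rewrite Rmult_comm. apply Rmult_le_compat_l; [apply Rabs_pos|].
  have Hb := one_minus_cos_bound c. rewrite Rabs_left1 by lra. have: c*c <= x*x.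
  { unfold Rmin, Rmax in Hr. destruct (Rle_dec 0 x); nra. }
  nra.
Qed.

Lemma exp_minus_bound x : Rabs x <= 1 -> Rabs (exp x-1-x) <= 3*(x*x).
Proof.
 intros Hx. destruct (MVT_abs exp exp 0 x) as (c&Hc&Hr).
 { intros c _. apply derivable_pt_lim_exp. }
 destruct (MVT_abs (fun t => exp t-t) (fun t => exp t-1) 0 x) as (b&Hb&Hbr).
 { intros b _. apply derivable_pt_lim_minus; [apply derivable_pt_lim_exp|apply derivable_pt_lim_id]. }
 rewrite exp_0, !Rminus_0_r in Hb. replace (exp x-1-x) with (exp x-x-1) by ring.
 have Habs: forall t, Rmin 0 x <= t <= Rmax 0 x -> Rabs t <= Rabs x.
 { intros t Ht. unfold Rmin, Rmax in Ht. destruct (Rle_dec 0 x).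
  - rewrite !Rabs_right; lra.
  - rewrite !Rabs_left1; lra. }
 have Hb3: Rabs (exp b-1) <= 3*Rabs b.
 { destruct (MVT_abs exp exp 0 b) as (c2&Hc2&Hr2).
  { intros; apply derivable_pt_lim_exp. }
  rewrite exp_0, Rminus_0_r in Hc2. rewrite Hc2. apply Rmult_le_compat_r; [apply Rabs_pos|].
  rewrite Rabs_right by (left; apply exp_pos). eapply Rle_trans; [|apply exp_le_3]. have: c2 <= 1.
  { have := Habs b Hbr. unfold Rmin, Rmax in Hr2.
   revert Hr2 H Hx; unfold Rabs; destruct (Rle_dec 0 b); repeat destruct Rcase_abs; lra. }
  destruct (Req_dec c2 1); [subst; lra|left; apply exp_increasing; lra]. }
 have := Habs b Hbr. have := Rabs_pos x. replace (x*x) with (Rabs x*Rabs x)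
  by (rewrite <- Rabs_mult; apply Rabs_right; nra).
 nra.
Qed.

(** The constant 20 is crude: this bound only serves to differentiate [Cexp], after which the mean
    value inequality yields the constant 3 of [Cexp_1_second]. *)
Lemma Cexp_second_order h : Cmod h <= 1 -> Cmod (Cexp h-1-h) <= 20*(Cmod h*Cmod h).
Proof.
 intros Hh. destruct h as [a b]. have Ha := re_le_Cmod (a,b). have Hb := Cmod_Im_le (a,b). simpl in Ha, Hb.
 set (m := Cmod (a,b)) in *. have Ha1: Rabs a <= 1 by lra.
 have H1 := exp_minus_bound a Ha1. have H2 := one_minus_cos_bound b. have H3 := sin_minus_bound b.
 have Haa: a*a <= m*m.
 { replace (a*a) with (Rabs a*Rabs a) by (rewrite <- Rabs_mult; apply Rabs_right; nra). have := Rabs_pos a. nra. }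
 have Hbb: b*b <= m*m.
 { replace (b*b) with (Rabs b*Rabs b) by (rewrite <- Rabs_mult; apply Rabs_right; nra). have := Rabs_pos b. nra. }
 have Hm0: 0 <= m by apply Cmod_ge_0. have Hea: 0 < exp a <= 3.
 { split; [apply exp_pos|]. eapply Rle_trans; [|apply exp_le_3]. destruct (Rle_lt_or_eq_dec a 1).
  - revert Ha1; unfold Rabs; destruct Rcase_abs; lra.
  - left; apply exp_increasing; auto.
  - subst; lra. }
 le_trans Cmod_le_Re_Im. unfold Cexp; simpl.
 replace (exp a*cos b + - (1) + - a) with ((exp a-1-a)-exp a*(1-cos b)) by ring.
 replace (exp a*sin b + - 0 + - b) with (exp a*(sin b-b)+b*(exp a-1)) by ring.
 have E1: Rabs ((exp a-1-a)-exp a*(1-cos b)) <= 3*(m*m)+3*(m*m/2).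
 { le_trans Rabs_triang. rewrite Rabs_Ropp. apply Rplus_le_compat; [nra|]. rewrite Rabs_right by nra. nra. }
 have E2: Rabs (exp a*(sin b-b)+b*(exp a-1)) <= 3*(m*m)+4*(m*m).
 { le_trans Rabs_triang. rewrite !Rabs_mult. apply Rplus_le_compat.
  - rewrite (Rabs_right (exp a)) by lra. have: Rabs (sin b-b) <= m*m.
   { nra. }
   nra.
  - have: Rabs (exp a-1) <= 4*m.
   { replace (exp a-1) with ((exp a-1-a)+a) by ring. le_trans Rabs_triang. nra. }
   have := Rabs_pos b. nra. }
 lra.
Qed.

(** * Complex differentiability and the mean value inequality *)

Definition Cderiv (f: C -> C) (z l: C) : Prop := forall eps, 0 < eps -> exists delta, 0 < delta /\
  forall h, Cmod h < delta -> Cmod (f (z+h)-f z-l*h)%C <= eps*Cmod h.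

Definition Ccont (f: C -> C) (z: C) : Prop := forall eps, 0 < eps -> exists delta, 0 < delta /\
  forall h, Cmod h < delta -> Cmod (f (z+h)-f z)%C < eps.

Lemma Cderiv_bound f z l : Cderiv f z l -> exists delta, 0 < delta /\ forall h, Cmod h < delta ->
  Cmod (f (z+h)-f z)%C <= (Cmod l+1)*Cmod h.
Proof.
 intros H. destruct (H 1 Rlt_0_1) as (d&Hd&H1). exists d; split; [auto|]. intros h Hh. specialize (H1 h Hh).
 replace (f (z+h)-f z)%C with ((f (z+h)-f z-l*h)+l*h)%C by ring. le_trans Cmod_triangle. rewrite Cmod_mult. lra.
Qed.

Lemma Cderiv_cont f z l : Cderiv f z l -> Ccont f z.
Proof.
 intros H eps Heps. destruct (Cderiv_bound f z l H) as (d&Hd&H1). have := Cmod_ge_0 l.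
 exists (Rmin d (eps/(Cmod l+1))). split.
 - apply Rmin_glb_lt; [auto|]. apply Rdiv_lt_0_compat; lra.
 - intros h Hh. have Hh1 := lt_min_l Hh. have Hh2 := lt_min_r Hh. eapply Rle_lt_trans; [apply H1; auto|].
  apply (Rmult_lt_compat_l (Cmod l+1)) in Hh2; [|lra].
  replace ((Cmod l+1)*(eps/(Cmod l+1))) with eps in Hh2 by (field; lra). auto.
Qed.

Lemma Cderiv_ext f g z l : (exists r, 0 < r /\ forall h, Cmod h < r -> f (z+h)%C = g (z+h)%C) ->
 Cderiv f z l -> Cderiv g z l.
Proof.
 intros [r [Hr E]] H eps Heps. destruct (H eps Heps) as (d&Hd&H1).
 exists (Rmin d r). split; [apply Rmin_glb_lt; auto|]. intros h Hh.
 rewrite <- E by (eapply Rlt_le_trans; [exact Hh|apply Rmin_r]). replace (g z) with (f z).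
 - apply H1. eapply Rlt_le_trans; [exact Hh|apply Rmin_l].
 - have E0 := E 0%C. rewrite Cplus_0_r in E0. apply E0. rewrite Cmod_0. lra.
Qed.

Lemma Cderiv_const c z : Cderiv (fun _ => c) z 0.
Proof.
 intros eps Heps. exists 1. split; [lra|]. intros h _. replace (c-c-0*h)%C with (RtoC 0) by ring. rewrite Cmod_0.
 have := Cmod_ge_0 h. nra.
Qed.

Lemma Cderiv_id z : Cderiv (fun w => w) z 1.
Proof.
 intros eps Heps. exists 1. split; [lra|]. intros h _. replace (z+h-z-1*h)%C with (RtoC 0) by ring. rewrite Cmod_0.
 have := Cmod_ge_0 h. nra.
Qed.

Lemma Cderiv_plus f g z a b : Cderiv f z a -> Cderiv g z b -> Cderiv (fun w => f w+g w)%C z (a+b).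
Proof.
 intros Hf Hg eps Heps. destruct (Hf (eps/2) ltac:(lra)) as (d1&Hd1&H1), (Hg (eps/2) ltac:(lra)) as (d2&Hd2&H2).
 exists (Rmin d1 d2). split; [apply Rmin_glb_lt; auto|]. intros h Hh. specialize (H1 h (lt_min_l Hh)).
 specialize (H2 h (lt_min_r Hh)). replace (f (z+h)+g (z+h)-(f z+g z)-(a+b)*h)%C
  with ((f (z+h)-f z-a*h)+(g (z+h)-g z-b*h))%C by ring.
 le_trans Cmod_triangle. lra.
Qed.

Lemma Cderiv_comp f g z a b : Cderiv f z a -> Cderiv g (f z) b -> Cderiv (fun w => g (f w)) z (b*a).
Proof.
 intros Hf Hg eps Heps. have Ha := Cmod_ge_0 a. have Hb := Cmod_ge_0 b.
 destruct (Cderiv_bound f z a Hf) as (d0&Hd0&H0), (Hf (eps/(2*(Cmod b+1)))) as (d1&Hd1&H1).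
 { apply Rdiv_lt_0_compat; lra. }
 destruct (Hg (eps/(2*(Cmod a+1)))) as (d2&Hd2&H2).
 { apply Rdiv_lt_0_compat; lra. }
 exists (Rmin (Rmin d0 d1) (d2/(Cmod a+1))). split.
 { repeat apply Rmin_glb_lt; try auto. apply Rdiv_lt_0_compat; lra. }
 intros h Hh. have Hh0: Cmod h < d0 by (eapply Rlt_le_trans; [exact Hh|]; eapply Rle_trans; apply Rmin_l).
 have Hh1: Cmod h < d1.
 { eapply Rlt_le_trans; [exact Hh|]; eapply Rle_trans; [apply Rmin_l|apply Rmin_r]. }
 have Hh2: Cmod h < d2/(Cmod a+1) by (eapply Rlt_le_trans; [exact Hh|apply Rmin_r]).
 specialize (H0 h Hh0). specialize (H1 h Hh1). set (k := (f (z+h)-f z)%C) in *. have Hk: Cmod k < d2.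
 { eapply Rle_lt_trans; [exact H0|]. apply (Rmult_lt_compat_l (Cmod a+1)) in Hh2; [|lra].
  replace ((Cmod a+1)*(d2/(Cmod a+1))) with d2 in Hh2 by (field; lra). auto. }
 specialize (H2 k Hk). replace (f z+k)%C with (f (z+h)%C) in H2 by (unfold k; ring).
 replace (g (f (z+h))-g (f z)-b*a*h)%C with ((g (f (z+h))-g (f z)-b*k)+b*(k-a*h))%C by ring.
 le_trans Cmod_triangle. rewrite Cmod_mult. have Hh' := Cmod_ge_0 h.
 have E1: eps/(2*(Cmod a+1))*Cmod k <= eps/2*Cmod h.
 { replace (eps/2*Cmod h) with (eps/(2*(Cmod a+1))*((Cmod a+1)*Cmod h)) by (field; lra).
  apply Rmult_le_compat_l; [|auto]. left. apply Rdiv_lt_0_compat; lra. }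
 have E2: Cmod b*Cmod (k-a*h) <= eps/2*Cmod h.
 { apply Rle_trans with (Cmod b*(eps/(2*(Cmod b+1))*Cmod h)).
  - apply Rmult_le_compat_l; auto.
  - replace (Cmod b*(eps/(2*(Cmod b+1))*Cmod h)) with (eps/2*Cmod h*(Cmod b/(Cmod b+1))) by (field; lra).
   rewrite <- (Rmult_1_r (eps/2*Cmod h)) at 2. apply Rmult_le_compat_l; [nra|]. apply Rle_div_l; lra. }
 lra.
Qed.

Lemma Cderiv_scal f c z a : Cderiv f z a -> Cderiv (fun w => c*f w)%C z (c*a).
Proof.
 intros Hf. apply (Cderiv_comp f (fun w => c*w)%C); [auto|]. intros eps Heps. exists 1; split; [lra|]. intros h _.
 replace (c*(f z+h)-c*f z-c*h)%C with (RtoC 0) by ring. rewrite Cmod_0. have := Cmod_ge_0 h. nra.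
Qed.

Lemma Cderiv_exp z : Cderiv Cexp z (Cexp z).
Proof.
 intros eps Heps. have He := exp_pos (Re z). exists (Rmin 1 (eps/(20*exp (Re z)))). split.
 - apply Rmin_glb_lt; [lra|]. apply Rdiv_lt_0_compat; lra.
 - intros h Hh. rewrite Cexp_plus. replace (Cexp z*Cexp h-Cexp z-Cexp z*h)%C with (Cexp z*(Cexp h-1-h))%C by ring.
  rewrite Cmod_mult, Cmod_Cexp. have H1 := lt_min_l Hh. have H2 := lt_min_r Hh.
  have H3 := Cexp_second_order h ltac:(lra). have := Cmod_ge_0 h.
  apply Rle_trans with (exp (Re z)*(20*(Cmod h*Cmod h))).
  + apply Rmult_le_compat_l; lra.
  + set (r := eps/(20*exp (Re z))) in *. replace eps with (20*exp (Re z)*r) by (unfold r; field; lra).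
   replace (exp (Re z)*(20*(Cmod h*Cmod h))) with (20*exp (Re z)*Cmod h*Cmod h) by ring.
   apply Rmult_le_compat_r; [auto|]. apply Rmult_le_compat_l; lra.
Qed.

Definition Cconvex (S: C -> Prop) : Prop := forall x y (t: R), S x -> S y -> 0 <= t <= 1 -> S (x+RtoC t*(y-x))%C.

(** The mean value theorem fails for complex values, so the increment [W] is first rotated onto the
    positive real axis by the unit [e], and the real theorem is applied to [g]. Subtracting the
    linear part [L] lets one lemma serve for Lipschitz bounds ([L = 0]) and for Taylor
    remainders. *)
Lemma Cmvt f f' x y L M : (forall t: R, 0 <= t <= 1 -> Cderiv f (x+RtoC t*(y-x))%C (f' (x+RtoC t*(y-x))%C)) ->
 (forall t: R, 0 <= t <= 1 -> Cmod (f' (x+RtoC t*(y-x))%C-L)%C <= M) -> Cmod (f y-f x-L*(y-x)) <= M*Cmod (y-x).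
Proof.
 intros Hd HM. set (D := (y-x)%C) in *. set (W := (f y-f x-L*D)%C). have HM0: 0 <= M.
 { eapply Rle_trans; [|apply (HM 0); lra]. apply Cmod_ge_0. }
 have HD := Cmod_ge_0 D. destruct (Req_dec (Cmod W) 0) as [E|E].
 { nra. }
 have HW := Cmod_ge_0 W. set (e := (Cconj W*RtoC (/ Cmod W))%C). have He: Cmod e = 1.
 { unfold e. rewrite Cmod_mult, Cmod_conj, Cmod_pos_R by (left; apply Rinv_0_lt_compat; lra). field; lra. }
 have HeW: Re (e*W) = Cmod W.
 { replace (e*W)%C with (RtoC (Cmod W)); [auto|].
  unfold e. replace (Cconj W*RtoC (/ Cmod W)*W)%C with (W*Cconj W*RtoC (/ Cmod W))%C by ring.
  rewrite <- Cmod2_conj, <- RtoC_mult. f_equal. field. lra. }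
 set (g := fun t => Re (e*(f (x+t*D)-L*(t*D)))%C).
 destruct (MVT_cor2 g (fun t => Re (e*((f' (x+t*D)-L)*D))%C) 0 1 Rlt_0_1) as (c&Hc&Hcr).
 - intros t Ht eps Heps. destruct (Hd t Ht (eps/(2*(Cmod D+1)))) as (d&Hd0&H1).
  { apply Rdiv_lt_0_compat; lra. }
  have Hdd: 0 < d/(Cmod D+1) by (apply Rdiv_lt_0_compat; lra).
  exists (mkposreal _ Hdd). intros h Hh0 Hh. simpl in Hh. have Hm: Cmod (h*D) < d.
  { rewrite Cmod_mult, Cmod_R. apply (Rmult_lt_compat_r (Cmod D+1)) in Hh; [|lra].
   replace (d/(Cmod D+1)*(Cmod D+1)) with d in Hh by (field; lra). nra. }
  specialize (H1 _ Hm). set (z := (x+t*D)%C) in *. set (r := (f (z+h*D)-f z-f' z*(h*D))%C) in *.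
  have Eg: (g (t+h)-g t)/h-Re (e*((f' z-L)*D)) = Re (e*r)/h.
  { unfold g. rewrite RtoC_plus. replace (x+(t+h)*D)%C with (z+h*D)%C by (unfold z; ring). fold z.
   replace (f (z+h*D)%C) with (r+f z+f' z*(h*D))%C by (unfold r; ring). set (G := Re (e*((f' z-L)*D))).
   replace (Re (e*(r+f z+f' z*(h*D)-L*((t+h)*D)))) with (Re (e*(f z-L*(t*D)))+(Re (e*r)+h*G)).
   { field. auto. }
   unfold G. rewrite <- re_scal_l, <- !re_plus. f_equal. ring. }
  rewrite Eg. unfold Rdiv. rewrite Rabs_mult, Rabs_inv. have Hha := Rabs_pos_lt h Hh0.
  apply Rmult_lt_reg_r with (Rabs h); [auto|]. rewrite Rmult_assoc, Rinv_l, Rmult_1_r by lra.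
  eapply Rle_lt_trans; [apply re_le_Cmod|]. rewrite Cmod_mult, He, Rmult_1_l.
  eapply Rle_lt_trans; [exact H1|]. rewrite Cmod_mult, Cmod_R. replace (eps/(2*(Cmod D+1))*(Rabs h*Cmod D))
   with (eps*Rabs h*(Cmod D/(2*(Cmod D+1)))) by (field; lra).
  rewrite <- (Rmult_1_r (eps*Rabs h)) at 2. apply Rmult_lt_compat_l; [nra|]. apply Rlt_div_l; lra.
 - rewrite Rminus_0_r, Rmult_1_r in Hc. have Eg: g 1-g 0 = Cmod W.
  { rewrite <- HeW. unfold g, W. replace (x+1*D)%C with y by (unfold D; ring).
   replace (x+0*D)%C with x by ring. match goal with |- ?a-?b = ?d => cut (a = b+d); [lra|] end.
   rewrite <- re_plus. f_equal. ring. }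
  rewrite <- Eg, Hc. le_trans Rle_abs. le_trans re_le_Cmod. rewrite !Cmod_mult, He, Rmult_1_l.
  apply Rmult_le_compat_r; [auto|]. apply HM. lra.
Qed.

Lemma Cmvt_convex S f f' L M x y : Cconvex S -> (forall z, S z -> Cderiv f z (f' z)) -> (forall z, S z -> Cmod (f' z-L)
 <= M) -> S x -> S y ->
 Cmod (f y-f x-L*(y-x)) <= M*Cmod (y-x).
Proof.
 intros HS Hd HM Hx Hy. apply (Cmvt f f'); intros t Ht; [apply Hd|apply HM]; apply HS; auto.
Qed.

Lemma Clipschitz S f f' M x y : Cconvex S -> (forall z, S z -> Cderiv f z (f' z)) ->
 (forall z, S z -> Cmod (f' z) <= M) -> S x -> S y -> Cmod (f x-f y) <= M*Cmod (x-y).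
Proof.
 intros HS Hd HM Hx Hy. replace (f x-f y)%C with (f x-f y-0*(x-y))%C by ring. apply (Cmvt_convex S f f'); trivial.
 intros z Hz. replace (f' z-0)%C with (f' z) by ring. auto.
Qed.

Lemma Cconvex_ball c r : Cconvex (fun z => Cmod (z-c) <= r).
Proof.
 intros x y t Hx Hy Ht. replace (x+t*(y-x)-c)%C with (RtoC (1-t)*(x-c)+t*(y-c))%C by (rewrite RtoC_minus; ring).
 le_trans Cmod_triangle. rewrite !Cmod_mult, !Cmod_pos_R by lra. nra.
Qed.

Lemma Cconvex_disk r : Cconvex (fun z => Cmod z <= r).
Proof.
 intros x y t Hx Hy Ht. have H := Cconvex_ball 0 r x y t. cbv beta in H.
 replace (x+t*(y-x)-0)%C with (x+t*(y-x))%C in H by ring.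
 replace (x-0)%C with x in H by ring. replace (y-0)%C with y in H by ring. auto.
Qed.

Lemma Cconvex_Re_le b : Cconvex (fun z => Re z <= b).
Proof.
 intros x y t Hx Hy Ht. rewrite re_plus, re_scal_l. unfold Cminus. rewrite re_plus, re_opp. nra.
Qed.

Lemma Cconvex_Re_ge b : Cconvex (fun z => b <= Re z).
Proof.
 intros x y t Hx Hy Ht. rewrite re_plus, re_scal_l. unfold Cminus. rewrite re_plus, re_opp. nra.
Qed.

Lemma Cconvex_and S S' : Cconvex S -> Cconvex S' -> Cconvex (fun z => S z /\ S' z).
Proof. intros H H' x y t [] [] Ht. split; [apply H|apply H']; auto. Qed.

Lemma exp_le x y : x <= y -> exp x <= exp y.
Proof. intros [H|H]; [left; apply exp_increasing; auto|subst; lra]. Qed.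

Lemma Cexp_lipschitz b z w : Re z <= b -> Re w <= b -> Cmod (Cexp z-Cexp w) <= exp b*Cmod (z-w).
Proof.
 intros Hz Hw. apply (Clipschitz (fun z => Re z <= b) Cexp Cexp); trivial.
 - apply Cconvex_Re_le.
 - intros; apply Cderiv_exp.
 - intros u Hu. rewrite Cmod_Cexp. apply exp_le; auto.
Qed.

Lemma Cexp_1_bound h : Cmod h <= 1 -> Cmod (Cexp h-1) <= 3*Cmod h.
Proof.
 intros Hh. have Hr := re_le_Cmod h. apply Rabs_le_between in Hr. have H := Cexp_lipschitz 1 h 0.
 rewrite Cexp_0 in H. replace (h-0)%C with h in H by ring. eapply Rle_trans; [apply H; simpl; lra|].
 apply Rmult_le_compat_r; [apply Cmod_ge_0|apply exp_le_3].
Qed.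

Lemma Cexp_1_second h : Cmod h <= 1 -> Cmod (Cexp h-1-h) <= 3*(Cmod h*Cmod h).
Proof.
 intros Hh. replace (Cexp h-1-h)%C with (Cexp h-Cexp 0-1*(h-0))%C by (rewrite Cexp_0; ring).
 replace (Cmod h*Cmod h) with (Cmod h*Cmod (h-0)) by (f_equal; f_equal; ring). rewrite <- Rmult_assoc.
 apply (Cmvt_convex (fun z => Cmod z <= Cmod h) Cexp Cexp).
 - apply Cconvex_disk.
 - intros; apply Cderiv_exp.
 - intros z Hz. eapply Rle_trans; [apply Cexp_1_bound; lra|]. lra.
 - rewrite Cmod_0. apply Cmod_ge_0.
 - lra.
Qed.

Lemma Cexp_1_third h : Cmod h <= 1 -> Cmod (Cexp h-1-h-h*h/2) <= 3*(Cmod h*Cmod h*Cmod h).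
Proof.
 intros Hh. set (f := fun z => (Cexp z+(-1/2)*(z*z))%C). replace (Cexp h-1-h-h*h/2)%C with (f h-f 0-1*(h-0))%C.
 2:{ unfold f. rewrite Cexp_0. field. } replace (3*(Cmod h*Cmod h*Cmod h)) with (3*(Cmod h*Cmod h)*Cmod (h-0)).
 2:{ replace (h-0)%C with h by ring. ring. } apply (Cmvt_convex (fun z => Cmod z <= Cmod h) f (fun z => Cexp z-z)%C).
 - apply Cconvex_disk.
 - intros z Hz. apply Cderiv_plus; [apply Cderiv_exp|]. intros eps Heps. exists eps; split; [auto|]. intros k Hk.
  replace (-1/2*((z+k)*(z+k)) - -1/2*(z*z) - - z*k)%C with (- (/ 2*(k*k)))%C. 2:{ field. }
  rewrite Cmod_opp, !Cmod_mult. rewrite Cmod_inv by (intros H; injection H; lra).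
  rewrite Cmod_R, (Rabs_right 2) by lra. have := Cmod_ge_0 k. nra.
 - intros z Hz. replace (Cexp z-z-1)%C with (Cexp z-1-z)%C by ring. have := Cmod_ge_0 z.
  eapply Rle_trans; [apply Cexp_1_second; lra|]. nra.
 - rewrite Cmod_0. apply Cmod_ge_0.
 - lra.
Qed.

(** The principal logarithm, correct on the right half-plane only. That is all that [1-x] with
    [|x| < 1] requires, and there the argument is a plain arctangent. *)
Definition Clog (w: C) : C := (ln (Cmod w), atan (Im w/Re w)).

Lemma Cexp_Clog w : 0 < Re w -> Cexp (Clog w) = w.
Proof.
 intros Hw. have Hs := Cmod_sqr w. have Hm: 0 < Cmod w. { have := Cmod_ge_0 w. nra. }
 unfold Cexp, Clog; simpl Re; simpl Im. rewrite exp_ln by auto. rewrite cos_atan, sin_atan.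
 replace (sqrt (1+(Im w/Re w)²)) with (Cmod w/Re w).
 - apply C_ext; simpl; field; lra.
 - symmetry. apply sqrt_lem_1.
  + have := Rle_0_sqr (Im w/Re w). lra.
  + apply Rlt_le, Rdiv_lt_0_compat; lra.
  + unfold Rsqr. field_simplify; [|lra|lra]. f_equal. nra.
Qed.

Lemma Clog_1 : Clog 1 = 0.
Proof. apply C_ext; unfold Re, Im; simpl.
 - rewrite Cmod_1. apply ln_1.
 - unfold Rdiv. rewrite Rmult_0_l. apply atan_0.
Qed.

Lemma Clog_Im_bound w : Rabs (Im (Clog w)) <= PI/2.
Proof.
 unfold Clog; simpl. have := atan_bound (Im w/Re w). apply Rabs_le. lra.
Qed.

Lemma Clog_cont w : 0 < Re w -> Ccont Clog w.
Proof.
 intros Hw eps Heps. have Hs := Cmod_sqr w. have Hm: 0 < Cmod w. { have := Cmod_ge_0 w. nra. }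
 destruct (derivable_continuous_pt ln (Cmod w)
   (exist _ _ (derivable_pt_lim_ln _ Hm)) (eps/2) ltac:(lra)) as (d1&Hd1&H1), (derivable_continuous_pt atan (Im w/Re w)
   (exist _ _ (derivable_pt_lim_atan _)) (eps/2) ltac:(lra)) as (d2&Hd2&H2).
 simpl in H1, H2. unfold Rdist in H1, H2. set (c := Re w) in *. set (m := Cmod w) in *.
 set (d3 := d2*(c*c/2)/(2*m+1)).
 have Hd3: 0 < d3. { apply Rdiv_lt_0_compat; [apply Rmult_lt_0_compat; [lra|nra]|lra]. }
 exists (Rmin d1 (Rmin (c/2) d3)). split.
 { repeat apply Rmin_glb_lt; lra. }
 intros h Hh. have Hh1 := lt_min_l Hh. have Hh' := lt_min_r Hh. clear Hh. have Hh2 := lt_min_l Hh'.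
 have Hh3 := lt_min_r Hh'. clear Hh'. have Hre := re_le_Cmod h. have Him := Cmod_Im_le h.
 have Hwre := re_le_Cmod w. have Hwim := Cmod_Im_le w. fold m in Hwre, Hwim. apply Rabs_le_between in Hre.
 have Hc2: c/2 < Re (w+h). { rewrite re_plus. fold c. lra. } eapply Rle_lt_trans; [apply Cmod_le_Re_Im|].
 have A1: Rabs (ln (Cmod (w+h))-ln m) < eps/2.
 { destruct (Req_dec (Cmod (w+h)) m) as [E|E].
  - rewrite E, Rminus_diag, Rabs_R0. lra.
  - apply H1. split; [split; [exact I|auto]|]. eapply Rle_lt_trans; [|exact Hh1]. apply Rabs_le. split.
   + have := Cmod_reverse w (w+h)%C. rewrite Cmod_sym in H. replace (w+h-w)%C with h in H by ring. fold m in H. lra.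
   + have := Cmod_triangle w h. fold m in H. lra. }
 have A2: Rabs (atan (Im (w+h)/Re (w+h))-atan (Im w/c)) < eps/2.
 { destruct (Req_dec (Im (w+h)/Re (w+h)) (Im w/c)) as [E|E].
  - rewrite E, Rminus_diag, Rabs_R0. lra.
  - apply H2. split; [split; [exact I|auto]|]. have Hi: Im (w+h) = Im w+Im h by auto.
   have Hr: Re (w+h) = c+Re h by auto. rewrite Hi. rewrite Hr in *. clear E.
   replace ((Im w+Im h)/(c+Re h)-Im w/c) with ((Im h*c-Im w*Re h)/((c+Re h)*c)) by (field; lra).
   unfold Rdiv. rewrite Rabs_mult, Rabs_inv, (Rabs_right ((c+Re h)*c)) by nra.
   apply Rmult_lt_reg_r with ((c+Re h)*c); [nra|]. rewrite Rmult_assoc, Rinv_l, Rmult_1_r by nra.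
   apply Rle_lt_trans with (Cmod h*(2*m)).
   + le_trans Rabs_triang. rewrite Rabs_Ropp, !Rabs_mult, (Rabs_right c) by lra.
    have: Rabs (Re h) <= Cmod h by apply re_le_Cmod. have: c <= m. { revert Hwre. fold c. rewrite Rabs_right; lra. }
    have := Rabs_pos (Im w). nra.
   + have: Cmod h*(2*m+1) < d2*(c*c/2).
    { apply (Rmult_lt_compat_r (2*m+1)) in Hh3; [|lra]. unfold d3 in Hh3.
     replace (d2*(c*c/2)/(2*m+1)*(2*m+1)) with (d2*(c*c/2)) in Hh3 by (field; lra). auto. }
    have: c*c/2 <= (c+Re h)*c by nra. nra. }
 change (Rabs (ln (Cmod (w+h))-ln m)+Rabs (atan (Im (w+h)/Re (w+h))-atan (Im w/c)) < eps). lra.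
Qed.

(** Continuity suffices: the increment [k] satisfies [Cexp k = 1+h/w], so the second-order bound for
    the exponential gives [h/w-k = O(|k|^2)], hence [|k| <= 2|h/w|] and an error quadratic in
    [h]. *)
Lemma Cderiv_log w : 0 < Re w -> Cderiv Clog w (/ w)%C.
Proof.
 intros Hw eps Heps. have Hm: 0 < Cmod w.
 { have := re_le_Cmod w. have := Rle_abs (Re w). lra. }
 have Hw0: w <> 0 by (apply Cmod_gt_0; auto). destruct (Clog_cont w Hw (1/6) ltac:(lra)) as (d1&Hd1&H1).
 exists (Rmin (Rmin d1 (Re w/2)) (eps*(Cmod w*Cmod w)/12)). split.
 { repeat apply Rmin_glb_lt; try lra. apply Rdiv_lt_0_compat; [|lra]. apply Rmult_lt_0_compat; [auto|nra]. }
 intros h Hh. have Hh' := lt_min_l Hh. have Hh3 := lt_min_r Hh. have Hh1 := lt_min_l Hh'.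
 have Hh2 := lt_min_r Hh'. clear Hh Hh'. specialize (H1 h Hh1). set (k := (Clog (w+h)-Clog w)%C) in *.
 have Hre: 0 < Re (w+h).
 { rewrite re_plus. have H := re_le_Cmod h. apply Rabs_le_between in H. lra. }
 have Hk: Cexp k = (1+h/w)%C.
 { unfold k. rewrite Cexp_minus, !Cexp_Clog by auto. field. auto. }
 have H2 := Cexp_1_second k ltac:(lra). rewrite Hk in H2. replace (1+h/w-1-k)%C with (h/w-k)%C in H2 by ring.
 have Hk0 := Cmod_ge_0 k. have Hh0 := Cmod_ge_0 h. have H3: Cmod k <= 2*Cmod (h/w).
 { have := Cmod_reverse k (h/w)%C. rewrite Cmod_sym in H2. nra. }
 rewrite Cmod_div in H3 by auto. replace (k - / w*h)%C with (- (h/w-k))%C by (unfold Cdiv; ring).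
 rewrite Cmod_opp. set (m := Cmod w) in *. set (a := Cmod h) in *. have: Cmod k*Cmod k <= 4*(a*a)/(m*m).
 { replace (4*(a*a)/(m*m)) with ((2*(a/m))*(2*(a/m))) by (field; lra). nra. }
 apply Rle_trans with (12*a/(m*m)*a).
 { lra. }
 apply Rmult_le_compat_r; [auto|]. apply Rle_div_l; nra.
Qed.

Definition Log1m (x: C) : C := Clog (1-x)%C.

Lemma Re_1m_pos x : Cmod x < 1 -> 0 < Re (1-x).
Proof.
 intros H. unfold Cminus. rewrite re_plus, re_opp, re_RtoC. have H1 := re_le_Cmod x. apply Rabs_le_between in H1. lra.
Qed.

Lemma Cexp_Log1m x : Cmod x < 1 -> Cexp (Log1m x) = (1-x)%C.
Proof. intros H. apply Cexp_Clog, Re_1m_pos, H. Qed.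

Lemma Log1m_0 : Log1m 0 = 0.
Proof. unfold Log1m. replace (1-0)%C with (RtoC 1) by ring. apply Clog_1. Qed.

Lemma Cderiv_Log1m x : Cmod x < 1 -> Cderiv Log1m x (- / (1-x))%C.
Proof.
 intros H. replace (- / (1-x))%C with (/ (1-x)*(0 + -1*1))%C by ring. apply (Cderiv_comp (fun w => 1-w)%C Clog).
 - apply (Cderiv_ext (fun w => 1 + -1*w)%C).
  { exists 1; split; [lra|]. intros; ring. }
  apply Cderiv_plus; [apply Cderiv_const|]. apply Cderiv_scal, Cderiv_id.
 - apply Cderiv_log, Re_1m_pos, H.
Qed.

Lemma one_minus_neq0 x : Cmod x < 1 -> (1-x <> 0)%C.
Proof.
 intros H E. have H1 := Re_1m_pos x H. rewrite E in H1. simpl in H1. lra.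
Qed.

Lemma Cmod_inv_1m x b : b < 1 -> Cmod x <= b -> Cmod (/ (1-x)) <= / (1-b).
Proof.
 intros Hb Hx. have Hn: (1-x <> 0)%C by (apply one_minus_neq0; lra). rewrite Cmod_inv by auto.
 apply Rinv_le_contravar; [lra|]. have := Cmod_reverse 1 x. rewrite Cmod_1 in H. lra.
Qed.

Lemma Log1m_lipschitz b x y : b < 1 -> Cmod x <= b -> Cmod y <= b -> Cmod (Log1m x-Log1m y) <= / (1-b)*Cmod (x-y).
Proof.
 intros Hb Hx Hy. apply (Clipschitz (fun z => Cmod z <= b) Log1m (fun z => - / (1-z))%C); trivial.
 - apply Cconvex_disk.
 - intros z Hz. apply Cderiv_Log1m. lra.
 - intros z Hz. rewrite Cmod_opp. apply Cmod_inv_1m; auto.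
Qed.

Lemma Log1m_bound b x : b < 1 -> Cmod x <= b -> Cmod (Log1m x) <= / (1-b)*Cmod x.
Proof.
 intros Hb Hx. have H := Log1m_lipschitz b x 0 Hb Hx. rewrite Log1m_0 in H.
 replace (Log1m x-0)%C with (Log1m x) in H by ring. replace (x-0)%C with x in H by ring. apply H. rewrite Cmod_0.
 have := Cmod_ge_0 x. lra.
Qed.

(** The class of all error terms: [A] bounds the derivative, [B] is a Lipschitz constant of the
    derivative. The latter is what permits a quadratic expansion at the parabolic point
    ([C11_second]), and both constants pass explicitly through sums and compositions. *)
Definition C11 (S: C -> Prop) (f f': C -> C) (A B: R) : Prop := (forall z, S z -> Cderiv f z (f' z)) /\
 (forall z, S z -> Cmod (f' z) <= A) /\ (forall z w, S z -> S w -> Cmod (f' z-f' w) <= B*Cmod (z-w)).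

Lemma C11_weaken S S' f f' A B A' B' : (forall z, S' z -> S z) -> A <= A' -> B <= B' -> C11 S f f' A B -> C11 S' f f'
 A' B'.
Proof.
 intros HS HA HB [H1 [H2 H3]]. split; [|split]; intros.
 - auto.
 - eapply Rle_trans; [apply H2; auto|auto].
 - eapply Rle_trans; [apply H3; auto|]. apply Rmult_le_compat_r; [apply Cmod_ge_0|auto].
Qed.

Lemma C11_lip S f f' A B x y : Cconvex S -> C11 S f f' A B -> S x -> S y -> Cmod (f x-f y) <= A*Cmod (x-y).
Proof. intros HS [H1 [H2 _]] Hx Hy. apply (Clipschitz S f f'); auto. Qed.

Lemma C11_second S f f' A B x0 x y : Cconvex S -> C11 S f f' A B -> 0 <= B -> S x0 -> S x -> S y -> Cmod (f x-f y-f'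
 x0*(x-y))
  <= B*(Cmod (x-x0)+Cmod (y-x0))*Cmod (x-y).
Proof.
 intros HS [H1 [H2 H3]] HB H0 Hx Hy. have := Cmod_ge_0 (x-x0)%C. have := Cmod_ge_0 (y-x0)%C.
 apply (Cmvt_convex (fun z => S z /\ Cmod (z-x0) <= Cmod (x-x0)+Cmod (y-x0)) f f').
 - apply Cconvex_and; [auto|apply Cconvex_ball].
 - intros z [Hz _]. auto.
 - intros z [Hz Hz']. eapply Rle_trans; [apply H3; auto|]. apply Rmult_le_compat_l; auto.
 - split; [auto|lra].
 - split; [auto|lra].
Qed.

Lemma C11_plus S f f' g g' A B A' B' : C11 S f f' A B -> C11 S g g' A' B' ->
 C11 S (fun z => f z+g z)%C (fun z => f' z+g' z)%C (A+A') (B+B').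
Proof.
 intros [H1 [H2 H3]] [G1 [G2 G3]]. split; [|split].
 - intros z Hz. apply Cderiv_plus; auto.
 - intros z Hz. le_trans Cmod_triangle. apply Rplus_le_compat; auto.
 - intros z w Hz Hw. replace (f' z+g' z-(f' w+g' w))%C with ((f' z-f' w)+(g' z-g' w))%C by ring.
  le_trans Cmod_triangle. rewrite Rmult_plus_distr_r. apply Rplus_le_compat; auto.
Qed.

Lemma C11_scal S c f f' A B : C11 S f f' A B -> C11 S (fun z => c*f z)%C (fun z => c*f' z)%C (Cmod c*A) (Cmod c*B).
Proof.
 intros [H1 [H2 H3]]. have := Cmod_ge_0 c. split; [|split].
 - intros z Hz. apply Cderiv_scal; auto.
 - intros z Hz. rewrite Cmod_mult. apply Rmult_le_compat_l; auto.
 - intros z w Hz Hw. replace (c*f' z-c*f' w)%C with (c*(f' z-f' w))%C by ring.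
  rewrite Cmod_mult, Rmult_assoc. apply Rmult_le_compat_l; auto.
Qed.

Lemma C11_affine S a b : C11 S (fun z => a*z+b)%C (fun _ => a) (Cmod a) 0.
Proof.
 split; [|split].
 - intros z _. cut (Cderiv (fun z => a*z+b)%C z (a*1+0)%C).
  { intros H. replace (a*1+0)%C with a in H by ring. exact H. }
  apply Cderiv_plus; [apply Cderiv_scal, Cderiv_id|apply Cderiv_const].
 - intros; lra.
 - intros z w _ _. replace (a-a)%C with (RtoC 0) by ring. rewrite Cmod_0. lra.
Qed.

Lemma C11_comp S S' f f' g g' A B A' B' : Cconvex S -> 0 <= A -> 0 <= A' -> 0 <= B' ->
 C11 S f f' A B -> C11 S' g g' A' B' -> (forall z, S z -> S' (f z)) ->
 C11 S (fun z => g (f z)) (fun z => g' (f z)*f' z)%C (A'*A) (B'*(A*A)+A'*B).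
Proof.
 intros HS HA HA' HB' Hf [G1 [G2 G3]] Hm. have [H1 [H2 H3]] := Hf. split; [|split].
 - intros z Hz. apply Cderiv_comp; auto.
 - intros z Hz. rewrite Cmod_mult. apply Rmult_le_compat; auto using Cmod_ge_0.
 - intros z w Hz Hw. replace (g' (f z)*f' z-g' (f w)*f' w)%C
   with ((g' (f z)-g' (f w))*f' z+g' (f w)*(f' z-f' w))%C by ring.
  le_trans Cmod_triangle. rewrite !Cmod_mult, Rmult_plus_distr_r. have HL := C11_lip S f f' A B z w HS Hf Hz Hw.
   apply Rplus_le_compat.
  + apply Rle_trans with ((B'*Cmod (f z-f w))*A).
   * apply Rmult_le_compat; auto using Cmod_ge_0.
   * replace (B'*(A*A)*Cmod (z-w)) with (B'*A*(A*Cmod (z-w))) by ring.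
    replace (B'*Cmod (f z-f w)*A) with (B'*A*Cmod (f z-f w)) by ring. apply Rmult_le_compat_l; [nra|auto].
  + rewrite Rmult_assoc. apply Rmult_le_compat; auto using Cmod_ge_0.
Qed.

(** The prototype of every error term: away from its circle of zeros, a factor of the rational map
    is a monomial or a constant times [1-k*Cexp(a*z)] with a small second term. *)
Lemma C11_Log1m_exp S k a b : Cconvex S -> 0 <= b <= 1/2 ->
 (forall z, S z -> Cmod (k*Cexp (a*z))%C <= b) -> C11 S (fun z => Log1m (k*Cexp (a*z))%C)
  (fun z => - / (1-k*Cexp (a*z))*(k*(Cexp (a*z)*(a*1))))%C (2*Cmod a*b) (4*(Cmod a*Cmod a)*b).
Proof.
 intros HS Hb Hk. have Ha := Cmod_ge_0 a.
 have Hd: forall z, Cderiv (fun z => k*Cexp (a*z))%C z (k*(Cexp (a*z)*(a*1)))%C.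
 { intros z. apply Cderiv_scal, (Cderiv_comp (fun z => a*z)%C Cexp).
  - apply Cderiv_scal, Cderiv_id.
  - apply Cderiv_exp. }
 have HL: forall z w, S z -> S w -> Cmod (k*Cexp (a*z)-k*Cexp (a*w))%C <= Cmod a*b*Cmod (z-w).
 { intros z w Hz Hw. apply (Clipschitz S (fun z => k*Cexp (a*z))%C (fun z => k*(Cexp (a*z)*(a*1)))%C); trivial.
  intros u Hu. replace (k*(Cexp (a*u)*(a*1)))%C with (a*(k*Cexp (a*u)))%C by ring.
  rewrite Cmod_mult. apply Rmult_le_compat_l; auto. }
 split; [|split].
 - intros z Hz. apply (Cderiv_comp (fun z => k*Cexp (a*z))%C Log1m); [apply Hd|].
  apply Cderiv_Log1m. specialize (Hk z Hz). lra.
 - intros z Hz. replace (- / (1-k*Cexp (a*z))*(k*(Cexp (a*z)*(a*1))))%C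
   with (- (/ (1-k*Cexp (a*z))*(a*(k*Cexp (a*z)))))%C by ring.
  rewrite Cmod_opp, !Cmod_mult. specialize (Hk z Hz). rewrite Cmod_mult in Hk.
  have Hi := Cmod_inv_1m (k*Cexp (a*z))%C (1/2) ltac:(lra). rewrite Cmod_mult in Hi. specialize (Hi ltac:(lra)).
  have := Cmod_ge_0 (/ (1-k*Cexp (a*z)))%C. have := Cmod_ge_0 k. have := Cmod_ge_0 (Cexp (a*z))%C.
  replace (2*Cmod a*b) with (/ (1-1/2)*(Cmod a*b)) by field. apply Rmult_le_compat; try auto.
  + apply Rmult_le_pos; [auto|]. apply Rmult_le_pos; auto.
  + apply Rmult_le_compat_l; auto.
 - intros z w Hz Hw. set (x := (k*Cexp (a*z))%C). set (y := (k*Cexp (a*w))%C).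
  have Hx: Cmod x <= b by (apply Hk; auto). have Hy: Cmod y <= b by (apply Hk; auto).
  have Hx1: (1-x <> 0)%C by (apply one_minus_neq0; lra). have Hy1: (1-y <> 0)%C by (apply one_minus_neq0; lra).
  replace (- / (1-x)*(k*(Cexp (a*z)*(a*1))) - - / (1-y)*(k*(Cexp (a*w)*(a*1))))%C
   with (- (a*((/ (1-x) * / (1-y))*(x-y))))%C.
  2:{ replace (k*(Cexp (a*z)*(a*1)))%C with (a*x)%C by (unfold x; ring).
    replace (k*(Cexp (a*w)*(a*1)))%C with (a*y)%C by (unfold y; ring). field. split; auto. }
  rewrite Cmod_opp, !Cmod_mult. have I1 := Cmod_inv_1m x (1/2) ltac:(lra) ltac:(lra).
  have I2 := Cmod_inv_1m y (1/2) ltac:(lra) ltac:(lra). replace (/ (1-1/2)) with 2 in I1, I2 by field.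
  have := Cmod_ge_0 (/ (1-x))%C. have := Cmod_ge_0 (/ (1-y))%C. have H3 := HL z w Hz Hw.
  have := Cmod_ge_0 (x-y)%C. replace (4*(Cmod a*Cmod a)*b*Cmod (z-w))
   with (Cmod a*((2*2)*(Cmod a*b*Cmod (z-w)))) by ring.
  apply Rmult_le_compat_l; [auto|]. apply Rmult_le_compat; [nra|auto| |auto]. apply Rmult_le_compat; auto.
Qed.

(** * Horodiscs and one step of a parabolic map *)

Lemma Re_inv (u: C) : u <> 0 -> Re (/ u) = Re u/(Cmod u*Cmod u).
Proof.
 intros Hu. rewrite Cmod_sqr. unfold Re, Im, Cinv; simpl. f_equal. ring.
Qed.

Lemma Re_conj_div (c u: C) : u <> 0 -> Re (Cconj c/u) = Re (u*c)/(Cmod u*Cmod u).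
Proof.
 intros Hu. have Hp := proj1 (Cmod_gt_0 u) Hu. rewrite Cmod_sqr. have Hs := Cmod_sqr u.
 unfold Cdiv, Cinv, Re, Im, Cconj in *; simpl. field_simplify; nra.
Qed.

Lemma Re_le_Cmod z : Re z <= Cmod z.
Proof. eapply Rle_trans; [apply Rle_abs|apply re_le_Cmod]. Qed.

Lemma Re_ge_Cmod z : - Cmod z <= Re z.
Proof. have H := re_le_Cmod z. apply Rabs_le_between in H. lra. Qed.

Lemma Re_minus a b : Re (a-b) = Re a-Re b.
Proof. auto. Qed.

Lemma sum_sq_le x n b : 2*x*sum_f_R0 b n <= sum_f_R0 (fun k => b k*b k) n+INR (S n)*(x*x).
Proof.
 induction n as [|n IH].
 - simpl. have := Rle_0_sqr (x-b 0%nat). unfold Rsqr in H. lra.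
 - rewrite S_INR, !tech5. have H := Rle_0_sqr (x-b (S n)). unfold Rsqr in H. lra.
Qed.

Lemma cauchy_schwarz_ones n b : sum_f_R0 b n*sum_f_R0 b n <= INR (S n)*sum_f_R0 (fun k => b k*b k) n.
Proof.
 induction n as [|n IH].
 - simpl. lra.
 - have H := sum_sq_le (b (S n)) n b. rewrite (S_INR (S n)), !tech5. lra.
Qed.

Fixpoint Cgeom (y: C) (n: nat) : C := match n with O => 1%C | S k => (Cgeom y k+y^(S k))%C end.

Lemma Cgeom_spec y n : ((1-y)*Cgeom y n = 1-y^(S n))%C.
Proof.
 induction n as [|n IH].
 - simpl. ring.
 - simpl Cgeom. rewrite Cmult_plus_distr_l, IH. simpl. ring.
Qed.

Lemma Cgeom_mod y n : Cmod (Cgeom y n) <= sum_f_R0 (fun k => Cmod y^k) n.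
Proof.
 induction n as [|n IH].
 - simpl. rewrite Cmod_1. lra.
 - change (Cgeom y (S n)) with (Cgeom y n+y^(S n))%C. rewrite tech5. le_trans Cmod_triangle. rewrite Cmod_pow. lra.
Qed.

Lemma Re_inv_1m w : Cmod w < 1 -> Re (/ (1-w)) = 1/2+(1-Cmod w*Cmod w)/(2*(Cmod (1-w)*Cmod (1-w))).
Proof.
 intros Hw. have Hn := one_minus_neq0 w Hw. rewrite Re_inv by auto. have Hp := proj1 (Cmod_gt_0 _) Hn.
 have H: Cmod (1-w)*Cmod (1-w) = 1-2*Re w+Cmod w*Cmod w.
 { rewrite !Cmod_sqr. unfold Re, Im; simpl. ring. }
 rewrite Re_minus, re_RtoC. set (m := Cmod (1-w)) in *. replace (Cmod w*Cmod w) with (m*m-1+2*Re w) by lra.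
 field. lra.
Qed.

(* Poisson kernels: the horodisc Re (1/(1-y)) > t is mapped by y |-> y^N strictly into a smaller one. *)
Lemma poisson_power y n : Cmod y < 1 -> Re (/ (1-y))+INR n/2 <= INR (S n)*Re (/ (1-y^(S n)))%C.
Proof.
 intros Hy. have H0 := Cmod_ge_0 y. have Hyn: Cmod (y^S n) < 1.
 { rewrite Cmod_pow. apply pow_lt_1_compat; [lra|lia]. }
 rewrite !Re_inv_1m by auto. have HG := Cgeom_spec y n. set (P := Cgeom y n) in *.
 rewrite <- HG, Cmod_mult, Cmod_pow. have HP := Cgeom_mod y n. fold P in HP.
 have HC := cauchy_schwarz_ones n (fun k => Cmod y^k). set (r := Cmod y) in *.
 have Hg: (1-r*r)*sum_f_R0 (fun k => r^k*r^k) n = 1-r^S n*r^S n.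
 { clear. induction n as [|n IH]; [simpl; ring|]. rewrite tech5, Rmult_plus_distr_l, IH. simpl. ring. }
 set (Q := sum_f_R0 (fun k => r^k*r^k) n) in *. have HPn: P <> 0.
 { intros E. rewrite E, Cmult_0_r in HG. apply (one_minus_neq0 _ Hyn). symmetry; auto. }
 have Hp := proj1 (Cmod_gt_0 _) HPn. have Hm := proj1 (Cmod_gt_0 _) (one_minus_neq0 _ Hy).
 set (p := Cmod P) in *. set (m := Cmod (1-y)) in *. rewrite <- Hg. rewrite S_INR in *.
 (* With [P] the geometric sum, [1-y^(n+1) = (1-y)*P], and [1-r^(2n+2) = (1-r^2)*Q]. The comparison
    of Poisson kernels thus reduces to [|P|^2 <= (n+1)*Q], which is Cauchy-Schwarz. *)
 have Hkey: (1-r*r)/(m*m) <= (INR n+1)*((1-r*r)*Q/(m*p*(m*p))).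
 { replace ((INR n+1)*((1-r*r)*Q/(m*p*(m*p)))) with ((1-r*r)/(m*m)*((INR n+1)*Q/(p*p))) by (field; lra).
  rewrite <- (Rmult_1_r ((1-r*r)/(m*m))) at 1. apply Rmult_le_compat_l; [apply Rlt_le, Rdiv_lt_0_compat; nra|].
  apply Rle_div_r; nra. }
 replace ((1-r*r)/(2*(m*m))) with ((1-r*r)/(m*m)/2) by (field; lra). replace ((1-r*r)*Q/(2*(m*p*(m*p))))
  with ((1-r*r)*Q/(m*p*(m*p))/2) by (field; lra).
 lra.
Qed.

(** In the coordinate [1/u] the map [u+u^2(a+w)] is nearly the translation by [-a]. The factor
    [Cconj c] selects the half-plane that corresponds to one of the two tilted discs. *)
Lemma near_step (u w c: C) a : u <> 0 -> 1 <= a -> Cmod w <= a/16 -> Cmod (u*(RtoC a+w)) <= 1/16 ->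
 Re c = 1 -> Cmod c <= 2 -> let u' := (u+u*u*(RtoC a+w))%C in u' <> 0 /\ Re (Cconj c/u') <= Re (Cconj c/u)-a/2.
Proof.
 intros Hu Ha Hw Hz Hc Hc2 u'. set (z := (u*(a+w))%C) in *. have Hz1: (1+z <> 0)%C.
 { intros E. have Hzz: z = (-1)%R.
  { transitivity ((1+z)-1)%C; [ring|]. rewrite E. apply C_ext; simpl; ring. }
  rewrite Hzz, Cmod_R in Hz. rewrite Rabs_left in Hz; lra. }
 have Hu': u' = (u*(1+z))%C by (unfold u', z; ring). split.
 - rewrite Hu'. apply Cmult_neq_0; auto.
 - have E: (Cconj c/u' = Cconj c/u-Cconj c*((a+w)/(1+z)))%C.
  { rewrite Hu'. unfold z. field. split; [|auto]. intros E. apply Hz1. unfold z. rewrite <- E. ring. }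
  rewrite E, Re_minus. have Hd: ((a+w)/(1+z) = a+(w-a*z)/(1+z))%C by (field; auto).
  rewrite Hd, Cmult_plus_distr_l, re_plus. have H1: Re (Cconj c*a) = a.
  { rewrite re_scal_r, re_conj, Hc. ring. }
  have H2: Cmod (Cconj c*((w-a*z)/(1+z))) <= a/2.
  { rewrite Cmod_mult, Cmod_conj, Cmod_div by auto. have Hden: 15/16 <= Cmod (1+z).
   { have H := Cmod_reverse 1 (-z)%C. rewrite Cmod_1, Cmod_opp in H.
    replace (1 - - z)%C with (1+z)%C in H by ring. lra. }
   have Hnum: Cmod (w-a*z) <= a/8.
   { le_trans Cmod_minus_le. rewrite Cmod_mult, Cmod_pos_R by lra. nra. }
   have Hq: Cmod (w-a*z)/Cmod (1+z) <= a/4.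
   { apply Rle_div_l; [lra|]. nra. }
   have: 0 <= Cmod (w-a*z)/Cmod (1+z).
   { apply Rmult_le_pos; [apply Cmod_ge_0|left; apply Rinv_0_lt_compat; lra]. }
   nra. }
  have := Re_ge_Cmod (Cconj c*((w-a*z)/(1+z)))%C. lra.
Qed.

Lemma small_log u : Cmod u <= 1/2 -> exists v, Cexp v = (1+u)%C /\ Cmod v <= 2*Cmod u.
Proof.
 intros Hu. exists (Log1m (- u)%C). split.
 - rewrite Cexp_Log1m by (rewrite Cmod_opp; lra). ring.
 - eapply Rle_trans; [apply (Log1m_bound (1/2)); [lra|rewrite Cmod_opp; lra]|]. rewrite Cmod_opp. lra.
Qed.

Lemma exp_INR_mult n x : exp (INR n*x) = exp x^n.
Proof.
 induction n as [|n IH].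
 - rewrite Rmult_0_l. apply exp_0.
 - rewrite S_INR. replace ((INR n+1)*x) with (x+INR n*x) by ring. rewrite exp_plus, IH. auto.
Qed.

(** * The parabolic petal *)

Lemma nearest_period y : exists k : Z, Rabs (y-2*PI*IZR k) <= PI.
Proof.
 have HPI := PI_RGT_0. exists (up (y/(2*PI)-1/2)). destruct (archimed (y/(2*PI)-1/2)) as [H1 H2].
  have E: y = 2*PI*(y/(2*PI)) by (field; lra).
 apply Rabs_le. split; nra.
Qed.

Lemma nearest_lift v : exists k : Z, Re (v-turn k) = Re v /\ Rabs (Im (v-turn k)) <= PI.
Proof.
 destruct (nearest_period (Im v)) as [k Hk]. exists k. split.
 - unfold Re; simpl. ring.
 - auto.
Qed.

(** With [y = Cexp v], [mf] is [y |-> (1-th)+th*y^N] with the power perturbed by the factor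
    [Cexp (et v)]. By [lm_et0] and [lm_th] below it fixes 1 with derivative exactly 1. *)
Definition mXi (N: nat) (et: C -> C) (v: C) : C := (RtoC (INR N)*v+et v)%C.
Definition mf (N: nat) (th: R) (et: C -> C) (v: C) : C := (RtoC (1-th)+RtoC th*Cexp (mXi N et v))%C.
Definition mro (N: nat) : R := 1-1/(4*INR N).
(* The petal {mVq < 0} is the union of the two discs through 1 with centres
  1 - mro + i ka mro and 1 - mro - i ka mro: the tilt ka makes its complement
  a sector of opening less than pi at the parabolic point 1. *)
Definition mVq (N: nat) (ka: R) (y: C) : R := Cmod (y-1)*Cmod (y-1)+2*mro N*(Re (y-1)-ka*Rabs (Im (y-1))).
Definition mV (N: nat) (ka: R) (y: C) : Prop := mVq N ka y < 0.
Definition mVc (N: nat) (ka: R) (y: C) : Prop := mVq N ka y <= 0.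

(** The scales: [ka] is the tilt of the discs; within [de] of the point 1 the quadratic expansion
    governs the map; beyond it the closed petal satisfies [|y|^2 <= 1-mu]; [d4] separates the two
    contraction estimates [mX_near] and [mX_far]. The perturbation has size [ep], far below all of
    these, on the half-plane [Re v <= M]. *)
Record local_model {N : nat} {ka de mu d4 ep M th : R} {et et' : C -> C} : Prop := {
 lm_N : 4 <= INR N;
 lm_ka : 0 < ka <= 1/1000;
 lm_de : de = 16*INR N*ka;
 lm_mu : mu = 2*ka*de;
 lm_ep : 0 <= ep <= 1/1000;
 lm_s1 : 320*(INR N*INR N*INR N)*(ep+de) <= 1/32;
 lm_s2 : 128*INR N*de <= 1;
 lm_s3 : 16*ep <= mu;
 lm_s4 : 400*INR N*ep <= mu*mu;
 lm_s4' : mu <= 1/2;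
 lm_s5 : 0 < d4 /\ 4000*INR N*d4 <= ka;
 lm_s6 : 64*ep <= ka;
 lm_s7 : 200000*(INR N*INR N)*ep <= d4*d4;
 lm_M : 1 <= M;
 lm_et : C11 (fun v => Re v <= M) et et' ep ep;
 lm_et0 : et 0 = 0;
 lm_per : forall v (k: Z), et (v+turn k)%C = et v;
 lm_th : (RtoC th*(RtoC (INR N)+et' 0))%C = 1%R }.

Definition sgc (ka: R) (c: C) : Prop := c = (1, ka) \/ c = (1, - ka).

(** A logarithm of [Cexp v-(1-th)]. Since [1-th] will be [T/exp x], this is the normalised form of
    the coordinate [log (w-T)] in which distances are measured. *)
Definition mX (th: R) (v: C) : C := (v+Log1m (RtoC (1-th)*Cexp (- v)))%C.

(* Comparing log(1-x) with its quadratic Taylor polynomial shows where the Lipschitz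
  constant 1/(1-b) is not attained: only when both points are close to b. *)
Lemma Log1m_gain b x y : b < 1 -> Cmod x <= b -> Cmod y <= b -> Cmod (Log1m x-Log1m y)
  <= ((Cmod (2+y)+Cmod x)/2+b*b/(1-b))*Cmod (x-y).
Proof.
 intros Hb Hx Hy. set (h := fun z => (Log1m z+(1*z+(1/2)*(z*z)))%C).
 have Hh: Cmod (h x-h y-0*(x-y)) <= b*b/(1-b)*Cmod (x-y).
 { apply (Cmvt_convex (fun z => Cmod z <= b) h (fun z => - / (1-z)+(1*1+z))%C); trivial.
  - apply Cconvex_disk.
  - intros z Hz. apply Cderiv_plus; [apply Cderiv_Log1m; lra|]. apply Cderiv_plus; [apply Cderiv_scal, Cderiv_id|].
   intros eps Heps. exists eps; split; [auto|]. intros k Hk. replace (1/2*((z+k)*(z+k))-1/2*(z*z)-z*k)%C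
    with (/ 2*(k*k))%C by field.
   rewrite !Cmod_mult. rewrite Cmod_inv by (intros H; injection H; lra).
   rewrite Cmod_pos_R by lra. have := Cmod_ge_0 k. nra.
  - intros z Hz. have Hn: (1-z <> 0)%C by (apply one_minus_neq0; lra).
   replace (- / (1-z)+(1*1+z)-0)%C with (- (z*z * / (1-z)))%C by (field; auto).
   rewrite Cmod_opp, !Cmod_mult. have := Cmod_ge_0 z. have := Cmod_inv_1m z b Hb Hz. have := Cmod_ge_0 (/ (1-z))%C.
   apply Rmult_le_compat; try auto; nra. }
 replace (Log1m x-Log1m y)%C with ((h x-h y-0*(x-y))-(x-y)*((2+y+x) * / 2))%C by (unfold h; field).
 le_trans Cmod_minus_le. rewrite !Cmod_mult.
 rewrite Cmod_inv by (intros H; injection H; lra). rewrite Cmod_pos_R by lra.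
 have := Cmod_triangle (2+y)%C x. have := Cmod_ge_0 (x-y)%C. nra.
Qed.

Lemma sqrt_like A B x : 0 < A -> 0 <= B -> 0 <= x -> x*x <= A*A-2*A*B -> x <= A-B.
Proof. intros. have: 0 <= A-2*B by nra. nra. Qed.

Lemma exp_small_bound x : 0 <= x <= 1/2 -> exp x <= 1+2*x.
Proof.
 intros Hx. have H := exp_ineq1_le (- x). rewrite exp_Ropp in H. have Hp := exp_pos x.
 have: exp x * / exp x = 1 by (field; lra). nra.
Qed.

Lemma iI_plus a b : iI (a+b) = (iI a+iI b)%C.
Proof. apply C_ext; unfold Re, Im; simpl; ring. Qed.

Lemma iI_opp a : iI (- a) = (- iI a)%C.
Proof. apply C_ext; unfold Re, Im; simpl; ring. Qed.

Lemma Cexp_opp_period v k : Cexp (- (v+turn k))%C = Cexp (- v)%C.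
Proof. rewrite !Cexp_opp, Cexp_period. auto. Qed.

Lemma mX_shift th v k : mX th (v+turn k)%C = (mX th v+turn k)%C.
Proof. unfold mX. rewrite Cexp_opp_period. ring. Qed.

Lemma Cmod_iI x : Cmod (iI x) = Rabs x.
Proof.
 replace (iI x) with (Ci*x)%C by (apply C_ext; unfold Re, Im; simpl; ring). rewrite Cmod_mult, Cmod_Ci, Cmod_R. ring.
Qed.

(** The petal is given by [|y|^2-2*gbeta y-gk < 0] ([Vq_beta]), and [gbeta] is positively
    homogeneous. So [y/t] lies on its boundary exactly when [t] is the positive root of
    [gk*t^2+2*gbeta*t-|y|^2], and that root is the formula for [gauge]. *)
Definition gbeta (N: nat) (ka: R) (y: C) : R := (1-mro N)*Re y+mro N*(ka*Rabs (Im y)).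
Definition gk (N: nat) : R := 2*mro N-1.
(* Minkowski gauge of the petal with respect to 0. *)
Definition gauge (N: nat) (ka: R) (y: C) : R := (Cmod (gbeta N ka y, sqrt (gk N)*Cmod y)-gbeta N ka y)/gk N.

Section LocalModel.

Context {N : nat} {ka de mu d4 ep M th : R} {et et' : C -> C}.
Hypothesis LM : @local_model N ka de mu d4 ep M th et et'.
Local Notation D := (INR N).
Local Notation Xi := (mXi N et).
Local Notation fm := (mf N th et).
Local Notation ro := (mro N).
Local Notation Vq := (mVq N ka).
Local Notation V := (mV N ka).
Local Notation Vc := (mVc N ka).
Local Notation am := ((/ th-1)/2).
Local Notation sgc := (sgc ka).
Let HN := lm_N LM.
Let Hka := lm_ka LM.
Let Hde := lm_de LM.
Let Hmu := lm_mu LM.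
Let Hep := lm_ep LM.
Let Hs1 := lm_s1 LM.
Let Hs2 := lm_s2 LM.
Let Hs3 := lm_s3 LM.
Let Hs4 := lm_s4 LM.
Let Hs4' := lm_s4' LM.
Let Hs5 := lm_s5 LM.
Let Hs6 := lm_s6 LM.
Let Hs7 := lm_s7 LM.
Let HM := lm_M LM.
Let Het := lm_et LM.
Let Het0 := lm_et0 LM.
Let Hper := lm_per LM.
Let Hth := lm_th LM.

Lemma th_facts : 0 < th /\ D-ep <= / th <= D+ep /\ (RtoC D+et' 0)%C = RtoC (/ th).
Proof.
 have Hn: th <> 0.
 { intros E. rewrite E, Cmult_0_l in Hth. injection Hth. lra. }
 have E: (D+et' 0)%C = RtoC (/ th).
 { rewrite RtoC_inv by auto. have Hc: RtoC th <> 0 by (intros E; injection E; auto).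
  transitivity (/ th*(th*(D+et' 0)))%C; [field; auto|]. rewrite Hth. ring. }
 have He: Cmod (et' 0) <= ep.
 { apply Het. simpl. lra. }
 have E2: et' 0 = RtoC (/ th-D).
 { rewrite RtoC_minus, <- E. ring. }
 rewrite E2, Cmod_R in He. apply Rabs_le_between in He. have: 0 < / th by lra. split; [|split; [lra|exact E]].
 rewrite <- Rinv_inv. apply Rinv_0_lt_compat; auto.
Qed.

Lemma th_lower : / (D+1) <= th.
Proof.
 destruct th_facts as (H1&H2&_). rewrite <- (Rinv_inv th). apply Rinv_le_contravar; [apply Rinv_0_lt_compat|]; lra.
Qed.

Lemma th_upper : th <= 1/3.
Proof.
 destruct th_facts as (H1&H2&_). rewrite <- (Rinv_inv th). unfold Rdiv. rewrite Rmult_1_l.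
 apply Rinv_le_contravar; lra.
Qed.

(** Periodicity moves [v] to [|Im v| <= PI], so the bound grows with the real part alone. *)
Lemma et_bound v : Re v <= M -> Cmod (et v) <= ep*(Rabs (Re v)+4).
Proof.
 intros Hv. destruct (nearest_lift v) as (k&Hk1&Hk2). set (w := (v-turn k)%C) in *. have E: et v = et w.
 { rewrite <- (Hper w k). f_equal. unfold w. ring. }
 rewrite E. have H := C11_lip _ _ _ _ _ w 0 (Cconvex_Re_le M) Het.
 rewrite Het0 in H. replace (et w-0)%C with (et w) in H by ring. replace (w-0)%C with w in H by ring.
 eapply Rle_trans; [apply H; [lra|simpl; lra]|]. apply Rmult_le_compat_l; [lra|].
 le_trans Cmod_le_Re_Im. rewrite Hk1. have := PI_4. lra.
Qed.

Lemma Xi_periodic v k : Cexp (Xi (v+turn k)%C) = Cexp (Xi v).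
Proof.
 unfold mXi. rewrite Hper. replace (D*(v+turn k)+et v)%C with ((D*v+et v)+turn (Z.of_nat N*k))%C.
 - apply Cexp_period.
 - rewrite mult_IZR, <- INR_IZR_INZ. apply C_ext; unfold Re, Im; simpl; ring.
Qed.

Lemma fm_periodic v k : fm (v+turn k)%C = fm v.
Proof. unfold mf. rewrite Xi_periodic. auto. Qed.

Lemma ro_bounds : 15/16 <= ro < 1.
Proof.
 unfold mro. have: 0 < 1/(4*D) <= 1/16.
 { split; [apply Rdiv_lt_0_compat; lra|]. apply Rle_div_l; [lra|]. lra. }
 lra.
Qed.

Lemma inv_ro_gap : 1/(4*D) <= / ro-1.
Proof.
 have := ro_bounds. have E: 1/(4*D) = 1-ro by (unfold mro; ring).
  have: / ro-1-(1-ro) = (1-ro)*(1-ro) * / ro by (field; lra).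
 have: 0 < / ro by (apply Rinv_0_lt_compat; lra). have: 0 <= (1-ro)*(1-ro) * / ro by (apply Rmult_le_pos; nra). lra.
Qed.

Lemma Vq_le y c : sgc c -> Vq y <= Cmod (y-1)*Cmod (y-1)+2*ro*Re ((y-1)*c).
Proof.
 intros Hc. have := ro_bounds. apply Rplus_le_compat_l, Rmult_le_compat_l; [lra|].
 set (u := (y-1)%C). rewrite re_mult. have := Rle_abs (Im u). have := Rle_abs (- Im u). rewrite Rabs_Ropp in H1.
 destruct Hc as [-> | ->].
 - change (Re (1, ka)) with 1. change (Im (1, ka)) with ka. nra.
 - change (Re (1, - ka)) with 1. change (Im (1, - ka)) with (- ka). nra.
Qed.

Lemma Vq_eq y : exists c, sgc c /\ Vq y = Cmod (y-1)*Cmod (y-1)+2*ro*Re ((y-1)*c).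
Proof.
 unfold mVq. set (u := (y-1)%C). destruct (Rle_dec 0 (Im u)) as [H|H].
 - exists (1, ka). split; [left; auto|]. rewrite re_mult, Rabs_right by lra. simpl. ring.
 - exists (1, - ka). split; [right; auto|]. rewrite re_mult, Rabs_left by lra. simpl. ring.
Qed.

Lemma sgc_facts c : sgc c -> Re c = 1 /\ Cmod c <= 2.
Proof.
 intros Hc. assert (Re c = 1 /\ Rabs (Im c) = ka) as [H1 H2].
 { destruct Hc as [-> | ->]; simpl; split; try auto.
  - apply Rabs_right; lra.
  - rewrite Rabs_Ropp. apply Rabs_right; lra. }
 split; [auto|]. le_trans Cmod_le_Re_Im. rewrite H1, H2, Rabs_R1. lra.
Qed.

(** Inversion at 1 turns each disc of the petal into a half-plane. For [c = 1 + i ka] or [1 - i ka]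
    the disc has centre [1-ro*Cconj c] and passes through 1. *)
Lemma V_of_form (y c: C) : y <> 1 -> sgc c -> Re (Cconj c/(y-1)) < - / (2*ro) -> V y.
Proof.
 intros Hy Hc H. have := ro_bounds. have Hu: (y-1 <> 0)%C by (apply Cminus_eq_contra; auto).
 rewrite Re_conj_div in H by auto. have Hp := proj1 (Cmod_gt_0 _) Hu. eapply Rle_lt_trans; [apply (Vq_le y c Hc)|].
  set (u := (y-1)%C) in *. set (m := Cmod u) in *.
 apply (Rmult_lt_compat_r (m*m)) in H; [|nra]. replace (Re (u*c)/(m*m)*(m*m)) with (Re (u*c)) in H by (field; lra).
 apply (Rmult_lt_compat_l (2*ro)) in H; [|lra].
 replace (2*ro*(- / (2*ro)*(m*m))) with (- (m*m)) in H by (field; lra). lra.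
Qed.

Lemma Vc_form (y: C) : y <> 1 -> Vc y -> exists c, sgc c /\ Re (Cconj c/(y-1)) <= - / (2*ro).
Proof.
 intros Hy HV. have := ro_bounds. have Hu: (y-1 <> 0)%C by (apply Cminus_eq_contra; auto).
 destruct (Vq_eq y) as (c&Hc&E). exists c. split; [auto|].
 unfold mVc in HV. rewrite Re_conj_div by auto. have Hp := proj1 (Cmod_gt_0 _) Hu.
 set (u := (y-1)%C) in *. set (m := Cmod u) in *. apply Rle_div_l; [nra|]. apply Rmult_le_reg_l with (2*ro); [lra|].
 replace (2*ro*(- / (2*ro)*(m*m))) with (- (m*m)) by (field; lra). lra.
Qed.

Lemma V_small y : Cmod y <= 1-3/(4*D) -> V y.
Proof.
 intros Hy. unfold mV, mVq. have E: Cmod (y-1)*Cmod (y-1)+2*ro*Re (y-1) = Cmod y*Cmod y-2*(1-ro)*Re y+1-2*ro.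
 { rewrite !Cmod_sqr. unfold Re, Im; simpl. ring. }
 have := Re_ge_Cmod y. have := Cmod_ge_0 y. have := Rabs_pos (Im (y-1)). have Hi: 0 < / (4*D) <= / 16.
 { split; [apply Rinv_0_lt_compat; lra|apply Rinv_le_contravar; lra]. }
 have E2: 1-ro = / (4*D) by (unfold mro; field; lra). replace (3/(4*D)) with (3 * / (4*D)) in Hy by (field; lra).
 set (i := / (4*D)) in *.
 have: - (2*(1-ro)*Re y) <= 2*i*(1-3*i) by nra. have: 0 <= 2*ro*(ka*Rabs (Im (y-1))) by (apply Rmult_le_pos; nra).
 nra.
Qed.

(** This disc is tangent at 1 to the disc of radius [ro > th] around [1-ro], and the petal contains
    the latter because the tilt only lowers [mVq]. Hence every [v] with [Re (Xi v) < 0] is sent into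
    the petal. *)
Lemma V_ball Y : Cmod Y <= th -> (RtoC (1-th)+Y)%C <> 1 -> V (RtoC (1-th)+Y)%C.
Proof.
 intros HY Hne. have Hr := ro_bounds. have Ht3 := th_upper.
 have Hu: ((RtoC (1-th)+Y)-1 <> 0)%C by (apply Cminus_eq_contra; auto). have Hp := proj1 (Cmod_gt_0 _) Hu.
 unfold mV, mVq. set (u := ((RtoC (1-th)+Y)-1)%C) in *. have E: Cmod u*Cmod u+2*th*Re u = Cmod Y*Cmod Y-th*th.
 { rewrite !Cmod_sqr. unfold Re, Im; simpl. ring. }
 have := Cmod_ge_0 Y. have := Rabs_pos (Im u). have H1: Cmod u*Cmod u+2*th*Re u <= 0 by nra.
 have H2: th*(Cmod u*Cmod u+2*ro*Re u) < 0.
 { nra. }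
 have: 0 <= 2*ro*(ka*Rabs (Im u)) by (apply Rmult_le_pos; nra). nra.
Qed.

Lemma V_Vc y : V y -> Vc y.
Proof. unfold mV, mVc. lra. Qed.

Lemma V_not_1 y : V y -> y <> 1.
Proof.
 intros H E. unfold mV, mVq in H. rewrite E in H.
 replace (1-1)%C with (RtoC 0) in H by ring. rewrite Cmod_0 in H. simpl in H. rewrite Rabs_R0 in H. lra.
Qed.

(** The discs are smaller than the unit disc: at distance [m] from 1 their curvature gains at least
    [m^2/(4N)], while the tilt loses at most [2*ka*m]. The choice [de = 16*N*ka] makes the gain at
    least twice the loss, which leaves [2*ka*m >= mu]. *)
Lemma Vc_far y : Vc y -> de <= Cmod (y-1) -> Cmod y*Cmod y <= 1-mu.
Proof.
 intros HV Hu. unfold mVc, mVq in HV. have E: Cmod y*Cmod y = 1+2*Re (y-1)+Cmod (y-1)*Cmod (y-1).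
 { rewrite !Cmod_sqr. unfold Re, Im; simpl. ring. }
 set (u := (y-1)%C) in *. have Hr := ro_bounds. have Hi := Cmod_Im_le u. have Hi0 := Rabs_pos (Im u).
 have Hg := inv_ro_gap. set (m := Cmod u) in *. have H1: 2*Re u <= 2*ka*m - / ro*(m*m).
 { apply Rmult_le_reg_l with ro; [lra|]. replace (ro*(2*ka*m - / ro*(m*m))) with (2*ka*m*ro-m*m) by (field; lra).
  have: ka*Rabs (Im u) <= ka*m by nra. nra. }
 have H2: 4*ka*m <= 1/(4*D)*(m*m).
 { apply Rmult_le_reg_l with (4*D); [lra|]. replace (4*D*(1/(4*D)*(m*m))) with (m*m) by (field; lra). nra. }
 nra.
Qed.

Lemma de_pos : 0 < de.
Proof. nra. Qed.

Lemma mu_pos : 0 < mu.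
Proof. nra. Qed.

Lemma Vc_bounded y : Vc y -> Cmod y <= 2.
Proof.
 intros HV. destruct (Rle_dec de (Cmod (y-1))) as [H|H].
 - have := Vc_far y HV H. nra.
 - have Ht := Cmod_triangle (y-1)%C 1. rewrite Cmod_1 in Ht. replace (y-1+1)%C with y in Ht by ring.
  have: de <= 1 by nra. lra.
Qed.

Lemma am_bounds : 1 <= am <= D.
Proof. destruct th_facts as (_&H&_). lra. Qed.

(** Origin of [am]: to second order [v = u-u^2/2] and [Xi v = v/th], so
    [th*(Xi+Xi^2/2) = u+(1/th-1)/2*u^2]. The linear term is exactly [u] by [lm_th]. The errors [E1],
    [E2], [E3] come from linearising [Xi], from the outer exponential and from the logarithm of
    [1+u]. *)
Lemma near_expansion v : Cmod (Cexp v-1) <= de -> exists w, Cmod w <= 1/16 /\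
  (fm v-1 = (Cexp v-1)+(Cexp v-1)*(Cexp v-1)*(RtoC am+w))%C.
Proof.
 intros Hu. set (u := (Cexp v-1)%C) in *. have Hd0 := de_pos.
 destruct th_facts as (Ht&Hit&Hd). have Ham := am_bounds. have Hde1: de <= 1/512 by nra.
 destruct (small_log u ltac:(lra)) as (v0&Hv0&Hm0). have Hvv: Cexp v = Cexp v0 by (rewrite Hv0; unfold u; ring).
 destruct (Cexp_eq _ _ Hvv) as [k Hk]. have Hf: fm v = fm v0 by (rewrite Hk; apply fm_periodic).
 rewrite Hf. clear Hf Hk Hvv. have Hu0 := Cmod_ge_0 u. destruct (Req_dec (Cmod u) 0) as [Eu|Eu].
 { exists 0%C. rewrite Cmod_0. split; [lra|]. have: v0 = 0%C by (apply Cmod_eq_0; have := Cmod_ge_0 v0; lra).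
  apply Cmod_eq_0 in Eu. rewrite Eu. subst v0. unfold mf, mXi.
  rewrite Het0, Cmult_0_r, Cplus_0_r, Cexp_0, RtoC_minus. ring. }
 have Hune: u <> 0 by (apply Cmod_gt_0; lra). set (m := Cmod v0) in *. have Hm := Cmod_ge_0 v0 : 0 <= m.
 have HRe: Re v0 <= M.
 { have := Re_le_Cmod v0. fold m in H. lra. }
 set (E1 := (Xi v0-v0*RtoC (/ th))%C). have HE1: Cmod E1 <= ep*(m*m).
 { have H := C11_second _ _ _ _ _ 0 v0 0 (Cconvex_Re_le M) Het ltac:(lra).
  replace (et v0-et 0-et' 0*(v0-0))%C with E1 in H. 2:{ unfold E1, mXi. rewrite Het0, <- Hd. ring. }
  replace (v0-0)%C with v0 in H by ring. replace (0-0)%C with (RtoC 0) in H by ring.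
  rewrite Cmod_0, Rplus_0_r in H. rewrite <- Rmult_assoc. apply H; simpl; lra. }
 have HXi: Cmod (Xi v0) <= 2*D*m.
 { replace (Xi v0) with (v0*RtoC (/ th)+E1)%C by (unfold E1; ring).
  le_trans Cmod_triangle. rewrite Cmod_mult, Cmod_pos_R by lra. fold m. nra. }
 have HXi1: 2*D*m <= 1 by nra. set (E2 := (Cexp (Xi v0)-1-Xi v0-Xi v0*Xi v0/2)%C).
 have HE2: Cmod E2 <= 24*(D*D*D)*(m*m*m).
 { eapply Rle_trans; [apply Cexp_1_third; lra|]. have := Cmod_ge_0 (Xi v0).
  apply Rle_trans with (3*((2*D*m)*(2*D*m)*(2*D*m))); [|nra]. apply Rmult_le_compat_l; [lra|].
  apply Rmult_le_compat; try nra. }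
 set (E3 := (u-v0-v0*v0/2)%C). have HE3: Cmod E3 <= 3*(m*m*m).
 { unfold E3. replace u with (Cexp v0-1)%C by (rewrite Hv0; ring). apply Cexp_1_third. fold m. lra. }
 have Hmu2: Cmod (v0*v0-u*u) <= 8*(m*m*m).
 { replace (v0*v0-u*u)%C with ((v0-u)*(v0+u))%C by ring. rewrite Cmod_mult. have H1: Cmod (v0-u) <= 2*(m*m).
  { replace (v0-u)%C with (- (E3+v0*v0/2))%C by (unfold E3; ring). rewrite Cmod_opp. le_trans Cmod_triangle.
   unfold Cdiv. rewrite !Cmod_mult. fold m. rewrite Cmod_inv by (intros E; injection E; lra).
   rewrite Cmod_pos_R by lra. nra. }
  have H2: Cmod (v0+u) <= 4*m.
  { replace (v0+u)%C with (2*v0-(v0-u))%C by ring. le_trans Cmod_minus_le. rewrite Cmod_mult, Cmod_pos_R by lra.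
   fold m. nra. }
  have := Cmod_ge_0 (v0-u)%C. have := Cmod_ge_0 (v0+u)%C. apply Rle_trans with ((2*(m*m))*(4*m)); [|lra].
  apply Rmult_le_compat; auto. }
 set (Er := (fm v0-1-u-u*u*am)%C). have Htc: RtoC th <> 0 by (intros E; injection E; lra).
 have HEr: Er = (th*E1+v0*E1+th*(E1*E1)/2+th*E2-E3
   + am*(v0*v0-u*u))%C.
 { unfold Er, mf. replace (Cexp (Xi v0)) with (E2+1+Xi v0+Xi v0*Xi v0/2)%C by (unfold E2; ring).
  replace (Xi v0) with (v0 * / th+E1)%C by (unfold E1; rewrite RtoC_inv by lra; ring).
  unfold E3. rewrite RtoC_minus, RtoC_div, RtoC_minus, RtoC_inv by lra. field. auto. }
 have Hth1: th <= 1. { have := th_upper; lra. } have HErm: Cmod Er <= 3*ep*(m*m)+40*(D*D*D)*(m*m*m).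
 { rewrite HEr. have B1: Cmod (th*E1) <= ep*(m*m).
  { rewrite Cmod_mult, Cmod_pos_R by lra. have := Cmod_ge_0 E1. nra. }
  have B2: Cmod (v0*E1) <= ep*(m*m).
  { rewrite Cmod_mult. fold m. have := Cmod_ge_0 E1. nra. }
  have B3: Cmod (th*(E1*E1)/2) <= ep*(m*m).
  { unfold Cdiv. rewrite !Cmod_mult, Cmod_pos_R by lra.
   rewrite Cmod_inv by (intros E; injection E; lra). rewrite Cmod_pos_R by lra.
   have := Cmod_ge_0 E1. have: m*m <= 1 by nra. have: ep*(m*m) <= 1 by nra.
   have: Cmod E1*Cmod E1 <= ep*(m*m) by nra. nra. }
  have B4: Cmod (th*E2) <= 24*(D*D*D)*(m*m*m).
  { rewrite Cmod_mult, Cmod_pos_R by lra. have := Cmod_ge_0 E2. nra. }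
  have B5: Cmod (am*(v0*v0-u*u)) <= 8*D*(m*m*m).
  { rewrite Cmod_mult, Cmod_pos_R by lra. have := Cmod_ge_0 (v0*v0-u*u)%C.
   apply Rle_trans with (D*(8*(m*m*m))); [|lra]. apply Rmult_le_compat; lra. }
  have Hm3: 0 <= m*m*m by (apply Rmult_le_pos; nra). have HD3: 4*4*D <= D*D*D by nra. le_trans Cmod_triangle.
  eapply Rle_trans; [apply Rplus_le_compat_r; apply Cmod_minus_le|].
  eapply Rle_trans; [apply Rplus_le_compat_r, Rplus_le_compat_r; apply Cmod_triangle|].
  eapply Rle_trans; [apply Rplus_le_compat_r, Rplus_le_compat_r, Rplus_le_compat_r; apply Cmod_triangle|].
  eapply Rle_trans; [apply Rplus_le_compat_r, Rplus_le_compat_r, Rplus_le_compat_r, Rplus_le_compat_r; apply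
   Cmod_triangle|].
  have: 8*D*(m*m*m) <= (D*D*D)*(m*m*m) by mono.
  have: 3*(m*m*m) <= (D*D*D)*(m*m*m) by (apply Rmult_le_compat_r; nra). lra. }
 exists (Er/(u*u))%C. split.
 - have Huu: (u*u <> 0)%C by (apply Cmult_neq_0; auto). rewrite Cmod_div, Cmod_mult by auto.
  set (a := Cmod u) in *. have: 0 < a by lra. apply Rle_div_l; [nra|].
  have H2: m*m <= 4*(a*a) by nra. have H3: m*m*m <= 8*(a*a*a).
  { apply Rle_trans with ((4*(a*a))*(2*a)); [|lra]. apply Rmult_le_compat; nra. }
  have HD3: 64 <= D*D*D by nra. have A2: 40*(D*D*D)*(m*m*m) <= 320*(D*D*D)*de*(a*a).
  { apply Rle_trans with (40*(D*D*D)*(8*(a*a*a))).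
   - apply Rmult_le_compat_l; lra.
   - replace (40*(D*D*D)*(8*(a*a*a))) with (320*(D*D*D)*(a*a)*a) by ring.
    replace (320*(D*D*D)*de*(a*a)) with (320*(D*D*D)*(a*a)*de) by ring.
    apply Rmult_le_compat_l; [|auto]. apply Rmult_le_pos; nra. }
  have A3: 12*ep*(a*a) <= 320*(D*D*D)*ep*(a*a).
  { apply Rmult_le_compat_r; [nra|]. apply Rmult_le_compat_r; lra. }
  have A4: 320*(D*D*D)*(ep+de)*(a*a) <= 1/32*(a*a) by (apply Rmult_le_compat_r; nra). nra.
 - unfold Er. field. auto.
Qed.

Lemma near_form v c : Cexp v <> 1 -> Cmod (Cexp v-1) <= de -> Re c = 1 -> Cmod c <= 2 ->
 fm v <> 1 /\ Re (Cconj c/(fm v-1)) <= Re (Cconj c/(Cexp v-1))-1/2.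
Proof.
 intros Hne Hu Hc Hc2. have Ha := am_bounds. destruct (near_expansion v Hu) as (w&Hw&E).
 have Hne': (Cexp v-1 <> 0)%C by (apply Cminus_eq_contra; auto).
 destruct (near_step (Cexp v-1)%C w c am Hne') as [H1 H2]; try auto; try lra.
 - rewrite Cmod_mult. have Ht := Cmod_triangle (am) w. rewrite Cmod_pos_R in Ht by lra.
  have := Cmod_ge_0 (Cexp v-1)%C. have := Cmod_ge_0 (am+w)%C. apply Rle_trans with (de*(2*D)); [|nra].
  apply Rmult_le_compat; lra.
 - rewrite E. split.
  + intros E2. apply H1. rewrite <- E, E2. ring.
  + lra.
Qed.

Lemma far_Xi v : Re v <= M -> Cmod (Cexp v)*Cmod (Cexp v) <= 1-mu -> Re v <= - mu/2 /\ Re (Xi v) <= - mu.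
Proof.
 intros HRe HC. have Hm := mu_pos. rewrite Cmod_Cexp in HC. have Hv: Re v <= - mu/2.
 { destruct (Rle_dec (Re v) (- mu/2)) as [H|H]; [auto|exfalso].
  have H1: exp (- mu) < exp (Re v+Re v) by (apply exp_increasing; lra).
  rewrite exp_plus in H1. have := exp_ineq1_le (- mu). lra. }
 split; [auto|]. unfold mXi. rewrite re_plus, re_scal_l.
 have H1 := Re_le_Cmod (et v). have H2 := et_bound v HRe. rewrite Rabs_left1 in H2 by lra. nra.
Qed.

(** Near 1 the translation in the coordinate [1/(y-1)] pushes points strictly inside. Far from 1 a
    point of the closed petal has modulus less than 1, so its image falls into the disc of
    [V_ball]. *)
Lemma fm_Vc_V v : Re v <= M -> Vc (Cexp v) -> Cexp v <> 1 -> V (fm v).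
Proof.
 intros HRe HV Hne. destruct (Rle_dec (Cmod (Cexp v-1)) de) as [H|H].
 - destruct (Vc_form _ Hne HV) as (c&Hc&Hf), (sgc_facts c Hc) as [Hc1 Hc2].
  destruct (near_form v c Hne H Hc1 Hc2) as [H1 H2]. apply (V_of_form _ c H1 Hc). lra.
 - have Hfar := Vc_far _ HV ltac:(lra). destruct (far_Xi v HRe Hfar) as [_ HX]. have := mu_pos.
  destruct th_facts as [Ht _]. have Hlt: Cmod (th*Cexp (Xi v))%C < th.
  { rewrite Cmod_mult, Cmod_pos_R, Cmod_Cexp by lra. rewrite <- (Rmult_1_r th) at 2. apply Rmult_lt_compat_l; [auto|].
   rewrite <- exp_0. apply exp_increasing. lra. }
  apply V_ball; [lra|]. intros E. have E2: (th*Cexp (Xi v))%C = th.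
  { transitivity (RtoC (1-th)+th*Cexp (Xi v)-RtoC (1-th))%C; [ring|]. rewrite E, RtoC_minus. ring. }
  rewrite E2, Cmod_pos_R in Hlt by lra. lra.
Qed.

Lemma lin_exp_bound x : 0 <= x -> (x+4)*exp (- x) <= 5.
Proof.
 intros Hx. rewrite exp_Ropp. apply Rle_div_l; [apply exp_pos|]. have := exp_ineq1_le x. lra.
Qed.

(** The bound is uniform up to [Re v = -infinity]: [et] grows at most linearly in [Re v], while the
    power decays exponentially. *)
Lemma et_pow_error v : Re v <= 0 -> Cmod (Cexp (Xi v)-Cexp v^N)%C <= 15*ep.
Proof.
 intros Hv. unfold mXi. rewrite Cexp_plus, Cexp_INR_mult.
 replace (Cexp v^N*Cexp (et v)-Cexp v^N)%C with (Cexp v^N*(Cexp (et v)-Cexp 0))%C by (rewrite Cexp_0; ring).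
 rewrite Cmod_mult, Cmod_pow, Cmod_Cexp. have Hb: Cmod (et v) <= ep*(- Re v+4).
 { eapply Rle_trans; [apply et_bound; lra|]. rewrite Rabs_left1 by lra. lra. }
 set (x := - Re v) in *. have Hx: 0 <= x by (unfold x; lra).
 have HL: Cmod (Cexp (et v)-Cexp 0)%C <= exp (ep*(x+4))*(ep*(x+4)).
 { le_trans (Cexp_lipschitz (ep*(x+4))).
  - have := Re_le_Cmod (et v). lra.
  - simpl. nra.
  - replace (et v-0)%C with (et v) by ring. apply Rmult_le_compat_l; [left; apply exp_pos|auto]. }
 have Hp: exp (Re v)^N = exp (- (D*x)).
 { rewrite <- exp_INR_mult. f_equal. unfold x. ring. }
 rewrite Hp. apply Rle_trans with (exp (- (D*x))*(exp (ep*(x+4))*(ep*(x+4)))).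
 { apply Rmult_le_compat_l; [left; apply exp_pos|auto]. }
 rewrite <- Rmult_assoc, <- exp_plus. apply Rle_trans with (exp (1 + - x)*(ep*(x+4))).
 { apply Rmult_le_compat_r; [nra|]. apply exp_le. nra. }
 rewrite exp_plus. have He := exp_le_3. have HLn := lin_exp_bound x Hx. have := exp_pos (- x).
 replace (exp 1*exp (- x)*(ep*(x+4))) with (exp 1*(ep*((x+4)*exp (- x)))) by ring.
 apply Rle_trans with (3*(ep*5)); [|lra]. apply Rmult_le_compat; try lra.
 - left; apply exp_pos.
 - apply Rmult_le_pos; [lra|]. apply Rmult_le_pos; lra.
 - apply Rmult_le_compat_l; lra.
Qed.

Lemma pow_le_sqr r n : 0 <= r <= 1 -> (2 <= n)%nat -> r^n <= r*r.
Proof.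
 intros Hr Hn. destruct n as [|[|n]]; try lia. simpl.
 have: 0 <= r^n <= 1. { split; [apply pow_le; lra|]. rewrite <- (pow1 n). apply pow_incr; lra. } nra.
Qed.

(** Near 1 this is the translation with [c = 1]. Elsewhere [1/(1-fm v) = (1/th)/(1-E)] with [1/th]
    close to [N] and [E] close to the pure power. [poisson_power] then gives an increase of
    [(N-1)/2 >= 3/2], from which the perturbation takes only a small part. *)
Lemma fm_lyapunov v : Re v <= M -> V (Cexp v) -> Re (/ (1-Cexp v))+1/2 <= Re (/ (1-fm v)).
Proof.
 intros HRe HV. have Hne := V_not_1 _ HV. destruct th_facts as (Ht&Hit&_). have Hmp := mu_pos.
 destruct (Rle_dec (Cmod (Cexp v-1)) de) as [H|H].
 - have C1: Re (RtoC 1) = 1 by auto. have C2: Cmod (RtoC 1) <= 2 by (rewrite Cmod_1; lra).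
  destruct (near_form v 1 Hne H C1 C2) as [H1 H2]. have Hc: Cconj 1 = 1%C by (apply C_ext; simpl; ring).
  rewrite Hc in H2. have Hn1: (Cexp v-1 <> 0)%C by (apply Cminus_eq_contra; auto).
  have Hn2: (fm v-1 <> 0)%C by (apply Cminus_eq_contra; auto). have N1: (1-Cexp v <> 0)%C.
  { intros E. apply Hn1. replace (Cexp v-1)%C with (- (1-Cexp v))%C by ring. rewrite E. ring. }
  have N2: (1-fm v <> 0)%C.
  { intros E. apply Hn2. replace (fm v-1)%C with (- (1-fm v))%C by ring. rewrite E. ring. }
  replace (/ (1-Cexp v))%C with (- (1/(Cexp v-1)))%C by (field; split; auto).
  replace (/ (1-fm v))%C with (- (1/(fm v-1)))%C by (field; split; auto). rewrite !re_opp. lra.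
 - have Hfar := Vc_far _ (V_Vc _ HV) ltac:(lra). destruct (far_Xi v HRe Hfar) as [Hv0 HX].
  have Herr := et_pow_error v ltac:(lra). set (E := Cexp (Xi v)) in *. set (E0 := (Cexp v^N)%C) in *.
  have HE0: Cmod E0 <= 1-mu.
  { unfold E0. rewrite Cmod_pow. eapply Rle_trans; [|exact Hfar]. have := Cmod_ge_0 (Cexp v). apply pow_le_sqr.
   - split; [auto|nra].
   - apply INR_le. simpl. lra. }
  have HEb: Cmod E < 1.
  { unfold E. rewrite Cmod_Cexp, <- exp_0. apply exp_increasing. lra. }
  have Hy1: Cmod (Cexp v) < 1.
  { rewrite Cmod_Cexp, <- exp_0. apply exp_increasing. lra. }
  have HP: Re (/ (1-Cexp v))+(D-1)/2 <= D*Re (/ (1-E0)).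
  { destruct N as [|n]; [simpl in HN; lra|]. have HP := poisson_power (Cexp v) n Hy1. rewrite S_INR in *.
   replace (INR n+1-1) with (INR n) by ring. auto. }
  have Hn0 := one_minus_neq0 E0 ltac:(lra). have Hn1 := one_minus_neq0 E HEb. have Hd0: mu <= Cmod (1-E0).
  { have Hq := Cmod_reverse 1 E0. rewrite Cmod_1 in Hq. lra. }
  have Hep15: 15*ep <= mu/2.
  { nra. }
  have Hd1: mu/2 <= Cmod (1-E).
  { have Hq := Cmod_reverse (1-E0)%C (E-E0)%C. replace (1-E0-(E-E0))%C with (1-E)%C in Hq by ring. lra. }
  have Hdiff: Cmod (/ (1-E) - / (1-E0)) <= 30*ep/(mu*mu).
  { replace (/ (1-E) - / (1-E0))%C with ((E-E0)/((1-E)*(1-E0)))%C by (field; split; auto).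
   rewrite Cmod_div by (apply Cmult_neq_0; auto). rewrite Cmod_mult.
   replace (30*ep/(mu*mu)) with (15*ep/(mu/2*mu)) by (field; lra). apply Rmult_le_compat; try auto.
   - apply Cmod_ge_0.
   - left. apply Rinv_0_lt_compat. nra.
   - apply Rinv_le_contravar; [nra|]. apply Rmult_le_compat; lra. }
  have Hfm: (1-fm v = th*(1-E))%C.
  { unfold mf. fold E. rewrite RtoC_minus. ring. }
  rewrite Hfm. have Htc: RtoC th <> 0 by (intros Eq; injection Eq; lra).
  replace (/ (th*(1-E)))%C with (RtoC (/ th) * / (1-E))%C by (rewrite RtoC_inv by lra; field; split; auto).
  rewrite re_scal_l. have A: Re (/ (1-E0))-30*ep/(mu*mu) <= Re (/ (1-E)).
  { have Hq := Re_ge_Cmod (/ (1-E) - / (1-E0))%C. rewrite Re_minus in Hq. lra. }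
  have B: Rabs (Re (/ (1-E0))) <= / mu.
  { le_trans re_le_Cmod. rewrite Cmod_inv by auto. apply Rinv_le_contravar; lra. }
  apply Rabs_le_between in B. have Hmm: 0 < mu*mu by nra. have C1: D*(30*ep/(mu*mu)) <= 3/40.
  { replace (D*(30*ep/(mu*mu))) with ((30*D*ep)/(mu*mu)) by (field; lra). apply Rle_div_l; [auto|]. lra. }
  have C2: ep * / mu <= 1/16.
  { apply Rmult_le_reg_r with mu; [auto|]. rewrite Rmult_assoc, Rinv_l by lra. lra. }
  have C3: 0 <= 30*ep/(mu*mu).
  { apply Rmult_le_pos; [lra|left; apply Rinv_0_lt_compat; auto]. }
  set (x := Re (/ (1-E0))) in *. set (z := Re (/ (1-E))) in *.
  set (err := 30*ep/(mu*mu)) in *. set (t := / th) in *. set (im := / mu) in *. have: t*z >= t*(x-err) by nra.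
  have: t*(x-err) >= D*x-ep*im-(D+ep)*err.
  { have: Rabs ((t-D)*x) <= ep*im.
   { rewrite Rabs_mult. apply Rmult_le_compat; try apply Rabs_pos.
    - apply Rabs_le; lra.
    - apply Rabs_le; lra. }
   apply Rabs_le_between in H1. nra. }
  have: (D+ep)*err <= 2*(D*err) by nra. lra.
Qed.

Lemma fm_notV_Xi v : Re v <= M -> ~ V (fm v) -> 0 <= Re (Xi v) /\ - (2*ep) <= Re v.
Proof.
 intros HRe HV. destruct th_facts as [Ht _]. have HX: 0 <= Re (Xi v).
 { destruct (Rle_dec 0 (Re (Xi v))) as [H|H]; [auto|exfalso; apply HV]. have Hlt: Cmod (th*Cexp (Xi v))%C < th.
  { rewrite Cmod_mult, Cmod_pos_R, Cmod_Cexp by lra. rewrite <- (Rmult_1_r th) at 2. apply Rmult_lt_compat_l; [auto|].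
   rewrite <- exp_0. apply exp_increasing. lra. }
  apply V_ball; [lra|]. intros E. have E2: (th*Cexp (Xi v))%C = th.
  { transitivity (RtoC (1-th)+th*Cexp (Xi v)-RtoC (1-th))%C; [ring|]. rewrite E, RtoC_minus. ring. }
  rewrite E2, Cmod_pos_R in Hlt by lra. lra. }
 split; [auto|]. destruct (Rle_dec (- (2*ep)) (Re v)) as [H|H]; [auto|exfalso].
 unfold mXi in HX. rewrite re_plus, re_scal_l in HX. have := Re_le_Cmod (et v). have H2 := et_bound v HRe.
 rewrite Rabs_left in H2 by lra. nra.
Qed.

End LocalModel.

(** * Expansion outside the petal, and star shape of the petal *)

Section Contraction.

Context {N : nat} {ka de mu d4 ep M th : R} {et et' : C -> C}.
Hypothesis LM : @local_model N ka de mu d4 ep M th et et'.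
Local Notation D := (INR N).
Local Notation Xi := (mXi N et).
Local Notation fm := (mf N th et).
Local Notation ro := (mro N).
Local Notation Vq := (mVq N ka).
Local Notation V := (mV N ka).
Local Notation Vc := (mVc N ka).

Lemma Xi_lower v v' : Re v <= M -> Re v' <= M -> (D-ep)*Cmod (v-v') <= Cmod (Xi v-Xi v').
Proof.
 intros Hv Hv'. have HN := lm_N LM. have H := C11_lip _ _ _ _ _ v v' (Cconvex_Re_le M) (lm_et LM) Hv Hv'.
 have H2 := Cmod_reverse (D*(v-v'))%C (- (et v-et v'))%C.
 replace (D*(v-v') - - (et v-et v'))%C with (Xi v-Xi v')%C in H2 by (unfold mXi; ring).
 rewrite Cmod_mult, Cmod_pos_R, Cmod_opp in H2 by lra. lra.
Qed.

(** The tilt at work: an untilted petal would leave out a region tangent to a half-plane, and no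
    positive lower bound for [Re v/|v|] would hold. This bound is the source of the linear gain in
    [mX_near]. *)
Lemma sector v : Cmod v <= ka/32 -> ~ V (Cexp v) -> ka/8*Cmod v <= Re v.
Proof.
 intros Hv HV. have Hka := lm_ka LM. have Hr := ro_bounds LM. unfold mV, mVq in HV. apply Rnot_lt_le in HV.
 set (u := (Cexp v-1)%C) in *. have Hv0 := Cmod_ge_0 v. set (m := Cmod v) in *.
 have Hu: Cmod (u-v) <= 3*(m*m) by (apply Cexp_1_second; fold m; lra).
 have H1 := Cmod_reverse v (v-u)%C. replace (v-(v-u))%C with u in H1 by ring.
 rewrite (Cmod_sym v u) in H1. fold m in H1. have H2: Cmod u <= m+3*(m*m).
 { have H := Cmod_triangle v (u-v)%C. replace (v+(u-v))%C with u in H by ring. fold m in H. lra. }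
 have Hu0 := Cmod_ge_0 u. set (a := Cmod u) in *. have Ha: a <= ka/16 by nra.
 have H3 := Cmod_le_Re_Im u. fold a in H3. have H4 := re_le_Cmod u. apply Rabs_le_between in H4.
 have Hre: ka/4*a <= Re u.
 { destruct (Rle_dec (ka/4*a) (Re u)) as [H|H]; [auto|exfalso].
  have HR: - (a*a) <= 15/8*(Re u-ka*Rabs (Im u)) \/ 0 <= Re u-ka*Rabs (Im u).
  { destruct (Rle_dec 0 (Re u-ka*Rabs (Im u))); [right; auto|left; nra]. }
  have Hlow: - (a*a) <= Re u.
  { have := Rabs_pos (Im u). destruct HR; nra. }
  have Habs: Rabs (Re u) <= a/8.
  { apply Rabs_le. split; nra. }
  have Ha0: 0 < a.
  { nra. }
  destruct HR; nra. }
 have H5 := Re_ge_Cmod (v-u)%C. rewrite Re_minus, Cmod_sym in H5. nra.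
Qed.

(** With [t = 1/th] and [b = (1-th)t^2/2], the Taylor expansion of [mX] starts with [t*v-b*v^2], so
    [mX v-mX v'] is close to [(v-v')*(t-b*(v+v'))]. As [v+v'] lies in the sector, [|t-b*(v+v')|]
    falls below [t] by a multiple of [ka*(|v|+|v'|)]. On the other side [Xi] expands by [t] up to
    [ep*(|v|+|v'|)], which is smaller. *)
Lemma mX_near v v' : Cmod v <= d4 -> Cmod v' <= d4 -> ~ V (Cexp v) -> ~ V (Cexp v') ->
 Cmod (mX th v-mX th v') <= / th*Cmod (v-v') /\ Cmod (mX th v-mX th v')+ka/64*(Cmod v+Cmod v')*Cmod (v-v')
  <= Cmod (Xi v-Xi v').
Proof.
 intros Hv Hv' HV HV'. destruct (th_facts LM) as (Ht&Hit&Hd). have Hka := lm_ka LM. have HN := lm_N LM.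
 have Hep := lm_ep LM. have Hd4 := lm_s5 LM. have Hs6 := lm_s6 LM. have Ht3 := th_upper LM.
 have Hd4b: d4 <= ka/16000 by nra. have Hs := sector v ltac:(lra) HV. have Hs' := sector v' ltac:(lra) HV'.
 set (t := / th) in *. set (b := ((1-th)*(t*t)/2)). set (h := fun z => (mX th z+(- t*z+b*(z*z)))%C).
 set (s := Cmod v+Cmod v'). have Hv0 := Cmod_ge_0 v. have Hv0' := Cmod_ge_0 v'. have Hs0: 0 <= s by (unfold s; lra).
 have Hs1: s <= 2*d4 by (unfold s; lra). have Htt: th*t = 1 by (unfold t; field; lra). have Hs2: s <= th/8.
 { have: th >= / (D+1) by (apply Rle_ge, (th_lower LM)). have: 2*d4 <= / (D+1)/8; [|lra].
  apply Rmult_le_reg_r with (8*(D+1)); [lra|]. field_simplify; [|lra]. nra. }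
 have Hden: forall z, Cmod z <= s -> exists g,
   (1-RtoC (1-th)*Cexp (- z) = th+g)%C /\ Cmod (g-RtoC (1-th)*z) <= 3*(Cmod z*Cmod z) /\ Cmod g <= 2*Cmod z.
 { intros z Hz. exists (RtoC (1-th)*(1-Cexp (- z)))%C. have Hz0 := Cmod_ge_0 z.
  have Hz1: Cmod (Cexp (- z)-1 - - z)%C <= 3*(Cmod z*Cmod z).
  { rewrite <- (Cmod_opp z). apply Cexp_1_second. rewrite Cmod_opp. lra. }
  split; [rewrite RtoC_minus; ring|split].
  - replace (RtoC (1-th)*(1-Cexp (- z))-RtoC (1-th)*z)%C with (- (RtoC (1-th)*(Cexp (- z)-1 - - z)))%C by ring.
   rewrite Cmod_opp, Cmod_mult, Cmod_pos_R by lra. nra.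
  - rewrite Cmod_mult, Cmod_pos_R by lra. have: Cmod (1-Cexp (- z))%C <= Cmod z+3*(Cmod z*Cmod z).
   { replace (1-Cexp (- z))%C with (z-(Cexp (- z)-1 - - z))%C by ring. le_trans Cmod_minus_le. lra. }
   nra. }
 have Hder: forall z, Cmod z <= s -> exists l, Cderiv h z l /\ Cmod l <= 12*(t*t*t)*(s*s).
 { intros z Hz. destruct (Hden z Hz) as (g&Hg1&Hg2&Hg3). have Htg: th/2 <= Cmod (th+g).
  { have H := Cmod_reverse (th) (- g)%C. rewrite Cmod_opp, Cmod_pos_R in H by lra.
   replace (th - - g)%C with (th+g)%C in H by ring. lra. }
  have Htn: (th+g <> 0)%C by (apply Cmod_gt_0; lra). have Htc: RtoC th <> 0 by (intros E; injection E; lra).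
  have Hx: Cmod (RtoC (1-th)*Cexp (- z))%C < 1.
  { replace (RtoC (1-th)*Cexp (- z))%C with (RtoC (1-th)-(g-RtoC 0))%C.
   2:{ transitivity (1-(1-RtoC (1-th)*Cexp (- z)))%C; [rewrite Hg1, RtoC_minus; ring|ring]. }
   eapply Rle_lt_trans; [apply Cmod_minus_le|]. rewrite Cmod_pos_R by lra. replace (g-0)%C with g by ring. lra. }
  exists (/ (th+g)+(- t+RtoC (2*b)*z))%C. split.
  - apply Cderiv_plus.
   + replace (/ (th+g))%C with (1+(- / (1-RtoC (1-th)*Cexp (- z)))*(RtoC (1-th)*(Cexp (- z)*(-1*1))))%C.
    2:{ rewrite Hg1. replace (RtoC (1-th)*(Cexp (- z)*(-1*1)))%C with (- (1-(th+g)))%C by (rewrite <- Hg1; ring).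
      field. auto. }
    apply Cderiv_plus; [apply Cderiv_id|]. apply (Cderiv_comp (fun z => RtoC (1-th)*Cexp (- z))%C Log1m).
    * apply Cderiv_scal. apply (Cderiv_comp (fun z => - z)%C Cexp); [|apply Cderiv_exp].
     apply (Cderiv_ext (fun z => -1*z)%C).
     { exists 1; split; [lra|]. intros; ring. }
     apply Cderiv_scal, Cderiv_id.
    * apply Cderiv_Log1m. auto.
   + apply Cderiv_plus.
    * replace (- t)%C with (- t*1)%C at 2 by ring. apply Cderiv_scal, Cderiv_id.
    * intros eps Heps. exists (eps/(Rabs b+1)).
     have := Rabs_pos b. split; [apply Rdiv_lt_0_compat; lra|]. intros k Hk. rewrite RtoC_mult.
     replace (b*((z+k)*(z+k))-b*(z*z)-2*b*z*k)%C with (b*(k*k))%C by ring.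
     rewrite !Cmod_mult, Cmod_R. have := Cmod_ge_0 k. apply Rlt_div_r in Hk; [|lra]. nra.
  - have El: (/ (th+g)+(- t+RtoC (2*b)*z) = RtoC (t*t)*(g*g * / (th+g))-RtoC (t*t)*(g-RtoC (1-th)*z))%C.
   { unfold b, t. replace (2*((1-th)*(/ th * / th)/2)) with ((1-th)*(/ th * / th)) by (field; lra).
    rewrite !RtoC_mult, !RtoC_inv by lra. field. split; auto. }
   rewrite El. le_trans Cmod_minus_le. rewrite !Cmod_mult, Cmod_pos_R by nra. rewrite Cmod_inv by auto.
   have Hi: / Cmod (th+g) <= 2*t.
   { replace (2*t) with (/ (th/2)) by (unfold t; field; lra). apply Rinv_le_contravar; lra. }
   have Hip: 0 < / Cmod (th+g) by (apply Rinv_0_lt_compat; lra). have Hg0 := Cmod_ge_0 g.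
   have A1: Cmod g*Cmod g * / Cmod (th+g) <= 4*(s*s)*(2*t).
   { apply Rmult_le_compat; try lra; try nra. }
   have Ht1: 3 <= t by lra. apply Rle_trans with (t*t*(4*(s*s)*(2*t))+t*t*(3*(s*s))); [|nra].
   apply Rplus_le_compat; apply Rmult_le_compat_l; try nra. }
 have HL: Cmod (h v-h v'-0*(v-v')) <= 12*(t*t*t)*(s*s)*Cmod (v-v').
 { have Hex: exists h', forall z, Cmod z <= s -> Cderiv h z (h' z) /\ Cmod (h' z) <= 12*(t*t*t)*(s*s).
  { destruct (fun_choice (fun z l => Cmod z <= s ->
     Cderiv h z l /\ Cmod l <= 12*(t*t*t)*(s*s))) as [h' Hh'].
   - intros z. destruct (Rle_dec (Cmod z) s) as [H|H].
    + destruct (Hder z H) as [l Hl]. exists l; auto.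
    + exists 0%C. intros; contradiction.
   - exists h'. auto. }
  destruct Hex as [h' Hh']. apply (Cmvt_convex (fun z => Cmod z <= s) h h').
  - apply Cconvex_disk.
  - intros z Hz. apply Hh', Hz.
  - intros z Hz. replace (h' z-0)%C with (h' z) by ring. apply Hh', Hz.
  - unfold s. lra.
  - unfold s. lra. }
 set (w := (v+v')%C). have E: (mX th v-mX th v' = (h v-h v'-0*(v-v'))+(v-v')*(t-b*w))%C by (unfold h, w; ring).
 have Hw: ka/8*s <= Re w by (unfold w, s; rewrite re_plus; lra).
 have Hw2: Cmod w <= s by (unfold w, s; apply Cmod_triangle). have Hw0 := Cmod_ge_0 w. have Hb1: t*t/3 <= b <= t*t/2.
 { unfold b. split; nra. }
 have Ht1: 3 <= t by lra. have Hsqr: Cmod (t-b*w)*Cmod (t-b*w) = t*t-2*t*(b*Re w)+b*b*(Cmod w*Cmod w).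
 { rewrite !Cmod_sqr. unfold Re, Im; simpl. ring. }
 have Hmain: Cmod (t-b*w) <= t-(b*(ka/8*s)-b*b*(s*s)/t).
 { apply sqrt_like; try lra.
  - have: b*s/t <= ka/8.
   { apply Rle_div_l; [lra|].
    apply Rle_trans with (t*t/2*(2*d4)); [apply Rmult_le_compat; nra|]. have: t*d4 <= ka/8 by nra. nra. }
   replace (b*(ka/8*s)-b*b*(s*s)/t) with (b*s*(ka/8-b*s/t)) by (field; lra).
   apply Rmult_le_pos; [apply Rmult_le_pos; nra|lra].
  - apply Cmod_ge_0.
  - replace (t*t-2*t*(b*(ka/8*s)-b*b*(s*s)/t)) with (t*t-2*t*(b*(ka/8*s))+2*(b*b*(s*s))) by (field; lra).
   have: b*(ka/8*s) <= b*Re w by (apply Rmult_le_compat_l; nra).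
   have: b*b*(Cmod w*Cmod w) <= b*b*(s*s) by (apply Rmult_le_compat_l; nra). nra. }
 set (dv := Cmod (v-v')) in *. have Hdv: 0 <= dv by apply Cmod_ge_0. have Hrho: Cmod (mX th v-mX th v') <=
   dv*(t-b*(ka/8*s)+b*b*(s*s)/t+12*(t*t*t)*(s*s)).
 { rewrite E. le_trans Cmod_triangle. rewrite Cmod_mult. fold dv. nra. }
 have HtD: t <= 2*D by lra. have Hts: t*s <= ka/1000.
 { apply Rle_trans with (2*D*(2*d4)); [apply Rmult_le_compat; lra|]. lra. }
 have Hquad: b*b*(s*s)/t+12*(t*t*t)*(s*s) <= t*t*(ka/70*s).
 { have: b*b*(s*s)/t <= t*t*t*(s*s).
  { apply Rle_div_l; [lra|]. apply Rle_trans with (t*t*(t*t)*(s*s)); [apply Rmult_le_compat_r; nra|]. nra. }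
  have: t*t*t*(s*s) <= t*t*(ka/1000*s).
  { replace (t*t*t*(s*s)) with (t*t*(t*s*s)) by ring. apply Rmult_le_compat_l; [nra|]. apply Rmult_le_compat_r; lra. }
  have: 0 <= t*t*(ka*s) by (apply Rmult_le_pos; nra). nra. }
 have Hlin: t*t*(ka/24*s) <= b*(ka/8*s).
 { have: 0 <= ka*s by nra. nra. }
 have H9: 9*(ka*s) <= t*t*(ka*s).
 { apply Rmult_le_compat_r; nra. }
 have Hrho2: Cmod (mX th v-mX th v') <= dv*(t-ka/20*s).
 { eapply Rle_trans; [exact Hrho|]. apply Rmult_le_compat_l; [auto|]. nra. }
 have Hkas: 0 <= ka*s by nra. split; [nra|]. have HXi: dv*(t-ep*s) <= Cmod (Xi v-Xi v').
 { have HM := lm_M LM. have H := C11_second _ _ _ _ _ 0 v v' (Cconvex_Re_le M) (lm_et LM) ltac:(lra).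
  replace (v-0)%C with v in H by ring. replace (v'-0)%C with v' in H by ring.
  have H1: Cmod (et v-et v'-et' 0*(v-v')) <= ep*s*dv.
  { have := Re_le_Cmod v. have := Re_le_Cmod v'. apply H; simpl; lra. }
  have H2 := Cmod_reverse (t*(v-v'))%C (- (et v-et v'-et' 0*(v-v')))%C.
  rewrite Cmod_opp, Cmod_mult, Cmod_pos_R in H2 by lra. fold dv in H2.
  replace (t*(v-v') - - (et v-et v'-et' 0*(v-v')))%C with (Xi v-Xi v')%C in H2.
  2:{ unfold mXi. rewrite <- Hd. ring. } lra. }
 have: ep*s <= ka/64*s by mono. nra.
Qed.

Lemma Xi_shift v k : Xi (v+turn k)%C = (Xi v+RtoC D*turn k)%C.
Proof. unfold mXi. rewrite (lm_per LM). ring. Qed.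

(** The Lipschitz constant [1/(1-b)] of [mX] is about [N] and merely balances the expansion of [Xi].
    When one of the two points keeps distance [d4] from all lifts of the parabolic point,
    [Log1m_gain] improves it by a multiple of [d4^2], and [lm_s7] makes this exceed the errors. *)
Lemma mX_far v v' : Re v <= M -> Re v' <= M -> ~ V (fm v) -> ~ V (fm v') ->
 (forall k: Z, d4 < Cmod (v'-turn k)) -> Cmod (mX th v-mX th v') <= 2*D*Cmod (v-v') /\
 Cmod (mX th v-mX th v')+d4*d4/3072*Cmod (v-v') <= Cmod (Xi v-Xi v').
Proof.
 intros Hv Hv' HV HV' Hfar. destruct (th_facts LM) as (Ht&Hit&_). have HN := lm_N LM. have Hep := lm_ep LM.
 have Hd4 := lm_s5 LM. have Hs7 := lm_s7 LM. have Hka := lm_ka LM. have Ht3 := th_upper LM. have Ht4 := th_lower LM.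
 destruct (fm_notV_Xi LM v Hv HV) as [_ Hre], (fm_notV_Xi LM v' Hv' HV') as [_ Hre'].
 have Hd41: d4 <= 1/16000 by nra. set (g := 1-th). have Hg: 2/3 <= g < 1 by (unfold g; lra).
 have Hexp: exp (2*ep) <= 1+4*ep by (have := exp_small_bound (2*ep); lra).
 have Hye: forall z, - (2*ep) <= Re z -> Cmod (Cexp (- z)%C) <= 1+4*ep.
 { intros z Hz. rewrite Cmod_Cexp, re_opp. eapply Rle_trans; [|exact Hexp]. apply exp_le. lra. }
 set (x := (g*Cexp (- v))%C). set (x' := (g*Cexp (- v'))%C). set (b := g*(1+4*ep)).
 have HDD: 16 <= D*D by nra. have Hep2: 16*ep*200000 <= d4*d4 by nra.
 have Hd4s: d4*d4 <= 1/16000*(1/16000) by (apply Rmult_le_compat; lra). have Hthep: 8*ep*(D+1) <= 1/1000.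
 { have: ep*(D+1) <= ep*(D*D) by (apply Rmult_le_compat_l; nra). lra. }
 have Hth2: 8*ep <= th/1000.
 { have: 8*ep <= 1/1000 * / (D+1); [|lra].
  apply Rmult_le_reg_r with (D+1); [lra|]. replace (1/1000 * / (D+1)*(D+1)) with (1/1000) by (field; lra). lra. }
 have Hb: b < 1. { unfold b, g. nra. } have Hb1: th-4*ep <= 1-b. { unfold b, g in *. nra. } have Hx: Cmod x <= b.
 { unfold x, b. rewrite Cmod_mult, Cmod_pos_R by lra. apply Rmult_le_compat_l; [lra|]. apply Hye; auto. }
 have Hx': Cmod x' <= b.
 { unfold x', b. rewrite Cmod_mult, Cmod_pos_R by lra. apply Rmult_le_compat_l; [lra|]. apply Hye; auto. }
 set (c1 := d4*d4/384). have Hc1: 0 < c1 <= 1/1000 by (unfold c1; split; nra). set (y' := Cexp (- v')%C) in *.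
 have H2x: Cmod (2+x') <= 2+g-c1.
 { destruct (Rle_dec (Cmod y') (1/2)) as [Hy|Hy].
  - le_trans Cmod_triangle. unfold x'. rewrite Cmod_mult, !Cmod_pos_R by lra. nra.
  - apply Rnot_le_lt in Hy. have He1: d4/2 <= Cmod (Cexp v'-1).
   { destruct (Rle_dec (d4/2) (Cmod (Cexp v'-1))) as [H|H]; [auto|exfalso].
    destruct (small_log (Cexp v'-1)%C ltac:(lra)) as (w&Hw1&Hw2), (Cexp_eq v' w) as [k Hk]; [rewrite Hw1; ring|].
     specialize (Hfar k). rewrite Hk in Hfar.
    replace (w+turn k-turn k)%C with w in Hfar by ring. lra. }
   have Hyy: (Cexp v'*y' = 1)%C.
   { unfold y'. rewrite <- Cexp_plus, Cplus_opp_r. apply Cexp_0. }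
   have Hy1: d4/4 <= Cmod (y'-1).
   { replace (y'-1)%C with (- ((Cexp v'-1)*y'))%C.
    2:{ replace ((Cexp v'-1)*y')%C with (Cexp v'*y'-y')%C by ring. rewrite Hyy. ring. }
    rewrite Cmod_opp, Cmod_mult. apply Rle_trans with (d4/2*(1/2)); [lra|]. apply Rmult_le_compat; lra. }
   have Hyb := Hye v' Hre'. fold y' in Hyb. have E1: Cmod (y'-1)*Cmod (y'-1) = Cmod y'*Cmod y'-2*Re y'+1.
   { rewrite !Cmod_sqr. unfold Re, Im; simpl. ring. }
   have E2: Cmod (2+x')*Cmod (2+x') = 4+4*g*Re y'+g*g*(Cmod y'*Cmod y').
   { rewrite !Cmod_sqr. unfold Re, Im; simpl. ring. }
   have Hy2: Cmod y'*Cmod y' <= 1+9*ep by nra. have Hd16: d4/4*(d4/4) <= Cmod (y'-1)*Cmod (y'-1)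
    by (apply Rmult_le_compat; lra).
   have Hrey: Re y' <= 1+5*ep-d4*d4/32 by lra. have Hgc: 0 <= (1-g)*c1 by (apply Rmult_le_pos; lra).
   have Hcc: 0 <= c1*c1 by (apply Rmult_le_pos; lra). have := Cmod_ge_0 (2+x')%C.
   have Hfin: Cmod (2+x')*Cmod (2+x') <= (2+g-c1)*(2+g-c1).
   { have A1: 4*g*Re y' <= 4*g*(1+5*ep-d4*d4/32) by mono.
    have A2: g*g*(Cmod y'*Cmod y') <= g*g*(1+9*ep) by (apply Rmult_le_compat_l; nra).
    have A3: g*ep <= 1*ep by mono. have A4: g*(g*ep) <= 1*(g*ep) by (apply Rmult_le_compat_r; nra).
    have A5: 2/3*(d4*d4) <= g*(d4*d4) by (apply Rmult_le_compat_r; nra). have Ec1: c1 = d4*d4/384 by auto.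
    lra. }
   clear-Hfin H Hg Hc1. nra. }
 have Hxx: Cmod (x-x') <= b*Cmod (v-v').
 { unfold x, x', b. replace (g*Cexp (- v)-g*y')%C with (g*(Cexp (- v)-y'))%C by ring.
  rewrite Cmod_mult, Cmod_pos_R by lra. rewrite Rmult_assoc. apply Rmult_le_compat_l; [lra|].
  apply Rle_trans with (exp (2*ep)*Cmod (- v - - v')).
  - apply Cexp_lipschitz; rewrite re_opp; lra.
  - replace (- v - - v')%C with (- (v-v'))%C by ring. rewrite Cmod_opp.
   apply Rmult_le_compat_r; [apply Cmod_ge_0|auto]. }
 have HG := Log1m_gain b x x' Hb Hx Hx'. set (dv := Cmod (v-v')) in *. have Hdv: 0 <= dv by apply Cmod_ge_0.
 have H1b: 0 < 1-b by lra. have Hcoef: (Cmod (2+x')+Cmod x)/2+b*b/(1-b) <= / (1-b)-c1/2.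
 { replace (b*b/(1-b)) with (/ (1-b)-1-b) by (field; lra). have: g <= b by (unfold b; nra). lra. }
 have Hbh: 1/2 <= b by (unfold b; nra). have Hrho: Cmod (mX th v-mX th v') <= dv*(/ (1-b)-c1/4).
 { unfold mX. fold g. fold x. fold y'. fold x'.
  replace (v+Log1m x-(v'+Log1m x'))%C with ((v-v')+(Log1m x-Log1m x'))%C by ring. le_trans Cmod_triangle. fold dv.
  have: Cmod (Log1m x-Log1m x') <= (/ (1-b)-c1/2)*(b*dv).
  { eapply Rle_trans; [exact HG|]. have := Cmod_ge_0 (x-x')%C. have: 0 <= / (1-b)-c1/2.
   { have: 1 <= / (1-b); [|lra]. rewrite <- Rinv_1. apply Rinv_le_contravar; lra. }
   apply Rle_trans with ((/ (1-b)-c1/2)*Cmod (x-x')).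
   - apply Rmult_le_compat_r; auto.
   - apply Rmult_le_compat_l; auto. }
  have Ei: (/ (1-b))*b = / (1-b)-1 by (field; lra). have Ei2: / (1-b)*b*dv = (/ (1-b)-1)*dv by (rewrite Ei; ring).
  have Hbd: 1/2*dv <= b*dv by mono. have Hcbd: c1/2*(1/2*dv) <= c1/2*(b*dv) by mono. lra. }
 have Hib: / (1-b) <= D+ep+16*(D*D)*ep.
 { apply Rle_trans with (/ (th-4*ep)); [apply Rinv_le_contravar; lra|].
  apply Rmult_le_reg_r with (th-4*ep); [lra|]. rewrite Rinv_l by lra. have Htt: th * / th = 1 by (field; lra).
   clear-Htt Hit HN Hep Ht Hth2 Ht4 HDD.
  have H1: 1 <= th*(D+ep) by (rewrite <- Htt; apply Rmult_le_compat_l; lra). have H2: 1 <= th*(D+1).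
  { replace 1 with (/ (D+1)*(D+1)) at 1 by (field; lra). apply Rmult_le_compat_r; lra. }
  have HD2: 4/5*(D*(D+1)) <= D*D by nra. have H3: (D+ep)*4 <= 16*(D*D)*(th-4*ep).
  { apply Rle_trans with (16*(D*D)*(th*(999/1000))).
   - apply Rle_trans with (16*(4/5*(D*(D+1)))*(th*(999/1000))).
    + have: D*1 <= D*(th*(D+1)) by mono. lra.
    + apply Rmult_le_compat_r; lra.
   - apply Rmult_le_compat_l; lra. }
  have H4: ep*((D+ep)*4) <= ep*(16*(D*D)*(th-4*ep)) by mono. lra. }
 have HXi := Xi_lower v v' Hv Hv'. fold dv in HXi. split.
 - eapply Rle_trans; [exact Hrho|]. rewrite Rmult_comm. apply Rmult_le_compat_r; [auto|]. lra.
 - have Ec1: c1 = d4*d4/384 by auto. have: dv*(/ (1-b)-c1/4+d4*d4/3072) <= dv*(D-ep) by mono. lra.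
Qed.

(** Near the parabolic point the gain is linear in [|v|+|v'| >= |v-v'|], hence quadratic in the
    distance. Elsewhere it is linear in the distance, and the bound [B] converts it into a quadratic
    one. A quadratic gain suffices for the iteration in [rho_gc]. *)
Lemma mX_contraction B : 0 < B -> exists c, 0 < c /\
 forall v v', Re v <= M -> Re v' <= M -> ~ V (Cexp v) -> ~ V (Cexp v') -> ~ V (fm v) -> ~ V (fm v') ->
  Cmod (mX th v-mX th v') <= B -> Cmod (mX th v-mX th v')+c*(Cmod (mX th v-mX th v')*Cmod (mX th v-mX th v'))
   <= Cmod (Xi v-Xi v').
Proof.
 intros HB. destruct (th_facts LM) as (Ht&Hit&_). have HN := lm_N LM. have Hep := lm_ep LM.
 have Hd4 := lm_s5 LM. have Hka := lm_ka LM. have HM := lm_M LM. have Hd41: d4 <= 1/16000 by nra.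
 set (ca := ka/64*(th*th)). set (cb := d4*d4/3072/(2*D)/B). set (cc := / (2*B)).
 have Hca: 0 < ca by (unfold ca; apply Rmult_lt_0_compat; nra). have Hcb: 0 < cb.
 { repeat apply Rdiv_lt_0_compat; try lra. nra. }
 have Hcc: 0 < cc by (unfold cc; apply Rinv_0_lt_compat; lra). exists (Rmin ca (Rmin cb cc)).
 split; [repeat apply Rmin_glb_lt; auto|]. have Ha := Rmin_l ca (Rmin cb cc). have Hbc := Rmin_r ca (Rmin cb cc).
 have Hb := Rmin_l cb cc. have Hc := Rmin_r cb cc. set (c := Rmin ca (Rmin cb cc)) in *. clearbody c.
 have Hcb': c <= cb by lra. have Hcc': c <= cc by lra. clear Hbc Hb Hc.
 have Hlin: forall r x, 0 <= r <= B -> 0 <= x -> c*B <= x -> c*(r*r) <= x*r.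
 { intros r x Hr Hx H. have: r*r <= B*r by nra. destruct (Rle_dec 0 c) as [Hc0|Hc0]; [|nra].
  apply Rle_trans with (c*(B*r)); [apply Rmult_le_compat_l; lra|]. nra. }
 have HFar: forall v v', Re v <= M -> Re v' <= M -> ~ V (fm v) -> ~ V (fm v') ->
   (forall k: Z, d4 < Cmod (v'-turn k)) -> Cmod (mX th v-mX th v') <= B ->
   Cmod (mX th v-mX th v')+c*(Cmod (mX th v-mX th v')*Cmod (mX th v-mX th v')) <= Cmod (Xi v-Xi v').
 { intros v v' Hv Hv' HV HV' Hf HBr. destruct (mX_far v v' Hv Hv' HV HV' Hf) as [H1 H2].
  set (r := Cmod (mX th v-mX th v')) in *. have Hr: 0 <= r by apply Cmod_ge_0.
  set (e := d4*d4/3072) in *. have He: 0 <= e by (unfold e; nra). have HL := Hlin r (e/(2*D)).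
  have: c*(r*r) <= e/(2*D)*r.
  { apply HL; [lra|apply Rmult_le_pos; [lra|left; apply Rinv_0_lt_compat; lra]|].
   apply Rle_trans with (cb*B); [apply Rmult_le_compat_r; lra|]. unfold cb. right. field. lra. }
  have: e/(2*D)*r <= e*Cmod (v-v').
  { replace (e/(2*D)*r) with (e*(r/(2*D))) by (field; lra). apply Rmult_le_compat_l; [auto|]. apply Rle_div_l; lra. }
  lra. }
 intros v v' Hv Hv' HVv HVv' HV HV' HBr. destruct (classic (forall k: Z, d4 < Cmod (v'-turn k))) as [Hf|Hf].
 { apply HFar; auto. }
 destruct (classic (forall k: Z, d4 < Cmod (v-turn k))) as [Hf2|Hf2].
 { rewrite (Cmod_sym (mX th v)), (Cmod_sym (Xi v)). rewrite Cmod_sym in HBr. apply HFar; auto. }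
 apply not_all_ex_not in Hf. apply not_all_ex_not in Hf2. destruct Hf as [k' Hk'], Hf2 as [k Hk].
 apply Rnot_lt_le in Hk. apply Rnot_lt_le in Hk'. set (v0 := (v-turn k)%C) in *. set (v0' := (v'-turn k')%C) in *.
 have Ev: v = (v0+turn k)%C by (unfold v0; ring). have Ev': v' = (v0'+turn k')%C by (unfold v0'; ring).
 destruct (Z.eq_dec k k') as [Ek|Ek].
 - subst k'. rewrite Ev, Ev' in *. rewrite Cexp_period in HVv, HVv'. rewrite !mX_shift, !Xi_shift in *.
  replace (mX th v0+turn k-(mX th v0'+turn k))%C with (mX th v0-mX th v0')%C in * by ring.
  replace (Xi v0+D*turn k-(Xi v0'+D*turn k))%C with (Xi v0-Xi v0')%C by ring.
  destruct (mX_near v0 v0' Hk Hk' HVv HVv') as [H1 H2].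
  set (r := Cmod (mX th v0-mX th v0')) in *. have Hr: 0 <= r by apply Cmod_ge_0. set (dv := Cmod (v0-v0')) in *.
  have Hs: dv <= Cmod v0+Cmod v0' by apply Cmod_minus_le. have Hdv: th*r <= dv.
  { apply Rmult_le_reg_l with (/ th); [apply Rinv_0_lt_compat; auto|].
   rewrite <- Rmult_assoc, Rinv_l, Rmult_1_l by lra. auto. }
  have: c*(r*r) <= ka/64*(Cmod v0+Cmod v0')*dv.
  { apply Rle_trans with (ca*(r*r)); [apply Rmult_le_compat_r; nra|].
   unfold ca. replace (ka/64*(th*th)*(r*r)) with (ka/64*((th*r)*(th*r))) by ring.
   rewrite (Rmult_assoc (ka/64)). apply Rmult_le_compat_l; [lra|].
   have: 0 <= th*r by nra. apply Rmult_le_compat; lra. }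
  lra.
 (* The points sit near different lifts of the parabolic point, hence at least 4 apart. There [mX]
    at most doubles the distance, while [Xi] multiplies it by nearly [N >= 4]. *)
 - set (r := Cmod (mX th v-mX th v')) in *. have Hr: 0 <= r by apply Cmod_ge_0. have HXi := Xi_lower v v' Hv Hv'.
  set (dv := Cmod (v-v')) in *. have Hdv: 4 <= dv.
  { have Hz: 1 <= Rabs (IZR k-IZR k').
   { rewrite <- minus_IZR, <- abs_IZR. apply IZR_le. lia. }
   have H := Cmod_reverse (iI (2*PI*(IZR k-IZR k')))%C (v0'-v0)%C.
   replace (iI (2*PI*(IZR k-IZR k'))-(v0'-v0))%C with (v-v')%C in H.
   2:{ rewrite Ev, Ev'. replace (2*PI*(IZR k-IZR k')) with (2*PI*IZR k + - (2*PI*IZR k')) by ring.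
     rewrite iI_plus, iI_opp. ring. }
   fold dv in H. rewrite Cmod_iI, Rabs_mult in H. have := PI2_3_2. rewrite (Rabs_right (2*PI)) in H by lra.
   have := Cmod_minus_le v0' v0. nra. }
  have Hrdv: r <= 2*dv.
  { unfold r. rewrite Ev, Ev', !mX_shift. unfold mX. replace (v0+Log1m (RtoC (1-th)*Cexp (- v0))+turn k -
    (v0'+Log1m (RtoC (1-th)*Cexp (- v0'))+turn k'))%C
    with ((v-v')+(Log1m (RtoC (1-th)*Cexp (- v0))-Log1m (RtoC (1-th)*Cexp (- v0'))))%C by (rewrite Ev, Ev'; ring).
   le_trans Cmod_triangle. fold dv. have Ht3 := th_upper LM. have Ht4 := th_lower LM.
   have H4D: 4000*D*d4 <= 1 by lra. have Hd4t: 100*d4 <= th.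
   { eapply Rle_trans; [|exact Ht4]. apply Rmult_le_reg_r with (D+1); [lra|]. rewrite Rinv_l by lra. nra. }
   have Hsm: forall z, Cmod z <= d4 -> Cmod (RtoC (1-th)*Cexp (- z))%C <= 1-th/2.
   { intros z Hz. rewrite Cmod_mult, Cmod_pos_R, Cmod_Cexp, re_opp by lra.
    have := Re_ge_Cmod z. have: exp (- Re z) <= exp d4 by (apply exp_le; lra).
    have := exp_small_bound d4 ltac:(lra). nra. }
   have HL := Log1m_lipschitz (1-th/2) _ _ ltac:(lra) (Hsm v0 Hk) (Hsm v0' Hk').
   replace (1-(1-th/2)) with (th/2) in HL by ring. replace (RtoC (1-th)*Cexp (- v0)-RtoC (1-th)*Cexp (- v0'))%C
    with (RtoC (1-th)*(Cexp (- v0)-Cexp (- v0')))%C in HL by ring.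
   rewrite Cmod_mult, (Cmod_pos_R (1-th)) in HL by lra. have HE: Cmod (Cexp (- v0)-Cexp (- v0'))%C <= 6*d4.
   { have Hm := Cmod_minus_le v0' v0. apply Rle_trans with (exp 1*Cmod (- v0 - - v0')).
    - have := Re_ge_Cmod v0. have := Re_ge_Cmod v0'. apply Cexp_lipschitz; rewrite re_opp; lra.
    - replace (- v0 - - v0')%C with (v0'-v0)%C by ring. have := exp_le_3. have := exp_pos 1. nra. }
   have Hi: / (th/2)*((1-th)*Cmod (Cexp (- v0)-Cexp (- v0'))%C) <= 1.
   { apply Rmult_le_reg_l with (th/2); [lra|]. rewrite <- Rmult_assoc, Rinv_r, Rmult_1_l by lra. nra. }
   lra. }
  have HL: c*(r*r) <= 1/2*r.
  { apply Hlin; [lra|lra|]. apply Rle_trans with (cc*B); [apply Rmult_le_compat_r; lra|].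
   unfold cc. right. field. lra. }
  nra.
Qed.

(** The petal is starlike with respect to [1-th], with room for a slight rotation. Relative to the
    disc with centre [1-ro*Cconj c] and radius [Rr], the point is [Y+G] and [1-th] lies [th/4] deep.
    Shrinking towards [1-th] gains [(1-e)*th/4], and the rotation costs at most half of that. *)
Lemma star_disc y a b : 0 <= a -> Rabs b <= 2*ep*a -> Vc y -> Vc (RtoC (1-th)+Cexp ((- a)%R, b)*(y-RtoC (1-th)))%C /\
 (0 < a -> V (RtoC (1-th)+Cexp ((- a)%R, b)*(y-RtoC (1-th)))%C).
Proof.
 intros Ha Hb HV. have Hr := ro_bounds LM. destruct (th_facts LM) as (Ht&Hit&_).
 have Ht3 := th_upper LM. have Ht4 := th_lower LM. have HN := lm_N LM. have Hep := lm_ep LM.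
 have Hs1 := lm_s1 LM. have Hde := de_pos LM. have Hthep: 64*ep <= th.
 { eapply Rle_trans; [|exact Ht4]. apply Rmult_le_reg_r with (D+1); [lra|]. rewrite Rinv_l by lra.
  have: 0 <= D*D*D*de by (repeat apply Rmult_le_pos; lra). have: D+1 <= D*D*D by nra.
  have: ep*(D+1) <= ep*(D*D*D) by mono. lra. }
 destruct (Vq_eq (N := N) (ka := ka) y) as (c&Hc&E). unfold mVc in HV. rewrite E in HV.
 destruct (sgc_facts LM c Hc) as [Hc1 Hc2]. set (Rr := ro*Cmod c).
 have HRr: 0 <= Rr <= 2 by (unfold Rr; have := Cmod_ge_0 c; split; nra).
 set (G := (RtoC ro*Cconj c-RtoC th)%C). set (Y := (y-RtoC (1-th))%C).
 have HRr1: 1 <= Cmod c by (have := Re_le_Cmod c; lra).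
 have Hsq: forall z, Cmod (z-RtoC th+RtoC ro*Cconj c)*Cmod (z-RtoC th+RtoC ro*Cconj c)
   = Cmod (z-RtoC th)*Cmod (z-RtoC th)+2*ro*Re ((z-RtoC th)*c)+Rr*Rr.
 { intros z. replace (Rr*Rr) with (ro*ro*(Cmod c*Cmod c)) by (unfold Rr; ring).
  rewrite !Cmod_sqr. unfold Re, Im; simpl. ring. }
 have EY: (y-1 = Y-RtoC th)%C by (unfold Y; rewrite RtoC_minus; ring). have HYG: Cmod (Y+G) <= Rr.
 { replace (Y+G)%C with (Y-RtoC th+RtoC ro*Cconj c)%C by (unfold G; ring).
  have H := Hsq Y. rewrite <- EY in H at 3 4 5. have := Cmod_ge_0 (Y-RtoC th+RtoC ro*Cconj c)%C. nra. }
 have HG: Cmod G <= Rr-th/4.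
 { have EG: Cmod G*Cmod G = Rr*Rr-th*(2*ro-th).
  { replace (Rr*Rr) with (ro*ro*(Cmod c*Cmod c)) by (unfold Rr; ring).
   unfold G. rewrite !Cmod_sqr. have: fst c = 1 by exact Hc1. unfold Re, Im; simpl. rewrite H. ring. }
  have: th/4 <= Rr by (unfold Rr; nra). have := Cmod_ge_0 G. have: th*1 <= th*(2*ro-th) by mono.
  have: th*Rr <= th*2 by mono. destruct (Rle_dec (Cmod G) (Rr-th/4)) as [Hl|Hl]; [assumption|exfalso].
  have: (Rr-th/4)*(Rr-th/4) < Cmod G*Cmod G by (apply Rmult_le_0_lt_compat; lra). nra. }
 set (m := Cexp (- a, b)). set (e := exp (- a)). have He: 0 < e <= 1.
 { unfold e. split; [apply exp_pos|]. rewrite <- exp_0. apply exp_le. lra. }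
 have Hae: e*a <= 1-e.
 { have := exp_ineq1_le a. unfold e. rewrite exp_Ropp. have := exp_pos a.
  apply Rmult_le_reg_l with (exp a); [assumption|]. replace (exp a*(/ exp a*a)) with a by (field; lra).
  replace (exp a*(1 - / exp a)) with (exp a-1) by (field; lra). lra. }
 have Hme: m = (RtoC e*Cexp (iI b))%C.
 { unfold m, e. rewrite <- Cexp_R, <- Cexp_plus. f_equal. unfold iI. apply C_ext; unfold Re, Im; simpl; ring. }
 have Hib: Cmod (Cexp (iI b)-1)%C <= Rabs b.
 { rewrite <- Cexp_0. have H := Cexp_lipschitz 0 (iI b) 0. rewrite exp_0, Rmult_1_l in H.
  replace (iI b-0)%C with (iI b) in H by ring. rewrite Cmod_iI in H. apply H; simpl; lra. }
 have HY4: Cmod Y <= 4.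
 { replace Y with ((Y+G)-G)%C by ring. le_trans Cmod_minus_le. lra. }
 have Hmain: Cmod (m*Y+G) <= Rr-(1-e)*(th/8).
 { replace (m*Y+G)%C with (RtoC e*(Y+G)+RtoC (1-e)*G+RtoC e*((Cexp (iI b)-1)*Y))%C by (rewrite Hme, RtoC_minus; ring).
  le_trans Cmod_triangle. eapply Rle_trans; [apply Rplus_le_compat_r, Cmod_triangle|].
  rewrite !Cmod_mult, !Cmod_pos_R by lra. have A1: e*Cmod (Y+G) <= e*Rr by mono.
  have A2: (1-e)*Cmod G <= (1-e)*(Rr-th/4) by mono. have A3: Cmod (Cexp (iI b)-1)%C*Cmod Y <= (2*ep*a)*4.
  { apply Rmult_le_compat; try apply Cmod_ge_0; lra. }
  have A4: e*(Cmod (Cexp (iI b)-1)%C*Cmod Y) <= e*((2*ep*a)*4) by mono. have A5: 8*ep*(e*a) <= 8*ep*(1-e) by mono.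
  have A6: 8*ep*(1-e) <= th/8*(1-e) by mono. lra. }
 set (y' := (RtoC (1-th)+m*Y)%C). have EY': (y'-1 = m*Y-RtoC th)%C by (unfold y'; rewrite RtoC_minus; ring).
 have Hfin: Vq y' <= Cmod (m*Y+G)*Cmod (m*Y+G)-Rr*Rr.
 { le_trans (Vq_le LM y' c Hc). rewrite EY'. have H := Hsq (m*Y)%C.
  replace (m*Y+G)%C with (m*Y-RtoC th+RtoC ro*Cconj c)%C by (unfold G; ring). lra. }
 have Hp := Cmod_ge_0 (m*Y+G)%C. have Hrr0: 0 <= (1-e)*(th/8) by (apply Rmult_le_pos; lra). split.
 - unfold mVc. fold Y m y'. nra.
 - intros Ha0. have He1: e < 1. { unfold e. rewrite <- exp_0. apply exp_increasing. lra. }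
  have Hrr1: 0 < (1-e)*(th/8) by (apply Rmult_lt_0_compat; lra). unfold mV. fold Y m y'. nra.
Qed.

(** Moving [v] to the left shrinks [fm v] towards [1-th] with almost no rotation. This keeps the
    radial retraction inside the second preimage of the petal. *)
Lemma fm_star v t : Re v <= M -> 0 <= t -> Vc (fm v) -> Vc (fm (v-RtoC t)%C) /\ (0 < t -> V (fm (v-RtoC t)%C)).
Proof.
 intros Hv Ht HV. have HN := lm_N LM. have Hep := lm_ep LM. set (h := (et (v-t)-et v)%C). have Hh: Cmod h <= ep*t.
 { have H := C11_lip _ _ _ _ _ (v-t)%C v (Cconvex_Re_le M) (lm_et LM). replace (v-t-v)%C with (- t)%C in H by ring.
  rewrite Cmod_opp, Cmod_pos_R in H by auto. apply H; [|auto]. rewrite Re_minus, re_RtoC. lra. }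
 have H1 := re_le_Cmod h. apply Rabs_le_between in H1. have H2 := Cmod_Im_le h. have E: fm (v-t)%C
  = (RtoC (1-th)+Cexp ((- (D*t-Re h))%R, Im h)*(fm v-RtoC (1-th)))%C.
 { unfold mf. replace (mXi N et (v-t)%C) with (mXi N et v+((- (D*t-Re h))%R, Im h))%C.
  - rewrite Cexp_plus. ring.
  - apply C_ext; unfold Re, Im; simpl; ring. }
 rewrite E. destruct (star_disc (fm v) (D*t-Re h) (Im h)) as [A B]; try auto; try nra.
 split; [auto|]. intros Ht0. apply B. nra.
Qed.

Lemma gk_pos : 7/8 <= gk N < 1.
Proof. unfold gk. have := ro_bounds LM. lra. Qed.

Lemma Vq_beta y : Vq y = Cmod y*Cmod y-2*gbeta N ka y-gk N.
Proof.
 unfold mVq, gbeta, gk. rewrite !Cmod_sqr. have E: Im (y-1) = Im y by (unfold Im; simpl; ring).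
 rewrite E, Re_minus. change (Re 1%R) with 1. ring.
Qed.

Lemma gauge_root_sqr y : Cmod (gbeta N ka y, sqrt (gk N)*Cmod y)*Cmod (gbeta N ka y, sqrt (gk N)*Cmod y)
 = gbeta N ka y*gbeta N ka y+gk N*(Cmod y*Cmod y).
Proof.
 rewrite Cmod_sqr. unfold Re, Im; simpl fst; simpl snd. have := gk_pos.
 replace (sqrt (gk N)*Cmod y*(sqrt (gk N)*Cmod y)) with (sqrt (gk N)*sqrt (gk N)*(Cmod y*Cmod y)) by ring.
 rewrite sqrt_sqrt by lra. ring.
Qed.

Lemma gauge_le_1 y : gauge N ka y <= 1 <-> Vc y.
Proof.
 unfold mVc. rewrite Vq_beta. have Hk := gk_pos. have Hs := gauge_root_sqr y.
 unfold gauge. set (r := Cmod (gbeta N ka y, sqrt (gk N)*Cmod y)) in *. have Hr: 0 <= r by apply Cmod_ge_0.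
  split; intros H.
 - apply Rle_div_l in H; [|lra]. nra.
 - apply Rle_div_l; [lra|]. nra.
Qed.

Lemma gauge_lt_1 y : gauge N ka y < 1 <-> V y.
Proof.
 unfold mV. rewrite Vq_beta. have Hk := gk_pos. have Hs := gauge_root_sqr y.
 unfold gauge. set (r := Cmod (gbeta N ka y, sqrt (gk N)*Cmod y)) in *. have Hr: 0 <= r by apply Cmod_ge_0.
  split; intros H.
 - apply Rlt_div_l in H; [|lra]. nra.
 - apply Rlt_div_l; [lra|]. nra.
Qed.

Lemma gauge_scal t y : 0 <= t -> gauge N ka (RtoC t*y)%C = t*gauge N ka y.
Proof.
 intros Ht. unfold gauge. have Eb: gbeta N ka (t*y)%C = t*gbeta N ka y.
 { unfold gbeta. rewrite re_scal_l, im_scal_l, Rabs_mult, (Rabs_pos_eq t) by auto. ring. }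
 rewrite Eb, Cmod_mult, (Cmod_pos_R t) by auto. replace ((t*gbeta N ka y, sqrt (gk N)*(t*Cmod y)) : C)
  with (t*((gbeta N ka y, sqrt (gk N)*Cmod y)%R : C))%C.
 - rewrite Cmod_mult, Cmod_pos_R by auto. unfold Rdiv. ring.
 - apply C_ext; unfold Re, Im; simpl; ring.
Qed.

Lemma gauge_lip y y' : Rabs (gauge N ka y-gauge N ka y') <= 10*Cmod (y-y').
Proof.
 have Hk := gk_pos. have Hr := ro_bounds LM. have Hka := lm_ka LM.
 set (dy := Cmod (y-y')). have Hdy: 0 <= dy by apply Cmod_ge_0. have Hb: Rabs (gbeta N ka y-gbeta N ka y') <= dy.
 { unfold gbeta. replace ((1-ro)*Re y+ro*(ka*Rabs (Im y))-((1-ro)*Re y'+ro*(ka*Rabs (Im y'))))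
   with ((1-ro)*(Re (y-y'))+(ro*ka)*(Rabs (Im y)-Rabs (Im y'))) by (rewrite Re_minus; ring).
  le_trans Rabs_triang. rewrite !Rabs_mult, (Rabs_pos_eq (1-ro)), (Rabs_pos_eq (ro)), (Rabs_pos_eq ka) by lra.
  have: Rabs (Rabs (Im y)-Rabs (Im y')) <= dy.
  { le_trans Rabs_triang_inv2. change (Im y-Im y') with (Im (y-y')). apply Cmod_Im_le. }
  have := re_le_Cmod (y-y')%C. fold dy in H0. have: ro*ka <= 1/2 by nra. have: 0 <= ro*ka by nra. nra. }
 set (P := (gbeta N ka y, sqrt (gk N)*Cmod y) : C). set (P' := (gbeta N ka y', sqrt (gk N)*Cmod y') : C).
 have HP: Cmod (P-P') <= 2*dy.
 { le_trans Cmod_le_Re_Im. have: Rabs (Im (P-P')) <= dy.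
  { unfold P, P', Im; simpl.
   replace (sqrt (gk N)*Cmod y + - (sqrt (gk N)*Cmod y')) with (sqrt (gk N)*(Cmod y-Cmod y')) by ring.
   rewrite Rabs_mult, (Rabs_pos_eq (sqrt (gk N))) by apply sqrt_pos.
   have: sqrt (gk N) <= 1. { rewrite <- sqrt_1. apply sqrt_le_1_alt. lra. } have := sqrt_pos (gk N).
   have: Rabs (Cmod y-Cmod y') <= dy.
   { apply Rabs_le. have := Cmod_reverse y y'. have := Cmod_reverse y' y. rewrite Cmod_sym in H2. unfold dy. lra. }
   nra. }
  change (Re (P-P')) with (gbeta N ka y-gbeta N ka y'). lra. }
 have HPP: Rabs (Cmod P-Cmod P') <= 2*dy.
 { apply Rabs_le. have := Cmod_reverse P P'. have := Cmod_reverse P' P. rewrite Cmod_sym in H0. lra. }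
 unfold gauge. fold P P'. replace ((Cmod P-gbeta N ka y)/gk N-(Cmod P'-gbeta N ka y')/gk N)
  with (((Cmod P-Cmod P')-(gbeta N ka y-gbeta N ka y'))/gk N) by (field; lra).
 unfold Rdiv. rewrite Rabs_mult, Rabs_inv, (Rabs_pos_eq (gk N)) by lra. apply Rle_div_l; [lra|].
 le_trans Rabs_triang. rewrite Rabs_Ropp. nra.
Qed.

End Contraction.

(** * The chordal metric *)

Definition norm3 (u: C) (t: R) : R := Cmod (Cmod u, t).

Lemma Cmod_fst_mono a b t : 0 <= a <= b -> Cmod (a, t) <= Cmod (b, t).
Proof.
 intros H. apply Cmod_le_sqr; [apply Cmod_ge_0|]. rewrite Cmod_sqr. unfold Re, Im; simpl. nra.
Qed.

Lemma norm3_triangle u v s t : norm3 (u+v)%C (s+t) <= norm3 u s+norm3 v t.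
Proof. eapply Rle_trans.
 - apply (Cmod_fst_mono _ (Cmod u+Cmod v)). split; [apply Cmod_ge_0|apply Cmod_triangle].
 - apply (Cmod_triangle (Cmod u, s) (Cmod v, t)).
Qed.

(** Horizontal and vertical coordinates on the unit sphere. The chordal distance is the Euclidean
    distance of these points, whence the triangle inequality. *)
Definition stereo_u (p: sphere) : C := match p with Some z => (RtoC (2/(1+Cmod z*Cmod z))*z)%C | None => 0%C end.
Definition stereo_t (p: sphere) : R := match p with Some z => 1-2/(1+Cmod z*Cmod z) | None => 1 end.

Lemma Cnorm2_Cmod z : Cnorm2 z = Cmod z*Cmod z.
Proof. rewrite Cmod_sqr. unfold Cnorm2, Re, Im. ring. Qed.

Lemma sqrt_eq a b : 0 <= b -> a = b*b -> sqrt a = b.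
Proof. intros Hb ->. apply sqrt_square; auto. Qed.

Lemma inv_sqrt_nonneg a : 0 < a -> 0 <= / sqrt a.
Proof. intros Ha. left. apply Rinv_0_lt_compat, sqrt_lt_R0, Ha. Qed.

Lemma norm3_opp u v s t : norm3 (u-v)%C (s-t) = norm3 (v-u)%C (t-s).
Proof.
 unfold norm3. rewrite Cmod_sym. unfold Cmod at 1 3; simpl. f_equal. ring.
Qed.

Lemma chordal_norm3 p q : chordal p q = norm3 (stereo_u p-stereo_u q)%C (stereo_t p-stereo_t q).
Proof.
 have H2: forall z w : C, 2*Cnorm (Csub z w)/sqrt ((1+Cnorm2 z)*(1+Cnorm2 w)) =
   norm3 (stereo_u (Some z)-stereo_u (Some w))%C (stereo_t (Some z)-stereo_t (Some w)).
 { intros z w. symmetry. apply sqrt_eq.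
  - apply Rmult_le_pos.
   + apply Rmult_le_pos; [lra|apply sqrt_pos].
   + rewrite !Cnorm2_Cmod. apply inv_sqrt_nonneg. nra.
  - rewrite !Cnorm2_Cmod.
   have Hp: 0 < (1+Cmod z*Cmod z)*(1+Cmod w*Cmod w) by nra. change (Cnorm (Csub z w)) with (Cmod (z-w)).
   set (r := sqrt ((1+Cmod z*Cmod z)*(1+Cmod w*Cmod w))). have Hr: 0 < r by (apply sqrt_lt_R0; auto).
   have Hrr: r*r = (1+Cmod z*Cmod z)*(1+Cmod w*Cmod w) by (apply sqrt_sqrt; lra).
   replace (2*Cmod (z-w)/r*(2*Cmod (z-w)/r)) with (4*(Cmod (z-w)*Cmod (z-w))/(r*r)) by (field; lra). rewrite Hrr.
   unfold stereo_u, stereo_t; simpl fst; simpl snd. set (a := 2/(1+Cmod z*Cmod z)). set (b := 2/(1+Cmod w*Cmod w)).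
   replace (Cmod (a*z-b*w)^2) with (Cmod (a*z-b*w)*Cmod (a*z-b*w)) by ring.
   have Ez := Cmod_sqr z. have Ew := Cmod_sqr w. rewrite !Cmod_sqr.
   have Ea: a*(1+(Re z*Re z+Im z*Im z)) = 2 by (unfold a; rewrite Ez; field; nra).
   have Eb: b*(1+(Re w*Re w+Im w*Im w)) = 2 by (unfold b; rewrite Ew; field; nra).
   have Ea': / (1+(Re z*Re z+Im z*Im z)) = a/2 by (rewrite <- Ea at 1; field; nra).
   have Eb': / (1+(Re w*Re w+Im w*Im w)) = b/2 by (rewrite <- Eb at 1; field; nra).
   unfold Rdiv at 1. rewrite Rinv_mult, Ea', Eb', !Re_minus, !re_scal_l.
   replace (Im (a*z-b*w)) with (a*Im z-b*Im w) by (unfold Im; simpl; ring).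
   replace (Im (z-w)) with (Im z-Im w) by auto.
   set (x := Re z) in *. set (y := Im z) in *. set (x' := Re w) in *. set (y' := Im w) in *.
    have E3: a*b*(x*x+y*y) = 2*b-a*b.
   { replace (a*b*(x*x+y*y)) with (b*(a*(1+(x*x+y*y))-a)) by ring. rewrite Ea. ring. }
   have E4: a*b*(x'*x'+y'*y') = 2*a-a*b.
   { replace (a*b*(x'*x'+y'*y')) with (a*(b*(1+(x'*x'+y'*y'))-b)) by ring. rewrite Eb. ring. }
   nra. }
 have H1: forall z : C, 2/sqrt (1+Cnorm2 z) = norm3 (stereo_u (Some z)-0)%C (stereo_t (Some z)-1).
 { intros z. symmetry. apply sqrt_eq.
  - apply Rmult_le_pos; [lra|]. rewrite Cnorm2_Cmod. apply inv_sqrt_nonneg. nra.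
  - rewrite !Cnorm2_Cmod. have Hp: 0 < 1+Cmod z*Cmod z by nra.
   set (r := sqrt (1+Cmod z*Cmod z)). have Hr: 0 < r by (apply sqrt_lt_R0; auto).
   have Hrr: r*r = 1+Cmod z*Cmod z by (apply sqrt_sqrt; lra).
   replace (2/r*(2/r)) with (4/(r*r)) by (field; lra). rewrite Hrr.
   unfold stereo_u, stereo_t; simpl fst; simpl snd. replace (RtoC (2/(1+Cmod z*Cmod z))*z-0)%C
    with (RtoC (2/(1+Cmod z*Cmod z))*z)%C by ring.
   rewrite Cmod_mult, Cmod_pos_R by (apply Rlt_le, Rdiv_lt_0_compat; lra). field. lra. }
 destruct p as [z|], q as [w|].
 - apply H2.
 - apply H1.
 - simpl chordal. rewrite H1. apply norm3_opp.
 - simpl. unfold norm3. replace (0-0)%C with (RtoC 0) by ring. rewrite Cmod_0.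
  replace (1-1) with 0 by ring. symmetry. apply Cmod_0.
Qed.

Lemma chordal_sym p q : chordal p q = chordal q p.
Proof. rewrite !chordal_norm3. apply norm3_opp. Qed.

Lemma chordal_refl p : chordal p p = 0.
Proof.
 rewrite chordal_norm3. unfold norm3. replace (stereo_u p-stereo_u p)%C with (RtoC 0) by ring.
 rewrite Cmod_0. replace (stereo_t p-stereo_t p) with 0 by ring. apply Cmod_0.
Qed.

Lemma chordal_triangle p q r : chordal p r <= chordal p q+chordal q r.
Proof.
 rewrite !chordal_norm3.
 replace (stereo_u p-stereo_u r)%C with ((stereo_u p-stereo_u q)+(stereo_u q-stereo_u r))%C by ring.
 replace (stereo_t p-stereo_t r) with ((stereo_t p-stereo_t q)+(stereo_t q-stereo_t r)) by ring. apply norm3_triangle.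
Qed.

Lemma chordal_le z w : chordal (Some z) (Some w) <= 2*Cmod (z-w).
Proof.
 unfold chordal. change (Cnorm (Csub z w)) with (Cmod (z-w)). rewrite !Cnorm2_Cmod.
 have H1: 1 <= sqrt ((1+Cmod z*Cmod z)*(1+Cmod w*Cmod w)).
 { rewrite <- sqrt_1 at 1. apply sqrt_le_1_alt. nra. }
 apply Rle_div_l; [lra|]. have := Cmod_ge_0 (z-w)%C. nra.
Qed.

Lemma chordal_inf_small e : 0 < e -> exists M, 0 < M /\ forall w : C, M < Cmod w -> chordal None (Some w) < e.
Proof.
 intros He. exists (2/e). have Hm: 0 < 2/e by (apply Rdiv_lt_0_compat; lra).
 split; [auto|]. intros w Hw. simpl. rewrite Cnorm2_Cmod. have H: Cmod w < sqrt (1+Cmod w*Cmod w).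
 { rewrite <- (sqrt_square (Cmod w)) at 1 by lra. apply sqrt_lt_1_alt. nra. }
 apply Rlt_div_l; [lra|]. apply (Rmult_lt_compat_l e) in Hw; [|auto].
 replace (e*(2/e)) with 2 in Hw by (field; lra). nra.
Qed.

Lemma chordal_inf_nbhd M : exists dl, 0 < dl /\
 forall q, chordal None q < dl -> q = None \/ exists w : C, q = Some w /\ M < Cmod w.
Proof.
 set (m := Rabs M+1). have HM' := Rle_abs M. exists (2/sqrt (1+m*m)).
 have Hs: 0 < sqrt (1+m*m) by (apply sqrt_lt_R0; nra). split; [apply Rdiv_lt_0_compat; lra|].
 intros [w|] H; [right; exists w; split; [auto|]|left; auto].
 simpl in H. rewrite Cnorm2_Cmod in H. have := Cmod_ge_0 w.
 have Hsw: 0 < sqrt (1+Cmod w*Cmod w) by (apply sqrt_lt_R0; nra). have Hlt: sqrt (1+m*m) < sqrt (1+Cmod w*Cmod w).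
 { apply Rmult_lt_reg_l with 2; [lra|]. apply (Rmult_lt_compat_r (sqrt (1+Cmod w*Cmod w))) in H; [|auto].
  apply (Rmult_lt_compat_r (sqrt (1+m*m))) in H; [|auto]. field_simplify in H; [|lra|lra]. lra. }
 apply sqrt_lt_0_alt in Hlt. unfold m in *. nra.
Qed.

Lemma chordal_finite_nbhd z r : 0 < r -> exists dl, 0 < dl /\
 forall q, chordal (Some z) q < dl -> exists w : C, q = Some w /\ Cmod (w-z) < r.
Proof.
 intros Hr. set (m := Cmod z+r). have Hz := Cmod_ge_0 z. set (c := (1+m)). have Hm: 0 < m by (unfold m; lra).
 set (d1 := 2*r/(c*(1+Cmod z))). have Hc: 1 <= c by (unfold c; nra).
 have Hd1: 0 < d1 by (unfold d1; apply Rdiv_lt_0_compat; nra). exists (Rmin d1 (2/(1+Cmod z))). split.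
 { apply Rmin_glb_lt; [auto|]. apply Rdiv_lt_0_compat; lra. }
 intros q Hq. have Hq1 := lt_min_l Hq. have Hq2 := lt_min_r Hq. have Hsz: sqrt (1+Cmod z*Cmod z) <= 1+Cmod z.
 { rewrite <- (sqrt_square (1+Cmod z)) by lra. apply sqrt_le_1_alt. nra. }
 have Hszp: 0 < sqrt (1+Cmod z*Cmod z) by (apply sqrt_lt_R0; nra). destruct q as [w|].
 - exists w. split; [auto|]. destruct (Rlt_dec (Cmod (w-z)) r) as [H|H]; [auto|exfalso].
  apply Rnot_lt_le in H. rewrite Cmod_sym in H.
  unfold chordal in Hq1. change (Cnorm (Csub z w)) with (Cmod (z-w)) in Hq1.
  rewrite !Cnorm2_Cmod, sqrt_mult in Hq1 by nra. set (t := Cmod (z-w)) in *. have Hw: Cmod w <= Cmod z+t.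
  { have := Cmod_reverse w z. rewrite Cmod_sym in H0. unfold t. lra. }
  have Hw0 := Cmod_ge_0 w. have Hsw: sqrt (1+Cmod w*Cmod w) <= 1+(Cmod z+t).
  { rewrite <- (sqrt_square (1+(Cmod z+t))) by lra. apply sqrt_le_1_alt. nra. }
  have Hswp: 0 < sqrt (1+Cmod w*Cmod w) by (apply sqrt_lt_R0; nra).
  have Hprod: sqrt (1+Cmod z*Cmod z)*sqrt (1+Cmod w*Cmod w)
        <= (1+Cmod z)*(1+(Cmod z+t)) by (apply Rmult_le_compat; lra).
  have Hpp: 0 < sqrt (1+Cmod z*Cmod z)*sqrt (1+Cmod w*Cmod w) by nra. apply (proj1 (Rlt_div_l _ _ _ Hpp)) in Hq1.
  have Hup: d1*(sqrt (1+Cmod z*Cmod z)*sqrt (1+Cmod w*Cmod w)) <= d1*((1+Cmod z)*(1+(Cmod z+t))) by mono.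
  have E: d1*((1+Cmod z)*(1+(Cmod z+t))) = 2*r*(1+(Cmod z+t))/c.
  { unfold d1. field. lra. }
  have Hlt: 2*t < 2*r*(1+(Cmod z+t))/c by lra. apply Rlt_div_r in Hlt; [|lra]. unfold c, m in Hlt. nra.
 - simpl in Hq2. rewrite Cnorm2_Cmod in Hq2. have: 2/(1+Cmod z) <= 2/sqrt (1+Cmod z*Cmod z); [|lra].
  apply Rmult_le_compat_l; [lra|]. apply Rinv_le_contravar; lra.
Qed.

Definition scont (F: sphere -> sphere) (p: sphere) : Prop :=
 forall e, 0 < e -> exists dl, 0 < dl /\ forall q, chordal p q < dl -> chordal (F p) (F q) < e.

Lemma scont_iter F k p : (forall q, scont F q) -> scont (iter F k) p.
Proof.
 intros HF. induction k as [|k IH]; intros e He.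
 - exists e. split; [auto|]. intros q Hq. auto.
 - destruct (HF (iter F k p) e He) as (d1&Hd1&H1), (IH d1 Hd1) as (d2&Hd2&H2).
  exists d2. split; [auto|]. intros q Hq. apply H1, H2, Hq.
Qed.

Lemma iter_comm F k p : iter F k (F p) = F (iter F k p).
Proof. induction k as [|k IH]; [auto|]. simpl. rewrite IH. auto. Qed.

Lemma iter_add F j k p : iter F (j+k) p = iter F j (iter F k p).
Proof. induction j as [|j IH]; [auto|]. simpl. rewrite IH. auto. Qed.

Lemma ball_open_nbhd p q r : chordal p q < r -> exists r', 0 < r' /\ forall q', chordal q q' < r' -> chordal p q' < r.
Proof.
 intros H. exists (r-chordal p q). split; [lra|]. intros q' H'.
 eapply Rle_lt_trans; [apply (chordal_triangle p q q')|]. lra.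
Qed.

(** * Cantor sets of circles from inverse branches *)

Lemma C_complete u : (forall e, 0 < e -> exists N, forall j k, (N <= j)%nat -> (N <= k)%nat -> Cmod (u j-u k) < e) ->
 exists l, forall e, 0 < e -> exists N, forall k, (N <= k)%nat -> Cmod (u k-l) < e.
Proof.
 intros HC. have H1: Cauchy_crit (fun k => Re (u k)).
 { intros e He. destruct (HC e He) as [N HN]. exists N. intros j k Hj Hk. unfold Rdist.
  rewrite <- Re_minus. eapply Rle_lt_trans; [apply re_le_Cmod|]. apply HN; auto. }
 have H2: Cauchy_crit (fun k => Im (u k)).
 { intros e He. destruct (HC e He) as [N HN]. exists N. intros j k Hj Hk. unfold Rdist.
  change (Im (u j)-Im (u k)) with (Im (u j-u k)). eapply Rle_lt_trans; [apply Cmod_Im_le|]. apply HN; auto. }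
 destruct (R_complete _ H1) as [a Ha], (R_complete _ H2) as [b Hb]. exists (a, b). intros e He.
 destruct (Ha (e/2) ltac:(lra)) as [N1 HN1], (Hb (e/2) ltac:(lra)) as [N2 HN2]. exists (Nat.max N1 N2). intros k Hk.
 specialize (HN1 k ltac:(lia)). specialize (HN2 k ltac:(lia)). unfold Rdist in *.
 eapply Rle_lt_trans; [apply Cmod_le_Re_Im|].
 change (Re (u k-(a, b))) with (Re (u k)-a). change (Im (u k-(a, b))) with (Im (u k)-b). lra.
Qed.

Lemma Cexp_close b e : 0 < e -> exists dl, 0 < dl /\
 forall z w, Rabs (Re z) <= b -> Rabs (Re w) <= b -> Cmod (Cexp z-Cexp w) < dl -> exists k : Z, Cmod (z+turn k-w) < e.
Proof.
 intros He. set (d0 := Rmin (1/2) (e/3)). have Hd0: 0 < d0 by (apply Rmin_glb_lt; lra).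
 exists (d0*exp (- b)). split; [apply Rmult_lt_0_compat; [auto|apply exp_pos]|]. intros z w Hz Hw H.
 have Hm: Cmod (Cexp (z-w)-1)%C < d0.
 { rewrite Cexp_minus. replace (Cexp z/Cexp w-1)%C with ((Cexp z-Cexp w) * / Cexp w)%C by (field; apply Cexp_neq0).
  rewrite Cmod_mult, Cmod_inv, Cmod_Cexp by apply Cexp_neq0. rewrite <- exp_Ropp. apply Rabs_le_between in Hw.
  have: exp (- Re w) <= exp b by (apply exp_le; lra). have := exp_pos b.
  apply Rle_lt_trans with (Cmod (Cexp z-Cexp w)*exp b).
  { apply Rmult_le_compat_l; [apply Cmod_ge_0|auto]. }
  apply (Rmult_lt_compat_r (exp b)) in H; [|auto].
  rewrite Rmult_assoc, <- exp_plus in H. replace (- b+b) with 0 in H by ring. rewrite exp_0, Rmult_1_r in H. auto. }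
 have Hd0a: d0 <= 1/2 by apply Rmin_l. have Hd0b: d0 <= e/3 by apply Rmin_r.
 destruct (small_log (Cexp (z-w)-1)%C ltac:(lra)) as (v&Hv1&Hv2), (Cexp_eq v (z-w)%C) as [k Hk]; [rewrite Hv1; ring|].
 exists k. replace (z+turn k-w)%C with v by (rewrite Hk; ring). lra.
Qed.

Lemma Rabs_IZR_ge_1 k : k <> 0%Z -> 1 <= Rabs (IZR k).
Proof. intros H. rewrite <- abs_IZR. apply IZR_le. lia. Qed.

Definition word := nat -> nat.
Definition wshift (k: nat) (w: word) : word := fun j => w (k+j)%nat.

Fixpoint gc (G: nat -> C -> C) (k: nat) (w: word) (z: C) : C :=
 match k with O => z | S k' => G (w 0%nat) (gc G k' (wshift 1 w) z) end.
(** The signed degree of the [k]-th iterate along the curve coded by [w]: the factor by which the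
    angle is multiplied after [k] steps. *)
Fixpoint Dk (m: nat -> Z) (k: nat) (w: word) : Z :=
 match k with O => 1%Z | S k' => (m (w 0%nat)*Dk m k' (wshift 1 w))%Z end.

Definition wok (n: nat) (w: word) : Prop := forall k, (1 <= w k <= n)%nat.

Lemma wok_shift n k w : wok n w -> wok n (wshift k w).
Proof. intros H j. apply H. Qed.

(** An abstract system of inverse branches [G i] on a set [Om] in the logarithmic coordinate.
    [cs_Im] says that [G i] divides heights by the degree [m i] up to the constant [CC], and
    [Re = y0] is a line in [Om] whose pullbacks converge to the coded curves. [cs_contr] asks for no
    rate: parabolic dynamics provides only uniformity in the word. *)
Record circle_sys {n : nat} {F : sphere -> sphere} {Om : C -> Prop} {G : nat -> C -> C}
  {m : nat -> Z} {CC y0 Rb : R} : Prop := {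
 cs_CC : 0 <= CC;
 cs_closed : forall z, (forall e, 0 < e -> exists w, Om w /\ Cmod (w-z) < e) -> Om z;
 cs_per : forall z (k: Z), Om z -> Om (z+turn k)%C;
 cs_line : forall t, Om (y0, t);
 cs_Re : forall z, Om z -> Rabs (Re z) <= Rb;
 cs_m : forall i, (1 <= i <= n)%nat -> 2 <= Rabs (IZR (m i));
 cs_G : forall i z, (1 <= i <= n)%nat -> Om z -> Om (G i z);
 cs_Im : forall i z, (1 <= i <= n)%nat -> Om z -> Rabs (Im z-IZR (m i)*Im (G i z)) <= CC;
 cs_Gper : forall i z (k: Z), (1 <= i <= n)%nat -> Om z ->
   G i (z+turn (m i*k))%C = (G i z+turn k)%C;
 cs_F : forall i z, (1 <= i <= n)%nat -> Om z -> F (Some (Cexp (G i z))) = Some (Cexp z);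
 cs_contr : forall B e, 0 < B -> 0 < e -> exists k0, forall k w u v, (k0 <= k)%nat -> wok n w ->
   Om u -> Om v -> Cmod (u-v) <= B -> Cmod (gc G k w u-gc G k w v) < e;
 cs_lip : exists L, 0 < L /\ forall i u v, (1 <= i <= n)%nat -> Om u -> Om v ->
   Cmod (G i u-G i v) <= L*Cmod (u-v);
 cs_equi : forall e, 0 < e -> exists dl, 0 < dl /\ forall i u v, (1 <= i <= n)%nat -> Om u -> Om v ->
   Cmod (G i u-G i v) < dl -> Cmod (u-v) < e;
 cs_sep : exists dl, 0 < dl /\ forall i j u v, (1 <= i <= n)%nat -> (1 <= j <= n)%nat ->
   Om u -> Om v -> Cmod (G i u-G j v) < dl -> i = j;
 cs_branch : forall z z', Om z -> Om z' -> F (Some (Cexp z)) = Some (Cexp z') ->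
   exists i z'', (1 <= i <= n)%nat /\ Om z'' /\ Cexp z'' = Cexp z' /\ z = G i z'' }.

(** * Ternary digits and the coding of words *)

Definition stream := nat -> bool.
Definition sshift (a: stream) : stream := fun j => a (S j).
Definition cdigit (a: stream) (k: nat) : R := (if a k then 2 else 0)/3^(S k).

Lemma cdigit_bounds a k : 0 <= cdigit a k <= 2/3^(S k).
Proof.
 unfold cdigit. have: 0 < 3^S k by (apply pow_lt; lra). have: 0 < / 3^S k by (apply Rinv_0_lt_compat; auto).
  destruct (a k); split; nra.
Qed.

Lemma cdigit_sum_bounds a N : 0 <= sum_f_R0 (cdigit a) N <= 1 - / 3^(S N).
Proof.
 induction N as [|N IH].
 - simpl sum_f_R0. have := cdigit_bounds a 0. lra.
 - rewrite tech5. have := cdigit_bounds a (S N). have E: / 3^S N = 3 * / 3^S (S N).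
  { simpl. field. apply pow_nonzero. lra. }
  lra.
Qed.

Lemma cantor_value_ex a : exists x, infinite_sum (cdigit a) x.
Proof.
 destruct (Un_cv_crit (sum_f_R0 (cdigit a))) as [l Hl].
 - intros N. rewrite tech5. have := cdigit_bounds a (S N). lra.
 - exists 1. intros y [N ->]. have := cdigit_sum_bounds a N.
  have: 0 < / 3^S N by (apply Rinv_0_lt_compat, pow_lt; lra). lra.
 - exists l. auto.
Qed.

Lemma cantor_value_range a x : infinite_sum (cdigit a) x -> 0 <= x <= 1.
Proof.
 intros H. split; apply le_epsilon; intros e He; destruct (H e He) as [N HN];
  specialize (HN N (le_n _)); unfold Rdist in HN; apply Rabs_def2 in HN; have := cdigit_sum_bounds a N;
  have: 0 < / 3^S N by (apply Rinv_0_lt_compat, pow_lt; lra); lra.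
Qed.

Lemma cantor_value_shift a x : infinite_sum (cdigit a) x ->
 infinite_sum (cdigit (sshift a)) (3*x-(if a 0%nat then 2 else 0)).
Proof.
 intros H e He. destruct (H (e/3) ltac:(lra)) as [N HN]. exists N. intros k Hk.
 specialize (HN (S k) ltac:(lia)). unfold Rdist in *. rewrite decomp_sum in HN by lia.
 have E: sum_f_R0 (cdigit (sshift a)) k = 3*sum_f_R0 (fun i => cdigit a (S i)) k.
 { rewrite scal_sum. apply sum_eq. intros i _. unfold cdigit, sshift. simpl. field. apply pow_nonzero. lra. }
 rewrite E. unfold cdigit at 1 in HN. simpl pow in HN.
 set (s := sum_f_R0 _ _) in *. set (b := if a 0%nat then 2 else 0) in *.
 replace (3*s-(3*x-b)) with (3*(b/(3*1)+s-x)) by field. rewrite Rabs_mult, (Rabs_right 3) by lra. lra.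
Qed.

Lemma cantor_agree_close K : forall (a a': stream) (x x': R),
 infinite_sum (cdigit a) x -> infinite_sum (cdigit a') x' ->
 (forall j, (j < K)%nat -> a j = a' j) -> Rabs (x-x') <= / 3^K.
Proof.
 induction K as [|K IH]; intros a a' x x' H H' HA.
 - have := cantor_value_range _ _ H. have := cantor_value_range _ _ H'. apply Rabs_le. lra.
 - have HI := IH _ _ _ _ (cantor_value_shift _ _ H) (cantor_value_shift _ _ H'). rewrite <- (HA 0%nat) in HI by lia.
  set (b := if a 0%nat then 2 else 0) in *. replace (3*x-b-(3*x'-b)) with (3*(x-x')) in HI by ring.
  rewrite Rabs_mult, (Rabs_right 3) in HI by lra.
  have E: / 3^S K = / 3^K/3 by (simpl; field; apply pow_nonzero; lra). have: 3*Rabs (x-x') <= / 3^K; [|lra]. apply HI.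
   intros j Hj. apply HA. lia.
Qed.

(** Two points with different first digits lie on opposite sides of the middle third, at least 1/3
    apart. Rescaling by 3 repeats the argument for the later digits. *)
Lemma cantor_close_agree K : forall (a a': stream) (x x': R),
 infinite_sum (cdigit a) x -> infinite_sum (cdigit a') x' ->
 Rabs (x-x') < / 3^K -> forall j, (j < K)%nat -> a j = a' j.
Proof.
 induction K as [|K IH]; intros a a' x x' H H' HA j Hj; [lia|].
 have E: / 3^S K = / 3^K/3 by (simpl; field; apply pow_nonzero; lra). have Hp: / 3^K <= 1.
 { rewrite <- Rinv_1. apply Rinv_le_contravar; [lra|]. apply pow_R1_Rle. lra. }
 have R1 := cantor_value_range _ _ (cantor_value_shift _ _ H).
 have R2 := cantor_value_range _ _ (cantor_value_shift _ _ H'). apply Rabs_def2 in HA. have E0: a 0%nat = a' 0%nat.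
 { destruct (a 0%nat), (a' 0%nat); try auto; exfalso; lra. }
 destruct j as [|j]; [auto|]. apply (IH _ _ _ _ (cantor_value_shift _ _ H) (cantor_value_shift _ _ H')); [|lia].
 rewrite <- E0. apply Rabs_def1; lra.
Qed.

(* The symbols 1, ..., c+1 are coded by the complete prefix code 1, 01, 001, ..., 0^(c-1)1, 0^c. *)
Fixpoint cnt (c: nat) (a: stream) : nat :=
 match c with O => O | S c' => if a 0%nat then O else S (cnt c' (sshift a)) end.
Fixpoint tl (c: nat) (a: stream) : stream :=
 match c with O => a | S c' => if a 0%nat then sshift a else tl c' (sshift a) end.
Fixpoint dec (c k: nat) (a: stream) : nat := match k with O => S (cnt c a) | S k' => dec c k' (tl c a) end.
Fixpoint enc (N j c: nat) (w: word) : bool := match j with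
 | O => Nat.eqb (S c) (w 0%nat)
 | S j' => if orb (Nat.eqb (S c) (w 0%nat)) (Nat.eqb (S c) N) then enc N j' 0 (wshift 1 w) else enc N j' (S c) w end.

Lemma cnt_le c a : (cnt c a <= c)%nat.
Proof.
 revert a. induction c as [|c IH]; intros a; simpl; [lia|].
 destruct (a 0%nat); [lia|]. specialize (IH (sshift a)). lia.
Qed.

Lemma dec_range c k a : (1 <= dec c k a <= S c)%nat.
Proof.
 revert a. induction k as [|k IH]; intros a; simpl; [|apply IH]. have := cnt_le c a. lia.
Qed.

(** The invariant of the encoder: [c] zeros of the current codeword have been written, and at most
    [f = N-c] digits of it remain. *)
Lemma enc_read N f c w : (c+f = N)%nat -> (1 <= f)%nat -> (S c <= w 0%nat <= S N)%nat ->
 cnt f (fun j => enc N j c w) = (w 0%nat-S c)%nat /\ tl f (fun j => enc N j c w) = (fun j => enc N j 0 (wshift 1 w)).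
Proof.
 revert c. induction f as [|f IH]; intros c Hf H1 Hw; [lia|]. set (A := fun j => enc N j c w).
 have H0: A 0%nat = Nat.eqb (S c) (w 0%nat) by auto. have Hs: sshift A =
   (fun j => if orb (Nat.eqb (S c) (w 0%nat)) (Nat.eqb (S c) N)
      then enc N j 0 (wshift 1 w) else enc N j (S c) w) by auto.
 cbn [cnt tl]. rewrite H0, Hs. clearbody A. destruct (Nat.eqb_spec (S c) (w 0%nat)) as [E|E].
 - split; [lia|auto].
 - cbn [orb]. destruct (Nat.eqb_spec (S c) N) as [E2|E2].
  + have: f = 0%nat by lia. subst f. simpl. split; [lia|auto].
  + destruct (IH (S c)) as [A1 B]; [lia|lia|lia|]. split; [rewrite A1; lia|exact B].
Qed.

Lemma dec_enc N k w : (1 <= N)%nat -> wok (S N) w -> dec N k (fun j => enc N j 0 w) = w k.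
Proof.
 intros HN. revert w. induction k as [|k IH]; intros w Hw.
 - simpl. destruct (enc_read N N 0 w) as [A _]; [lia|lia|apply Hw|]. specialize (Hw 0%nat). lia.
 - simpl. destruct (enc_read N N 0 w) as [_ B]; [lia|lia|apply Hw|]. rewrite B, IH by (apply wok_shift, Hw). auto.
Qed.

Lemma cnt_agree c L : forall a a' : stream, (forall j, (j < c+L)%nat -> a j = a' j) ->
 cnt c a = cnt c a' /\ forall j, (j < L)%nat -> tl c a j = tl c a' j.
Proof.
 induction c as [|c IH]; intros a a' H; simpl.
 - split; [auto|]. intros j Hj. apply H. lia.
 - rewrite <- (H 0%nat) by lia. destruct (a 0%nat).
  + split; [auto|]. intros j Hj. apply H. lia.
  + destruct (IH (sshift a) (sshift a')) as [A B].
   * intros j Hj. apply H. lia.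
   * split; [f_equal; exact A|exact B].
Qed.

Lemma dec_agree c K : forall a a' : stream, (forall j, (j < K*c)%nat -> a j = a' j) ->
 forall k, (k < K)%nat -> dec c k a = dec c k a'.
Proof.
 induction K as [|K IH]; intros a a' H k Hk; [lia|].
 destruct (cnt_agree c (K*c) a a') as [A B]; [intros j Hj; apply H; simpl; lia|].
 destruct k as [|k]; simpl; [f_equal; exact A|]. apply IH; [exact B|lia].
Qed.

(** A codeword has at least one digit when [1 <= c], so each known symbol yields at least one
    further known digit. *)
Lemma cnt_inverse c K : (1 <= c)%nat -> forall a a' : stream, cnt c a = cnt c a' ->
 (forall j, (j < K)%nat -> tl c a j = tl c a' j) -> forall j, (j < S K)%nat -> a j = a' j.
Proof.
 induction c as [|c IH]; intros Hc a a' H1 H2 j Hj; [lia|]. simpl in H1, H2.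
 have E0: a 0%nat = a' 0%nat by (destruct (a 0%nat), (a' 0%nat); try auto; discriminate).
 destruct j as [|j]; [auto|]. rewrite <- E0 in H1, H2. destruct (a 0%nat).
 - apply H2. lia.
 - destruct c as [|c].
  + apply H2. lia.
  + injection H1 as H1. apply (IH ltac:(lia) (sshift a) (sshift a') H1 H2). lia.
Qed.

Lemma dec_inverse c K : (1 <= c)%nat -> forall a a' : stream,
 (forall k, (k < K)%nat -> dec c k a = dec c k a') -> forall j, (j < K)%nat -> a j = a' j.
Proof.
 intros Hc. induction K as [|K IH]; intros a a' H j Hj; [lia|]. apply (cnt_inverse c K Hc); [|apply IH|auto].
 - have E := H 0%nat ltac:(lia). auto.
 - intros k Hk. apply (H (S k)). lia.
Qed.

Lemma angle_eq t s : cos t = cos s -> sin t = sin s -> exists k : Z, t = s+2*PI*IZR k.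
Proof.
 intros H1 H2. destruct (Cexp_eq (iI t) (iI s)) as [k Hk].
 - unfold Cexp, iI. simpl. rewrite H1, H2. auto.
 - exists k. apply (f_equal Im) in Hk. auto.
Qed.

Lemma circle_dist t s : Rabs (cos t-cos s) <= Rabs (t-s) /\ Rabs (sin t-sin s) <= Rabs (t-s).
Proof.
 have H := Cexp_lipschitz 0 (iI t) (iI s). rewrite exp_0, Rmult_1_l in H.
 have Hb: Cmod (Cexp (iI t)-Cexp (iI s))%C <= Rabs (t-s).
 { eapply Rle_trans; [apply H; simpl; lra|]. unfold Rminus. rewrite <- Cmod_iI, iI_plus, iI_opp. right. auto. }
 have H1 := re_le_Cmod (Cexp (iI t)-Cexp (iI s))%C. have H2 := Cmod_Im_le (Cexp (iI t)-Cexp (iI s))%C.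
 unfold Cexp, iI, Re, Im in H1, H2. simpl in H1, H2. rewrite exp_0, !Rmult_1_l in H1, H2.
 unfold Cexp, iI, Re, Im in Hb. simpl in Hb. rewrite exp_0, !Rmult_1_l in Hb. unfold Rminus at 1 3. lra.
Qed.

Lemma circle_angle_close e : 0 < e -> exists dl, 0 < dl /\ forall t s,
 Rabs (cos t-cos s) < dl -> Rabs (sin t-sin s) < dl -> exists k : Z, Rabs (t+2*PI*IZR k-s) < e.
Proof.
 intros He. destruct (Cexp_close 0 e He) as (d&Hd&H). exists (d/2). split; [lra|].
 intros t s H1 H2. destruct (H (iI t) (iI s)) as [k Hk].
 - simpl. rewrite Rabs_R0. lra.
 - simpl. rewrite Rabs_R0. lra.
 - eapply Rle_lt_trans; [apply Cmod_le_Re_Im|]. unfold Cexp, iI, Re, Im; simpl.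
  rewrite exp_0, !Rmult_1_l. unfold Rminus in H1, H2. lra.
 - exists k. replace (iI t+turn k-iI s)%C with (iI (t+2*PI*IZR k-s)) in Hk.
  + rewrite Cmod_iI in Hk. auto.
  + apply C_ext; unfold Re, Im; simpl; ring.
Qed.

Lemma dist3_bounds p q : Rabs (fst p-fst q) <= dist3 p q /\ Rabs (fst (snd p)-fst (snd q)) <= dist3 p q /\
 Rabs (snd (snd p)-snd (snd q)) <= dist3 p q /\
 dist3 p q <= Rabs (fst p-fst q)+Rabs (fst (snd p)-fst (snd q))+Rabs (snd (snd p)-snd (snd q)).
Proof.
 unfold dist3. set (a := fst p-fst q). set (b := fst (snd p)-fst (snd q)). set (c := snd (snd p)-snd (snd q)).
 have Ha: forall x y, 0 <= y -> Rabs x <= sqrt (x^2+y).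
 { intros x y Hy. rewrite <- sqrt_Rsqr_abs. apply sqrt_le_1_alt. unfold Rsqr. lra. }
 have A := pow2_ge_0 a. have B := pow2_ge_0 b. have C' := pow2_ge_0 c. repeat split.
 - replace (a^2+b^2+c^2) with (a^2+(b^2+c^2)) by ring. apply Ha. lra.
 - replace (a^2+b^2+c^2) with (b^2+(a^2+c^2)) by ring. apply Ha. lra.
 - replace (a^2+b^2+c^2) with (c^2+(a^2+b^2)) by ring. apply Ha. lra.
 - have := Rabs_pos a. have := Rabs_pos b. have := Rabs_pos c.
  rewrite <- (sqrt_square (Rabs a+Rabs b+Rabs c)) by lra. apply sqrt_le_1_alt.
  rewrite (pow2_abs a), (pow2_abs b), (pow2_abs c) || rewrite <- (pow2_abs a), <- (pow2_abs b), <- (pow2_abs c). nra.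
Qed.

(** * Curves coded by words *)

Section CircleSystem.

Context {n : nat} {F : sphere -> sphere} {Om : C -> Prop} {G : nat -> C -> C}
  {m : nat -> Z} {CC y0 Rb : R}.
Hypothesis CS : @circle_sys n F Om G m CC y0 Rb.
Local Notation gck := (gc G).
Local Notation Dkm := (Dk m).

Let HCC := cs_CC CS.

Lemma gc_add j k w z : gck (j+k) w z = gck j w (gck k (wshift j w) z).
Proof.
 revert w. induction j as [|j IH]; intros w; [auto|]. simpl. rewrite IH. auto.
Qed.

Lemma Dk_add j k w : Dkm (j+k) w = (Dkm j w*Dkm k (wshift j w))%Z.
Proof.
 revert w. induction j as [|j IH]; intros w.
 - simpl. destruct (Dkm k _); auto.
 - simpl. rewrite IH. change (wshift j (wshift 1 w)) with (wshift (S j) w). ring.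
Qed.

Lemma Dk_ext k w w' : (forall j, (j < k)%nat -> w j = w' j) -> Dkm k w = Dkm k w'.
Proof.
 revert w w'. induction k as [|k IH]; intros w w' H; [auto|].
 simpl. rewrite (H 0%nat) by lia. f_equal. apply IH. intros j Hj. apply H. lia.
Qed.

Lemma gc_ext k w w' z : (forall j, (j < k)%nat -> w j = w' j) -> gck k w z = gck k w' z.
Proof.
 revert w w'. induction k as [|k IH]; intros w w' H; [auto|].
 simpl. rewrite (H 0%nat) by lia. f_equal. apply IH. intros j Hj. apply H. lia.
Qed.

Lemma Dk_big k w : wok n w -> 2^k <= Rabs (IZR (Dkm k w)).
Proof.
 revert w. induction k as [|k IH]; intros w Hw.
 - simpl. rewrite Rabs_R1. lra.
 - simpl Dk. rewrite mult_IZR, Rabs_mult.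
  apply Rmult_le_compat; [lra|apply pow_le; lra| |apply IH, wok_shift, Hw]. apply (cs_m CS), Hw.
Qed.

Lemma Dk_pos k w : wok n w -> 1 <= Rabs (IZR (Dkm k w)).
Proof.
 intros Hw. eapply Rle_trans; [|apply Dk_big, Hw]. apply pow_R1_Rle. lra.
Qed.

Lemma gc_Om k w z : wok n w -> Om z -> Om (gck k w z).
Proof.
 revert w. induction k as [|k IH]; intros w Hw Hz; [auto|]. apply (cs_G CS); [apply Hw|].
  apply IH; [apply wok_shift, Hw|auto].
Qed.

(** The errors add up like a geometric series: one more letter turns [CC*|b|] into at most
    [2*CC*|b|], and the new degree is at least 2 in modulus. So the same [CC] serves for all [k]. *)
Lemma gc_Im k w z : wok n w -> Om z -> Rabs (Im z-IZR (Dkm k w)*Im (gck k w z)) <= CC*Rabs (IZR (Dkm k w)).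
Proof.
 revert w. induction k as [|k IH]; intros w Hw Hz.
 - simpl. rewrite Rmult_1_l, Rminus_diag, Rabs_R0, Rabs_R1. lra.
 - simpl. set (u := gck k (wshift 1 w) z). set (D := Dkm k (wshift 1 w)).
  have Hu: Om u by (apply gc_Om; [apply wok_shift, Hw|auto]).
  have H1 := IH (wshift 1 w) (wok_shift _ 1 _ Hw) Hz. fold u D in H1. have H2 := cs_Im CS (w 0%nat) u (Hw 0%nat) Hu.
  have H3 := cs_m CS (w 0%nat) (Hw 0%nat).
  rewrite mult_IZR, Rabs_mult. set (a := IZR (m (w 0%nat))) in *. set (b := IZR D) in *.
  replace (Im z-a*b*Im (G (w 0%nat) u)) with ((Im z-b*Im u)+b*(Im u-a*Im (G (w 0%nat) u))) by ring.
  le_trans Rabs_triang. rewrite Rabs_mult. have := Rabs_pos b.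
  have: Rabs b*Rabs (Im u-a*Im (G (w 0%nat) u)) <= Rabs b*CC by mono.
  have: 2*(CC*Rabs b) <= Rabs a*(CC*Rabs b) by (apply Rmult_le_compat_r; nra). lra.
Qed.

Lemma gc_period k w z j : wok n w -> Om z -> gck k w (z+turn (Dkm k w*j))%C = (gck k w z+turn j)%C.
Proof.
 revert w j. induction k as [|k IH]; intros w j Hw Hz.
 - rewrite Z.mul_1_l. auto.
 - simpl gc. replace (m (w 0%nat)*Dkm k (wshift 1 w)*j)%Z with (Dkm k (wshift 1 w)*(m (w 0%nat)*j))%Z by ring.
  rewrite IH by (auto using wok_shift). apply (cs_Gper CS); [apply Hw|]. apply gc_Om; auto using wok_shift.
Qed.

Lemma gc_F k w z : wok n w -> Om z -> iter F k (Some (Cexp (gck k w z))) = Some (Cexp z).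
Proof.
 revert w. induction k as [|k IH]; intros w Hw Hz; [auto|].
 simpl. rewrite <- iter_comm, (cs_F CS); [|apply Hw|apply gc_Om; auto using wok_shift].
 apply IH; auto using wok_shift.
Qed.

(** The [k]-th approximation of the curve coded by [w]: the line [Re = y0], run through [Dk] times
    as fast, pulled back by [k] branches. [BB] bounds the distance from a point of [Om] to a point
    of the line whose height differs by at most [CC] ([near_line]). *)
Definition Hk (k: nat) (w: word) (x: R) : C := gck k w (y0, IZR (Dkm k w)*x).
Definition BB : R := CC+2*Rb+1.
Definition unif (e: R) (k0: nat) : Prop := forall k w u v, (k0 <= k)%nat -> wok n w -> Om u -> Om v ->
  Cmod (u-v) <= BB -> Cmod (gck k w u-gck k w v) < e.

Lemma BB_pos : 0 < BB.
Proof.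
 unfold BB. have H := cs_Re CS _ (cs_line CS 0). have := Rabs_pos (Re (y0, 0)). lra.
Qed.

Lemma unif_ex e : 0 < e -> exists k0, unif e k0.
Proof.
 intros He. destruct (cs_contr CS BB e BB_pos He) as [k0 H]. exists k0. exact H.
Qed.

Lemma near_line z t : Om z -> Rabs (Im z-t) <= CC -> Cmod (z-(y0, t)) <= BB.
Proof.
 intros Hz Ht. le_trans Cmod_le_Re_Im. change (Re (z-(y0, t))) with (Re z-y0). change (Im (z-(y0, t))) with (Im z-t).
 have H := cs_Re CS _ (cs_line CS t). simpl in H. have H1 := cs_Re CS _ Hz.
 unfold BB. have H2 := Rabs_triang (Re z) (- y0). rewrite Rabs_Ropp in H2. unfold Rminus at 1. lra.
Qed.

Lemma Hk_Im k w x : wok n w -> Rabs (Im (Hk k w x)-x) <= CC.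
Proof.
 intros Hw. have H := gc_Im k w (y0, IZR (Dkm k w)*x) Hw (cs_line CS _).
 change (Im (y0, IZR (Dkm k w)*x)) with (IZR (Dkm k w)*x) in H.
 set (I := Im _) in *. have HD := Dk_pos k w Hw. set (D := IZR (Dkm k w)) in *.
 replace (D*x-D*I) with (- (D*(I-x))) in H by ring. rewrite Rabs_Ropp, Rabs_mult, Rmult_comm in H.
 apply Rmult_le_reg_r in H; lra.
Qed.

Lemma Hk_add j k w x : Hk (j+k) w x = gck j w (Hk k (wshift j w) (IZR (Dkm j w)*x)).
Proof.
 unfold Hk. rewrite gc_add, Dk_add, mult_IZR. f_equal. f_equal. f_equal. ring.
Qed.

Lemma Hk_Om k w x : wok n w -> Om (Hk k w x).
Proof. intros Hw. apply gc_Om; [auto|apply (cs_line CS)]. Qed.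

Lemma Hk_cauchy e k0 j k w x : unif e k0 -> wok n w -> (k0 <= j)%nat -> Cmod (Hk (j+k) w x-Hk j w x)%C < e.
Proof.
 intros HU Hw Hj. rewrite Hk_add. have Hw' := wok_shift n j w Hw. apply HU; trivial.
 - apply Hk_Om, Hw'.
 - apply (cs_line CS).
 - apply near_line; [apply Hk_Om, Hw'|]. apply Hk_Im, Hw'.
Qed.

(** The limit is specified together with its rate, which depends neither on the word nor on the
    angle. Continuity in both is read off from this. *)
Definition is_H (w: word) (x: R) (h: C) : Prop :=
 forall e k0, unif e k0 -> forall k, (k0 <= k)%nat -> Cmod (Hk k w x-h) <= e.

Lemma is_H_ex w x : wok n w -> exists h, is_H w x h.
Proof.
 intros Hw. destruct (C_complete (fun k => Hk k w x)) as [l Hl].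
 - intros e He. destruct (unif_ex (e/2) ltac:(lra)) as [k0 HU]. exists k0. intros j k Hj Hk'.
  replace j with (k0+(j-k0))%nat by lia. replace k with (k0+(k-k0))%nat by lia.
  have := Hk_cauchy _ _ k0 (j-k0) w x HU Hw (le_n _). have H1 := Hk_cauchy _ _ k0 (k-k0) w x HU Hw (le_n _).
  rewrite Cmod_sym in H1. have := Cmod_dist_triangle (Hk (k0+(j-k0)) w x) (Hk k0 w x) (Hk (k0+(k-k0)) w x). lra.
 - exists l. intros e k0 HU k Hk'. apply le_epsilon. intros e' He'.
  destruct (Hl e' He') as [N HN]. specialize (HN (k+N)%nat ltac:(lia)).
  have H1 := Hk_cauchy _ _ k N w x HU Hw Hk'. rewrite Cmod_sym in H1.
  have := Cmod_dist_triangle (Hk k w x) (Hk (k+N) w x) l. lra.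
Qed.

Definition HH (w: word) (x: R) : C := epsilon (inhabits (0%R : C)) (is_H w x).

Lemma HH_spec w x : wok n w -> is_H w x (HH w x).
Proof. intros Hw. unfold HH. apply epsilon_spec, is_H_ex, Hw. Qed.

Lemma eq_of_close a b : (forall e, 0 < e -> Cmod (a-b) <= e) -> a = b.
Proof.
 intros H. apply Cmod_zero_eq, le_epsilon. intros e He. rewrite Rplus_0_l. apply H, He.
Qed.

Lemma HH_char w x h : wok n w ->
 (forall e, 0 < e -> forall N, exists k, (N <= k)%nat /\ Cmod (Hk k w x-h) <= e) -> h = HH w x.
Proof.
 intros Hw H. apply eq_of_close. intros e He. destruct (unif_ex (e/2) ltac:(lra)) as [k0 HU], (H (e/2) ltac:(lra) k0)
  as (k&Hk1&Hk2). have := HH_spec w x Hw _ _ HU k Hk1. rewrite Cmod_sym in Hk2.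
 have := Cmod_dist_triangle h (Hk k w x) (HH w x). lra.
Qed.

Lemma HH_Om w x : wok n w -> Om (HH w x).
Proof.
 intros Hw. apply (cs_closed CS). intros e He. destruct (unif_ex (e/2) ltac:(lra)) as [k0 HU]. exists (Hk k0 w x).
 split; [apply Hk_Om, Hw|]. have := HH_spec w x Hw _ _ HU k0 (le_n _). lra.
Qed.

Lemma HH_Im w x : wok n w -> Rabs (Im (HH w x)-x) <= CC.
Proof.
 intros Hw. apply le_epsilon. intros e He.
 destruct (unif_ex e He) as [k0 HU]. have H := HH_spec w x Hw _ _ HU k0 (le_n _).
 have H1 := Hk_Im k0 w x Hw. rewrite Cmod_sym in H. have H2 := Cmod_Im_le (HH w x-Hk k0 w x)%C.
 change (Im (HH w x-Hk k0 w x)) with (Im (HH w x)-Im (Hk k0 w x)) in H2.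
 replace (Im (HH w x)-x) with ((Im (HH w x)-Im (Hk k0 w x))+(Im (Hk k0 w x)-x)) by ring. le_trans Rabs_triang. lra.
Qed.

Lemma HH_period w x j : wok n w -> HH w (x+2*PI*IZR j) = (HH w x+turn j)%C.
Proof.
 intros Hw. symmetry. apply HH_char; [auto|]. intros e He N.
 destruct (unif_ex e He) as [k0 HU]. exists (Nat.max N k0). split; [lia|].
 have H := HH_spec w x Hw _ _ HU (Nat.max N k0) ltac:(lia). set (k := Nat.max N k0) in *.
 have E: Hk k w (x+2*PI*IZR j) = (Hk k w x+turn j)%C.
 { unfold Hk. rewrite <- gc_period; [|auto|apply (cs_line CS)].
  f_equal. rewrite mult_IZR. apply C_ext; unfold Re, Im; simpl; ring. }
 rewrite E. replace (Hk k w x+turn j-(HH w x+turn j))%C with (Hk k w x-HH w x)%C by ring. auto.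
Qed.

Lemma HH_shift w x : wok n w -> HH w x = G (w 0%nat) (HH (wshift 1 w) (IZR (m (w 0%nat))*x)).
Proof.
 intros Hw. symmetry. apply HH_char; [auto|]. intros e He N. destruct (cs_lip CS) as (L&HL&HLip).
 destruct (unif_ex (e/L) ltac:(apply Rdiv_lt_0_compat; lra)) as [k0 HU]. exists (S (Nat.max N k0)). split; [lia|].
 have Hw' := wok_shift n 1 w Hw.
 have H := HH_spec (wshift 1 w) (IZR (m (w 0%nat))*x) Hw' _ _ HU (Nat.max N k0) ltac:(lia).
 set (k := Nat.max N k0) in *. change (S k) with (1+k)%nat. rewrite Hk_add.
 change (Dkm 1 w) with (m (w 0%nat)*1)%Z. rewrite Z.mul_1_r.
 eapply Rle_trans; [apply HLip; [apply Hw|apply Hk_Om, Hw'|apply HH_Om, Hw']|].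
 apply (Rmult_le_compat_l L) in H; [|lra]. replace (L*(e/L)) with e in H by (field; lra). exact H.
Qed.

Lemma HH_gc k w x : wok n w -> HH w x = gck k w (HH (wshift k w) (IZR (Dkm k w)*x)).
Proof.
 revert w x. induction k as [|k IH]; intros w x Hw.
 - rewrite Rmult_1_l. auto.
 - rewrite HH_shift by auto. simpl. f_equal. rewrite IH by (apply wok_shift, Hw). rewrite mult_IZR. f_equal.
  f_equal. ring.
Qed.

Lemma HH_iter k w x : wok n w -> iter F k (Some (Cexp (HH w x))) = Some (Cexp (HH (wshift k w) (IZR (Dkm k w)*x))).
Proof.
 intros Hw. rewrite (HH_gc k w x Hw). apply gc_F; [auto|]. apply HH_Om, wok_shift, Hw.
Qed.

(** An orbit of lifts with itinerary [w] is determined by rough information on its heights: the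
    [k]-th point is within [BB] of the line at height [Dk*x], and [k] pullbacks contract this
    distance to 0. *)
Lemma HH_unique w x z : wok n w -> (forall k, Om (z k)) -> (forall k, z k = G (w k) (z (S k))) ->
 (forall k, Rabs (Im (z k)-IZR (Dkm k w)*x) <= CC) -> z 0%nat = HH w x.
Proof.
 intros Hw HO Hz HI. have Hg: forall k, z 0%nat = gck k w (z k).
 { induction k as [|k IH]; [auto|]. rewrite IH, Hz. replace (S k) with (k+1)%nat by lia. rewrite gc_add. simpl.
  unfold wshift. rewrite Nat.add_0_r. auto. }
 apply HH_char; [auto|]. intros e He N. destruct (unif_ex e He) as [k0 HU]. exists (Nat.max N k0). split; [lia|].
 rewrite (Hg (Nat.max N k0)), Cmod_sym. left. apply HU; trivial; [lia| |].
 - apply (cs_line CS).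
 - apply near_line; auto.
Qed.

Definition Jset (p: sphere) : Prop := forall k, exists z, Om z /\ iter F k p = Some (Cexp z).

Lemma HH_Jset w x : wok n w -> Jset (Some (Cexp (HH w x))).
Proof.
 intros Hw k. rewrite HH_iter by auto. eexists. split; [|auto]. apply HH_Om, wok_shift, Hw.
Qed.

(** The lifts must be chosen coherently, so that each one is the image of the next under a branch,
    not merely up to a period. The selector [st] returns the branch together with the right lift of
    the next point. *)
Lemma Jset_param p : Jset p -> exists w x, wok n w /\ p = Some (Cexp (HH w x)).
Proof.
 intros HJ. destruct (fun_choice (fun (z: C) (iz: nat*C) =>
  (Om z -> (exists z', Om z' /\ F (Some (Cexp z)) = Some (Cexp z')) ->
   (1 <= fst iz <= n)%nat /\ Om (snd iz) /\ F (Some (Cexp z)) = Some (Cexp (snd iz)) /\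
   z = G (fst iz) (snd iz)))) as [st Hst].
 { intros z. destruct (classic (Om z /\ exists z', Om z' /\ F (Some (Cexp z)) = Some (Cexp z'))) as [[H1 [z' [H2 H3]]]|H].
  - destruct (cs_branch CS z z' H1 H2 H3) as (i&z''&A1&A2&A3&A4).
   exists (i, z''). intros _ _. simpl. rewrite A3. auto.
  - exists (0%nat, 0%R : C). intros H1 H2. exfalso. apply H. split; auto. }
 destruct (HJ 0%nat) as (z0&Hz0&Hp). simpl in Hp.
 set (z := fix z (k: nat) : C := match k with O => z0 | S k' => snd (st (z k')) end).
 have Hz: forall k, Om (z k) /\ iter F k p = Some (Cexp (z k)).
 { induction k as [|k [IH1 IH2]]; [split; [auto|auto]|].
  destruct (HJ (S k)) as (z'&Hz'&HF). simpl in HF. rewrite IH2 in HF.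
  destruct (Hst (z k) IH1) as (A1&A2&A3&A4); [exists z'; auto|]. simpl. rewrite IH2. split; auto. }
 set (w := fun k => fst (st (z k))). have Hs: forall k, (1 <= w k <= n)%nat /\ z k = G (w k) (z (S k)).
 { intros k. destruct (Hz k) as [IH1 IH2], (HJ (S k)) as (z'&Hz'&HF). simpl in HF. rewrite IH2 in HF.
  destruct (Hst (z k) IH1) as (A1&A2&A3&A4); [exists z'; auto|]. split; [auto|auto]. }
 have Hw: wok n w by (intros k; apply Hs). have Hg: forall j k, z j = gck k (wshift j w) (z (j+k)%nat).
 { intros j k. induction k as [|k IH]; [simpl; f_equal; lia|]. rewrite IH, (proj2 (Hs (j+k)%nat)).
  replace (S k) with (k+1)%nat by lia. rewrite gc_add. simpl gc.
  replace (wshift k (wshift j w) 0%nat) with (w (j+k)%nat) by (unfold wshift; f_equal; lia).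
  replace (j+(k+1))%nat with (S (j+k)) by lia. auto. }
 (* The angle is recovered as the limit of the rescaled heights. By [gc_Im] the tail of this
    sequence varies by at most [CC/|Dk|], which tends to 0. *)
 set (a := fun k => Im (z k)/IZR (Dkm k w)). have Ha: forall j k, Rabs (a (j+k)%nat-a j) <= CC/Rabs (IZR (Dkm j w)).
 { intros j k. unfold a. rewrite Dk_add, mult_IZR.
  have H := gc_Im k (wshift j w) (z (j+k)%nat) (wok_shift n j w Hw) (proj1 (Hz _)). rewrite <- Hg in H.
  have H1 := Dk_pos j w Hw. have H2 := Dk_pos k (wshift j w) (wok_shift n j w Hw).
  set (D := IZR (Dkm j w)) in *. set (E := IZR (Dkm k (wshift j w))) in *.
  have HD0: D <> 0 by (intros E0; rewrite E0, Rabs_R0 in H1; lra).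
  have HE0: E <> 0 by (intros E0; rewrite E0, Rabs_R0 in H2; lra). replace (Im (z (j+k)%nat)/(D*E)-Im (z j)/D)
   with ((Im (z (j+k)%nat)-E*Im (z j))/(D*E)) by (field; auto).
  unfold Rdiv. rewrite Rabs_mult, Rabs_inv, Rabs_mult. apply Rle_trans with (CC*Rabs E * / (Rabs D*Rabs E)).
  - apply Rmult_le_compat_r; [|auto]. left. apply Rinv_0_lt_compat. nra.
  - right. field. lra. }
 have Hc: Cauchy_crit a.
 { intros e He. destruct (exists_INR_gt (2*CC/e+1)) as [N HN]. exists N. intros j k Hj Hk'. have HB := Dk_big N w Hw.
  have HN2: INR N < 2^N.
  { clear. induction N as [|N IH]; [simpl; lra|]. rewrite S_INR. simpl. have := pow_R1_Rle 2 N ltac:(lra). lra. }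
  have Hdiv: CC/Rabs (IZR (Dkm N w)) < e/2.
  { have := pos_INR N. apply Rlt_div_l; [lra|]. have: 2*CC/e < Rabs (IZR (Dkm N w)) by lra.
   apply Rlt_div_l in H0; [|lra]. lra. }
  unfold Rdist. replace (a j-a k) with ((a j-a N)-(a k-a N)) by ring.
  eapply Rle_lt_trans; [apply Rabs_triang|]. rewrite Rabs_Ropp. have A1 := Ha N (j-N)%nat. have A2 := Ha N (k-N)%nat.
  replace (N+(j-N))%nat with j in A1 by lia. replace (N+(k-N))%nat with k in A2 by lia. lra. }
 destruct (R_complete a Hc) as [x Hx]. exists w, x. split; [auto|]. rewrite Hp. f_equal. f_equal.
 change z0 with (z 0%nat). apply HH_unique; [auto|intros k; apply Hz|intros k; apply Hs|].
 intros k. apply le_epsilon. intros e He. have HD := Dk_pos k w Hw. set (D := IZR (Dkm k w)) in *.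
 have HD0: D <> 0 by (intros E0; rewrite E0, Rabs_R0 in HD; lra).
 destruct (Hx (e/Rabs D)) as [N HN]; [apply Rdiv_lt_0_compat; lra|].
 specialize (HN (k+N)%nat ltac:(lia)). unfold Rdist in HN. have H1 := Ha k N. fold D in H1.
 have H2: Rabs (a k-x) <= (CC+e)/Rabs D.
 { replace (a k-x) with (- (a (k+N)%nat-a k)+(a (k+N)%nat-x)) by ring. le_trans Rabs_triang. rewrite Rabs_Ropp. lra. }
 replace (Im (z k)-D*x) with (D*(a k-x)) by (unfold a; fold D; field; auto).
 rewrite Rabs_mult. apply (Rmult_le_compat_l (Rabs D)) in H2; [|lra].
 replace (Rabs D*((CC+e)/Rabs D)) with (CC+e) in H2 by (field; lra). auto.
Qed.

Lemma gc_lip k : exists L, 0 < L /\ forall w u v, wok n w -> Om u -> Om v ->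
 Cmod (gck k w u-gck k w v) <= L*Cmod (u-v).
Proof.
 destruct (cs_lip CS) as (L&HL&HLip). induction k as [|k [L' [HL' IH]]].
 - exists 1. split; [lra|]. intros. simpl. lra.
 - exists (L*L'). split; [apply Rmult_lt_0_compat; auto|]. intros w u v Hw Hu Hv. have Hw' := wok_shift n 1 w Hw.
  eapply Rle_trans; [apply HLip; [apply Hw|apply gc_Om; auto|apply gc_Om; auto]|].
  rewrite Rmult_assoc. apply Rmult_le_compat_l; [lra|]. apply IH; auto.
Qed.

Lemma HH_cont e : 0 < e -> exists k0, forall w x, wok n w -> exists dl, 0 < dl /\
 forall w' x', wok n w' -> (forall j, (j < k0)%nat -> w j = w' j) -> Rabs (x-x') < dl -> Cmod (HH w x-HH w' x') < e.
Proof.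
 intros He. destruct (unif_ex (e/4) ltac:(lra)) as [k0 HU]. exists k0.
 intros w x Hw. destruct (gc_lip k0) as (L&HL&HLip). have HD := Dk_pos k0 w Hw. set (D := IZR (Dkm k0 w)) in *.
 exists (e/4/(L*Rabs D)). have HLD: 0 < L*Rabs D by (apply Rmult_lt_0_compat; lra).
 split; [apply Rdiv_lt_0_compat; lra|]. intros w' x' Hw' Hww Hx.
 have H1 := HH_spec w x Hw _ _ HU k0 (le_n _). rewrite Cmod_sym in H1.
 have H2 := HH_spec w' x' Hw' _ _ HU k0 (le_n _). have H3: Cmod (Hk k0 w x-Hk k0 w' x') <= e/4.
 { unfold Hk. rewrite <- (gc_ext k0 w w'), <- (Dk_ext k0 w w') by auto.
  fold D. eapply Rle_trans; [apply HLip; [auto|apply (cs_line CS)..]|].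
  replace (Cminus (y0, D*x) (y0, D*x')) with (iI (D*(x-x'))) by (unfold iI; apply C_ext; unfold Re, Im; simpl; ring).
  rewrite Cmod_iI, Rabs_mult. apply Rlt_div_r in Hx; [|auto]. lra. }
 have := Cmod_dist_triangle (HH w x) (Hk k0 w x) (HH w' x').
 have := Cmod_dist_triangle (Hk k0 w x) (Hk k0 w' x') (HH w' x'). lra.
Qed.

Lemma HH_step_back K : forall e, 0 < e -> exists dl, 0 < dl /\ forall w w' x x',
 wok n w -> wok n w' -> Cmod (HH w x-HH w' x') < dl -> (forall j, (j < K)%nat -> w j = w' j) /\
 Cmod (HH (wshift K w) (IZR (Dkm K w)*x)-HH (wshift K w') (IZR (Dkm K w')*x'))%C < e.
Proof.
 destruct (cs_sep CS) as (d0&Hd0&Hsep). induction K as [|K IH]; intros e He.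
 - exists e. split; [auto|]. intros w w' x x' Hw Hw' H. split; [intros; lia|]. rewrite !Rmult_1_l. exact H.
 - destruct (IH e He) as (d1&Hd1&H1), (cs_equi CS d1 Hd1) as (d2&Hd2&H2).
  exists (Rmin d0 d2). split; [apply Rmin_glb_lt; auto|]. intros w w' x x' Hw Hw' H.
  have Ha := lt_min_l H. have Hb := lt_min_r H. rewrite (HH_shift w x Hw), (HH_shift w' x' Hw') in Ha, Hb.
  have Hs := wok_shift n 1 w Hw. have Hs' := wok_shift n 1 w' Hw'. have E: w 0%nat = w' 0%nat.
  { eapply Hsep; [apply Hw|apply Hw'| | |exact Ha]; apply HH_Om; auto. }
  rewrite <- E in Hb. apply H2 in Hb; [|apply Hw|apply HH_Om; auto|apply HH_Om; auto].
  destruct (H1 _ _ _ _ Hs Hs' Hb) as [B1 B2]. split.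
  + intros [|j] Hj; [exact E|]. apply (B1 j). lia.
  + simpl Dk. rewrite !mult_IZR, <- E. replace (IZR (m (w 0%nat))*IZR (Dkm K (wshift 1 w))*x)
    with (IZR (Dkm K (wshift 1 w))*(IZR (m (w 0%nat))*x)) by ring.
   replace (IZR (m (w 0%nat))*IZR (Dkm K (wshift 1 w'))*x')
    with (IZR (Dkm K (wshift 1 w'))*(IZR (m (w 0%nat))*x')) by ring.
   auto.
Qed.

(** Closeness of two points reveals the first letter by [cs_sep] and is handed on to their images by
    [cs_equi]. After [K] steps the heights still nearly agree, while the difference of the angles
    has been multiplied by at least [2^K]. *)
Lemma HH_inverse K : exists dl, 0 < dl /\ forall w w' x x', wok n w -> wok n w' ->
 Cmod (Cexp (HH w x)-Cexp (HH w' x'))%C < dl -> (forall j, (j < K)%nat -> w j = w' j) /\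
 exists k : Z, 2^K*Rabs (x+2*PI*IZR k-x') <= 2*CC+1.
Proof.
 destruct (HH_step_back K 1 Rlt_0_1) as (d1&Hd1&H1), (Cexp_close Rb d1 Hd1) as (d2&Hd2&H2).
 exists d2. split; [auto|]. intros w w' x x' Hw Hw' H. destruct (H2 _ _ (cs_Re CS _ (HH_Om w x Hw))
  (cs_Re CS _ (HH_Om w' x' Hw')) H) as [k Hk'].
 rewrite <- HH_period in Hk' by auto. destruct (H1 _ _ _ _ Hw Hw' Hk') as [A1 A2]. split; [auto|]. exists k.
 rewrite <- (Dk_ext K w w' A1) in A2. set (D := IZR (Dkm K w)) in *.
 have I1 := HH_Im (wshift K w) (D*(x+2*PI*IZR k)) (wok_shift n K w Hw).
 have I2 := HH_Im (wshift K w') (D*x') (wok_shift n K w' Hw').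
 set (P := HH (wshift K w) (D*(x+2*PI*IZR k))) in *. set (Q := HH (wshift K w') (D*x')) in *.
 have I3 := Cmod_Im_le (P-Q)%C. change (Im (P-Q)) with (Im P-Im Q) in I3. have HB := Dk_big K w Hw.
 apply Rle_trans with (Rabs D*Rabs (x+2*PI*IZR k-x')).
 { apply Rmult_le_compat_r; [apply Rabs_pos|auto]. }
 rewrite <- Rabs_mult. replace (D*(x+2*PI*IZR k-x')) with (- (Im P-D*(x+2*PI*IZR k))+(Im P-Im Q)+(Im Q-D*x')) by ring.
 le_trans Rabs_triang. eapply Rle_trans; [apply Rplus_le_compat_r, Rabs_triang|]. rewrite Rabs_Ropp. lra.
Qed.

Lemma HH_injective w w' x x' : wok n w -> wok n w' ->
 Cexp (HH w x) = Cexp (HH w' x') -> (forall j, w j = w' j) /\ exists k : Z, x' = x+2*PI*IZR k.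
Proof.
 intros Hw Hw' E. have HA: forall K, (forall j, (j < K)%nat -> w j = w' j) /\
  exists k : Z, 2^K*Rabs (x+2*PI*IZR k-x') <= 2*CC+1.
 { intros K. destruct (HH_inverse K) as (d&Hd&H). apply H; trivial.
  rewrite E. replace (Cexp (HH w' x')-Cexp (HH w' x'))%C with (RtoC 0) by ring. rewrite Cmod_0. auto. }
 split; [intros j; apply (HA (S j)); lia|]. destruct (Cexp_eq _ _ E) as [k Hk']. exists (- k)%Z.
 have Hww: forall j, w j = w' j by (intros j; apply (HA (S j)); lia).
 have Hx: forall K, 2^K*Rabs (x+2*PI*IZR (- k)-x') <= 2*CC.
 { intros K. have E2: HH w (x+2*PI*IZR (- k)) = HH w' x'.
  { rewrite HH_period, Hk' by auto. rewrite opp_IZR.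
   replace (2*PI * - IZR k) with (- (2*PI*IZR k)) by ring. rewrite iI_opp. ring. }
  set (x1 := x+2*PI*IZR (- k)) in *.
  have E3: HH (wshift K w) (IZR (Dkm K w)*x1) = HH (wshift K w') (IZR (Dkm K w')*x').
  { apply eq_of_close. intros e He. destruct (HH_step_back K e He) as (d&Hd&H). left. apply H; trivial. rewrite E2.
   replace (HH w' x'-HH w' x')%C with (RtoC 0) by ring. rewrite Cmod_0. auto. }
  rewrite <- (Dk_ext K w w') in E3 by (intros; apply Hww).
  have I1 := HH_Im (wshift K w) (IZR (Dkm K w)*x1) (wok_shift n K w Hw).
  have I2 := HH_Im (wshift K w') (IZR (Dkm K w)*x') (wok_shift n K w' Hw').
  rewrite E3 in I1. have HB := Dk_big K w Hw. set (D := IZR (Dkm K w)) in *.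
  set (Q := Im (HH (wshift K w') (D*x'))) in *. apply Rle_trans with (Rabs D*Rabs (x1-x')).
  { apply Rmult_le_compat_r; [apply Rabs_pos|auto]. }
  rewrite <- Rabs_mult. replace (D*(x1-x')) with (- (Q-D*x1)+(Q-D*x')) by ring.
  le_trans Rabs_triang. rewrite Rabs_Ropp. lra. }
 set (t := Rabs (x+2*PI*IZR (- k)-x')) in *. destruct (Req_dec t 0) as [H0|H0].
 - destruct (Req_dec (x+2*PI*IZR (- k)-x') 0) as [H|H]; [lra|]. exfalso. apply (Rabs_no_R0 _ H). auto.
 - have Ht: 0 < t by (have: 0 <= t by apply Rabs_pos; lra).
  destruct (exists_INR_gt (2*CC/t)) as [K HK]. specialize (Hx K). have HN2: INR K < 2^K.
  { clear. induction K as [|K IH]; [simpl; lra|]. rewrite S_INR. simpl. have := pow_R1_Rle 2 K ltac:(lra). lra. }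
  apply Rlt_div_l in HK; [|auto]. nra.
Qed.

Lemma Cexp_chordal_lower z w : Rabs (Re z) <= Rb -> Rabs (Re w) <= Rb ->
 2*Cmod (Cexp z-Cexp w)/(1+exp (2*Rb)) <= chordal (Some (Cexp z)) (Some (Cexp w)).
Proof.
 intros Hz Hw. unfold chordal. change (Cnorm (Csub (Cexp z) (Cexp w))) with (Cmod (Cexp z-Cexp w)).
 rewrite !Cnorm2_Cmod, !Cmod_Cexp, <- !exp_plus. apply Rabs_le_between in Hz. apply Rabs_le_between in Hw.
 have H1: exp (Re z+Re z) <= exp (2*Rb) by (apply exp_le; lra).
 have H2: exp (Re w+Re w) <= exp (2*Rb) by (apply exp_le; lra).
 have := exp_pos (Re z+Re z). have := exp_pos (Re w+Re w). set (B := 1+exp (2*Rb)) in *.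
 have Hs: sqrt ((1+exp (Re z+Re z))*(1+exp (Re w+Re w))) <= B.
 { rewrite <- (sqrt_square B) by (unfold B; lra). apply sqrt_le_1_alt. unfold B. apply Rmult_le_compat; lra. }
 have Hp: 0 < sqrt ((1+exp (Re z+Re z))*(1+exp (Re w+Re w))) by (apply sqrt_lt_R0; nra).
 apply Rmult_le_compat_l; [have := Cmod_ge_0 (Cexp z-Cexp w)%C; lra|]. apply Rinv_le_contravar; auto.
Qed.

(* Moving the angle by pi/D_k moves the k-th image by half a turn, whence non-equicontinuity. *)
Lemma HH_sensitive : exists e0, 0 < e0 /\ forall p, Jset p -> forall r, 0 < r ->
 exists K0, forall k, (K0 <= k)%nat -> exists p', chordal p p' < r /\ e0 <= chordal (iter F k p) (iter F k p').
Proof.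
 destruct (exists_INR_gt (2*CC+1)) as [K HK]. have HN2: INR K < 2^K.
 { clear. induction K as [|K IH]; [simpl; lra|]. rewrite S_INR. simpl. have := pow_R1_Rle 2 K ltac:(lra). lra. }
 destruct (HH_inverse K) as (d&Hd&HI).
 have Hlow: forall w x, wok n w -> d <= Cmod (Cexp (HH w x)-Cexp (HH w (x+PI)))%C.
 { intros w x Hw. destruct (Rle_dec d (Cmod (Cexp (HH w x)-Cexp (HH w (x+PI)))%C)) as [H|H]; [auto|].
  apply Rnot_le_lt in H. destruct (HI _ _ _ _ Hw Hw H) as (_&k&Hk').
  replace (x+2*PI*IZR k-(x+PI)) with (PI*(2*IZR k-1)) in Hk' by ring.
  rewrite Rabs_mult in Hk'. have := PI2_3_2. rewrite (Rabs_right PI) in Hk' by lra. have H1: 1 <= Rabs (2*IZR k-1).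
  { replace (2*IZR k-1) with (IZR (2*k-1)) by (rewrite minus_IZR, mult_IZR; auto). apply Rabs_IZR_ge_1. lia. }
  have: 1 <= PI*Rabs (2*IZR k-1) by nra. have: 2^K*1 <= 2^K*(PI*Rabs (2*IZR k-1)) by mono. lra. }
 exists (2*d/(1+exp (2*Rb))). have Hexp := exp_pos (2*Rb). split; [apply Rdiv_lt_0_compat; lra|].
 intros p HJ r Hr. destruct (Jset_param p HJ) as (w&x&Hw&->).
 have He: 0 < r/(4*exp Rb) by (apply Rdiv_lt_0_compat; [lra|have := exp_pos Rb; lra]).
 destruct (HH_cont _ He) as [k0 Hc], (Hc w x Hw) as (dl&Hdl&Hcc). clear Hc.
 destruct (exists_INR_gt (4/dl)) as [K0 HK0]. exists K0. intros k Hk'. have HN3: forall j : nat, INR j < 2^j.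
 { clear. induction j as [|j IH]; [simpl; lra|]. rewrite S_INR. simpl. have := pow_R1_Rle 2 j ltac:(lra). lra. }
 have HB := Dk_big k w Hw. have Hkk := HN3 k. apply le_INR in Hk'.
 set (D := IZR (Dkm k w)) in *. have HD0: D <> 0 by (intros E; rewrite E, Rabs_R0 in HB; have := pow_R1_Rle 2 k
  ltac:(lra); lra).
 exists (Some (Cexp (HH w (x+PI/D)))). split.
 - have Hx: Rabs (x-(x+PI/D)) < dl.
  { replace (x-(x+PI/D)) with (- (PI/D)) by ring. rewrite Rabs_Ropp. unfold Rdiv.
   rewrite Rabs_mult, Rabs_inv. have := PI_4. have := PI_RGT_0. rewrite (Rabs_right PI) by lra.
   have := pos_INR k. apply Rlt_div_l; [lra|]. apply Rlt_div_l in HK0; [|auto].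
   have: INR K0*dl <= Rabs D*dl by mono. lra. }
  specialize (Hcc w (x+PI/D) Hw ltac:(auto) Hx). eapply Rle_lt_trans; [apply chordal_le|].
  have R1 := cs_Re CS _ (HH_Om w x Hw). have R2 := cs_Re CS _ (HH_Om w (x+PI/D) Hw).
  apply Rabs_le_between in R1. apply Rabs_le_between in R2.
  have HL := Cexp_lipschitz Rb (HH w x) (HH w (x+PI/D)) ltac:(lra) ltac:(lra). have Hp := exp_pos Rb.
  apply (Rmult_lt_compat_l (exp Rb)) in Hcc; [|auto].
  replace (exp Rb*(r/(4*exp Rb))) with (r/4) in Hcc by (field; lra). lra.
 - rewrite !HH_iter by auto. fold D. replace (D*(x+PI/D)) with (D*x+PI) by (field; auto).
  have Hw' := wok_shift n k w Hw. eapply Rle_trans; [|apply Cexp_chordal_lower; apply (cs_Re CS), HH_Om; auto].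
  specialize (Hlow (wshift k w) (D*x) Hw'). apply Rmult_le_compat_r; [left; apply Rinv_0_lt_compat; lra|]. lra.
Qed.

(** * The homeomorphism from the Cantor set times the circle *)

Hypothesis Hn : (2 <= n)%nat.

Definition ccode (x: R) : stream := epsilon (inhabits (fun _ => true)) (fun a => infinite_sum (cdigit a) x).
Definition cangle (u: R*R) : R := epsilon (inhabits 0) (fun t => fst u = cos t /\ snd u = sin t).
Definition cword (x: R) : word := fun k => dec (n-1) k (ccode x).
Definition cmap (p: R*(R*R)) : sphere := Some (Cexp (HH (cword (fst p)) (cangle (snd p)))).

Lemma ccode_spec x : cantor x -> infinite_sum (cdigit (ccode x)) x.
Proof. intros [a Ha]. unfold ccode. apply epsilon_spec. exists a. auto. Qed.

Lemma cangle_spec u : circle u -> fst u = cos (cangle u) /\ snd u = sin (cangle u).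
Proof.
 intros Hu. unfold cangle. apply epsilon_spec. destruct (circle_angle (fst u) (snd u)) as [t Ht].
 - unfold circle in Hu. lra.
 - exists t. auto.
Qed.

Lemma cword_ok x : wok n (cword x).
Proof. intros k. unfold cword. have := dec_range (n-1) k (ccode x). lia. Qed.

Theorem circle_sys_cantor_circles : cantor_circles Jset.
Proof.
 exists cmap. split; [|split; [|split; [|split]]].
 - intros p _. apply HH_Jset, cword_ok.
 - intros y Hy. destruct (Jset_param y Hy) as (w&x&Hw&->). set (a := fun j => enc (n-1) j 0 w).
  destruct (cantor_value_ex a) as [xc Hxc]. exists (xc, (cos x, sin x)). have Hp: CxS1 (xc, (cos x, sin x)).
  { split; simpl; [exists a; auto|]. unfold circle; simpl. have := sin2_cos2 x. unfold Rsqr in H. lra. }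
  split; [auto|]. unfold cmap. simpl fst. simpl snd. have E1: cword xc = w.
  (* [ccode] is only some choice of an expansion, but an expansion with digits 0 and 2 is unique, so
     it returns [a]. *)
  { apply functional_extensionality. intros k. unfold cword. have Ea: ccode xc = a.
   { apply functional_extensionality. intros j.
    apply (cantor_close_agree (S j) _ _ xc xc (ccode_spec xc (proj1 Hp)) Hxc); [|lia].
    rewrite Rminus_diag, Rabs_R0. apply Rinv_0_lt_compat, pow_lt. lra. }
   rewrite Ea. apply dec_enc; [lia|]. replace (S (n-1)) with n by lia. auto. }
  rewrite E1. destruct (cangle_spec (cos x, sin x) (proj2 Hp)) as [A B]. simpl in A, B.
  destruct (angle_eq (cangle (cos x, sin x)) x) as [k Hk]; [congruence|congruence|].
  rewrite Hk, HH_period by auto. rewrite Cexp_period. auto.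
 - intros p q Hp Hq E. injection E as E.
  have E': Cexp (HH (cword (fst p)) (cangle (snd p))) = Cexp (HH (cword (fst q)) (cangle (snd q)))
   by (apply C_ext; auto).
  destruct (HH_injective _ _ _ _ (cword_ok _) (cword_ok _) E') as (A&k&B), p as (x&u1&u2), q as (x'&u1'&u2').
   have Ex: x = x'.
  { have Ha: forall j, ccode x j = ccode x' j.
   { intros j. apply (dec_inverse (n-1) (S j)); [lia| |lia]. intros i _. apply A. }
   destruct (Req_dec (x-x') 0) as [H0|H0]; [lra|exfalso]. have Hpos := Rabs_pos_lt _ H0.
   destruct (exists_INR_gt (/ Rabs (x-x'))) as [K HK].
   have Hc := cantor_agree_close K _ _ _ _ (ccode_spec x (proj1 Hp)) (ccode_spec x' (proj1 Hq)) (fun j _ => Ha j).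
   have HN3: INR K < 3^K.
   { clear. induction K as [|K IH]; [simpl; lra|]. rewrite S_INR. simpl. have := pow_R1_Rle 3 K ltac:(lra). lra. }
   have Hi: 0 < / Rabs (x-x') by (apply Rinv_0_lt_compat; auto). have: / 3^K < Rabs (x-x'); [|lra].
   rewrite <- (Rinv_inv (Rabs (x-x'))). apply Rinv_lt_contravar; [|lra].
   apply Rmult_lt_0_compat; [auto|apply pow_lt; lra]. }
  destruct (cangle_spec _ (proj2 Hp)) as [A1 A2], (cangle_spec _ (proj2 Hq)) as [B1 B2].
  simpl in A1, A2, B1, B2, B. rewrite B in B1, B2.
  rewrite (proj1 (cos_sin_Zperiod _ _)) in B1. rewrite (proj2 (cos_sin_Zperiod _ _)) in B2. f_equal; congruence.
 - intros p Hp e He. set (w := cword (fst p)). set (t := cangle (snd p)). have Hexp := exp_pos Rb.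
  have He': 0 < e/(4*exp Rb) by (apply Rdiv_lt_0_compat; lra).
  destruct (HH_cont _ He') as [k0 Hc], (Hc w t (cword_ok _)) as (dl&Hdl&Hcc). clear Hc.
  destruct (circle_angle_close dl Hdl) as (d1&Hd1&H1). exists (Rmin (/ 3^(k0*(n-1))) d1). split.
  { apply Rmin_glb_lt; [apply Rinv_0_lt_compat, pow_lt; lra|auto]. }
  intros q Hq Hd. destruct (dist3_bounds p q) as (B1&B2&B3&_). have Hda := lt_min_l Hd. have Hdb := lt_min_r Hd.
  destruct (cangle_spec _ (proj2 Hp)) as [P1 P2], (cangle_spec _ (proj2 Hq)) as [Q1 Q2].
  destruct (H1 (cangle (snd q)) t) as [k Hk].
  { unfold t. rewrite <- P1, <- Q1, Rabs_minus_sym. lra. }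
  { unfold t. rewrite <- P2, <- Q2, Rabs_minus_sym. lra. }
  set (t' := cangle (snd q)) in *. set (w' := cword (fst q)). have Hww: forall j, (j < k0)%nat -> w j = w' j.
  { apply dec_agree. intros j Hj.
   apply (cantor_close_agree (k0*(n-1)) _ _ (fst p) (fst q) (ccode_spec _ (proj1 Hp)) (ccode_spec _ (proj1 Hq)));
    [lra|auto]. }
  specialize (Hcc w' (t'+2*PI*IZR k) (cword_ok _) Hww ltac:(rewrite Rabs_minus_sym; auto)).
  unfold cmap. fold t t' w w'. rewrite <- (Cexp_period (HH w' t') k), <- HH_period by apply cword_ok.
  eapply Rle_lt_trans; [apply chordal_le|]. set (P := HH w t) in *. set (Q := HH w' (t'+2*PI*IZR k)) in *.
  have R1: Rabs (Re P) <= Rb by (apply (cs_Re CS), HH_Om, cword_ok).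
  have R2: Rabs (Re Q) <= Rb by (apply (cs_Re CS), HH_Om, cword_ok).
  apply Rabs_le_between in R1. apply Rabs_le_between in R2. have HL := Cexp_lipschitz Rb P Q ltac:(lra) ltac:(lra).
  apply (Rmult_lt_compat_l (exp Rb)) in Hcc; [|auto].
  replace (exp Rb*(e/(4*exp Rb))) with (e/4) in Hcc by (field; lra). lra.
 - intros p Hp e He. destruct (exists_INR_gt ((4*CC+4)/e)) as [K HK]. have HN2: INR K < 2^K.
  { clear. induction K as [|K IH]; [simpl; lra|]. rewrite S_INR. simpl. have := pow_R1_Rle 2 K ltac:(lra). lra. }
  destruct (HH_inverse K) as (d1&Hd1&H1), (chordal_finite_nbhd (Cexp (HH (cword (fst p)) (cangle (snd p)))) d1 Hd1) as
   (dl&Hdl&H2).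
  exists dl. split; [auto|]. intros q Hq Hd. destruct (H2 _ Hd) as (z&Ez&Hz). injection Ez as Ez.
  rewrite <- Ez, Cmod_sym in Hz. destruct (H1 _ _ _ _ (cword_ok _) (cword_ok _) Hz) as (A&k&B).
  have Hx: Rabs (fst p-fst q) <= / 3^K.
  { apply (cantor_agree_close K (ccode (fst p)) (ccode (fst q))); [apply ccode_spec, Hp|apply ccode_spec, Hq|].
   apply (dec_inverse (n-1)); [lia|]. exact A. }
  destruct (cangle_spec _ (proj2 Hp)) as [P1 P2], (cangle_spec _ (proj2 Hq)) as [Q1 Q2].
  set (t := cangle (snd p)) in *. set (t' := cangle (snd q)) in *.
  destruct (circle_dist (t+2*PI*IZR k) t') as [C1 C2]. rewrite (proj1 (cos_sin_Zperiod t k)), <- P1, <- Q1 in C1.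
  rewrite (proj2 (cos_sin_Zperiod t k)), <- P2, <- Q2 in C2. destruct (dist3_bounds p q) as (_&_&_&B4).
  eapply Rle_lt_trans; [exact B4|]. have H3: / 3^K <= / 2^K.
  { apply Rinv_le_contravar; [apply pow_lt; lra|]. apply pow_incr. lra. }
  have Hp2: 0 < 2^K by (apply pow_lt; lra). set (D := Rabs (t+2*PI*IZR k-t')) in *.
  apply Rmult_lt_reg_l with (2^K); [auto|]. have: 2^K * / 2^K = 1 by (field; lra).
  apply Rlt_div_l in HK; [|auto]. have: INR K*e <= 2^K*e by mono.
  have: 2^K * / 3^K <= 1 by (rewrite <- H; apply Rmult_le_compat_l; lra).
  have: 2^K*Rabs (fst p-fst q) <= 2^K * / 3^K by mono. have: 2^K*Rabs (fst (snd p)-fst (snd q)) <= 2^K*D by mono.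
  have: 2^K*Rabs (snd (snd p)-snd (snd q)) <= 2^K*D by mono. lra.
Qed.

End CircleSystem.

(** * The rational map in logarithmic coordinates *)

Fixpoint csum (f: nat -> C) (k: nat) : C := match k with O => 0%C | S k' => (csum f k'+f (S k'))%C end.

Definition sgn (j: nat) : R := if Nat.even j then 1 else -1.

Lemma sgn_S j : sgn (S j) = - sgn j.
Proof. unfold sgn. rewrite Nat.even_succ, <- Nat.negb_even. destruct (Nat.even j); simpl; lra. Qed.

Lemma sgn_abs j : Rabs (sgn j) = 1.
Proof. unfold sgn. destruct (Nat.even j); [apply Rabs_R1|rewrite Rabs_left; lra]. Qed.

Lemma csum_ext f g k : (forall j, (1 <= j <= k)%nat -> f j = g j) -> csum f k = csum g k.
Proof.
 induction k as [|k IH]; intros H; [auto|]. simpl.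
 rewrite IH, (H (S k)); [auto|lia|]. intros j Hj. apply H. lia.
Qed.

Lemma csum_plus f g k : csum (fun j => f j+g j)%C k = (csum f k+csum g k)%C.
Proof. induction k as [|k IH]; simpl; [ring|]. rewrite IH. ring. Qed.

Lemma csum_mod f B k : (forall j, (1 <= j <= k)%nat -> Cmod (f j) <= B) -> Cmod (csum f k) <= INR k*B.
Proof.
 induction k as [|k IH]; intros H.
 - simpl. rewrite Cmod_0. lra.
 - simpl csum. rewrite S_INR. le_trans Cmod_triangle.
  have: Cmod (csum f k) <= INR k*B by (apply IH; intros; apply H; lia). have := H (S k) ltac:(lia). lra.
Qed.

Lemma csum_Re f k : Re (csum f k) = sum_upto (fun j => Re (f j)) k.
Proof. induction k as [|k IH]; simpl; [auto|]. rewrite <- IH. auto. Qed.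

Lemma sum_upto_ext f g k : (forall j, (1 <= j <= k)%nat -> f j = g j) -> sum_upto f k = sum_upto g k.
Proof.
 induction k as [|k IH]; intros H; [auto|]. simpl.
 rewrite IH, (H (S k)); [auto|lia|]. intros j Hj. apply H. lia.
Qed.

Lemma sum_upto_plus f g k : sum_upto (fun j => f j+g j) k = sum_upto f k+sum_upto g k.
Proof. induction k as [|k IH]; simpl; [ring|]. rewrite IH. ring. Qed.

Lemma C11_csum S f f' A B k : (forall j, (1 <= j <= k)%nat -> C11 S (f j) (f' j) A B) ->
 C11 S (fun z => csum (fun j => f j z) k) (fun z => csum (fun j => f' j z) k) (INR k*A) (INR k*B).
Proof.
 induction k as [|k IH]; intros H.
 - simpl. split; [|split].
  + intros z _. apply Cderiv_const.
  + intros. rewrite Cmod_0. lra.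
  + intros. replace (0-0)%C with (RtoC 0) by ring. rewrite Cmod_0. lra.
 - rewrite S_INR. replace ((INR k+1)*A) with (INR k*A+A) by ring. replace ((INR k+1)*B) with (INR k*B+B) by ring.
  apply (C11_plus S (fun z => csum (fun j => f j z) k) (fun z => csum (fun j => f' j z) k)).
  + apply IH. intros; apply H; lia.
  + apply H. lia.
Qed.

Lemma Cprod_le f g k : (forall j, (1 <= j <= k)%nat -> Cmod (f j) <= exp (g j)) ->
 Cmod (Cprod_upto f k) <= exp (sum_upto g k).
Proof.
 induction k as [|k IH]; intros H.
 - simpl. rewrite exp_0. right. apply Cmod_1.
 - simpl. rewrite exp_plus, Cmod_mult. apply Rmult_le_compat; try apply Cmod_ge_0.
  + apply IH. intros; apply H; lia.
  + apply H. lia.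
Qed.

Lemma Cprod_ge f g k : (forall j, (1 <= j <= k)%nat -> exp (g j) <= Cmod (f j)) ->
 exp (sum_upto g k) <= Cmod (Cprod_upto f k).
Proof.
 induction k as [|k IH]; intros H.
 - simpl. rewrite exp_0. right. symmetry. apply Cmod_1.
 - simpl. rewrite exp_plus, Cmod_mult. apply Rmult_le_compat; try (left; apply exp_pos).
  + apply IH. intros; apply H; lia.
  + apply H. lia.
Qed.

Lemma Cprod_neq0 (f: nat -> C) k : (forall j, (1 <= j <= k)%nat -> f j <> 0%C) -> (Cprod_upto f k: C) <> 0%C.
Proof.
 induction k as [|k IH]; intros H.
 - intros E. injection E. lra.
 - apply (Cmult_neq_0 (Cprod_upto f k) (f (S k))); [apply IH; intros; apply H; lia|apply H; lia].
Qed.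

Lemma Ccont_mult f g z : Ccont f z -> Ccont g z -> Ccont (fun w => f w*g w)%C z.
Proof.
 intros Hf Hg e He. have F0 := Cmod_ge_0 (f z). have G0 := Cmod_ge_0 (g z).
 destruct (Hf (Rmin 1 (e/(3*(Cmod (g z)+1))))) as (d1&Hd1&H1).
 { apply Rmin_glb_lt; [lra|]. apply Rdiv_lt_0_compat; lra. }
 destruct (Hg (e/(3*(Cmod (f z)+1)))) as (d2&Hd2&H2).
 { apply Rdiv_lt_0_compat; lra. }
 exists (Rmin d1 d2). split; [apply Rmin_glb_lt; auto|]. intros h Hh. specialize (H1 h (lt_min_l Hh)).
 specialize (H2 h (lt_min_r Hh)). have H1a := lt_min_l H1. have H1b := lt_min_r H1.
 set (a := (f (z+h)-f z)%C) in *. set (b := (g (z+h)-g z)%C) in *.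
 replace (f (z+h)*g (z+h)-f z*g z)%C with (a*g z+(f z+a)*b)%C by (unfold a, b; ring).
 eapply Rle_lt_trans; [apply Cmod_triangle|]. rewrite !Cmod_mult.
 have Ht := Cmod_triangle (f z) a. have := Cmod_ge_0 a. have := Cmod_ge_0 b.
 apply Rlt_div_r in H1b; [|lra]. apply Rlt_div_r in H2; [|lra]. have: Cmod (f z+a)*Cmod b <= e/3.
 { apply Rle_trans with ((Cmod (f z)+1)*Cmod b); [apply Rmult_le_compat_r; lra|]. lra. }
 lra.
Qed.

Lemma Ccont_const c z : Ccont (fun _ => c) z.
Proof. apply (Cderiv_cont _ _ 0), Cderiv_const. Qed.

Lemma Ccont_pow k z : Ccont (fun w => w^k)%C z.
Proof.
 induction k as [|k IH]; [exact (Ccont_const 1 z)|]. apply (Ccont_mult (fun w => w) (fun w => w^k)%C); [|auto].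
 apply (Cderiv_cont _ _ 1), Cderiv_id.
Qed.

Lemma Ccont_minus_const f c z : Ccont f z -> Ccont (fun w => f w-c)%C z.
Proof.
 intros H e He. destruct (H e He) as (d&Hd&H1). exists d. split; [auto|].
 intros h Hh. replace (f (z+h)-c-(f z-c))%C with (f (z+h)-f z)%C by ring. auto.
Qed.

Lemma Ccont_prod f k z : (forall j, (1 <= j <= k)%nat -> Ccont (f j) z) -> Ccont (fun w => Cprod_upto (fun j => f j w)
 k) z.
Proof.
 induction k as [|k IH]; intros H; [exact (Ccont_const 1 z)|].
 apply (Ccont_mult (fun w => Cprod_upto (fun j => f j w) k) (f (S k))).
 - apply IH. intros; apply H; lia.
 - apply H. lia.
Qed.

Section RationalMap.

Variables (n: nat) (d: nat -> nat) (s S0 T: R).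
Hypothesis Hn : (3 <= n)%nat.
Hypothesis Hodd : Nat.odd n = true.
Hypothesis Hd : forall i, (1 <= i <= n)%nat -> (2 <= d i)%nat.
Hypothesis Hs : 0 < s.
Hypothesis HS : 0 < S0.
Local Notation cc := (cseq n d s).
Definition lcf (i: nat) : R := ln (cseq n d s i).
Local Notation lc := lcf.
Local Notation dmx := (INR (dmax n d)).

Lemma max_upto_ge k i : (1 <= i <= k)%nat -> (d i <= max_upto d k)%nat.
Proof.
 induction k as [|k IH]; intros H; [lia|]. simpl. destruct (Nat.eq_dec i (S k)) as [E|E]; [subst; lia|]. lia.
Qed.

Lemma d_le_dmax i : (1 <= i <= n)%nat -> 2 <= INR (d i) <= dmx.
Proof.
 intros H. split.
 - apply (le_INR 2), Hd, H.
 - apply le_INR, max_upto_ge, H.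
Qed.

Lemma dmx_ge_2 : 2 <= dmx.
Proof. have := d_le_dmax 1 ltac:(lia). lra. Qed.

Lemma cseq_pos i : (1 <= i)%nat -> 0 < cc i.
Proof.
 intros H. induction i as [|i IH]; [lia|]. destruct i as [|i].
 - apply exp_pos.
 - apply Rmult_lt_0_compat; [apply exp_pos|apply IH; lia].
Qed.

Lemma exp_lc i : (1 <= i)%nat -> exp (lc i) = cc i.
Proof. intros H. apply exp_ln, cseq_pos, H. Qed.

Lemma lc_1 : INR (d 1)*lc 1 = ln (dmx*dmx)+ln s.
Proof. have := d_le_dmax 1 ltac:(lia). unfold lcf. simpl cseq. unfold Rpower.
 rewrite ln_exp, Rmult_1_r, ln_mult by nra. field. lra.
Qed.

Lemma lc_S i : (1 <= i)%nat -> (S i <= n)%nat -> INR (d (S i))*(lc (S i)-lc i) = ln s.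
Proof.
 intros H H'. have := d_le_dmax (S i) ltac:(lia). unfold lcf. destruct i as [|i]; [lia|].
 change (cseq n d s (S (S i))) with (Rpower s (/ INR (d (S (S i))))*cseq n d s (S i)).
 rewrite ln_mult; [|apply exp_pos|apply cseq_pos; lia]. unfold Rpower. rewrite ln_exp. field. lra.
Qed.

(** On the strip between the circles [i] and [i-1], [log |R-T|] is close to the affine function
    [kr i+mi i*Re z]. These pieces agree at each [lc i] ([kr_match]), where the common value is [he]
    for even and [ho] for odd [i]. *)
Definition mi (i: nat) : R := sgn i*INR (d i).
Definition kr (i: nat) : R := ln S0+sum_upto (fun j => if Nat.ltb j i then sgn j*(INR (Dd d j)*lcf j) else 0) (n-1).
Definition he : R := ln S0-ln (dmx*dmx).
Definition ho : R := he-ln s.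

Lemma sgn_n1 : sgn (n-1) = 1.
Proof.
 unfold sgn. destruct n as [|k]; [lia|]. simpl. rewrite Nat.sub_0_r.
 rewrite Nat.odd_succ in Hodd. rewrite Hodd. auto.
Qed.

Lemma Dd_INR j : INR (Dd d j) = INR (d j)+INR (d (S j)).
Proof. apply plus_INR. Qed.

(** The signs alternate and [D_j = d_j+d_{j+1}], so only the two end terms survive. This is how the
    exponents [D_j] produce the degree [d_i] on the [i]-th strip. *)
Lemma telescope i k : (1 <= i <= S k)%nat ->
 sum_upto (fun j => if Nat.ltb j i then 0 else sgn j*INR (Dd d j)) k = sgn i*INR (d i)+sgn k*INR (d (S k)).
Proof.
 induction k as [|k IH]; intros H.
 - assert (i = 1)%nat by lia. subst i. unfold sgn. simpl. ring.
 - destruct (Nat.eq_dec i (S (S k))) as [E|E].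
  + subst i. rewrite (sgn_S (S k)), (sum_upto_ext _ (fun _ => 0)).
   * have Z: forall p, sum_upto (fun _ => 0) p = 0 by (induction p; simpl; lra). rewrite Z. ring.
   * intros j Hj. destruct (Nat.ltb_spec j (S (S k))); [auto|lia].
  + cbn [sum_upto]. rewrite IH by lia. destruct (Nat.ltb_spec (S k) i); [lia|]. rewrite Dd_INR, (sgn_S k). ring.
Qed.

Lemma trop_eval i x : (1 <= i <= n)%nat ->
 sum_upto (fun j => sgn j*(INR (Dd d j)*(if Nat.ltb j i then lcf j else x))) (n-1) = (kr i-ln S0)+(mi i+INR (d n))*x.
Proof.
 intros Hi. rewrite (sum_upto_ext _ (fun j => (if Nat.ltb j i then sgn j*(INR (Dd d j)*lcf j) else 0)
   + x*(if Nat.ltb j i then 0 else sgn j*INR (Dd d j)))).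
 - rewrite sum_upto_plus. unfold kr. have Hx: forall f p, sum_upto (fun j => x*f j) p = x*sum_upto f p.
  { intros f p. induction p as [|p IH]; simpl; [ring|]. rewrite IH. ring. }
  rewrite Hx, telescope by lia. rewrite sgn_n1. unfold mi. replace (S (n-1)) with n by lia. ring.
 - intros j _. destruct (Nat.ltb j i); ring.
Qed.

Lemma kr_1 : kr 1 = ln S0.
Proof.
 unfold kr. rewrite (sum_upto_ext _ (fun _ => 0)).
 - have Z: forall p, sum_upto (fun _ => 0) p = 0 by (induction p; simpl; lra). rewrite Z. ring.
 - intros j Hj. destruct (Nat.ltb_spec j 1); [lia|auto].
Qed.

Lemma kr_S i : (1 <= i <= n-1)%nat -> kr (S i) = kr i+sgn i*(INR (Dd d i)*lc i).
Proof.
 intros Hi. unfold kr.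
 have H: forall p, sum_upto (fun j => if Nat.ltb j (S i) then sgn j*(INR (Dd d j)*lcf j) else 0) p
   = sum_upto (fun j => if Nat.ltb j i then sgn j*(INR (Dd d j)*lcf j) else 0) p
    + (if Nat.leb i p then sgn i*(INR (Dd d i)*lc i) else 0).
 { induction p as [|p IH].
  - simpl. destruct (Nat.leb_spec i 0); [lia|ring].
  - cbn [sum_upto]. rewrite IH.
   destruct (Nat.leb_spec i p), (Nat.leb_spec i (S p)), (Nat.ltb_spec (S p) (S i)), (Nat.ltb_spec (S p) i);
    try lia; try ring.
   have: i = S p by lia. subst i. ring. }
 rewrite H. destruct (Nat.leb_spec i (n-1)); [ring|lia].
Qed.

Lemma kr_match i : (1 <= i <= n-1)%nat -> kr (S i)+mi (S i)*lc i = kr i+mi i*lc i.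
Proof. intros Hi. rewrite kr_S by auto. unfold mi. rewrite sgn_S, Dd_INR. ring. Qed.

(** The recursion for the radii says that crossing a strip of slope [mi] changes the value by [ln s]
    or [-ln s] in turn. The first radius fixes the starting level. *)
Lemma h_value i : (1 <= i <= n-1)%nat -> kr i+mi i*lc i = if Nat.even i then he else ho.
Proof.
 intros Hi. induction i as [|i IH]; [lia|]. destruct i as [|i].
 - rewrite kr_1. unfold mi, sgn. simpl Nat.even. have := lc_1. unfold ho, he. lra.
 - have Hi': (1 <= S i <= n-1)%nat by lia. specialize (IH Hi').
  have Hm := kr_match (S i) Hi'. have Hl := lc_S (S i) ltac:(lia) ltac:(lia).
  have E: kr (S (S i))+mi (S (S i))*lc (S (S i)) = kr (S i)+mi (S i)*lc (S i)+sgn (S (S i))*ln s.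
  { rewrite <- Hm, <- Hl. unfold mi. ring. }
  rewrite E, IH. unfold sgn, ho. replace (Nat.even (S (S i))) with (Nat.even i) by auto.
  rewrite Nat.even_succ, <- Nat.negb_even. destruct (Nat.even i); simpl; lra.
Qed.

Variables gam K : R.
Hypothesis Hgam : 1 <= gam.
Hypothesis HK : 4*gam+4 <= K.
Hypothesis Hsep : forall i, (1 <= i)%nat -> (S i <= n-1)%nat -> lc (S i)+K <= lc i.

Lemma lc_decr i j : (1 <= i)%nat -> (i < j)%nat -> (j <= n-1)%nat -> lc j+K <= lc i.
Proof.
 intros Hi Hij Hj. induction j as [|j IH]; [lia|].
 have := Hsep j ltac:(lia) Hj. destruct (Nat.eq_dec i j) as [E|E]; [subst; lra|].
 specialize (IH ltac:(lia) ltac:(lia)). lra.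
Qed.

Lemma lc_le i j : (1 <= i)%nat -> (i <= j)%nat -> (j <= n-1)%nat -> lc j <= lc i.
Proof.
 intros Hi Hij Hj. destruct (Nat.eq_dec i j) as [E|E]; [subst; lra|]. have := lc_decr i j Hi ltac:(lia) Hj. lra.
Qed.

Definition strip (g: R) (i: nat) (z: C) : Prop := (i <> n -> lcf i+g <= Re z) /\ (i <> 1%nat -> Re z <= lcf (i-1)-g).

Lemma strip_convex g i : Cconvex (strip g i).
Proof.
 intros x y t [H1 H2] [H3 H4] Ht. split; intros Hi.
 - apply (Cconvex_Re_ge (lc i+g)); auto.
 - apply (Cconvex_Re_le (lc (i-1)-g)); auto.
Qed.

(** On strip [i] the factor [z^D-c^D] equals [Cexp (elin i j z)*(1-xarg i j z)] with [xarg]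
    exponentially small ([factor_exp]). For [j < i] the constant term dominates, and the imaginary
    part [PI] in [elin] accounts for its minus sign. *)
Definition xarg (i j: nat) (z: C) : C :=
 if Nat.ltb j i then (RtoC (exp (- (INR (Dd d j)*lcf j)))*Cexp (RtoC (INR (Dd d j))*z))%C
 else (RtoC (exp (INR (Dd d j)*lcf j))*Cexp (RtoC (- INR (Dd d j))*z))%C.
Definition elin (i j: nat) (z: C) : C := if Nat.ltb j i then (INR (Dd d j)*lcf j, PI) else (RtoC (INR (Dd d j))*z)%C.
Definition epsi (i: nat) (z: C) : C := csum (fun j => RtoC (sgn j)*Log1m (xarg i j z))%C (n-1).
Definition epsi' (i: nat) (z: C) : C := csum (fun j => RtoC (sgn j)*(if Nat.ltb j i then
   - / (1-xarg i j z)*(RtoC (exp (- (INR (Dd d j)*lcf j)))*(Cexp (RtoC (INR (Dd d j))*z)*(RtoC (INR (Dd d j))*1)))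
  else - / (1-xarg i j z)*(RtoC (exp (INR (Dd d j)*lcf j))*(Cexp (RtoC (- INR (Dd d j))*z)*(RtoC (- INR (Dd d
   j))*1)))))%C (n-1).
Definition kapi (i: nat) : C :=
 (RtoC (ln S0)+csum (fun j => RtoC (sgn j)*(if Nat.ltb j i then (INR (Dd d j)*lcf j, PI)%R : C else 0))%C (n-1))%C.
Definition Lami (i: nat) (z: C) : C := (RtoC (mi i)*z+kapi i+epsi i z)%C.
Definition ep0 : R := 16*INR n*(dmx*dmx)*exp (- gam).

Lemma Dj_bounds j : (1 <= j <= n-1)%nat -> 4 <= INR (Dd d j) <= 2*dmx.
Proof.
 intros Hj. rewrite Dd_INR. have := d_le_dmax j ltac:(lia). have := d_le_dmax (S j) ltac:(lia). lra.
Qed.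

Lemma exp_mgam : 0 < exp (- gam) <= 1/2.
Proof.
 split; [apply exp_pos|]. rewrite exp_Ropp. have := exp_ineq1_le gam.
 unfold Rdiv. rewrite Rmult_1_l. apply Rinv_le_contravar; lra.
Qed.

Lemma xarg_mod i j z : (1 <= i <= n)%nat -> (1 <= j <= n-1)%nat -> strip gam i z -> Cmod (xarg i j z) <= exp (- gam).
Proof.
 intros Hi Hj [H1 H2]. have HD := Dj_bounds j Hj. unfold xarg. destruct (Nat.ltb_spec j i) as [H|H].
 - rewrite Cmod_mult, Cmod_pos_R by (left; apply exp_pos). rewrite Cmod_Cexp, re_scal_l, <- exp_plus.
  apply exp_le. specialize (H2 ltac:(lia)). have := lc_le j (i-1) ltac:(lia) ltac:(lia) ltac:(lia).
  set (D := INR (Dd d j)) in *. have: D*(lc j-Re z) >= 1*gam; [|lra]. apply Rle_ge, Rmult_le_compat; lra.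
 - rewrite Cmod_mult, Cmod_pos_R by (left; apply exp_pos). rewrite Cmod_Cexp, re_scal_l, <- exp_plus.
  apply exp_le. specialize (H1 ltac:(lia)). have := lc_le i j ltac:(lia) H ltac:(lia).
  set (D := INR (Dd d j)) in *. have: D*(Re z-lc j) >= 1*gam; [|lra]. apply Rle_ge, Rmult_le_compat; lra.
Qed.

Lemma epsi_C11 i : (1 <= i <= n)%nat -> C11 (strip gam i) (epsi i) (epsi' i) ep0 ep0.
Proof.
 intros Hi. have Hg := exp_mgam. have Hdm := dmx_ge_2. set (b := exp (- gam)) in *.
 have Hb16: 4*dmx*b <= 16*(dmx*dmx)*b.
 { apply Rmult_le_compat_r; [lra|]. nra. }
 have HnR: INR (n-1) <= INR n by (apply le_INR; lia). have Hle: INR (n-1)*(16*(dmx*dmx)*b) <= ep0.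
 { unfold ep0. fold b. replace (16*INR n*(dmx*dmx)*b) with (INR n*(16*(dmx*dmx)*b)) by ring.
  apply Rmult_le_compat_r; [|auto]. apply Rmult_le_pos; [nra|lra]. }
 apply (C11_weaken (strip gam i) (strip gam i) _ _ (INR (n-1)*(16*(dmx*dmx)*b)) (INR (n-1)*(16*(dmx*dmx)*b)));
  [auto|auto|auto|]. apply (C11_csum (strip gam i) (fun j z => RtoC (sgn j)*Log1m (xarg i j z))%C).
 intros j Hj. have HD := Dj_bounds j Hj. set (D := INR (Dd d j)) in *.
 have HDD: 4*(D*D)*b <= 16*(dmx*dmx)*b by (apply Rmult_le_compat_r; nra).
 have HDb: 2*D*b <= 16*(dmx*dmx)*b by (apply Rmult_le_compat_r; nra).
 have Hsg: Cmod (RtoC (sgn j)) = 1 by (rewrite Cmod_R; apply sgn_abs). destruct (Nat.ltb j i) eqn:Eji.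
 - have HC: C11 (strip gam i) (fun z => Log1m (RtoC (exp (- (D*lc j)))*Cexp (D*z)))%C
    (fun z => - / (1-RtoC (exp (- (D*lc j)))*Cexp (D*z))*(RtoC (exp (- (D*lc j)))*(Cexp (D*z)*(D*1))))%C
    (2*Cmod (D)*b) (4*(Cmod (D)*Cmod (D))*b).
  { apply C11_Log1m_exp; [apply strip_convex|lra|]. intros z Hz.
   have Hx := xarg_mod i j z Hi Hj Hz. unfold xarg in Hx. rewrite Eji in Hx. auto. }
  apply (C11_scal _ (RtoC (sgn j))) in HC. rewrite Hsg, !Rmult_1_l, Cmod_pos_R in HC by lra.
  unfold xarg. rewrite Eji. eapply C11_weaken; [| | |exact HC]; [auto|auto|auto].
 - have HC: C11 (strip gam i) (fun z => Log1m (RtoC (exp (D*lc j))*Cexp (RtoC (- D)*z)))%C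
    (fun z => - / (1-RtoC (exp (D*lc j))*Cexp (RtoC (- D)*z))*(RtoC (exp (D*lc j))*(Cexp (RtoC (- D)*z)*(RtoC (-
     D)*1))))%C
    (2*Cmod (RtoC (- D))*b) (4*(Cmod (RtoC (- D))*Cmod (RtoC (- D)))*b).
  { apply C11_Log1m_exp; [apply strip_convex|lra|]. intros z Hz.
   have Hx := xarg_mod i j z Hi Hj Hz. unfold xarg in Hx. rewrite Eji in Hx. auto. }
  apply (C11_scal _ (RtoC (sgn j))) in HC.
  rewrite Hsg, !Rmult_1_l, RtoC_opp, Cmod_opp, Cmod_pos_R, <- RtoC_opp in HC by lra.
  unfold xarg. rewrite Eji. eapply C11_weaken; [| | |exact HC]; [auto|auto|auto].
Qed.

Lemma epsi_bound i z : (1 <= i <= n)%nat -> strip gam i z -> Cmod (epsi i z) <= ep0.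
Proof.
 intros Hi Hz. have Hg := exp_mgam. have Hdm := dmx_ge_2. apply Rle_trans with (INR (n-1)*(2*exp (- gam))).
 - apply csum_mod. intros j Hj. rewrite Cmod_mult, Cmod_R, sgn_abs, Rmult_1_l. have Hx := xarg_mod i j z Hi Hj Hz.
  eapply Rle_trans; [apply (Log1m_bound (1/2)); lra|]. lra.
 - unfold ep0. have: INR (n-1) <= INR n by (apply le_INR; lia). have := pos_INR (n-1). set (b := exp (- gam)) in *.
  replace (16*INR n*(dmx*dmx)*b) with (INR n*((16*(dmx*dmx))*b)) by ring.
  apply Rmult_le_compat; try lra. apply Rmult_le_compat_r; [lra|nra].
Qed.

Lemma Cexp_real_mult_period N c z k : (c = INR N \/ c = - INR N) -> Cexp (RtoC c*(z+turn k))%C = Cexp (RtoC c*z)%C.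
Proof.
 intros Hc. have H: forall e : Z, Cexp (RtoC (IZR e)*(z+turn k))%C = Cexp (RtoC (IZR e)*z)%C.
 { intros e. replace (RtoC (IZR e)*(z+turn k))%C with (RtoC (IZR e)*z+turn (e*k))%C; [apply Cexp_period|].
  rewrite mult_IZR. apply C_ext; unfold Re, Im; simpl; ring. }
 destruct Hc as [-> | ->]; rewrite INR_IZR_INZ; [apply H|]. rewrite <- opp_IZR. apply H.
Qed.

Lemma epsi_period i z k : epsi i (z+turn k)%C = epsi i z.
Proof. apply csum_ext. intros j _. f_equal. f_equal. unfold xarg.
 destruct (Nat.ltb j i); f_equal; apply (Cexp_real_mult_period (Dd d j)); auto.
Qed.

Lemma factor_exp i j z : (1 <= i <= n)%nat -> (1 <= j <= n-1)%nat -> strip gam i z ->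
 Rfactor n d s (Cexp z) j = Cexp (elin i j z+Log1m (xarg i j z))%C.
Proof.
 intros Hi Hj Hz. have Hx := xarg_mod i j z Hi Hj Hz. have Hg := exp_mgam. rewrite Cexp_plus, Cexp_Log1m by lra.
 match goal with |- _ = ?b => change ((Cexp z^Dd d j-RtoC (cc j^Dd d j))%C = b) end.
 rewrite <- Cexp_INR_mult, <- (exp_lc j) by lia. rewrite <- exp_INR_mult.
 set (D := INR (Dd d j)). unfold elin, xarg. fold D. destruct (Nat.ltb j i).
 - have E: Cexp (D*lc j, PI) = (- RtoC (exp (D*lc j)))%C.
  { unfold Cexp; simpl. rewrite cos_PI, sin_PI. apply C_ext; unfold Re, Im; simpl; ring. }
  rewrite E, exp_Ropp. rewrite RtoC_inv by (have := exp_pos (D*lc j); lra).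
  field. intros E0. injection E0. have := exp_pos (D*lc j); lra.
 - rewrite RtoC_opp. replace (- D*z)%C with (- (D*z))%C by ring. rewrite Cexp_opp. field. apply Cexp_neq0.
Qed.

Lemma kapi_lin i z : (1 <= i <= n)%nat ->
 (RtoC (ln S0)+csum (fun j => RtoC (sgn j)*elin i j z) (n-1)-RtoC (INR (d n))*z = RtoC (mi i)*z+kapi i)%C.
Proof.
 intros Hi. unfold kapi.
 rewrite (csum_ext _ (fun j => RtoC (sgn j)*(if Nat.ltb j i then (INR (Dd d j)*lcf j, PI)%R : C else 0)
   + RtoC (if Nat.ltb j i then 0 else sgn j*INR (Dd d j))*z)%C).
 - rewrite csum_plus. have Hx: forall (f: nat -> R) p, csum (fun j => RtoC (f j)*z)%C p = (RtoC (sum_upto f p)*z)%C.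
  { intros f p. induction p as [|p IH]; simpl; [ring|]. rewrite IH, RtoC_plus. ring. }
  rewrite Hx, telescope by lia. rewrite sgn_n1. replace (S (n-1)) with n by lia.
  unfold mi. rewrite RtoC_plus, Rmult_1_l. ring.
 - intros j _. unfold elin. destruct (Nat.ltb j i); [ring|]. rewrite RtoC_mult. ring.
Qed.

Lemma Rmap_strip i z : (1 <= i <= n)%nat -> strip gam i z ->
 Rmap n d s (RtoC S0) (RtoC T) (Some (Cexp z)) = Some (RtoC T+Cexp (Lami i z))%C.
Proof.
 intros Hi Hz. have Hf: forall j, (1 <= j <= n-1)%nat ->
   (Rfactor n d s (Cexp z) j : C) = Cexp (elin i j z+Log1m (xarg i j z))%C
  by (intros; apply factor_exp; auto).
 set (Po := Cprod_upto (fun j => if Nat.even j then Defs.C1 else Rfactor n d s (Cexp z) j) (n-1)).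
 set (Pe := Cprod_upto (fun j => if Nat.even j then Rfactor n d s (Cexp z) j else Defs.C1) (n-1)).
 (* Even and odd factors are treated together by keeping the denominator on the left: each index
    multiplies one side by its factor and the exponential by the factor or its inverse. *)
 have Hprod: forall p, (p <= n-1)%nat -> (Cexp (csum (fun j => RtoC (sgn j)*(elin i j z+Log1m (xarg i j z))) p) *
   (Cprod_upto (fun j => if Nat.even j then Defs.C1 else Rfactor n d s (Cexp z) j) p)
   = Cprod_upto (fun j => if Nat.even j then Rfactor n d s (Cexp z) j else Defs.C1) p)%C.
 { induction p as [|p IH]; intros Hp.
  - simpl. rewrite Cexp_0. apply C_ext; unfold Re, Im; simpl; ring.
  - cbn [csum Cprod_upto]. rewrite Cexp_plus. specialize (IH ltac:(lia)).
   set (A := Cexp (csum _ p)) in *. set (B := Cprod_upto (fun j => if Nat.even j then Defs.C1 else Rfactor n d s (Cexp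
    z) j) p) in *.
   set (C' := Cprod_upto (fun j => if Nat.even j then Rfactor n d s (Cexp z) j else Defs.C1) p) in *.
   change (A*Cexp (RtoC (sgn (S p))*(elin i (S p) z+Log1m (xarg i (S p) z))) *
    (B*(if Nat.even (S p) then Defs.C1 else Rfactor n d s (Cexp z) (S p))) =
    C'*(if Nat.even (S p) then Rfactor n d s (Cexp z) (S p) else Defs.C1))%C.
   rewrite <- IH, (Hf (S p)) by lia. unfold sgn. set (E := (elin i (S p) z+Log1m (xarg i (S p) z))%C).
   change Defs.C1 with (RtoC 1). destruct (Nat.even (S p)).
   + replace (RtoC 1*E)%C with E by ring. ring.
   + replace (RtoC (-1)*E)%C with (- E)%C by ring. rewrite Cexp_opp. field. apply Cexp_neq0. }
 specialize (Hprod (n-1)%nat (le_n _)). fold Po Pe in Hprod. have HPo: (Po: C) <> 0%C.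
 { apply Cprod_neq0. intros j Hj. destruct (Nat.even j).
  - intros E. injection E. lra.
  - rewrite Hf by auto. apply Cexp_neq0. }
 have Hzn: (Cexp z^d n <> 0)%C by (apply Cpow_nz, Cexp_neq0).
 have Hden: Rden n d s (Cexp z) = (Cexp z^d n*Po)%C by auto.
 have Hnum: Rnum n d s (RtoC S0) (Cexp z) = (S0*Pe)%C by auto. unfold Rmap. rewrite Hden, Hnum.
 destruct (Defs.Ceq_dec (Cexp z^d n*Po)%C C0) as [E|E].
 - exfalso. apply (Cmult_neq_0 _ _ Hzn HPo), E.
 - f_equal. change (S0*Pe/(Cexp z^d n*Po)+T = T+Cexp (Lami i z))%C.
  have HL: Lami i z = (RtoC (ln S0)+csum (fun j => RtoC (sgn j)*(elin i j z+Log1m (xarg i j z))) (n-1)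
    - RtoC (INR (d n))*z)%C.
  { unfold Lami. rewrite <- kapi_lin by auto. unfold epsi.
   rewrite (csum_ext (fun j => RtoC (sgn j)*(elin i j z+Log1m (xarg i j z)))%C
     (fun j => RtoC (sgn j)*elin i j z+RtoC (sgn j)*Log1m (xarg i j z))%C) by (intros; ring).
   rewrite csum_plus. ring. }
  rewrite HL, Cexp_minus, Cexp_plus, Cexp_R, exp_ln, Cexp_INR_mult by auto. rewrite <- Hprod. field. split; auto.
Qed.

Lemma kapi_Re i : (1 <= i <= n)%nat -> Re (kapi i) = kr i.
Proof.
 intros Hi. unfold kapi, kr. rewrite re_plus, re_RtoC, csum_Re. f_equal.
 apply sum_upto_ext. intros j _. destruct (Nat.ltb j i); simpl; ring.
Qed.

(** * Estimates in the gaps around the circles *)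

Definition tmax (x: R) (j: nat) : R := INR (Dd d j)*Rmax x (lcf j).

Lemma factor_mod z j : (1 <= j)%nat -> exists a, Cmod (Rfactor n d s (Cexp z) j) = a /\
  Rabs (exp (INR (Dd d j)*Re z)-exp (INR (Dd d j)*lc j)) <= a <= exp (INR (Dd d j)*Re z)+exp (INR (Dd d j)*lc j).
Proof.
 intros Hj. eexists. split; [auto|].
 change (Rfactor n d s (Cexp z) j) with (Cexp z^Dd d j-RtoC (cc j^Dd d j))%C.
 rewrite <- Cexp_INR_mult, <- (exp_lc j), <- exp_INR_mult by lia. set (D := INR (Dd d j)).
 have E1: Cmod (Cexp (D*z)) = exp (D*Re z) by (rewrite Cmod_Cexp, re_scal_l; auto).
 have E2: Cmod (RtoC (exp (D*lc j))) = exp (D*lc j) by (apply Cmod_pos_R; left; apply exp_pos).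
 set (A := Cexp (D*z)) in *. set (B := RtoC (exp (D*lc j))) in *.
 have := Cmod_reverse A B. have H' := Cmod_reverse B A. rewrite Cmod_sym in H'.
 have := Cmod_minus_le A B. split; [apply Rabs_le|]; lra.
Qed.

Lemma factor_upper z j : (1 <= j <= n-1)%nat -> Cmod (Rfactor n d s (Cexp z) j) <= exp (tmax (Re z) j+ln 2).
Proof.
 intros Hj. destruct (factor_mod z j ltac:(lia)) as (a&->&_&Ha). rewrite exp_plus, exp_ln by lra. unfold tmax.
  have HD := Dj_bounds j Hj.
 have: exp (INR (Dd d j)*Re z) <= exp (INR (Dd d j)*Rmax (Re z) (lcf j))
  by (apply exp_le, Rmult_le_compat_l; [lra|apply Rmax_l]).
 have: exp (INR (Dd d j)*lcf j) <= exp (INR (Dd d j)*Rmax (Re z) (lcf j))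
  by (apply exp_le, Rmult_le_compat_l; [lra|apply Rmax_r]).
 lra.
Qed.

Lemma exp_gap a b : a+1 <= b -> exp a <= exp b/2.
Proof.
 intros H. replace a with (b+(a-b)) by ring. rewrite exp_plus.
 have: exp (a-b) <= exp (Ropp 1) by (apply exp_le; lra). have: exp (Ropp 1) <= / 2.
 { rewrite exp_Ropp. apply Rinv_le_contravar; [lra|]. have := exp_ineq1_le 1. lra. }
 have := exp_pos b. apply Rmult_le_compat_l; lra.
Qed.

Lemma factor_lower z j : (1 <= j <= n-1)%nat -> 1 <= Rabs (Re z-lc j) ->
 exp (tmax (Re z) j-ln 2) <= Cmod (Rfactor n d s (Cexp z) j).
Proof.
 intros Hj Hz. destruct (factor_mod z j ltac:(lia)) as (a&->&Ha&_).
 eapply Rle_trans; [|exact Ha]. unfold Rminus at 1. rewrite exp_plus, exp_Ropp, exp_ln by lra.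
 unfold tmax. have HD := Dj_bounds j Hj. set (D := INR (Dd d j)) in *. have Hm: forall u v, u+1 <= v -> D*u+1 <= D*v.
 { intros u v Huv. have: D*1 <= D*(v-u) by mono. lra. }
 destruct (Rle_or_lt (Re z) (lc j)) as [H|H].
 - rewrite Rmax_right by auto. rewrite Rabs_left1 in Hz by lra.
  have := exp_gap (D*Re z) (D*lc j) (Hm (Re z) (lc j) ltac:(lra)). have := exp_pos (D*lc j).
  rewrite Rabs_left by lra. lra.
 - rewrite Rmax_left by lra. rewrite Rabs_pos_eq in Hz by lra.
  have := exp_gap (D*lc j) (D*Re z) (Hm (lc j) (Re z) ltac:(lra)). have := exp_pos (D*Re z).
  rewrite Rabs_pos_eq by lra. lra.
Qed.

(** The piecewise affine approximation of [log |R-T|] on the whole line: each factor is replaced by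
    the larger of its two terms. In the gaps, where the factor of the circle itself may vanish, it
    replaces the affine formula. *)
Definition trop (x: R) : R := ln S0-INR (d n)*x+sum_upto (fun j => sgn j*tmax x j) (n-1).

(** On both sides of the kink at [lc i] the slope is at most [dmx] in modulus. *)
Lemma trop_gap i x : (1 <= i <= n-1)%nat -> Rabs (x-lc i) <= 2*gam ->
 Rabs (trop x-(if Nat.even i then he else ho)) <= 2*gam*dmx.
Proof.
 intros Hi Hx. apply Rabs_le_between in Hx.
 have Hlin: forall k, (k = i \/ k = S i) -> kr k+mi k*lc i = (if Nat.even i then he else ho)
   /\ Rabs (mi k*(x-lc i)) <= 2*gam*dmx.
 { intros k Hk. split.
  - destruct Hk; subst k; [|rewrite kr_match by lia]; apply h_value; lia.
  - unfold mi. rewrite !Rabs_mult, sgn_abs, Rmult_1_l, (Rabs_pos_eq (INR _)) by apply pos_INR.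
   have := d_le_dmax k ltac:(lia). have: Rabs (x-lc i) <= 2*gam by (apply Rabs_le; lra).
   have := Rabs_pos (x-lc i). rewrite (Rmult_comm (2*gam)). apply Rmult_le_compat; lra. }
 have Hk: exists k, (k = i \/ k = S i) /\ trop x = kr k+mi k*x.
 { destruct (Rle_or_lt (lc i) x) as [H|H]; [exists i|exists (S i)]; (split; [auto|]); unfold trop.
  - rewrite (sum_upto_ext _ (fun j => sgn j*(INR (Dd d j)*(if Nat.ltb j i then lcf j else x)))).
   + rewrite trop_eval by lia. ring.
   + intros j Hj. unfold tmax. do 2 f_equal. destruct (Nat.ltb_spec j i).
    * apply Rmax_right. have := lc_decr j i ltac:(lia) ltac:(lia) ltac:(lia). lra.
    * apply Rmax_left. have := lc_le i j ltac:(lia) ltac:(lia) ltac:(lia). lra.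
  - rewrite (sum_upto_ext _ (fun j => sgn j*(INR (Dd d j)*(if Nat.ltb j (S i) then lcf j else x)))).
   + rewrite trop_eval by lia. ring.
   + intros j Hj. unfold tmax. do 2 f_equal. destruct (Nat.ltb_spec j (S i)).
    * apply Rmax_right. have := lc_le j i ltac:(lia) ltac:(lia) ltac:(lia). lra.
    * apply Rmax_left. have := lc_decr i j ltac:(lia) ltac:(lia) ltac:(lia). lra. }
 destruct Hk as (k&Hk&E), (Hlin k Hk) as [H1 H2].
 rewrite E, <- H1. replace (kr k+mi k*x-(kr k+mi k*lc i)) with (mi k*(x-lc i)) by ring. auto.
Qed.

Lemma gap_other i j x : (1 <= i <= n-1)%nat -> (1 <= j <= n-1)%nat -> i <> j ->
 Rabs (x-lc i) <= 2*gam -> 1 <= Rabs (x-lc j).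
Proof.
 intros Hi Hj Hij Hx. apply Rabs_le_between in Hx. destruct (Nat.lt_ge_cases i j) as [H|H].
 - have := lc_decr i j ltac:(lia) H ltac:(lia). rewrite Rabs_pos_eq; lra.
 - have := lc_decr j i ltac:(lia) ltac:(lia) ltac:(lia). rewrite Rabs_left; lra.
Qed.

Definition Pev (z: C) : C := Cprod_upto (fun j => if Nat.even j then Rfactor n d s z j else Defs.C1) (n-1).
Definition Pod (z: C) : C := Cprod_upto (fun j => if Nat.even j then Defs.C1 else Rfactor n d s z j) (n-1).

Lemma Rmap_value (z: C) : z <> 0%C -> Pod z <> 0%C ->
 Rmap n d s (RtoC S0) (RtoC T) (Some z) = Some (RtoC T+RtoC S0*Pev z/(z^d n*Pod z))%C.
Proof.
 intros Hz HP. unfold Rmap. change (Rden n d s z) with (z^d n*Pod z)%C.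
 destruct (Defs.Ceq_dec (z^d n*Pod z)%C C0) as [E|E].
 - exfalso. apply (Cmult_neq_0 _ _ (Cpow_nz _ (d n) Hz) HP), E.
 - f_equal. change (S0*Pev z/(z^d n*Pod z)+T = T+S0*Pev z/(z^d n*Pod z))%C. ring.
Qed.

Lemma Rmap_pole z : Pod z = 0%C -> Rmap n d s (RtoC S0) (RtoC T) (Some z) = None.
Proof.
 intros HP. unfold Rmap. change (Rden n d s z) with (z^d n*Pod z)%C.
 destruct (Defs.Ceq_dec (z^d n*Pod z)%C C0) as [E|E]; [auto|].
 exfalso. apply E. rewrite HP. change (z^d n*0 = 0)%C. ring.
Qed.

Lemma Q_mod z : Pod (Cexp z) <> 0%C -> Cmod (RtoC S0*Pev (Cexp z)/(Cexp z^d n*Pod (Cexp z)))%C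
  = exp (ln S0-INR (d n)*Re z)*Cmod (Pev (Cexp z))/Cmod (Pod (Cexp z)).
Proof.
 intros HP. have HP' := proj1 (Cmod_gt_0 _) HP. have Hz: (Cexp z^d n <> 0)%C by (apply Cpow_nz, Cexp_neq0).
 rewrite Cmod_div by (apply Cmult_neq_0; auto). rewrite !Cmod_mult, <- Cexp_INR_mult, Cmod_Cexp, re_scal_l, Cmod_pos_R
  by lra.
 unfold Rminus. rewrite exp_plus, exp_ln, exp_Ropp by auto. field. split; apply Rgt_not_eq; [apply exp_pos|auto].
Qed.

Lemma exp_1_cmod : Cmod (Defs.C1 : C) = exp 0.
Proof. rewrite exp_0. exact Cmod_1. Qed.

(** The only factor without a lower bound in this gap is the [i]-th. For even [i] it stands in the
    numerator, so an upper bound for the quotient survives. *)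
Lemma gap_even i z : (1 <= i <= n-1)%nat -> Nat.even i = true -> Rabs (Re z-lc i) <= 2*gam ->
 exists w, Rmap n d s (RtoC S0) (RtoC T) (Some (Cexp z)) = Some (RtoC T+w)%C /\ Cmod w <= exp (he+2*gam*dmx+INR n).
Proof.
 intros Hi Hev Hz.
 have Hlow: exp (sum_upto (fun j => if Nat.even j then 0 else tmax (Re z) j-ln 2) (n-1)) <= Cmod (Pod (Cexp z)).
 { apply Cprod_ge. intros j Hj. destruct (Nat.even j) eqn:Ej; [right; symmetry; exact exp_1_cmod|].
  apply factor_lower; [auto|]. apply (gap_other i); try auto. congruence. }
 have Hup: Cmod (Pev (Cexp z)) <= exp (sum_upto (fun j => if Nat.even j then tmax (Re z) j+ln 2 else 0) (n-1)).
 { apply Cprod_le. intros j Hj. destruct (Nat.even j) eqn:Ej; [|right; exact exp_1_cmod]. apply factor_upper; auto. }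
 have HP: Pod (Cexp z) <> 0%C.
 { intros E. rewrite E, Cmod_0 in Hlow. have := exp_pos (sum_upto (fun j => if Nat.even j then 0 else tmax (Re z) j-ln
  2) (n-1)). lra. }
 eexists. split; [apply Rmap_value; [apply Cexp_neq0|auto]|]. rewrite Q_mod by auto.
 set (a := sum_upto (fun j => if Nat.even j then 0 else tmax (Re z) j-ln 2) (n-1)) in *.
 set (b := sum_upto (fun j => if Nat.even j then tmax (Re z) j+ln 2 else 0) (n-1)) in *.
 have Ht := trop_gap i (Re z) Hi Hz. rewrite Hev in Ht. apply Rabs_le_between in Ht.
 have E: b-a = sum_upto (fun j => sgn j*tmax (Re z) j) (n-1)+INR (n-1)*ln 2.
 { unfold a, b. clear. generalize (n-1)%nat. intros p. induction p as [|p IH]; [simpl; ring|].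
  cbn [sum_upto]. rewrite S_INR. unfold sgn at 2. destruct (Nat.even (S p)); lra. }
 have Hl2: INR (n-1)*ln 2 <= INR n.
 { have: ln 2 <= 1. { rewrite <- (ln_exp 1). apply ln_le; [lra|]. have := exp_ineq1_le 1. lra. }
  have: INR (n-1) <= INR n by (apply le_INR; lia). have := pos_INR (n-1).
  apply Rle_trans with (INR (n-1)*1); [apply Rmult_le_compat_l|]; lra. }
 apply Rle_trans with (exp (ln S0-INR (d n)*Re z)*exp b/exp a).
 - apply Rmult_le_compat.
  + apply Rmult_le_pos; [left; apply exp_pos|apply Cmod_ge_0].
  + left. apply Rinv_0_lt_compat. eapply Rlt_le_trans; [apply exp_pos|exact Hlow].
  + apply Rmult_le_compat_l; [left; apply exp_pos|auto].
  + apply Rinv_le_contravar; [apply exp_pos|auto].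
 - unfold Rdiv. rewrite <- exp_Ropp, <- !exp_plus. apply exp_le. unfold trop in Ht. lra.
Qed.

(** Now the [i]-th factor stands in the denominator: the quotient is bounded below, and the zeros of
    the factor are the poles. *)
Lemma gap_odd i z : (1 <= i <= n-1)%nat -> Nat.even i = false -> Rabs (Re z-lc i) <= 2*gam ->
 Rmap n d s (RtoC S0) (RtoC T) (Some (Cexp z)) = None \/
 exists w, Rmap n d s (RtoC S0) (RtoC T) (Some (Cexp z)) = Some (RtoC T+w)%C /\ exp (ho-2*gam*dmx-INR n) <= Cmod w.
Proof.
 intros Hi Hev Hz. destruct (classic (Pod (Cexp z) = 0%C)) as [HP|HP]; [left; apply Rmap_pole, HP|right].
 have Hlow: exp (sum_upto (fun j => if Nat.even j then tmax (Re z) j-ln 2 else 0) (n-1)) <= Cmod (Pev (Cexp z)).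
 { apply Cprod_ge. intros j Hj. destruct (Nat.even j) eqn:Ej; [|right; symmetry; exact exp_1_cmod].
  apply factor_lower; [auto|]. apply (gap_other i); try auto. congruence. }
 have Hup: Cmod (Pod (Cexp z)) <= exp (sum_upto (fun j => if Nat.even j then 0 else tmax (Re z) j+ln 2) (n-1)).
 { apply Cprod_le. intros j Hj. destruct (Nat.even j) eqn:Ej; [right; exact exp_1_cmod|]. apply factor_upper; auto. }
 eexists. split; [apply Rmap_value; [apply Cexp_neq0|auto]|]. rewrite Q_mod by auto.
 set (a := sum_upto (fun j => if Nat.even j then 0 else tmax (Re z) j+ln 2) (n-1)) in *.
 set (b := sum_upto (fun j => if Nat.even j then tmax (Re z) j-ln 2 else 0) (n-1)) in *.
 have Ht := trop_gap i (Re z) Hi Hz. rewrite Hev in Ht. apply Rabs_le_between in Ht.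
 have E: b-a = sum_upto (fun j => sgn j*tmax (Re z) j) (n-1)-INR (n-1)*ln 2.
 { unfold a, b. clear. generalize (n-1)%nat. intros p. induction p as [|p IH]; [simpl; ring|].
  cbn [sum_upto]. rewrite S_INR. unfold sgn at 2. destruct (Nat.even (S p)); lra. }
 have Hl2: INR (n-1)*ln 2 <= INR n.
 { have: ln 2 <= 1. { rewrite <- (ln_exp 1). apply ln_le; [lra|]. have := exp_ineq1_le 1. lra. }
  have: INR (n-1) <= INR n by (apply le_INR; lia). have := pos_INR (n-1).
  apply Rle_trans with (INR (n-1)*1); [apply Rmult_le_compat_l|]; lra. }
 apply Rle_trans with (exp (ln S0-INR (d n)*Re z)*exp b/exp a).
 - unfold Rdiv. rewrite <- exp_Ropp, <- !exp_plus. apply exp_le. unfold trop in Ht. lra.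
 - apply Rmult_le_compat.
  + apply Rmult_le_pos; left; apply exp_pos.
  + left. apply Rinv_0_lt_compat, exp_pos.
  + apply Rmult_le_compat_l; [left; apply exp_pos|auto].
  + apply Rinv_le_contravar; [exact (proj1 (Cmod_gt_0 _) HP)|auto].
Qed.

(** * Continuity of the rational map on the sphere *)

Lemma factor_zero (z: C) j : (1 <= j <= n-1)%nat -> Rfactor n d s z j = C0 -> Cmod z = cc j.
Proof.
 intros Hj H. change (z^Dd d j-RtoC (cc j^Dd d j) = 0)%C in H. have Hc := cseq_pos j ltac:(lia). have Hz: z <> 0%C.
 { intros E. subst z. have Hdj := Dj_bounds j Hj. destruct (Dd d j) as [|k] eqn:Ed; [simpl in Hdj; lra|].
  apply (f_equal Cmod) in H. rewrite Cmod_0 in H.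
  replace (0^S k-RtoC (cc j^S k))%C with (- RtoC (cc j^S k))%C in H by (simpl; ring).
  rewrite Cmod_opp, Cmod_pos_R in H by (apply pow_le; lra). have := pow_lt (cc j) (S k) Hc. lra. }
 have E: (z^Dd d j)%C = RtoC (cc j^Dd d j).
 { replace (z^Dd d j)%C with (z^Dd d j-RtoC (cc j^Dd d j)+RtoC (cc j^Dd d j))%C by ring. rewrite H. ring. }
 apply (f_equal Cmod) in E. rewrite Cmod_pow, Cmod_pos_R in E by (apply pow_le; lra).
 have Hm: 0 < Cmod z by (apply Cmod_gt_0; auto).
 rewrite <- (exp_ln _ Hm), <- (exp_ln _ Hc), <- !exp_INR_mult in E. apply exp_inv in E.
 have HD := Dj_bounds j Hj. apply Rmult_eq_reg_l in E; [|lra]. apply ln_inv; auto.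
Qed.

Lemma Pod_zero z : Pod z = 0%C -> Pev z <> 0%C.
Proof.
 intros H1 H2. have HZ: forall f, (Cprod_upto f (n-1) : C) = 0%C -> exists j, (1 <= j <= n-1)%nat /\ f j = C0.
 { intros f Hf. apply NNPP. intros Hno. apply (Cprod_neq0 f (n-1)); [|auto].
  intros j Hj E. apply Hno. exists j. auto. }
 destruct (HZ _ H1) as (j&Hj&E1), (HZ _ H2) as (i&Hi&E2).
 destruct (Nat.even j) eqn:Ej; [injection E1; lra|]. destruct (Nat.even i) eqn:Ei; [|injection E2; lra].
 apply factor_zero in E1; [|auto]. apply factor_zero in E2; [|auto]. have Hne: i <> j by congruence.
 have Hg := gap_other i j (lc i) Hi Hj Hne. unfold lcf in Hg. rewrite <- E1, <- E2, Rminus_diag, Rabs_R0 in Hg. lra.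
Qed.

Lemma Pev_0 : Pev 0 <> 0%C /\ Pod 0 <> 0%C.
Proof.
 have H: forall j, (1 <= j <= n-1)%nat -> (Rfactor n d s C0 j: C) <> 0%C.
 { intros j Hj E. apply factor_zero in E; [|auto]. change C0 with (RtoC 0) in E. rewrite Cmod_0 in E.
  have := cseq_pos j ltac:(lia). lra. }
 split; apply Cprod_neq0; intros j Hj; destruct (Nat.even j); try (apply H; auto); intros E; injection E; lra.
Qed.

Lemma Rmap_0 : Rmap n d s (RtoC S0) (RtoC T) (Some C0) = None.
Proof.
 unfold Rmap. change (Rden n d s C0) with (0^d n*Pod 0)%C.
 destruct (Defs.Ceq_dec (0^d n*Pod 0)%C C0) as [E|E]; [auto|].
 exfalso. apply E. have := Hd n ltac:(lia). destruct (d n) as [|k]; [lia|]. change (RtoC 0*0^k*Pod 0 = 0)%C. ring.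
Qed.

Lemma Ccont_inv f z : Ccont f z -> f z <> 0%C -> Ccont (fun w => / f w)%C z.
Proof.
 intros Hf Hz e He. have Hm := proj1 (Cmod_gt_0 _) Hz. set (m := Cmod (f z)) in *.
 destruct (Hf (Rmin (m/2) (e*(m*m)/4))) as (dl&Hdl&H).
 { apply Rmin_glb_lt; [lra|]. have: 0 < e*(m*m) by (apply Rmult_lt_0_compat; nra). lra. }
 exists dl. split; [auto|]. intros h Hh. specialize (H h Hh). have H1 := lt_min_l H. have H2 := lt_min_r H.
 have Hg: m/2 <= Cmod (f (z+h)%C).
 { have Hr := Cmod_reverse (f z) (f z-f (z+h)%C)%C. rewrite (Cmod_sym (f z)) in Hr.
  replace (f z-(f z-f (z+h)))%C with (f (z+h))%C in Hr by ring. fold m in Hr. lra. }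
 have Hgz: f (z+h)%C <> 0%C by (intros E; rewrite E, Cmod_0 in Hg; lra).
 replace (/ f (z+h) - / f z)%C with (- (f (z+h)-f z)*(/ f (z+h) * / f z))%C by (field; auto).
 rewrite !Cmod_mult, Cmod_opp, !Cmod_inv by auto. apply Rle_lt_trans with (Cmod (f (z+h)-f z)%C*(2/m * / m)).
 - apply Rmult_le_compat_l; [apply Cmod_ge_0|]. apply Rmult_le_compat_r; [left; apply Rinv_0_lt_compat, Hm|].
  replace (2/m) with (/ (m/2)) by (field; lra). apply Rinv_le_contravar; lra.
 - apply Rlt_le_trans with (e*(m*m)/4*(2/m * / m)).
  + apply Rmult_lt_compat_r; [|auto]. apply Rmult_lt_0_compat; [apply Rdiv_lt_0_compat; lra|apply Rinv_0_lt_compat, Hm].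
  + replace (e*(m*m)/4*(2/m * / m)) with (e/2) by (field; lra). lra.
Qed.

Lemma Ccont_factor z j : Ccont (fun w => Rfactor n d s w j) z.
Proof. apply (Ccont_minus_const (fun w => w^Dd d j)%C), Ccont_pow. Qed.

Lemma Ccont_Pev z : Ccont Pev z.
Proof.
 apply (Ccont_prod (fun j w => if Nat.even j then Rfactor n d s w j else Defs.C1)).
 intros j _. destruct (Nat.even j); [apply Ccont_factor|exact (Ccont_const 1 z)].
Qed.

Lemma Ccont_Pod z : Ccont Pod z.
Proof.
 apply (Ccont_prod (fun j w => if Nat.even j then Defs.C1 else Rfactor n d s w j)).
 intros j _. destruct (Nat.even j); [exact (Ccont_const 1 z)|apply Ccont_factor].
Qed.

(** At a pole the numerator does not vanish, because its zeros lie on circles of other radii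
    ([Pod_zero]) and it is nonzero at 0. At infinity the expansion on the first strip shows that the
    map tends to [T]. *)
Lemma Rmap_cont p : scont (Rmap n d s (RtoC S0) (RtoC T)) p.
Proof.
 intros e He. destruct p as [z0|].
 - revert z0. intros z0; pose (z := (z0: C)); change z0 with z; clearbody z; clear z0.
  set (den := fun w => (w^d n*Pod w)%C). set (num := fun w => (S0*Pev w)%C).
  have Hden: Ccont den z by (apply (Ccont_mult (fun w => w^d n)%C Pod); [apply Ccont_pow|apply Ccont_Pod]).
  have Hnum: Ccont num z by (apply (Ccont_mult (fun _ => S0) Pev); [apply Ccont_const|apply Ccont_Pev]).
  have HF: forall w, Rmap n d s (RtoC S0) (RtoC T) (Some w) =
    if Defs.Ceq_dec (den w) C0 then None else Some (num w * / den w+T)%C by auto.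
  rewrite HF. destruct (Defs.Ceq_dec (den z) C0) as [E|E].
  + have HN: num z <> 0%C.
   { apply Cmult_neq_0; [intros E'; injection E'; lra|]. destruct (classic (z = 0%C)) as [->|Hz]; [apply Pev_0|].
    apply Pod_zero, NNPP. intros HP. apply (Cmult_neq_0 _ _ (Cpow_nz _ (d n) Hz) HP), E. }
   have Hm := proj1 (Cmod_gt_0 _) HN. set (m := Cmod (num z)) in *.
   destruct (chordal_inf_small e He) as (M&HM&Hinf), (Hnum (m/2) ltac:(lra)) as (d1&Hd1&H1).
   have HT0 := Cmod_ge_0 (T). have HMT: 0 < M+Cmod (T) by lra.
   destruct (Hden (m/2/(M+Cmod (T)))) as (d2&Hd2&H2); [apply Rdiv_lt_0_compat; lra|].
   destruct (chordal_finite_nbhd z (Rmin d1 d2)) as (dl&Hdl&Hn'); [apply Rmin_glb_lt; auto|].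
   exists dl. split; [auto|]. intros q Hq. destruct (Hn' q Hq) as (w&->&Hw).
   rewrite HF. destruct (Defs.Ceq_dec (den w) C0) as [E'|E']; [rewrite chordal_refl; auto|].
   apply Hinf. specialize (H1 (w-z)%C (lt_min_l Hw)). specialize (H2 (w-z)%C (lt_min_r Hw)).
   replace (z+(w-z))%C with w in * by ring.
   have HE: den z = 0%C by exact E. rewrite HE in H2. replace (den w-0)%C with (den w) in H2 by ring.
   have E'': den w <> 0%C by auto. have Hdw := proj1 (Cmod_gt_0 _) E''. have Hnw: m/2 < Cmod (num w).
   { have Hr := Cmod_reverse (num z) (num z-num w)%C. rewrite (Cmod_sym (num z)) in Hr.
    replace (num z-(num z-num w))%C with (num w) in Hr by ring. fold m in Hr. lra. }
   have HQ: M+Cmod (T) < Cmod (num w * / den w).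
   { rewrite Cmod_mult, Cmod_inv by auto. apply (proj1 (Rlt_div_r _ _ _ Hdw)).
    apply (proj2 (Rlt_div_r _ _ _ HMT)) in H2. lra. }
   have Hr := Cmod_reverse (num w * / den w)%C (- T)%C. rewrite Cmod_opp in Hr.
   replace (num w * / den w - - T)%C with (num w * / den w+T)%C in Hr by ring. lra.
  + have Hq: Ccont (fun w => num w * / den w)%C z.
   { apply Ccont_mult; [auto|]. apply Ccont_inv; [auto|exact E]. }
   destruct (Hq (e/2) ltac:(lra)) as (d1&Hd1&H1). have Hmz: 0 < Cmod (den z) by (apply Cmod_gt_0; exact E).
   destruct (Hden (Cmod (den z)) Hmz) as (d2&Hd2&H2), (chordal_finite_nbhd z (Rmin d1 d2)) as (dl&Hdl&Hn'); [apply
    Rmin_glb_lt; auto|].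
   exists dl. split; [auto|]. intros q Hq'. destruct (Hn' q Hq') as (w&->&Hw).
   specialize (H1 (w-z)%C (lt_min_l Hw)). specialize (H2 (w-z)%C (lt_min_r Hw)).
   replace (z+(w-z))%C with w in * by ring. rewrite HF. destruct (Defs.Ceq_dec (den w) C0) as [E'|E'].
   * have E2: den w = 0%C by auto. rewrite E2, Cmod_sym in H2.
    replace (den z-0)%C with (den z) in H2 by ring. lra.
   * rewrite chordal_sym. eapply Rle_lt_trans; [apply chordal_le|].
    replace (num w * / den w+T-(num z * / den z+T))%C with (num w * / den w-num z * / den z)%C by ring. lra.
 - have Hd1 := d_le_dmax 1 ltac:(lia). set (d1 := INR (d 1)) in *.
  set (c := kr 1+ep0). set (b := Rmax (lc 1+gam) ((c-ln (e/4))/d1)).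
  destruct (chordal_inf_nbhd (exp b)) as (dl&Hdl&H). exists dl. split; [auto|]. intros q Hq.
  destruct (H q Hq) as [-> | [w [-> Hw]]].
  { rewrite chordal_refl. auto. }
  have Hw0: w <> 0%C by (intros E; rewrite E, Cmod_0 in Hw; have := exp_pos b; lra).
  destruct (Cexp_surj w Hw0) as [z <-]. rewrite Cmod_Cexp in Hw. apply exp_lt_inv in Hw. have Hst: strip gam 1 z.
  { split; [|lia]. intros _. have := Rmax_l (lc 1+gam) ((c-ln (e/4))/d1). fold b in H0. lra. }
  rewrite (Rmap_strip 1 z ltac:(lia) Hst), chordal_sym. eapply Rle_lt_trans; [apply chordal_le|].
  replace (T+Cexp (Lami 1 z)-T)%C with (Cexp (Lami 1 z)) by ring. rewrite Cmod_Cexp.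
  have HRe: Re (Lami 1 z) <= ln (e/4).
  { unfold Lami. rewrite !re_plus, re_scal_l, kapi_Re by lia. unfold mi, sgn. simpl Nat.even. fold d1.
   have He1 := epsi_bound 1 z ltac:(lia) Hst. have := Re_le_Cmod (epsi 1 z).
   have Hb := Rmax_r (lc 1+gam) ((c-ln (e/4))/d1). fold b in Hb. have Hz: (c-ln (e/4))/d1 <= Re z by lra.
   have Hd1p: 0 < d1 by lra. apply (proj1 (Rle_div_l _ _ _ Hd1p)) in Hz. unfold c in Hz. lra. }
  apply exp_le in HRe. rewrite exp_ln in HRe by lra. lra.
Qed.

End RationalMap.

(** * Existence of the parameters *)

Definition gstrip (n: nat) (lc: nat -> R) (g: R) (i: nat) (z: C) : Prop :=
 (i <> n -> lc i+g <= Re z) /\ (i <> 1%nat -> Re z <= lc (i-1)%nat-g).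
Definition Lamb (m: nat -> Z) (kap: nat -> C) (eps: nat -> C -> C) (i: nat) (z: C) : C :=
 (RtoC (IZR (m i))*z+kap i+eps i z)%C.
(** The tilt of the petal discs. The fourth power of [N] is dictated by [lm_s1], which needs
    [N^3*de] small with [de = 16*N*ka]. *)
Definition kaN (N: nat) : R := / (1000000*(INR N*INR N*INR N*INR N)).

(** The interface between the rational map and its dynamics. [exp x] and [exp y] are the points of
    the cycle, in the innermost strip [n] and the outermost strip [1]. By [rs_Ln] and [rs_L1] they
    are exchanged, by [rs_mult] the multiplier is 1. Strips keep distance [g] from the circles while
    gaps reach out to [2*g], so the two descriptions overlap. [rs_range] provides the solutions of
    the affine part of each branch, with a margin. *)
Record rat_sys {n d1 dn : nat} {F : sphere -> sphere} {m : nat -> Z} {lc : nat -> R} {kap : nat -> C}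
  {eps eps' : nat -> C -> C} {g e T x y : R} : Prop := {
 rs_n : (3 <= n)%nat;
 rs_d : (2 <= d1)%nat /\ (2 <= dn)%nat;
 rs_m : forall i, (1 <= i <= n)%nat -> 2 <= Rabs (IZR (m i));
 rs_m1 : IZR (m 1%nat) = - INR d1;
 rs_mn : IZR (m n) = - INR dn;
 rs_g : 6 <= g;
 rs_e : 0 <= e;
 rs_small : 100*(INR (d1*dn)*INR (d1*dn))*e <= kaN (d1*dn)^5;
 rs_Te : 16*exp (x-lc 1%nat) <= e;
 rs_K1 : lc 1%nat+2*g+20*INR dn+20 <= y;
 rs_K2 : x+2*g+20 <= lc (n-1)%nat;
 rs_M : x+(y-lc 1%nat-2*g+2)/INR dn <= lc (n-1)%nat-g;
 rs_sep : forall i j, (1 <= i)%nat -> (i < j)%nat -> (j <= n-1)%nat -> lc j+4*g+4 <= lc i;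
 rs_cont : forall p, scont F p;
 rs_inf : F None = Some (RtoC T);
 rs_zero : F (Some (RtoC 0)) = None;
 rs_strip : forall i z, (1 <= i <= n)%nat -> gstrip n lc g i z ->
   F (Some (Cexp z)) = Some (RtoC T+Cexp (Lamb m kap eps i z))%C;
 rs_C11 : forall i, (1 <= i <= n)%nat -> C11 (gstrip n lc g i) (eps i) (eps' i) e e;
 rs_eps : forall i z, (1 <= i <= n)%nat -> gstrip n lc g i z -> Cmod (eps i z) <= e;
 rs_per : forall i z (k: Z), eps i (z+turn k)%C = eps i z;
 rs_T : 0 < T < exp x;
 rs_L1 : Lamb m kap eps 1 (RtoC y) = RtoC (ln (exp x-T));
 rs_Ln : Lamb m kap eps n (RtoC x) = RtoC (ln (exp y-T));
 rs_mult : ((RtoC (- INR d1)+eps' 1%nat (RtoC y))*(RtoC (- INR dn)+eps' n (RtoC x))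
   * RtoC ((exp x-T)*(exp y-T)) = RtoC (exp x*exp y))%C;
 rs_range : forall i X, (1 <= i <= n)%nat -> (i <> 1%nat -> ln (exp x-T) <= Re X) ->
   (i <> n -> Re X <= y+3) -> gstrip n lc (2*g+1) i ((X-kap i)/RtoC (IZR (m i)))%C;
 rs_gap : forall i z, (1 <= i <= n-1)%nat -> Rabs (Re z-lc i) <= 2*g ->
   (exists w, F (Some (Cexp z)) = Some (RtoC T+w)%C /\ Cmod w < exp x-T) \/
   F (Some (Cexp z)) = None \/
   (exists w, F (Some (Cexp z)) = Some (RtoC T+w)%C /\ exp (y+3) <= Cmod w);
 rs_gap1 : forall z, Rabs (Re z-lc 1%nat) <= 2*g -> F (Some (Cexp z)) = None \/
   (exists w, F (Some (Cexp z)) = Some (RtoC T+w)%C /\ exp (y+3) <= Cmod w);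
 rs_gapn : forall z, Rabs (Re z-lc (n-1)%nat) <= 2*g ->
   (exists w, F (Some (Cexp z)) = Some (RtoC T+w)%C /\ Cmod w < exp x-T);
 rs_kap : exists CK, forall i, (1 <= i <= n)%nat -> Rabs (Im (kap i)) <= CK }.

Lemma ln_1m_bounds u : 0 <= u <= 1/11 -> - (1/10) <= ln (1-u) <= 0.
Proof.
 intros H. split.
 - replace (ln (1-u)) with (- ln (/ (1-u))) by (rewrite ln_Rinv by lra; ring).
  have He := exp_ineq1_le (ln (/ (1-u))). rewrite exp_ln in He by (apply Rinv_0_lt_compat; lra).
  have: / (1-u) <= 11/10; [|lra]. replace (11/10) with (/ (10/11)) by field. apply Rinv_le_contravar; lra.
 - rewrite <- ln_1. apply ln_le; lra.
Qed.

Lemma exp_m10 t : t <= - 10 -> 0 < exp t <= 1/11.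
Proof.
 intros H. split; [apply exp_pos|]. apply Rle_trans with (exp (Ropp 10)); [apply exp_le; lra|].
 rewrite exp_Ropp. unfold Rdiv. rewrite Rmult_1_l. apply Rinv_le_contravar; [lra|]. have := exp_ineq1_le 10. lra.
Qed.

Lemma ln_near_1 r : 9/10 <= r <= 11/10 -> Rabs (ln r) <= 1/8.
Proof.
 intros H. have H1 := exp_ineq1_le (ln r). rewrite exp_ln in H1 by lra.
 have H2 := exp_ineq1_le (ln (/ r)). rewrite exp_ln in H2 by (apply Rinv_0_lt_compat; lra). rewrite ln_Rinv in H2 by lra.
 have: / r <= 10/9. { replace (10/9) with (/ (9/10)) by field. apply Rinv_le_contravar; lra. } apply Rabs_le. lra.
Qed.

Lemma continuity_pt_ln_comp f t : continuity_pt f t -> 0 < f t -> continuity_pt (fun u => ln (f u)) t.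
Proof.
 intros Hf Hp. apply (continuity_pt_comp f ln); [auto|]. apply derivable_continuous_pt.
 exists (/ f t). apply derivable_pt_lim_ln, Hp.
Qed.

Lemma continuity_pt_exp_comp f t : continuity_pt f t -> continuity_pt (fun u => exp (f u)) t.
Proof.
 intros Hf. apply (continuity_pt_comp f exp); [auto|]. apply derivable_continuous_pt, derivable_pt_exp.
Qed.

(* In logarithmic form the multiplier equation is [(dn - 1) (x - x0) + small = 0], so it is solved
  by the intermediate value theorem within distance one of [x0]. *)
Lemma two_cycle_parameters a b kp y x0 ep E1 E1' En En' : 2 <= a -> 2 <= b -> 0 <= ep <= 1/100 -> Rabs E1 <= ep -> Rabs
 E1' <= ep ->
 (forall t, x0-1 <= t <= x0+1 -> Rabs (En t) <= ep /\ Rabs (En' t) <= ep /\ continuity_pt En t /\ continuity_pt En' t) ->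
 (b-1)*x0 = kp+(a-1)*y-ln (a*b) -> x0+12+b <= y -> exists x lS, x0-1 <= x <= x0+1 /\
  (let S := exp lS in let Q1 := exp (- a*y+E1) in let Qn := exp (- b*x+kp+En x) in
   S*Q1 < exp x /\ exp y-(exp x-S*Q1) = S*Qn /\ (- a+E1')*(- b+En' x)*(S*Q1*(S*Qn)) = exp x*exp y /\
   Rabs (lS-(y+b*x-kp)) <= 1 /\ exp x/(3*(a*b)) <= S*Q1).
Proof.
 intros Ha Hb Hep HE1 HE1' HEn Hx0 Hy.
 have Hab: 4 <= a*b by nra. have Hlnab: 0 <= ln (a*b) by (rewrite <- ln_1; apply ln_le; lra).
 apply Rabs_le_between in HE1. apply Rabs_le_between in HE1'.
 (* The scale [S] is eliminated: the two cycle equations give [S*Qn = exp (y+U-W)], with [U] and [W]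
    the logarithms of [1-exp (x-y)] and [1-Q1/Qn]. Inserted into the logarithm of the multiplier
    equation, this leaves the single equation [Ph x = 0]. *)
 set (an := fun t => - b*t+kp+En t). set (a1 := - a*y+E1). set (l := fun t => (a-E1')*(b-En' t)).
 set (U := fun t => ln (1-exp (t-y))). set (W := fun t => ln (1-exp (a1-an t))).
 set (Ph := fun t => ln (l t)+2*U t-2*W t+(y+a1-t)-an t).
 have Hsmall: forall t, x0-1 <= t <= x0+1 -> t-y <= - 10 /\ a1-an t <= - 10.
 { intros t Ht. split; [lra|]. destruct (HEn t Ht) as [H1 _]. apply Rabs_le_between in H1. unfold a1, an.
  have: (b-1)*(t-x0) <= (b-1)*1 by mono. lra. }
 have HUW: forall t, x0-1 <= t <= x0+1 -> - (1/10) <= U t <= 0 /\ - (1/10) <= W t <= 0 /\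
   exp (U t) = 1-exp (t-y) /\ exp (W t) = 1-exp (a1-an t).
 { intros t Ht. destruct (Hsmall t Ht) as [H1 H2]. have := exp_m10 _ H1. have := exp_m10 _ H2.
  split; [apply ln_1m_bounds; lra|]. split; [apply ln_1m_bounds; lra|]. split; apply exp_ln; lra. }
 have Hl: forall t, x0-1 <= t <= x0+1 -> 3 <= l t <= 11/10*(a*b) /\ Rabs (ln (l t)-ln (a*b)) <= 1/8.
 { intros t Ht. destruct (HEn t Ht) as (_&H2&_). apply Rabs_le_between in H2. unfold l.
  have A1: 99/100*a <= a-E1' <= 101/100*a by lra. have A2: 99/100*b <= b-En' t <= 101/100*b by lra.
  have B1: 99/100*a*(99/100*b) <= (a-E1')*(b-En' t) by (apply Rmult_le_compat; lra).
  have B2: (a-E1')*(b-En' t) <= 101/100*a*(101/100*b) by (apply Rmult_le_compat; lra).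
  split; [lra|]. set (l0 := (a-E1')*(b-En' t)) in *.
  replace (ln l0-ln (a*b)) with (ln (l0/(a*b))) by (unfold Rdiv; rewrite ln_mult, ln_Rinv by (try apply
   Rinv_0_lt_compat; lra); ring).
  apply ln_near_1. split; [apply (proj1 (Rle_div_r _ _ _ (ltac:(lra) : 0 < a*b)))|apply (proj2 (Rle_div_l _ _ _
   (ltac:(lra) : 0 < a*b)))]; lra. }
 have HPh: forall t, x0-1 <= t <= x0+1 -> Rabs (Ph t-(b-1)*(t-x0)) <= 1/2.
 { intros t Ht. destruct (HUW t Ht) as (A1&A2&_), (Hl t Ht) as [_ A3]. destruct (HEn t Ht) as [A4 _].
  apply Rabs_le_between in A3. apply Rabs_le_between in A4. apply Rabs_le. unfold Ph, an, a1. lra. }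
 destruct (IVT_interv Ph (x0-1) (x0+1)) as (x&Hx&HPx).
 - intros t Ht. destruct (HEn t Ht) as (_&_&C1&C2), (Hsmall t Ht) as [S1 S2].
  have := exp_m10 _ S1. have := exp_m10 _ S2. destruct (Hl t Ht) as [L1 _].
  have Hc: forall c : R, continuity_pt (fun _ => c) t by (intros c; apply continuity_pt_const; intros ? ?; auto).
  have Hid: continuity_pt (fun u => u) t by (apply derivable_continuous_pt, derivable_pt_id).
  have Can: continuity_pt an t.
  { apply continuity_pt_plus; [apply continuity_pt_plus; [apply continuity_pt_mult; [apply Hc|auto]|apply Hc]|auto]. }
  apply continuity_pt_minus; [|auto].
  apply continuity_pt_plus; [|apply continuity_pt_minus; [apply Hc|auto]].
  apply continuity_pt_minus; [apply continuity_pt_plus|].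
  + apply (continuity_pt_ln_comp l); [|lra]. apply continuity_pt_mult; [apply Hc|].
   apply continuity_pt_minus; [apply Hc|auto].
  + apply continuity_pt_mult; [apply Hc|]. apply (continuity_pt_ln_comp (fun u => 1-exp (u-y))); [|lra].
   apply continuity_pt_minus; [apply Hc|]. apply continuity_pt_exp_comp. apply continuity_pt_minus; [auto|apply Hc].
  + apply continuity_pt_mult; [apply Hc|]. apply (continuity_pt_ln_comp (fun u => 1-exp (a1-an u))); [|lra].
   apply continuity_pt_minus; [apply Hc|]. apply continuity_pt_exp_comp. apply continuity_pt_minus; [apply Hc|auto].
 - lra.
 - have H := HPh (x0-1) ltac:(lra). apply Rabs_le_between in H. lra.
 - have H := HPh (x0+1) ltac:(lra). apply Rabs_le_between in H. lra.
 - exists x, (y+U x-an x-W x). split; [auto|]. intros S Q1 Qn.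
  destruct (HUW x Hx) as (U1&W1&EU&EW), (Hl x Hx) as [L1 _]. destruct (HEn x Hx) as [N1 _], (Hsmall x Hx) as [S1 _].
  apply Rabs_le_between in N1.
  have HSn: S*Qn = exp (y+U x-W x) by (unfold S, Qn; fold (an x); rewrite <- exp_plus; f_equal; ring).
  have HS1: S*Qn-S*Q1 = exp y-exp x.
  { replace (S*Q1) with (S*Qn*exp (a1-an x)).
   - replace (S*Qn-S*Qn*exp (a1-an x)) with (S*Qn*exp (W x)) by (rewrite EW; ring).
    rewrite HSn, <- exp_plus. replace (y+U x-W x+W x) with (y+U x) by ring. rewrite exp_plus, EU.
    replace (exp x) with (exp y*exp (x-y)) by (rewrite <- exp_plus; f_equal; ring). ring.
   - unfold Q1, Qn. fold a1 (an x). rewrite Rmult_assoc, <- exp_plus. do 2 f_equal. ring. }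
  have HM: l x*(S*Q1*(S*Qn)) = exp x*exp y.
  { unfold S, Q1, Qn. fold a1 (an x). rewrite <- (exp_ln (l x)) by lra. rewrite <- !exp_plus. f_equal.
   unfold Ph in HPx. lra. }
  have P1: 0 < S*Q1 by (apply Rmult_lt_0_compat; apply exp_pos). have Hge: exp y/2 <= S*Qn.
  { rewrite HSn. apply Rle_trans with (exp (y+U x)); [|apply exp_le; lra]. rewrite exp_plus, EU.
   have := exp_m10 _ S1. have := exp_pos y. apply Rmult_le_compat_l; lra. }
  have Hp := exp_pos y. have Hlt: S*Q1 < exp x.
  { apply Rmult_lt_reg_r with (exp y); [auto|]. rewrite <- HM.
   apply Rlt_le_trans with (S*Q1*(3*(S*Qn))); [apply Rmult_lt_compat_l; lra|].
   replace (l x*(S*Q1*(S*Qn))) with (S*Q1*(l x*(S*Qn))) by ring. apply Rmult_le_compat_l; [lra|].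
    apply Rmult_le_compat_r; lra. }
  split; [auto|]. split; [lra|]. split; [rewrite <- HM; unfold l; ring|]. split; [apply Rabs_le; unfold an; lra|].
  apply (proj2 (Rle_div_l _ _ _ (ltac:(lra) : 0 < 3*(a*b)))). apply Rmult_le_reg_r with (exp y); [auto|]. rewrite <- HM.
  replace (S*Q1*(3*(a*b))*exp y) with (3*(a*b)*(S*Q1*exp y)) by ring.
  apply Rmult_le_compat; [lra|apply Rmult_le_pos; lra|lra|]. apply Rmult_le_compat_l; lra.
Qed.

Lemma Im_mult_0 u v : Im u = 0 -> Im v = 0 -> Im (u*v) = 0.
Proof. intros H1 H2. destruct u as [a b], v as [c d]. unfold Im in *; simpl in *. subst. ring. Qed.

Lemma Im_plus_0 u v : Im u = 0 -> Im v = 0 -> Im (u+v) = 0.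
Proof. intros H1 H2. rewrite im_plus. lra. Qed.

Lemma Im_opp_0 u : Im u = 0 -> Im (- u) = 0.
Proof. intros H. rewrite im_opp. lra. Qed.

Lemma Im_inv_0 u : Im u = 0 -> Im (/ u) = 0.
Proof. intros H. destruct u as [a b]. unfold Im in *; simpl in *. subst. unfold Rdiv. ring. Qed.

Lemma Im_exp_0 u : Im u = 0 -> Im (Cexp u) = 0.
Proof. intros H. unfold Cexp, Im at 1. cbn [snd]. rewrite H, sin_0. ring. Qed.

Lemma Im_Log1m_0 u : Im u = 0 -> Im (Log1m u) = 0.
Proof.
 intros H. unfold Log1m, Clog.
 replace (Im (1-u)) with 0 by (unfold Cminus; rewrite im_plus, im_opp, H; simpl; ring). rewrite Rdiv_0_l. apply atan_0.
Qed.

Lemma csum_Im_0 f k : (forall j, (1 <= j <= k)%nat -> Im (f j) = 0) -> Im (csum f k) = 0.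
Proof.
 induction k as [|k IH]; intros H; [auto|]. apply Im_plus_0; [|apply H; lia].
 apply IH. intros j Hj. apply H. lia.
Qed.

Lemma real_of_Im_0 u : Im u = 0 -> u = RtoC (Re u).
Proof. intros H. apply C_ext; [rewrite re_RtoC|rewrite im_RtoC]; auto. Qed.

Ltac real_part := repeat first [reflexivity | apply Im_mult_0 | apply Im_plus_0 | apply Im_opp_0 | apply Im_inv_0
 | apply Im_exp_0 | apply Im_Log1m_0].

(** All coefficients are real, so the errors are real on the real axis and the cycle can be sought
    among real numbers. *)
Lemma xarg_real d n s t i j : Im (xarg n d s i j (RtoC t)) = 0.
Proof. unfold xarg. destruct (Nat.ltb j i); real_part. Qed.

Lemma epsi_real n d s t i : epsi n d s i (RtoC t) = RtoC (Re (epsi n d s i (RtoC t))).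
Proof.
 apply real_of_Im_0, csum_Im_0. intros j _. apply Im_mult_0; [auto|]. apply Im_Log1m_0, xarg_real.
Qed.

Lemma epsi'_real n d s t i : epsi' n d s i (RtoC t) = RtoC (Re (epsi' n d s i (RtoC t))).
Proof.
 apply real_of_Im_0, csum_Im_0. intros j _. apply Im_mult_0; [auto|].
 have H: Im (1-xarg n d s i j (t))%C = 0 by (unfold Cminus; apply Im_plus_0; [auto|apply Im_opp_0, xarg_real]).
 destruct (Nat.ltb j i); (apply Im_mult_0; [apply Im_opp_0, Im_inv_0, H|real_part]).
Qed.

Lemma Re_continuity f S B t : (forall z w, S z -> S w -> Cmod (f z-f w) <= B*Cmod (z-w)) -> S (RtoC t) ->
 (exists r, 0 < r /\ forall u, Rabs (u-t) < r -> S (RtoC u)) -> 0 <= B -> continuity_pt (fun u => Re (f (RtoC u))) t.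
Proof.
 intros HL Ht [r [Hr HS]] HB e He. exists (Rmin r (e/(B+1))). split; [apply Rmin_glb_lt; [auto|apply Rdiv_lt_0_compat;
  lra]|].
 intros u [_ Hu]. simpl in Hu. unfold R_dist in Hu. have H1 := lt_min_l Hu. have H2 := lt_min_r Hu.
 simpl. unfold R_dist. rewrite <- Re_minus. have H := HL _ _ (HS u H1) Ht. rewrite <- RtoC_minus, Cmod_R in H.
 have := Re_le_Cmod (f (u)-f (t))%C. have := Re_ge_Cmod (f (u)-f (t))%C.
 apply (proj2 (Rlt_div_r _ _ _ (ltac:(lra) : 0 < B+1))) in H2. have := Rabs_pos (u-t).
 apply Rle_lt_trans with (B*Rabs (u-t)); [apply Rabs_le; lra|]. lra.
Qed.

Lemma sum_upto_bound f k i : (forall j, (1 <= j <= k)%nat -> 0 < f j) -> (1 <= i <= k)%nat -> f i <= sum_upto f k.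
Proof.
 intros Hf. have Hpos: forall p, (p <= k)%nat -> 0 <= sum_upto f p.
 { induction p as [|p IH]; intros Hp; simpl; [lra|]. specialize (IH ltac:(lia)). have := Hf (S p) ltac:(lia). lra. }
 have H: forall p, (p <= k)%nat -> (1 <= i <= p)%nat -> f i <= sum_upto f p; [|intros Hi; apply (H k); [lia|auto]].
 induction p as [|p IH]; intros Hp Hi; [lia|]. simpl. have := Hpos p ltac:(lia). have := Hf (S p) ltac:(lia).
 destruct (Nat.eq_dec i (S p)) as [->|Hne]; [lra|]. specialize (IH ltac:(lia) ltac:(lia)). lra.
Qed.

(** * Choice of the constants for small s *)

Section Existence.

Variables (n: nat) (d: nat -> nat).
Hypothesis Hn : (3 <= n)%nat.
Hypothesis Hodd : Nat.odd n = true.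
Hypothesis Hd : forall i, (1 <= i <= n)%nat -> (2 <= d i)%nat.
Local Notation sg := (sum_upto (fun i => / INR (d i)) n).
Hypothesis Hsum : sg < 1.
Local Notation D := (INR (dmax n d)).
Local Notation a := (INR (d 1%nat)).
Local Notation b := (INR (d n)).

Definition mz (i: nat) : Z := if Nat.even i then Z.of_nat (d i) else (- Z.of_nat (d i))%Z.

Lemma mz_mi i : IZR (mz i) = mi d i.
Proof.
 unfold mz, mi, sgn. destruct (Nat.even i); rewrite ?opp_IZR, <- INR_IZR_INZ; ring.
Qed.

Lemma even_n : Nat.even n = false /\ Nat.even (n-1) = true.
Proof.
 split; [rewrite <- Nat.negb_odd, Hodd; auto|].
 destruct n as [|k]; [lia|]. simpl. rewrite Nat.sub_0_r. rewrite Nat.odd_succ in Hodd. auto.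
Qed.

Lemma kapi_1 s S0 : kapi n d s S0 1 = RtoC (ln S0).
Proof.
 unfold kapi. rewrite (csum_ext _ (fun _ => 0%C)).
 - have H: forall k, csum (fun _ => 0%C) k = 0%C by (induction k as [|k IH]; simpl; [auto|rewrite IH; ring]).
  rewrite H. ring.
 - intros j Hj. destruct (Nat.ltb_spec j 1); [lia|ring].
Qed.

(** The number [n-1] of factors is even, so the angles [PI] and [-PI] cancel in pairs and the
    constant is real. Its real part is read off from the value [he] at the innermost circle. *)
Lemma kapi_n s S0 : 0 < s -> kapi n d s S0 n = RtoC (b*lcf n d s (n-1)+he n d S0).
Proof.
 intros Hs. have HIm: Im (kapi n d s S0 n) = 0.
 { unfold kapi. rewrite im_plus, im_RtoC, Rplus_0_l.
  have H: forall k, (k < n)%nat -> Im (csum (fun j => RtoC (sgn j)*(if Nat.ltb j n then (INR (Dd d j)*lcf n d s j,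
   PI)%R : C else 0))%C k) = PI*((sgn k-1)/2).
  { induction k as [|k IH]; intros Hk; [unfold sgn; simpl; lra|]. cbn [csum]. rewrite im_plus, IH by lia.
   destruct (Nat.ltb_spec (S k) n); [|lia]. rewrite im_scal_l, sgn_S. simpl. field. }
  rewrite H by lia. rewrite (sgn_n1 n d Hn Hodd Hd). field. }
 rewrite (real_of_Im_0 _ HIm), kapi_Re by lia. f_equal. destruct even_n as [E1 E2].
 have H1 := kr_match n d s S0 Hn (n-1) ltac:(lia). have H2 := h_value n d s S0 Hn Hd Hs (n-1) ltac:(lia).
 rewrite E2 in H2. replace (S (n-1)) with n in H1 by lia. unfold mi at 1 in H1. unfold sgn in H1. rewrite E1 in H1. lra.
Qed.

Lemma lc_formula s i : 0 < s -> (1 <= i <= n)%nat -> lcf n d s i = ln (D*D)/a+ln s*sum_upto (fun i => / INR (d i)) i.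
Proof.
 intros Hs. induction i as [|i IH]; intros Hi; [lia|].
 have := d_le_dmax n d Hn Hd (S i) ltac:(lia). destruct i as [|i].
 - have H1 := lc_1 n d s Hn Hd Hs. simpl sum_upto. replace (lcf n d s 1) with ((a*lcf n d s 1)/a) by (field; lra).
  rewrite H1. field. lra.
 - specialize (IH ltac:(lia)). have H1 := lc_S n d s Hn Hd (S i) ltac:(lia) ltac:(lia).
  replace (lcf n d s (S (S i))) with (lcf n d s (S i)+(INR (d (S (S i)))*(lcf n d s (S (S i))-lcf n d s (S i)))/INR (d
   (S (S i)))) by (field; lra).
  rewrite H1, IH. cbn [sum_upto]. unfold Rdiv. ring.
Qed.

(** One margin large enough for all the separation clauses of [rat_sys] at once. *)
Definition K0 (gam: R) : R := 10*(gam+1)*(D+2)+INR n+3*INR (d 1%nat*d n)+100.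

(* With [L = - ln s], every separation needed below is a positive multiple of [L] minus a constant;
  positivity of the multiple in [ho-y] is exactly the hypothesis that the reciprocals sum to less than one. *)
Lemma separation gam W s : 6 <= gam -> 0 < s -> W <= (1-sg)/(4*D) * - ln s ->
 D*(K0 gam+6)+ln (D*D)+ln (a*b)+2*D+20 <= W -> let y := (1-sg)/(2*a)*ln s in let kp := b*lcf n d s (n-1)-ln (D*D) in
 let x0 := (kp+(a-1)*y-ln (a*b))/(b-1) in
 (forall i, (1 <= i)%nat -> (S i <= n-1)%nat -> lcf n d s (S i)+K0 gam <= lcf n d s i) /\
 lcf n d s 1+K0 gam <= y /\ x0+1+K0 gam <= lcf n d s (n-1) /\ x0+12+b <= y /\ (b-1)*x0 = kp+(a-1)*y-ln (a*b) /\
 forall x lS, x0-1 <= x <= x0+1 -> Rabs (lS-(y+b*x-kp)) <= 1 ->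
  lS-ln (D*D)+K0 gam <= x /\ y+K0 gam <= lS-ln (D*D)-ln s.
Proof.
 intros Hgam Hs HW1 HW2 y kp x0.
 have Ha := d_le_dmax n d Hn Hd 1 ltac:(lia). have Hb := d_le_dmax n d Hn Hd n ltac:(lia).
 have Hfpos: forall j, (1 <= j <= n)%nat -> 0 < / INR (d j).
 { intros j Hj. apply Rinv_0_lt_compat. have := d_le_dmax n d Hn Hd j Hj. lra. }
 set (L := - ln s) in *. set (lD := ln (D*D)) in *. set (lab := ln (a*b)) in *.
 have HlD: 0 <= lD by (unfold lD; rewrite <- ln_1; apply ln_le; [lra|nra]).
 have Hlab: 0 <= lab by (unfold lab; rewrite <- ln_1; apply ln_le; [lra|nra]). have HK: 100 <= K0 gam.
 { unfold K0. have := pos_INR n. have := pos_INR (d 1%nat*d n). have: 0 <= (gam+1)*(D+2) by (apply Rmult_le_pos; lra).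
  lra. }
 set (K := K0 gam) in *. have HDK: D*6+2*K <= D*(K+6). { have: 2*K <= D*K by mono. lra. }
 set (u := (1-sg)/(4*D)*L) in *. have Hu: (1-sg)*L = 4*(D*u) by (unfold u; field; lra). have Hsg0: 0 < sg.
 { have := sum_upto_bound (fun i => / INR (d i)) n 1 Hfpos ltac:(lia). have := Hfpos 1%nat ltac:(lia). lra. }
 have HDu: 2*u <= D*u by mono. have HL0: 0 < L. { apply Rmult_lt_reg_l with (1-sg); [lra|]. lra. }
 have HL: 4*(D*u) <= L by (rewrite <- Hu; rewrite <- (Rmult_1_l L) at 2; apply Rmult_le_compat_r; lra).
 have HLD: forall c, 2 <= c <= D -> 4*u <= L/c.
 { intros c Hc. apply (proj1 (Rle_div_r _ _ _ (ltac:(lra) : 0 < c))). have: u*c <= u*D by mono. lra. }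
 have Hls: ln s = - L by (unfold L; ring). have Hay: a*y = - (2*(D*u)).
 { unfold y. rewrite Hls. replace (a*((1-sg)/(2*a) * - L)) with (- ((1-sg)*L)/2) by (field; lra). rewrite Hu. field. }
 have Hy0: y <= 0. { apply Rmult_le_reg_l with a; [lra|]. lra. }
 have Hlc1: lcf n d s 1 = lD/a-L/a. { rewrite lc_formula by (try auto; lia). rewrite Hls. simpl sum_upto. unfold lD.
  field. lra. }
 have Hsn: sg = sum_upto (fun i => / INR (d i)) (n-1) + / b.
 { destruct n as [|k] eqn:En; [lia|]. simpl (S k-1)%nat. rewrite Nat.sub_0_r. auto. }
 set (sn := sum_upto (fun i => / INR (d i)) (n-1)) in *.
 have Hlcn: lcf n d s (n-1) = lD/a-L*sn. { rewrite lc_formula by (try auto; lia). rewrite Hls. unfold lD, sn. ring. }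
 have Hlda: 0 <= lD/a <= lD.
 { split; [apply Rmult_le_pos; [lra|left; apply Rinv_0_lt_compat; lra]|].
  apply (proj2 (Rle_div_l _ _ _ (ltac:(lra) : 0 < a))).
  rewrite <- (Rmult_1_r lD) at 1. apply Rmult_le_compat_l; lra. }
 have Hx0: (b-1)*x0 = kp+(a-1)*y-lab by (unfold x0; field; lra).
 have Hstep: forall i, (1 <= i)%nat -> (S i <= n-1)%nat -> lcf n d s (S i)+K <= lcf n d s i.
 { intros i Hi1 Hi2. have H := lc_S n d s Hn Hd i Hi1 ltac:(lia). have Hdi := d_le_dmax n d Hn Hd (S i) ltac:(lia).
  have := HLD (INR (d (S i))) Hdi. have E: lcf n d s i-lcf n d s (S i) = L/INR (d (S i)).
  { apply Rmult_eq_reg_l with (INR (d (S i))); [|lra]. field_simplify; [|lra]. lra. }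
  lra. }
 have H2: lcf n d s 1+K <= y.
 { apply Rmult_le_reg_l with a; [lra|]. rewrite Hay, Hlc1. replace (a*(lD/a-L/a+K)) with (lD-L+a*K) by (field; lra).
  have: a*K <= D*K by mono. lra. }
 have H3: x0+1+K <= lcf n d s (n-1).
 { apply Rmult_le_reg_l with (b-1); [lra|]. rewrite !Rmult_plus_distr_l, Hx0. unfold kp.
  have Hs1: / a <= sn. { apply (sum_upto_bound (fun i => / INR (d i))); [intros j Hj; apply Hfpos; lia|lia]. }
  have: L/a <= L*sn by (unfold Rdiv; apply Rmult_le_compat_l; lra).
  have: (a-1)*y <= 0. { have: 0 <= (a-1) * - y by (apply Rmult_le_pos; lra). lra. }
  have: (b-1)*K <= D*K by mono. lra. }
 have H4: x0+12+b <= y.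
 { have: lcf n d s (n-1) <= lcf n d s 1.
  { apply (lc_le n d s Hn gam K); try lra; try lia; [|auto]. unfold K, K0. have := pos_INR n.
   have := pos_INR (d 1%nat*d n).
   have: 0 <= (gam+1)*D by (apply Rmult_le_pos; lra). lra. }
  unfold K, K0 in *. have := pos_INR n. have := pos_INR (d 1%nat*d n). have: 7*(D+2) <= (gam+1)*(D+2) by mono. lra. }
 split; [auto|]. split; [auto|]. split; [auto|]. split; [auto|]. split; [auto|].
 intros x lS Hx HlS. apply Rabs_le_between in HlS.
 have Hbx1: (b-1)*x <= (b-1)*x0+(b-1) by (rewrite <- (Rmult_1_r (b-1)) at 3; rewrite <- Rmult_plus_distr_l; apply
  Rmult_le_compat_l; lra).
 have Hbx2: (b-1)*x0-(b-1) <= (b-1)*x by (replace ((b-1)*x0-(b-1)) with ((b-1)*(x0-1)) by ring; apply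
  Rmult_le_compat_l; lra).
 unfold kp in *. split.
 - lra.
 (* [b*sn = b*sg-1] turns the available room into [b*(1-sg)*L]. The choice of [y] spends at most
    half of it, and the other half pays for the constants. *)
 - set (lcn := lcf n d s (n-1)) in *. have Hbs: b*sn = b*sg-1 by (rewrite Hsn; field; lra).
  have HA: (b-1)*(K+y) <= (b-1)*(y+b*x-(b*lcn-lD)-1-lD+L).
  { have HB: - (L*sn)-lD-lab-2*(D*u)-b <= (b-1)*x-(b-1)*lcn.
   { lra. }
   apply (Rmult_le_compat_l b) in HB; [|lra].
   have HC: b*(- (L*sn)-lD-lab-2*(D*u)-b) = - (L*(b*sg-1))-b*(lD+lab+2*(D*u)+b) by (rewrite <- Hbs; ring).
   have HE: (b-1)*(L-1)-L*(b*sg-1) = b*((1-sg)*L)-(b-1) by ring. rewrite Hu in HE.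
   have HG: b*(K+lD+lab+b+1) <= b*(2*(D*u)) by mono. lra. }
  apply Rmult_le_reg_l in HA; [|lra]. lra.
Qed.

(** Since [exp (-gam) <= 1/gam], a large [gam] depending on the degrees alone makes the errors
    smaller than the fifth power of the tilt. *)
Lemma small_gamma : exists gam, 6 <= gam /\ ep0 n d gam <= 1/100 /\
 100*(INR (d 1%nat*d n)*INR (d 1%nat*d n))*ep0 n d gam <= kaN (d 1%nat*d n)^5.
Proof.
 have HD := dmx_ge_2 n d Hn Hd. have H1 := Hd 1%nat ltac:(lia). have H2 := Hd n ltac:(lia).
 have HN: 4 <= INR (d 1%nat*d n) by (rewrite mult_INR; apply (le_INR 2) in H1; apply (le_INR 2) in H2; simpl in H1, H2;
  nra).
 set (N := INR (d 1%nat*d n)) in *. have Hka: 0 < kaN (d 1%nat*d n).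
 { unfold kaN. fold N. apply Rinv_0_lt_compat. have: 0 < N*N by nra. nra. }
 set (c := 16*INR n*(D*D)). have Hc: 0 < c.
 { have: 0 < INR n by (apply lt_0_INR; lia). apply Rmult_lt_0_compat; nra. }
 set (tau := Rmin (1/100) (kaN (d 1%nat*d n)^5/(100*(N*N)))). have HNN: 0 < 100*(N*N) by nra.
 have Htau: 0 < tau by (apply Rmin_glb_lt; [lra|]; apply Rdiv_lt_0_compat; [apply pow_lt, Hka|lra]).
 exists (Rmax 6 (c/tau)). split; [apply Rmax_l|]. have He: ep0 n d (Rmax 6 (c/tau)) <= tau.
 { unfold ep0. fold c. rewrite exp_Ropp. apply (proj2 (Rle_div_l _ _ _ (exp_pos _))).
  have := Rmax_r 6 (c/tau). apply (proj1 (Rle_div_l _ _ _ Htau)) in H. rewrite Rmult_comm.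
  eapply Rle_trans; [exact H|]. apply Rmult_le_compat_r; [lra|]. have := exp_ineq1_le (Rmax 6 (c/tau)). lra. }
 split; [eapply Rle_trans; [exact He|apply Rmin_l]|].
 have He2 := Rle_trans _ _ _ He (Rmin_r _ _). apply (proj2 (Rle_div_r _ _ _ HNN)) in He2. lra.
Qed.

(** The order of choices: [gam] from the degrees, then the bound on [s], then [y] explicitly, then
    [x] and [S0] from [two_cycle_parameters], and finally [T = exp x-S0*Q1]. *)
Theorem rat_sys_exists : exists s0, 0 < s0 /\ forall s, 0 < s < s0 -> exists S0 T x y gam, 0 < S0 /\
 @rat_sys n (d 1%nat) (d n) (Rmap n d s (RtoC S0) (RtoC T)) mz (lcf n d s) (kapi n d s S0) (epsi n d s) (epsi' n d s)
  gam (ep0 n d gam) T x y.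
Proof.
 destruct small_gamma as (gam&Hgam&Hep1&Hep2).
 have Ha := d_le_dmax n d Hn Hd 1 ltac:(lia). have Hb := d_le_dmax n d Hn Hd n ltac:(lia).
 set (W := D*(K0 gam+6)+ln (D*D)+ln (a*b)+2*D+20).
 set (de := (1-sg)/(4*D)). have Hde: 0 < de by (apply Rdiv_lt_0_compat; lra).
 exists (exp (- (W/de))). split; [apply exp_pos|]. intros s [Hs Hs0]. have HW: W <= de * - ln s.
 { have Hl: ln s < - (W/de) by (rewrite <- (ln_exp (- (W/de))); apply ln_increasing; auto).
  have HWd: W/de <= - ln s by lra. apply (proj1 (Rle_div_l _ _ _ Hde)) in HWd. lra. }
 destruct (separation gam W s Hgam Hs HW ltac:(unfold W; lra)) as (Hstep&Hy1&Hx1&Hxy&Hx0&Hfin).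
 set (y := (1-sg)/(2*a)*ln s) in *. set (kp := b*lcf n d s (n-1)-ln (D*D)) in *.
 set (x0 := (kp+(a-1)*y-ln (a*b))/(b-1)) in *. have Hep0: 0 <= ep0 n d gam.
 { apply Rmult_le_pos; [|left; apply exp_pos]. apply Rmult_le_pos; [have := pos_INR n; lra|nra]. }
 have HnR := pos_INR n. set (Nn := (d 1%nat*d n)%nat) in *. have HNn: INR Nn = a*b by apply mult_INR.
 have HKval: K0 gam = 10*(gam*D)+20*gam+10*D+120+INR n+3*INR Nn by (unfold K0; fold Nn; ring).
 have Hab4: 4 <= a*b by nra. have Hg1: 1 <= gam by lra. have HgD: 6*D <= gam*D by mono.
 have HK4: 4*gam+4 <= K0 gam by lra. have HCi := fun i Hi => epsi_C11 n d s Hn Hd gam (K0 gam) Hg1 HK4 Hstep i Hi.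
 have Hbi := fun i z Hi => epsi_bound n d s Hn Hd gam (K0 gam) Hg1 HK4 Hstep i z Hi.
 have Hsy: strip n d s gam 1 (y) by (split; [intros _; rewrite re_RtoC; lra|congruence]).
 have Hsx: forall t, t <= lcf n d s (n-1)-gam -> strip n d s gam n (t) by (intros t Ht; split; [congruence|intros _;
  rewrite re_RtoC; lra]).
 destruct (two_cycle_parameters a b kp y x0 (ep0 n d gam) (Re (epsi n d s 1 (y))) (Re (epsi' n d s 1 (y)))
   (fun t => Re (epsi n d s n (t))) (fun t => Re (epsi' n d s n (t)))) as (x&lS&Hx&HP); try lra.
 { have H := Hbi 1%nat (y) ltac:(lia) Hsy. rewrite epsi_real, Cmod_R in H. exact H. }
 { destruct (HCi 1%nat ltac:(lia)) as (_&H&_). specialize (H _ Hsy). rewrite epsi'_real, Cmod_R in H. exact H. }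
 { intros t Ht. have Hst: strip n d s gam n (t) by (apply Hsx; lra). destruct (HCi n ltac:(lia)) as (H1&H2&H3).
  have Hnb: exists r, 0 < r /\ forall u, Rabs (u-t) < r -> strip n d s gam n (u).
  { exists 1. split; [lra|]. intros u Hu. apply Rabs_def2 in Hu. apply Hsx. lra. }
  split; [have H := Hbi n (t) ltac:(lia) Hst; rewrite epsi_real, Cmod_R in H; exact H|].
  split; [have H := H2 _ Hst; rewrite epsi'_real, Cmod_R in H; exact H|]. split.
  - apply (Re_continuity (epsi n d s n) (strip n d s gam n) (ep0 n d gam)); try auto.
   intros z w Hz Hw. apply (C11_lip (strip n d s gam n) _ (epsi' n d s n) (ep0 n d gam) (ep0 n d gam)); try auto;
    [apply strip_convex|apply HCi; lia].
  - apply (Re_continuity (epsi' n d s n) (strip n d s gam n) (ep0 n d gam)); auto. }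
 destruct (HP) as (HT&HpT&Hmul&HlS&Hlow). clear HP. destruct (Hfin x lS Hx HlS) as [Hhe Hho].
 set (S0 := exp lS) in *. set (Q1 := exp (- a*y+Re (epsi n d s 1 (y)))) in *.
  set (Qn := exp (- b*x+kp+Re (epsi n d s n (x)))) in *.
 have HS0: 0 < S0 by apply exp_pos. have HlnS: ln S0 = lS by apply ln_exp.
 have HQ1: 0 < S0*Q1 by (apply Rmult_lt_0_compat; apply exp_pos).
 set (T := exp x-S0*Q1) in *. exists S0, T, x, y, gam. split; [auto|].
 have Hhe': he n d S0+K0 gam <= x by (unfold he; rewrite HlnS; lra).
 have Hho': y+K0 gam <= ho n d s S0 by (unfold ho, he; rewrite HlnS; lra).
 have HqT: exp x-T = S0*Q1 by (unfold T; ring). destruct even_n as [En1 En2].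
 have Hm1: mi d 1 = - a by (unfold mi, sgn; simpl; ring).
 have Hmn: mi d n = - b by (unfold mi, sgn; rewrite En1; ring). have Hlo: x-3*INR Nn <= ln (exp x-T).
 { rewrite HqT. apply Rle_trans with (ln (exp x/(3*(a*b)))).
  - unfold Rdiv. rewrite ln_mult, ln_exp, ln_Rinv by (try apply exp_pos; try apply Rinv_0_lt_compat; lra).
   have H := exp_ineq1_le (ln (3*(a*b))). rewrite exp_ln in H by lra. lra.
  - apply ln_le; [apply Rdiv_lt_0_compat; [apply exp_pos|lra]|auto]. }
 have HLamb: forall i z, Lamb mz (kapi n d s S0) (epsi n d s) i z = Lami n d s S0 i z by (intros i z; unfold Lamb,
  Lami; rewrite mz_mi; auto).
 have HL1: Lami n d s S0 1 (y) = RtoC (ln (exp x-T)).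
 { unfold Lami. rewrite Hm1, kapi_1, epsi_real, HlnS, <- RtoC_mult, <- !RtoC_plus. f_equal.
  rewrite HqT. unfold S0, Q1. rewrite <- exp_plus, ln_exp. ring. }
 have HLn: Lami n d s S0 n (x) = RtoC (ln (exp y-T)).
 { unfold Lami. rewrite Hmn, kapi_n, epsi_real, <- RtoC_mult, <- !RtoC_plus by auto. f_equal.
  unfold he. rewrite HlnS, HpT. unfold S0, Qn. rewrite <- exp_plus, ln_exp. unfold kp. ring. }
 (* At the ends of its strip the affine part takes the values [he] and [ho], which lie far below and
    far above all admissible [Re X]. After division by the degree there is still a margin
    [2*gam+1]. *)
 have Hrange: forall i X, (1 <= i <= n)%nat -> (i <> 1%nat -> ln (exp x-T) <= Re X) -> (i <> n -> Re X <= y+3) ->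
   gstrip n (lcf n d s) (2*gam+1) i ((X-kapi n d s S0 i)/RtoC (IZR (mz i)))%C.
 { intros i X Hi Hlo' Hhi'. have Hdi := d_le_dmax n d Hn Hd i Hi.
  have Hmi: mi d i <> 0 by (unfold mi, sgn; destruct (Nat.even i); lra).
  have HRe: Re ((X-kapi n d s S0 i)/RtoC (IZR (mz i)))%C = (Re X-kr n d s S0 i)/mi d i.
  { rewrite mz_mi. unfold Cdiv. rewrite <- RtoC_inv by auto. rewrite re_scal_r, Re_minus, kapi_Re by auto. auto. }
  have Hdg: INR (d i)*(2*gam+1) <= 2*(gam*D)+D.
  { apply Rle_trans with (D*(2*gam+1)); [apply Rmult_le_compat_r; lra|lra]. }
  unfold gstrip. rewrite HRe. split; intros Hne.
  - have Hh := h_value n d s S0 Hn Hd Hs i ltac:(lia). specialize (Hhi' Hne).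
   have E: (Re X-kr n d s S0 i)/mi d i = lcf n d s i+(Re X-(kr n d s S0 i+mi d i*lcf n d s i))/mi d i by (field; auto).
   rewrite E, Hh. apply Rplus_le_compat_l. unfold mi, sgn. destruct (Nat.even i) eqn:Ei.
   + specialize (Hlo' ltac:(intros ->; discriminate)). rewrite Rmult_1_l.
    apply (proj1 (Rle_div_r _ _ _ (ltac:(lra) : 0 < INR (d i)))). lra.
   + replace ((Re X-ho n d s S0)/(-1*INR (d i))) with ((ho n d s S0-Re X)/INR (d i)) by (field; lra).
    apply (proj1 (Rle_div_r _ _ _ (ltac:(lra) : 0 < INR (d i)))). lra.
  - specialize (Hlo' Hne). have Hh := h_value n d s S0 Hn Hd Hs (i-1) ltac:(lia).
   have Hk := kr_match n d s S0 Hn (i-1) ltac:(lia).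
   replace (S (i-1)) with i in Hk by lia. rewrite <- Hk in Hh.
   have E: (Re X-kr n d s S0 i)/mi d i = lcf n d s (i-1)+(Re X-(kr n d s S0 i+mi d i*lcf n d s (i-1)))/mi d i by
    (field; auto).
   rewrite E, Hh. apply (Rplus_le_compat_l (lcf n d s (i-1)) _ (- (2*gam+1))).
   have Eev: Nat.even i = negb (Nat.even (i-1)). { destruct i as [|k]; [lia|]. simpl (S k-1)%nat.
    rewrite Nat.sub_0_r, Nat.even_succ, <- Nat.negb_even. auto. }
   unfold mi, sgn. rewrite Eev. destruct (Nat.even (i-1)); cbn [negb].
   + replace ((Re X-he n d S0)/(-1*INR (d i))) with (- ((Re X-he n d S0)/INR (d i))) by (field; lra).
    apply Ropp_le_contravar, (proj1 (Rle_div_r _ _ _ (ltac:(lra) : 0 < INR (d i)))). lra.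
   + specialize (Hhi' ltac:(intros ->; rewrite En1 in Eev; discriminate)).
    rewrite Rmult_1_l. replace ((Re X-ho n d s S0)/INR (d i)) with (- ((ho n d s S0-Re X)/INR (d i))) by (field; lra).
    apply Ropp_le_contravar, (proj1 (Rle_div_r _ _ _ (ltac:(lra) : 0 < INR (d i)))). lra. }
 have Hgev: forall i z, (1 <= i <= n-1)%nat -> Nat.even i = true -> Rabs (Re z-lcf n d s i) <= 2*gam ->
   exists w, Rmap n d s (RtoC S0) (RtoC T) (Some (Cexp z)) = Some (T+w)%C /\ Cmod w < exp x-T.
 { intros i z Hi He Hz. destruct (gap_even n d s S0 T Hn Hodd Hd Hs HS0 gam (K0 gam) Hg1 HK4 Hstep i z Hi He Hz) as
  (w&E&Hw).
  exists w. split; [exact E|]. eapply Rle_lt_trans; [exact Hw|]. rewrite <- (exp_ln (exp x-T)) by (rewrite HqT; auto).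
   apply exp_increasing. lra. }
 have Hgod: forall i z, (1 <= i <= n-1)%nat -> Nat.even i = false -> Rabs (Re z-lcf n d s i) <= 2*gam ->
   Rmap n d s (RtoC S0) (RtoC T) (Some (Cexp z)) = None \/
   exists w, Rmap n d s (RtoC S0) (RtoC T) (Some (Cexp z)) = Some (T+w)%C /\ exp (y+3) <= Cmod w.
 { intros i z Hi He Hz. destruct (gap_odd n d s S0 T Hn Hodd Hd Hs HS0 gam (K0 gam) Hg1 HK4 Hstep i z Hi He Hz) as
  [E|[w [E Hw]]]; [left; exact E|right].
  exists w. split; [exact E|]. eapply Rle_trans; [|exact Hw]. apply exp_le. lra. }
 constructor.
 - auto.
 - split; apply Hd; lia.
 - intros i Hi. rewrite mz_mi. unfold mi. rewrite Rabs_mult, sgn_abs, Rmult_1_l, Rabs_pos_eq by apply pos_INR.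
  apply (d_le_dmax n d Hn Hd i Hi).
 - rewrite mz_mi. auto.
 - rewrite mz_mi. auto.
 - auto.
 - auto.
 - auto.
 - unfold ep0. have Hle: exp (x-lcf n d s 1) <= exp (- gam).
  { apply exp_le. have := lc_le n d s Hn gam (K0 gam) Hg1 HK4 Hstep 1 (n-1) ltac:(lia) ltac:(lia) ltac:(lia). lra. }
  have: 1 <= INR n by (apply (le_INR 1); lia). have: 1*1 <= D*D by (apply Rmult_le_compat; lra). have := exp_pos (- gam).
  have: 1*1 <= INR n*(D*D) by (apply Rmult_le_compat; lra).
  have: 1*exp (- gam) <= INR n*(D*D)*exp (- gam) by mono. lra.
 - lra.
 - lra.
 - have HG: (y-lcf n d s 1-2*gam+2)/b <= lcf n d s (n-1)-gam-x; [|lra].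
  apply (proj2 (Rle_div_l _ _ _ (ltac:(lra) : 0 < b))).
  have Hl1 := lc_le n d s Hn gam (K0 gam) Hg1 HK4 Hstep 1 (n-1) ltac:(lia) ltac:(lia) ltac:(lia).
  apply Rabs_le_between in HlS. unfold kp in HlS. have: gam*b <= gam*D by mono. lra.
 - intros i j Hi Hij Hj. have := lc_decr n d s Hn gam (K0 gam) Hg1 HK4 Hstep i j Hi Hij Hj. lra.
 - apply (Rmap_cont n d s S0 T Hn Hodd Hd HS0 gam (K0 gam) Hg1 HK4 Hstep).
 - auto.
 - exact (Rmap_0 n d s S0 T Hn Hd).
 - intros i z Hi Hz. rewrite HLamb. apply (Rmap_strip n d s S0 T Hn Hodd Hd HS0 gam (K0 gam) Hg1 HK4 Hstep i z Hi Hz).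
 - auto.
 - auto.
 - apply epsi_period.
 - split; unfold T; lra.
 - rewrite HLamb. auto.
 - rewrite HLamb. auto.
 - rewrite (epsi'_real n d s y 1), (epsi'_real n d s x n), <- !RtoC_plus, <- !RtoC_mult. f_equal. rewrite HqT, HpT. auto.
 - auto.
 - intros i z Hi Hz. destruct (Nat.even i) eqn:Ei; [left; apply (Hgev i); auto|right; apply (Hgod i); auto].
 - intros z Hz. apply (Hgod 1%nat); [lia|auto|auto].
 - intros z Hz. apply (Hgev (n-1)%nat); [lia|auto|auto].
 - have Hk: forall k, exists CK, forall i, (i <= k)%nat -> Rabs (Im (kapi n d s S0 i)) <= CK.
  { induction k as [|k [CK IH]].
   - exists (Rabs (Im (kapi n d s S0 0))). intros i Hi. replace i with 0%nat by lia. lra.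
   - exists (Rmax CK (Rabs (Im (kapi n d s S0 (S k))))). intros i Hi.
    destruct (Nat.eq_dec i (S k)) as [->|Hne]; [apply Rmax_r|]. eapply Rle_trans; [apply IH; lia|apply Rmax_l]. }
  destruct (Hk n) as [CK HCK]. exists CK. intros i Hi. apply HCK. lia.
Qed.

End Existence.

(** * Limits, loops and homotopies on the sphere *)

Lemma Cbanach S f u0 : (forall z, (forall r, 0 < r -> exists w, S w /\ Cmod (w-z) < r) -> S z) -> S u0 -> (forall u, S
 u -> S (f u)) ->
 (forall u v, S u -> S v -> Cmod (f u-f v) <= / 2*Cmod (u-v)) -> exists z, S z /\ f z = z.
Proof.
 intros Hcl H0 Hf Hc. set (u := fix u k := match k with O => u0 | Datatypes.S k' => f (u k') end : C).
 have HS: forall k, S (u k) by (induction k as [|k IH]; simpl; auto).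
 set (a := Cmod (u 1%nat-u 0%nat)). have Ha := Cmod_ge_0 (u 1%nat-u 0%nat)%C. fold a in Ha.
 have Hstep: forall k, Cmod (u (Datatypes.S k)-u k)%C <= a*(/ 2)^k.
 { induction k as [|k IH]; [simpl; fold a; unfold a; simpl; lra|].
  change (Cmod (f (u (Datatypes.S k))-f (u k))%C <= a*(/ 2*(/ 2)^k)). eapply Rle_trans; [apply Hc; apply HS|]. lra. }
 have Hfar: forall j k, Cmod (u (k+j)%nat-u k)%C <= 2*a*(/ 2)^k*(1-(/ 2)^j).
 { induction j as [|j IH]; intros k.
  - rewrite Nat.add_0_r. replace (u k-u k)%C with (RtoC 0) by ring. rewrite Cmod_0. lra.
  - rewrite Nat.add_succ_r. have Ht := Cmod_dist_triangle (u (Datatypes.S (k+j))) (u (k+j)%nat) (u k).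
   have Hs := Hstep (k+j)%nat. rewrite pow_add in Hs. specialize (IH k).
   change ((/ 2)^Datatypes.S j) with (/ 2*(/ 2)^j). lra. }
 have Hfar': forall j k, Cmod (u (k+j)%nat-u k)%C <= 2*a*(/ 2)^k.
 { intros j k. le_trans Hfar. rewrite <- (Rmult_1_r (2*a*(/ 2)^k)) at 2.
  have: 0 < (/ 2)^j by (apply pow_lt; lra). have: 0 < (/ 2)^k by (apply pow_lt; lra). apply Rmult_le_compat_l; nra. }
 have Hlim: forall r, 0 < r -> exists K, forall k, (K <= k)%nat -> 2*a*(/ 2)^k < r.
 { intros r Hr. destruct (pow_lt_1_zero (/ 2) ltac:(rewrite Rabs_pos_eq; lra) (r/(2*a+1))) as [K HK].
  { apply Rdiv_lt_0_compat; lra. }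
  exists K. intros k Hk. specialize (HK k Hk). have Hp: 0 < (/ 2)^k by (apply pow_lt; lra).
  rewrite Rabs_pos_eq in HK by lra. apply (proj2 (Rlt_div_r _ _ _ (ltac:(lra) : 0 < 2*a+1))) in HK. lra. }
 destruct (C_complete u) as [z Hz].
 { intros r Hr. destruct (Hlim (r/2) ltac:(lra)) as [K HK]. exists K. intros j k Hj Hk.
  have H1 := Hfar' (j-K)%nat K. have H2 := Hfar' (k-K)%nat K.
  replace (K+(j-K))%nat with j in H1 by lia. replace (K+(k-K))%nat with k in H2 by lia.
  have H3 := Cmod_dist_triangle (u j) (u K) (u k). rewrite (Cmod_sym (u K)) in H3. specialize (HK K (le_n _)). lra. }
 have HSz: S z.
 { apply Hcl. intros r Hr. destruct (Hz r Hr) as [K HK]. exists (u K). split; [apply HS|apply HK; lia]. }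
 exists z. split; [auto|]. apply eq_of_close. intros r Hr. destruct (Hz (r/2) ltac:(lra)) as [K HK].
 have H1 := HK K (le_n _). have H2 := HK (Datatypes.S K) ltac:(lia).
 have H3 := Cmod_dist_triangle (f z) (u (Datatypes.S K)) z.
 have H4 := Hc z (u K) HSz (HS K). rewrite (Cmod_sym z) in H4. change (u (Datatypes.S K)) with (f (u K)) in *. lra.
Qed.

Lemma exp_1_gt_2 : 2 < exp 1.
Proof. have := exp_ineq1 1 ltac:(lra). lra. Qed.

Lemma Some_C a b : Some (a: Cx) = Some (b: Cx) -> a = b.
Proof. intros H. injection H. auto. Qed.

Lemma Clog_inv w : 0 < Re w -> Clog (/ w)%C = (- Clog w)%C.
Proof.
 intros H. have Hw: w <> 0%C by (intros E; rewrite E in H; simpl in H; lra).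
 have Hm := proj1 (Cmod_gt_0 _) Hw. unfold Clog. rewrite Cmod_inv, ln_Rinv by auto.
  have E: Im (/ w)/Re (/ w) = - (Im w/Re w).
 { destruct w as [a b]. simpl in *. field. repeat split; try lra; nra. }
 rewrite E, atan_opp. auto.
Qed.

Lemma subsequence P : (forall K, exists j, (K <= j)%nat /\ P j) ->
 exists phi : nat -> nat, (forall j, (phi j < phi (S j))%nat) /\ forall j, P (phi j).
Proof.
 intros H. set (f := fun K => epsilon (inhabits 0%nat) (fun j => (K <= j)%nat /\ P j)).
 have Hf: forall K, (K <= f K)%nat /\ P (f K) by (intros K; unfold f; apply epsilon_spec, H).
 exists (fix phi k := match k with O => f 0%nat | S k' => f (S (phi k')) end). split.
 - intros j. destruct (Hf (S ((fix phi k := match k with O => f 0%nat | S k' => f (S (phi k')) end) j))). lia.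
 - intros [|j]; apply Hf.
Qed.

Lemma strict_mono_ge phi : (forall j, (phi j < phi (S j))%nat) -> forall j, (j <= phi j)%nat.
Proof. intros H. induction j as [|j IH]; [lia|]. specialize (H j). lia. Qed.

(* Three cases: [m] takes one value infinitely often, or tends to infinity through even or through odd numbers. *)
Lemma normal_of_two_limits F U a b k : (forall p, U p -> exists r, 0 < r /\ forall q, chordal p q < r -> U q) ->
 (forall q, scont F q) ->
 (forall e, 0 < e -> exists K, forall j q, (K <= j)%nat -> U q ->
   chordal (iter F (k+2*j) q) a < e /\ chordal (iter F (k+S (2*j)) q) b < e) ->
 normal_iter F U.
Proof.
 intros HU HF Hlim m.
 have Hsub: forall phi g, (forall e, 0 < e -> exists K, forall j, (K <= j)%nat -> forall q, U q -> chordal (iter F (m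
  (phi j)) q) (g q) < e) ->
   lu_conv (fun j => iter F (m (phi j))) g U.
 { intros phi g H p Hp. destruct (HU p Hp) as (r&Hr&Hin). exists r. split; [auto|]. split; [auto|].
  intros e He. destruct (H e He) as [K HK]. exists K. intros j Hj q Hq. apply HK; auto. }
 destruct (classic (exists c, forall K, exists j, (K <= j)%nat /\ m j = c)) as [[c Hc]|Hno].
 - destruct (subsequence (fun j => m j = c) Hc) as (phi&H1&H2). exists phi. split; [auto|].
  exists (iter F c). apply Hsub. intros e He. exists 0%nat. intros j _ q _. rewrite H2, chordal_refl. auto.
 - have Hinf: forall B, exists K, forall j, (K <= j)%nat -> (B <= m j)%nat.
  { induction B as [|B [K IH]]; [exists 0%nat; intros; lia|].
   destruct (classic (exists K', forall j, (K' <= j)%nat -> m j <> B)) as [[K' HK']|Hn].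
   - exists (K+K')%nat. intros j Hj. specialize (IH j ltac:(lia)). specialize (HK' j ltac:(lia)). lia.
   - exfalso. apply Hno. exists B. intros K'. apply NNPP. intros Hn'. apply Hn. exists K'. intros j Hj E.
    apply Hn'. exists j. auto. }
  have Hone: forall (c: nat) (lim: sphere), (c < 2)%nat ->
   (forall e, 0 < e -> exists K, forall j q, (K <= j)%nat -> U q -> chordal (iter F (k+(c+2*j)) q) lim < e) ->
   (forall K, exists j, (K <= j)%nat /\ exists l, m j = (k+(c+2*l))%nat) ->
   exists phi : nat -> nat, (forall j, (phi j < phi (S j))%nat) /\ exists g, lu_conv (fun j => iter F (m (phi j))) g U.
  { intros c lim Hc Hl Hex. destruct (subsequence _ Hex) as (phi&H1&H2). exists phi. split; [auto|].
   exists (fun _ => lim). apply Hsub. intros e He. destruct (Hl e He) as [K HK], (Hinf (k+(c+2*K))%nat) as [K' HK'].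
    exists K'. intros j Hj q Hq.
   destruct (H2 j) as [l El]. rewrite El. apply HK; [|auto].
   specialize (HK' (phi j)). have := strict_mono_ge phi H1 j. lia. }
  destruct (classic (forall K, exists j, (K <= j)%nat /\ exists l, m j = (k+(0+2*l))%nat)) as [He|Hne].
  + apply (Hone 0%nat a); [lia| |auto]. intros e H0. destruct (Hlim e H0) as [K HK]. exists K. intros j q Hj Hq.
   apply HK; auto.
  + apply (Hone 1%nat b); [lia| |].
   * intros e H0. destruct (Hlim e H0) as [K HK]. exists K. intros j q Hj Hq. apply HK; auto.
   * apply not_all_ex_not in Hne. destruct Hne as [K1 Hne], (Hinf k) as [K2 HK2]. intros K.
    exists (K+K1+K2)%nat. split; [lia|]. specialize (HK2 (K+K1+K2)%nat ltac:(lia)).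
    destruct (Nat.Even_or_Odd (m (K+K1+K2)%nat-k)) as [[l El]|[l El]].
    -- exfalso. apply Hne. exists (K+K1+K2)%nat. split; [lia|]. exists l. lia.
    -- exists l. lia.
Qed.

(** Along a locally uniformly convergent subsequence all late iterates are close to one fixed
    iterate, which is continuous at [p]. Nearby points then stay together, against the assumed
    separation. *)
Lemma not_normal_of_sensitive F p e0 : (forall q, scont F q) -> 0 < e0 ->
 (forall r, 0 < r -> exists K0, forall k, (K0 <= k)%nat -> exists p', chordal p p' < r /\
  e0 <= chordal (iter F k p) (iter F k p')) -> ~ Fatou F p.
Proof.
 intros HF He0 Hs [r0 [Hr0 Hn]]. destruct (Hn (fun j => j)) as (phi&Hphi&g&Hg), (Hg p) as (r&Hr&_&Hc); [unfold ball;
  rewrite chordal_refl; auto|].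
 destruct (Hc (e0/8) ltac:(lra)) as [K HK], (scont_iter F (phi K) p HF (e0/8) ltac:(lra)) as (r1&Hr1&H1).
 destruct (Hs (Rmin r r1)) as [K0 HK0]; [apply Rmin_glb_lt; auto|].
 have Hge := strict_mono_ge phi Hphi (K+K0)%nat. destruct (HK0 (phi (K+K0)%nat) ltac:(lia)) as (p'&Hp'&He).
 have Hp1 := lt_min_l Hp'. have Hp2 := lt_min_r Hp'. have Hpp: chordal p p < r by (rewrite chordal_refl; auto).
 have A1 := HK (K+K0)%nat ltac:(lia) p Hpp. have A2 := HK (K+K0)%nat ltac:(lia) p' Hp1.
 have A3 := HK K (le_n _) p Hpp. have A4 := HK K (le_n _) p' Hp1. specialize (H1 p' Hp2).
 set (X := iter F (phi (K+K0)%nat) p) in *. set (X' := iter F (phi (K+K0)%nat) p') in *.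
 set (Y := iter F (phi K) p) in *. set (Y' := iter F (phi K) p') in *.
 have B1 := chordal_triangle X (g p) X'. have B2 := chordal_triangle (g p) Y X'.
 have B3 := chordal_triangle Y Y' X'. have B4 := chordal_triangle Y' (g p') X'.
 rewrite (chordal_sym (g p) Y) in B2. rewrite (chordal_sym (g p') X') in B4. lra.
Qed.

Lemma cantor_circles_ext J J' : (forall p, J p <-> J' p) -> cantor_circles J -> cantor_circles J'.
Proof.
 intros H [h [H1 [H2 [H3 H4]]]]. exists h. split; [intros p Hp; apply H, H1, Hp|].
 split; [intros y Hy; apply H2, H, Hy|]. split; auto.
Qed.

(** Compactness of the interval for an increasing family: if each parameter has a neighbourhood in
    some level, one level contains the whole loop. *)
Lemma interval_compact P : (forall j k t, (j <= k)%nat -> P j t -> P k t) ->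
 (forall t, 0 <= t <= 1 -> exists dl j, 0 < dl /\ forall t', 0 <= t' <= 1 -> Rabs (t-t') < dl -> P j t') ->
 exists j, forall t, 0 <= t <= 1 -> P j t.
Proof.
 intros Hm Hl. set (E := fun s => 0 <= s <= 1 /\ exists j, forall t, 0 <= t <= s -> P j t). have HE0: E 0.
 { split; [lra|]. destruct (Hl 0 ltac:(lra)) as (dl&j&Hdl&H). exists j. intros t Ht. apply H; [lra|].
  replace (0-t) with 0 by lra. rewrite Rabs_R0. auto. }
 destruct (completeness E) as (c&Hub&Hlub); [exists 1; intros s [Hs _]; lra|exists 0; auto|].
 have Hc: 0 <= c <= 1 by (split; [apply Hub, HE0|apply Hlub; intros s [Hs _]; lra]).
 destruct (Hl c Hc) as (dl&j&Hdl&H). have Hs: exists s, E s /\ c-dl < s.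
 { apply NNPP. intros Hno. have: c <= c-dl; [|lra]. apply Hlub. intros s HEs. apply Rnot_lt_le. intros Hlt. apply Hno.
  exists s. auto. }
 destruct Hs as [s [[Hs01 [k Hk]] Hs]]. have Hext: forall t, 0 <= t <= 1 -> t < c+dl -> P (j+k)%nat t.
 { intros t Ht Htc. destruct (Rle_or_lt t s) as [Hts|Hts]; [apply (Hm k); [lia|apply Hk; lra]|].
  apply (Hm j); [lia|]. apply H; [auto|]. apply Rabs_def1; lra. }
 exists (j+k)%nat. intros t Ht. apply Hext; [auto|]. have Hc1: Rmin 1 (c+dl/2) <= c.
 { apply Hub. have := Rmin_l 1 (c+dl/2). have := Rmin_r 1 (c+dl/2). split.
  - split; [apply Rmin_glb; lra|lra].
  - exists (j+k)%nat. intros t' Ht'. apply Hext; lra. }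
 unfold Rmin in Hc1. destruct (Rle_dec 1 (c+dl/2)); lra.
Qed.

(** * Loops and their contractions *)

Definition loop_in (Y: sphere -> Prop) (l: R -> sphere) : Prop :=
 (forall t, 0 <= t <= 1 -> Y (l t)) /\ path_cont l /\ l 0 = l 1.

Definition contr (U: sphere -> Prop) (b: sphere) (l: R -> sphere) : Prop := exists H : R -> R -> sphere,
  (forall s t, 0 <= s <= 1 -> 0 <= t <= 1 -> U (H s t)) /\ homot_cont H /\
  (forall t, 0 <= t <= 1 -> H 0 t = l t) /\ (forall s, 0 <= s <= 1 -> H s 0 = H s 1) /\
  (forall t, 0 <= t <= 1 -> H 1 t = b).

Lemma contr_concat U b K : (forall s t, 0 <= s <= 1 -> 0 <= t <= 1 -> U (K s t)) -> homot_cont K ->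
 (forall s, 0 <= s <= 1 -> K s 0 = K s 1) -> contr U b (K 1) -> contr U b (K 0).
Proof.
 intros HU HK HKl [H [H1 [H2 [H3 [H4 H5]]]]]. exists (fun s t => if Rle_dec s (1/2) then K (2*s) t else H (2*s-1) t).
 split; [|split; [|split; [|split]]].
 - intros s t Hs Ht. destruct (Rle_dec s (1/2)); [apply HU|apply H1]; lra.
 - intros s t Hs Ht e He. have HKc: s <= 1/2 -> exists dl, 0 < dl /\ forall s' t', 0 <= s' <= 1/2 -> 0 <= t' <= 1 ->
    Rabs (s-s') < dl -> Rabs (t-t') < dl -> chordal (K (2*s) t) (K (2*s') t') < e.
  { intros Hle. destruct (HK (2*s) t ltac:(lra) Ht e He) as (dl&Hdl&Hd). exists (dl/2). split; [lra|].
   intros s' t' Hs' Ht' A B. apply Hd; try lra. replace (2*s-2*s') with (2*(s-s')) by ring.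
   rewrite Rabs_mult, Rabs_pos_eq by lra. lra. }
  have HHc: 1/2 <= s -> exists dl, 0 < dl /\ forall s' t', 1/2 <= s' <= 1 -> 0 <= t' <= 1 ->
    Rabs (s-s') < dl -> Rabs (t-t') < dl -> chordal (H (2*s-1) t) (H (2*s'-1) t') < e.
  { intros Hle. destruct (H2 (2*s-1) t ltac:(lra) Ht e He) as (dl&Hdl&Hd). exists (dl/2). split; [lra|].
   intros s' t' Hs' Ht' A B. apply Hd; try lra. replace (2*s-1-(2*s'-1)) with (2*(s-s')) by ring.
   rewrite Rabs_mult, Rabs_pos_eq by lra. lra. }
  destruct (Rlt_or_le s (1/2)) as [L|L]; [|destruct (Rle_or_lt s (1/2)) as [L'|L']].
  + destruct (HKc ltac:(lra)) as (dl&Hdl&Hd). exists (Rmin dl (1/2-s)). split; [apply Rmin_glb_lt; lra|].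
   intros s' t' Hs' Ht' A B. have A1 := lt_min_l A. have A2 := lt_min_r A.
   have B1 := lt_min_l B. apply Rabs_def2 in A2.
   destruct (Rle_dec s (1/2)); [|lra]. destruct (Rle_dec s' (1/2)); [|lra]. apply Hd; lra.
  + have: s = 1/2 by lra. subst s. destruct (HKc ltac:(lra)) as (dl&Hdl&Hd), (HHc ltac:(lra)) as (dl'&Hdl'&Hd').
   exists (Rmin dl dl'). split; [apply Rmin_glb_lt; lra|].
   intros s' t' Hs' Ht' A B. have A1 := lt_min_l A. have A2 := lt_min_r A.
   have B1 := lt_min_l B. have B2 := lt_min_r B.
   destruct (Rle_dec (1/2) (1/2)); [|lra]. destruct (Rle_dec s' (1/2)); [apply Hd; lra|].
   specialize (Hd' s' t' ltac:(lra) Ht' A2 B2). replace (2*(1/2)-1) with 0 in Hd' by field.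
   rewrite H3 in Hd' by auto. replace (2*(1/2)) with 1 by field. auto.
  + destruct (HHc ltac:(lra)) as (dl&Hdl&Hd). exists (Rmin dl (s-1/2)). split; [apply Rmin_glb_lt; lra|].
   intros s' t' Hs' Ht' A B. have A1 := lt_min_l A. have A2 := lt_min_r A.
   have B1 := lt_min_l B. apply Rabs_def2 in A2.
   destruct (Rle_dec s (1/2)); [lra|]. destruct (Rle_dec s' (1/2)); [lra|]. apply Hd; lra.
 - intros t Ht. destruct (Rle_dec 0 (1/2)); [|lra]. rewrite Rmult_0_r. auto.
 - intros s Hs. destruct (Rle_dec s (1/2)); [apply HKl|apply H4]; lra.
 - intros t Ht. destruct (Rle_dec 1 (1/2)); [lra|]. replace (2*1-1) with 1 by ring. apply H5, Ht.
Qed.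

(** A contraction of the constant loop at [P] contains the path [s |-> H s 0] from [P] to [b], and a
    path cannot cross from one disjoint open set to another. *)
Lemma contr_connected U b : (forall P, U P -> contr U b (fun _ => P)) -> connected U.
Proof.
 intros Hc.
 have Hmain: forall O1 O2 : sphere -> Prop, open_set O1 -> open_set O2 -> (forall p, U p -> O1 p \/ O2 p) ->
   (forall p, U p -> O1 p -> O2 p -> False) -> O1 b -> forall P, U P -> O2 P -> False.
 { intros O1 O2 Ho1 Ho2 Hcov Hdis Hb P HP HP2. destruct (Hc P HP) as (H&H1&H2&H3&_&H5).
  have Hall: forall s, 0 <= s <= 1 -> O2 (H s 0).
  { set (E := fun s => 0 <= s <= 1 /\ forall t, 0 <= t <= s -> O2 (H t 0)).
   have HE0: E 0. { split; [lra|]. intros t Ht. replace t with 0 by lra. rewrite H3 by lra. auto. }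
   destruct (completeness E) as (c&Hub&Hlub); [exists 1; intros s [Hs _]; lra|exists 0; auto|].
   have Hc01: 0 <= c <= 1 by (split; [apply Hub, HE0|apply Hlub; intros s [Hs _]; lra]).
   have Hnear: forall O, open_set O -> O (H c 0) -> exists dl, 0 < dl /\ forall s, 0 <= s <= 1 -> Rabs (c-s) < dl -> O
    (H s 0).
   { intros O HO HOc. destruct (HO _ HOc) as (r&Hr&Hin), (H2 c 0 Hc01 ltac:(lra) r Hr) as (dl&Hdl&Hd).
    exists dl. split; [auto|]. intros s Hs Hsc. apply Hin, Hd; try lra. rewrite Rminus_diag, Rabs_R0. auto. }
   have Hlt: forall t, 0 <= t < c -> O2 (H t 0).
   { intros t Ht. apply NNPP. intros Hno. have: c <= t; [|lra]. apply Hlub. intros s [Hs Hs2]. apply Rnot_lt_le.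
    intros Hts.
    apply Hno, Hs2. lra. }
   destruct (Hcov (H c 0) (H1 c 0 Hc01 ltac:(lra))) as [HO|HO].
   - exfalso. destruct (Hnear O1 Ho1 HO) as (dl&Hdl&Hd), (Req_dec c 0) as [->|Hc0]; [rewrite H3 in HO by lra; exact
    (Hdis P HP HO HP2)|].
    set (t := Rmax 0 (c-dl/2)). have Ht: 0 <= t < c by (unfold t; split; [apply Rmax_l|apply Rmax_lub_lt; lra]).
    have Htc: c-dl/2 <= t by apply Rmax_r.
    apply (Hdis (H t 0)); [apply H1; lra| |apply Hlt, Ht]. apply Hd; [lra|]. rewrite Rabs_pos_eq; lra.
   - destruct (Hnear O2 Ho2 HO) as (dl&Hdl&Hd). have Hext: forall t, 0 <= t <= 1 -> t < c+dl -> O2 (H t 0).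
    { intros t Ht Htc. destruct (Rlt_or_le t c); [apply Hlt; lra|]. apply Hd; [auto|]. rewrite Rabs_left1; lra. }
    intros t Ht. apply Hext; [auto|]. have Hc1: Rmin 1 (c+dl/2) <= c.
    { apply Hub. have := Rmin_l 1 (c+dl/2). have := Rmin_r 1 (c+dl/2). split.
     - split; [apply Rmin_glb; lra|lra].
     - intros t' Ht'. apply Hext; lra. }
    unfold Rmin in Hc1. destruct (Rle_dec 1 (c+dl/2)); lra. }
  specialize (Hall 1 ltac:(lra)). rewrite H5 in Hall by lra.
   apply (Hdis b); [rewrite <- (H5 0) by lra; apply H1; lra|auto|auto]. }
 intros [O1 [O2 [Ho1 [Ho2 [Hcov [[P1 [HU1 HP1]] [[P2 [HU2 HP2]] Hdis]]]]]]].
 have HUb: U b. { destruct (Hc P1 HU1) as (H&H1&_&_&_&H5). rewrite <- (H5 0) by lra. apply H1; lra. }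
 destruct (Hcov b HUb) as [Hb|Hb].
 - exact (Hmain O1 O2 Ho1 Ho2 Hcov Hdis Hb P2 HU2 HP2).
 - apply (Hmain O2 O1 Ho2 Ho1) with (P := P1); auto.
  + intros p Hp. destruct (Hcov p Hp); auto.
  + intros p Hp A B. exact (Hdis p Hp B A).
Qed.

Lemma sphere_cases (P: sphere) : P = None \/ exists w : C, P = Some w.
Proof. destruct P as [w|]; [right; exists w|left]; auto. Qed.

Lemma scale_cont u : path_cont (fun t => Some (u t)) -> homot_cont (fun s t => Some (RtoC (1-s)*u t)%C).
Proof.
 intros Hu s t Hs Ht e He. set (A := Cmod (u t)+1). have HA: 0 < A by (unfold A; have := Cmod_ge_0 (u t); lra).
 destruct (chordal_finite_nbhd (u t) (e/4) ltac:(lra)) as (r&Hr&Hn), (Hu t Ht r Hr) as (d1&Hd1&H1).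
 exists (Rmin d1 (e/(4*A))). split; [apply Rmin_glb_lt; [auto|apply Rdiv_lt_0_compat; lra]|].
 intros s' t' Hs' Ht' B1 B2. destruct (Hn _ (H1 t' Ht' (lt_min_l B2))) as (w&E&Hw).
 apply Some_C in E. rewrite <- E in Hw. have B3 := lt_min_r B1.
 apply (proj2 (Rlt_div_r _ _ _ (ltac:(lra) : 0 < 4*A))) in B3. eapply Rle_lt_trans; [apply chordal_le|].
 replace (RtoC (1-s)*u t-RtoC (1-s')*u t')%C with (RtoC (s'-s)*u t+RtoC (1-s')*(u t-u t'))%C
  by (rewrite !RtoC_minus; ring).
 have Ht3 := Cmod_triangle (RtoC (s'-s)*u t)%C (RtoC (1-s')*(u t-u t'))%C.
 rewrite !Cmod_mult, !Cmod_R, (Rabs_pos_eq (1-s')), (Rabs_minus_sym s' s), (Cmod_sym (u t)) in Ht3 by lra.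
 have: (1-s')*Cmod (u t'-u t) <= 1*Cmod (u t'-u t) by (apply Rmult_le_compat_r; [apply Cmod_ge_0|lra]).
 have: Rabs (s-s')*Cmod (u t) <= Rabs (s-s')*A by (apply Rmult_le_compat_l; [apply Rabs_pos|unfold A; lra]). lra.
Qed.

(** The inversion [w |-> 1/w], an isometry of the chordal metric ([chordal_sinv]). It carries linear
    shrinking towards 0 over to neighbourhoods of infinity. *)
Definition sinv (P: sphere) : sphere :=
 match P with None => Some (RtoC 0) | Some w => if Defs.Ceq_dec w C0 then None else Some (/ w)%C end.

Lemma sinv_0 : sinv (Some (RtoC 0)) = None.
Proof. unfold sinv. destruct (Defs.Ceq_dec _ _) as [_|H]; [auto|]. exfalso. apply H. auto. Qed.

Lemma sinv_nz w : w <> RtoC 0 -> sinv (Some w) = Some (/ w)%C.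
Proof. intros H. unfold sinv. destruct (Defs.Ceq_dec _ _) as [E|_]; [|auto]. exfalso. exact (H E). Qed.

Lemma chordal_finite z w : chordal (Some z) (Some w) = 2*Cmod (z-w)/sqrt ((1+Cmod z*Cmod z)*(1+Cmod w*Cmod w)).
Proof. unfold chordal. rewrite !Cnorm2_Cmod. auto. Qed.

Lemma chordal_infinite z : chordal (Some z) None = 2/sqrt (1+Cmod z*Cmod z).
Proof. unfold chordal. rewrite Cnorm2_Cmod. auto. Qed.

Lemma chordal_sinv P Q : chordal (sinv P) (sinv Q) = chordal P Q.
Proof.
 have Hs: forall z : C, z <> RtoC 0 -> 0 < Cmod z /\
   sqrt (1+Cmod (/ z)*Cmod (/ z)) = sqrt (1+Cmod z*Cmod z)/Cmod z /\ 0 < sqrt (1+Cmod z*Cmod z).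
 { intros z Hz. have Hm := proj1 (Cmod_gt_0 z) Hz. rewrite Cmod_inv by auto. split; [auto|].
  have H1: 0 < 1+Cmod z*Cmod z by nra. have H0: 0 < sqrt (1+Cmod z*Cmod z) by (apply sqrt_lt_R0, H1).
  split; [|auto]. apply sqrt_eq; [left; apply Rdiv_lt_0_compat; auto|].
  replace (sqrt (1+Cmod z*Cmod z)/Cmod z*(sqrt (1+Cmod z*Cmod z)/Cmod z))
   with (sqrt (1+Cmod z*Cmod z)*sqrt (1+Cmod z*Cmod z)/(Cmod z*Cmod z)) by (field; lra).
  rewrite sqrt_sqrt by lra. field. lra. }
 have Hp: forall z : C, 0 < 1+Cmod z*Cmod z by (intros z; have := Cmod_ge_0 z; nra).
 have H1: forall z w : C, z <> RtoC 0 -> w <> RtoC 0 -> chordal (Some (/ z)%C) (Some (/ w)%C) = chordal (Some z) (Some w).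
 { intros z w Hz Hw. rewrite !chordal_finite, !sqrt_mult by (left; apply Hp).
  destruct (Hs z Hz) as (A1&A2&A3), (Hs w Hw) as (B1&B2&B3). rewrite A2, B2.
  replace (/ z - / w)%C with ((w-z)*(/ z * / w))%C by (field; auto).
  rewrite !Cmod_mult, !Cmod_inv, (Cmod_sym w z) by auto. field. lra. }
 have H2: forall z : C, z <> RtoC 0 -> chordal (Some (/ z)%C) (Some (RtoC 0)) = chordal (Some z) None.
 { intros z Hz. rewrite chordal_finite, chordal_infinite. destruct (Hs z Hz) as (A1&A2&A3).
  replace (/ z-RtoC 0)%C with (/ z)%C by ring. rewrite Cmod_0, Rmult_0_l, Rplus_0_r, Rmult_1_r, A2, Cmod_inv by auto.
   field. lra. }
 have H3: forall z : C, z <> RtoC 0 -> chordal (Some (/ z)%C) None = chordal (Some z) (Some (RtoC 0)).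
 { intros z Hz. rewrite chordal_finite, chordal_infinite. destruct (Hs z Hz) as (A1&A2&A3).
  replace (z-RtoC 0)%C with z by ring. rewrite Cmod_0, Rmult_0_l, Rplus_0_r, Rmult_1_r, A2. field. lra. }
 destruct (sphere_cases P) as [->|[z ->]]; [|destruct (classic (z = RtoC 0)) as [->|Hz]];
  (destruct (sphere_cases Q) as [->|[w ->]]; [|destruct (classic (w = RtoC 0)) as [->|Hw]]);
  rewrite ?sinv_0, ?(sinv_nz z), ?(sinv_nz w) by auto; change (sinv None) with (Some (RtoC 0) : sphere);
  first [rewrite !chordal_refl; auto|solve [auto]|apply chordal_sym
     |rewrite (chordal_sym _ (Some (/ w)%C)), (chordal_sym _ (Some w)); auto].
Qed.

(** * Julia set and parabolic components *)

Section RationalSystem.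

Context {n d1 dn : nat} {F : sphere -> sphere} {m : nat -> Z} {lc : nat -> R} {kap : nat -> C}
 {eps eps' : nat -> C -> C} {g e T x y : R}.
Hypothesis RS : @rat_sys n d1 dn F m lc kap eps eps' g e T x y.
Local Notation N := (d1*dn)%nat.
Local Notation q := (exp x).
Local Notation p := (exp y).
Local Notation Lam := (Lamb m kap eps).
Local Notation strip := (gstrip n lc).
Local Notation lo := (ln (exp x-T)).

Lemma Dn_pos : 2 <= INR dn /\ 2 <= INR d1 /\ INR N = INR d1*INR dn /\ 4 <= INR N /\ INR dn <= INR N /\ INR d1 <= INR N.
Proof.
 destruct (rs_d RS) as [H1 H2]. apply (le_INR 2) in H1. apply (le_INR 2) in H2. simpl in H1, H2.
  have: INR N = INR d1*INR dn by apply mult_INR. repeat split; try auto; nra.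
Qed.

Lemma kaN_pos : 0 < kaN N <= / 1000000 /\ 1000000*(INR N*INR N*INR N*INR N)*kaN N = 1.
Proof.
 destruct Dn_pos as (_&_&_&H&_). set (D := INR N) in *. have H2: 16 <= D*D by nra. have H4: 256 <= D*D*D*D.
 { nra. }
 unfold kaN. fold D. repeat split.
 - apply Rinv_0_lt_compat. lra.
 - apply Rinv_le_contravar; lra.
 - apply Rinv_r. lra.
Qed.

Lemma e_small : 100*(INR N*INR N)*e <= / 10^20 /\ e <= / 1000000.
Proof.
 have Hs := rs_small RS. destruct kaN_pos as [[H1 H2] _]. have He := rs_e RS.
 have H5: kaN N^5 <= (/ 1000000)^5 by (apply pow_incr; lra). have E: (/ 1000000)^5 <= / 10^20.
 { rewrite pow_inv. apply Rinv_le_contravar; lra. }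
 destruct Dn_pos as (_&_&_&H&_). have H6: 100*(INR N*INR N)*e <= / 10^20 by lra. split; [auto|].
 have: 1*e <= 100*(INR N*INR N)*e by (apply Rmult_le_compat_r; nra). lra.
Qed.

Lemma x_lt_y : x+60 <= y.
Proof.
 have := rs_K1 RS. have := rs_K2 RS. have Hn := rs_n RS.
 have := rs_sep RS 1%nat (n-1)%nat (le_n _) ltac:(lia) ltac:(lia). have := rs_g RS. destruct Dn_pos as [? _]. lra.
Qed.

Lemma lc_n1 : lc (n-1)%nat+4*g+4 <= lc 1%nat.
Proof.
 have Hn := rs_n RS. apply (rs_sep RS 1%nat (n-1)%nat (le_n _)); lia.
Qed.

Lemma T_q_p : 0 < T /\ T < q /\ 50*q <= p.
Proof.
 destruct (rs_T RS) as [H1 H2]. have := x_lt_y. replace y with (x+(y-x)) by ring. rewrite exp_plus.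
 have := exp_ineq1_le (y-x). nra.
Qed.

(** [Lf X] is a logarithm of [T+Cexp X] ([Cexp_Lf]), and it undoes [Xf] below. The shapes [1*X+0]
    and [1*v+x] match [C11_affine]. *)
Definition rr (X: C) : C := Log1m (RtoC (- T)*Cexp (RtoC (-1)*X))%C.
Definition rr' (X: C) : C :=
 (- / (1-RtoC (- T)*Cexp (RtoC (-1)*X))*(RtoC (- T)*(Cexp (RtoC (-1)*X)*(RtoC (-1)*1))))%C.
Definition Lf (X: C) : C := (1*X+0+rr X)%C.
Definition ax (v: C) : C := (1*v+RtoC x)%C.
Definition Ln (v: C) : C := Lam n (ax v).
(** In logarithms the second iterate is [Lam 1] after [Lf] after [Lam n], with linear part
    [(-d1)*(-dn) = N]. What is left beyond the linear part and constants is [et0], and [et] is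
    normalised to vanish at 0; [Xi_eq] states the outcome. *)
Definition et0 (v: C) : C := (RtoC (- INR d1)*eps n (ax v)+(RtoC (- INR d1)*rr (Ln v)+eps 1%nat (Lf (Ln v))))%C.
Definition et (v: C) : C := (et0 v+(0*v-et0 0))%C.
Definition et' (v: C) : C := (RtoC (- INR d1)*(eps' n (ax v)*1) +
  (RtoC (- INR d1)*(rr' (Ln v)*((RtoC (IZR (m n))+eps' n (ax v))*1)) +
  eps' 1%nat (Lf (Ln v))*((1+rr' (Ln v))*((RtoC (IZR (m n))+eps' n (ax v))*1)))+0)%C.
(** Large enough to admit all points [G n (G 1 u)] ([block_base]), and small enough for [Ln v] to
    stay above the outermost circle ([Ln_Re]). *)
Definition MM : R := (y-lc 1%nat-2*g+2)/INR dn.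
Definition thq : R := 1-T/q.

Lemma MM_ge : 20 <= MM /\ INR dn*MM = y-lc 1%nat-2*g+2.
Proof.
 destruct Dn_pos as [H _]. unfold MM. split; [|field; lra].
 apply (proj1 (Rle_div_r _ _ _ (ltac:(lra) : 0 < INR dn))). have := rs_K1 RS. lra.
Qed.

Lemma ax_strip v : Re v <= MM -> strip g n (ax v).
Proof.
 intros H. split; [congruence|]. intros _. unfold ax. rewrite re_plus, re_RtoC.
 replace (1*v)%C with v by ring. have := rs_M RS. fold MM in H0. lra.
Qed.

Lemma Lam_diff i u v : (1 <= i <= n)%nat -> strip g i u -> strip g i v ->
 Cmod (Lam i u-Lam i v-RtoC (IZR (m i))*(u-v))%C <= e*Cmod (u-v).
Proof.
 intros Hi Hu Hv. unfold Lamb.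
 replace (RtoC (IZR (m i))*u+kap i+eps i u-(RtoC (IZR (m i))*v+kap i+eps i v)-RtoC (IZR (m i))*(u-v))%C
  with (eps i u-eps i v)%C by ring.
 apply (C11_lip (strip g i) (eps i) (eps' i) e e); try auto.
 - intros a b t [H1 H2] [H3 H4] Ht. split; intros Hi'.
  + apply (Cconvex_Re_ge (lc i+g)); auto.
  + apply (Cconvex_Re_le (lc (i-1)%nat-g)); auto.
 - apply (rs_C11 RS), Hi.
Qed.

Lemma pT_ln : y-1 <= ln (p-T) <= y.
Proof.
 destruct T_q_p as (H1&H2&H3). split.
 - rewrite <- (ln_exp (y-1)). apply ln_le; [apply exp_pos|].
  unfold Rminus at 1. rewrite exp_plus. have: exp (Ropp 1) <= / 2.
  { rewrite exp_Ropp. apply Rinv_le_contravar; [lra|]. have := exp_ineq1_le 1. lra. }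
  nra.
 - rewrite <- (ln_exp y) at 2. apply ln_le; lra.
Qed.

Lemma Ln_Re v : Re v <= MM -> lc 1%nat+g+1 <= Re (Ln v).
Proof.
 intros Hv. have Hn := rs_n RS. destruct MM_ge as [HM HM']. have H0: strip g n (x).
 { replace (RtoC x) with (ax 0) by (unfold ax; ring). apply ax_strip. simpl. lra. }
 have HE: (Lam n (ax v)-Lam n (x) = RtoC (IZR (m n))*v+(eps n (ax v)-eps n (x)))%C by (unfold Lamb, ax; ring).
 rewrite (rs_Ln RS), (rs_mn RS) in HE.
 apply (f_equal Re) in HE. rewrite Re_minus, re_plus, re_scal_l, re_RtoC in HE. fold (Ln v) in HE.
 have E1 := rs_eps RS n (ax v) ltac:(lia) (ax_strip v Hv). have E2 := rs_eps RS n (x) ltac:(lia) H0.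
 have := Cmod_minus_le (eps n (ax v)) (eps n (x)).
 have := Re_ge_Cmod (eps n (ax v)-eps n (x))%C. destruct e_small as [_ He].
 have: INR dn*Re v <= INR dn*MM by (apply Rmult_le_compat_l; [destruct Dn_pos; lra|auto]).
 have := pT_ln. have := rs_g RS. lra.
Qed.

Lemma rr_arg X : lc 1%nat+g <= Re X -> Cmod (RtoC (- T)*Cexp (RtoC (-1)*X))%C <= e/16.
Proof.
 intros H. rewrite RtoC_opp. destruct T_q_p as (H1&H2&H3).
 rewrite Cmod_mult, Cmod_opp, Cmod_pos_R by lra. rewrite Cmod_Cexp, re_scal_l. have HT := rs_Te RS. have := rs_g RS.
 apply Rle_trans with (q*exp (-1*Re X)).
 - apply Rmult_le_compat_r; [left; apply exp_pos|lra].
 - rewrite <- exp_plus. have: exp (x + -1*Re X) <= exp (x-lc 1%nat) by (apply exp_le; lra). lra.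
Qed.

Lemma rr_C11 : C11 (fun X => lc 1%nat+g <= Re X) rr rr' e e.
Proof.
 have He := rs_e RS. destruct e_small as [_ He'].
 eapply C11_weaken; [| | |apply (C11_Log1m_exp (fun X => lc 1%nat+g <= Re X) (RtoC (- T)) (RtoC (-1)) (e/16))].
 - auto.
 - rewrite Cmod_R, Rabs_left by lra. lra.
 - rewrite Cmod_R, Rabs_left by lra. lra.
 - apply Cconvex_Re_ge.
 - lra.
 - apply rr_arg.
Qed.

Lemma rr_bound X : lc 1%nat+g <= Re X -> Cmod (rr X) <= e.
Proof.
 intros H. have Ha := rr_arg X H. destruct e_small as [_ He']. have He := rs_e RS.
  eapply Rle_trans; [apply (Log1m_bound (1/2)); lra|]. lra.
Qed.

Lemma Lf_strip X : lc 1%nat+g+1 <= Re X -> strip g 1 (Lf X) /\ Re X-1 <= Re (Lf X).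
Proof.
 intros H. have H': Re X-1 <= Re (Lf X).
 { unfold Lf. replace (1*X+0)%C with X by ring. rewrite re_plus. have := rr_bound X ltac:(lra).
  have := Re_ge_Cmod (rr X). destruct e_small as [_ He']. lra. }
 split; [|auto]. split; [intros _; lra|congruence].
Qed.

Lemma et_C11 : C11 (fun v => Re v <= MM) et et' (100*(INR N*INR N)*e) (100*(INR N*INR N)*e).
Proof.
 have Hn := rs_n RS. have He := rs_e RS. destruct e_small as [HeN He'], Dn_pos as (HD&HD1&HN&HN4&HDN&HD1N).
  set (D := INR dn) in *. set (D1 := INR d1) in *.
 set (S := fun v : C => Re v <= MM). have HS: Cconvex S by apply Cconvex_Re_le. have Ca: C11 S ax (fun _ => 1%C) 1 0.
 { have H := C11_affine S 1 (x). rewrite Cmod_1 in H. exact H. }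
 have Cen: C11 S (fun v => eps n (ax v)) (fun v => eps' n (ax v)*1)%C e e.
 { eapply C11_weaken; [| | |apply (C11_comp S (strip g n) ax (fun _ => 1%C) (eps n) (eps' n) 1 0 e e)]; try lra; auto.
  - apply (rs_C11 RS). lia.
  - apply ax_strip. }
 have CLn: C11 S Ln (fun v => (RtoC (IZR (m n))+eps' n (ax v))*1)%C (2*D) e.
 { eapply C11_weaken; [| | |apply (C11_comp S (strip g n) ax (fun _ => 1%C) (Lam n) (fun z => RtoC (IZR (m n))+eps' n
  z)%C 1 0 (D+e) e)];
   try lra; auto.
  - eapply C11_weaken; [| | |apply (C11_plus (strip g n) (fun z => RtoC (IZR (m n))*z+kap n)%C (fun _ => RtoC (IZR (m n)))
     (eps n) (eps' n) (Cmod (RtoC (IZR (m n)))) 0 e e)]; auto.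
   + rewrite (rs_mn RS), Cmod_R, Rabs_Ropp, Rabs_pos_eq by (fold D; lra). fold D. lra.
   + lra.
   + apply C11_affine.
   + apply (rs_C11 RS). lia.
  - apply ax_strip. }
 have HLS: forall v, S v -> lc 1%nat+g <= Re (Ln v) by (intros v Hv; have := Ln_Re v Hv; lra).
 have Cr: C11 S (fun v => rr (Ln v)) (fun v => rr' (Ln v)*((RtoC (IZR (m n))+eps' n (ax v))*1))%C
   (2*D*e) (e*(4*(D*D)+1)).
 { eapply C11_weaken; [| | |apply (C11_comp S (fun X => lc 1%nat+g <= Re X) Ln
    (fun v => (RtoC (IZR (m n))+eps' n (ax v))*1)%C rr rr' (2*D) e e e)]; auto; try lra.
  - have: e*e <= e*1 by mono. lra.
  - apply rr_C11. }
 have CLf: C11 (fun X => lc 1%nat+g <= Re X) Lf (fun X => 1+rr' X)%C 2 e.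
 { eapply C11_weaken; [| | |apply (C11_plus (fun X => lc 1%nat+g <= Re X) (fun X => 1*X+0)%C (fun _ => 1%C) rr rr' 1 0
  e e)]; auto; try lra.
  - have H := C11_affine (fun X => lc 1%nat+g <= Re X) 1 0. rewrite Cmod_1 in H. exact H.
  - apply rr_C11. }
 have HeD: e*(4*(D*D)+2) <= 1.
 { have: 4*(D*D)+2 <= 100*(INR N*INR N) by nra. have: e*(4*(D*D)+2) <= e*(100*(INR N*INR N)) by mono.
  have: / 10^20 <= 1. { rewrite <- Rinv_1. apply Rinv_le_contravar; lra. } lra. }
 have CLL: C11 S (fun v => Lf (Ln v)) (fun v => (1+rr' (Ln v))*((RtoC (IZR (m n))+eps' n (ax v))*1))%C (4*D) 1.
 { eapply C11_weaken; [| | |apply (C11_comp S (fun X => lc 1%nat+g <= Re X) Ln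
    (fun v => (RtoC (IZR (m n))+eps' n (ax v))*1)%C Lf (fun X => 1+rr' X)%C (2*D) e 2 e)]; auto; lra. }
 have Ce1: C11 S (fun v => eps 1%nat (Lf (Ln v)))
   (fun v => eps' 1%nat (Lf (Ln v))*((1+rr' (Ln v))*((RtoC (IZR (m n))+eps' n (ax v))*1)))%C (4*D*e) (e*(16*(D*D)+1)).
 { eapply C11_weaken; [| | |apply (C11_comp S (strip g 1) (fun v => Lf (Ln v))
    (fun v => (1+rr' (Ln v))*((RtoC (IZR (m n))+eps' n (ax v))*1))%C (eps 1%nat) (eps' 1%nat) (4*D) 1 e e)]; auto; try
     lra.
  - apply (rs_C11 RS). lia.
  - intros v Hv. apply Lf_strip, Ln_Re, Hv. }
 apply (C11_scal S (RtoC (- D1))) in Cen. apply (C11_scal S (RtoC (- D1))) in Cr.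
 rewrite Cmod_R, Rabs_Ropp, Rabs_pos_eq in Cen, Cr by lra.
 have Ct := C11_plus _ _ _ _ _ _ _ _ _ Cen (C11_plus _ _ _ _ _ _ _ _ _ Cr Ce1).
 have Ct' := C11_plus _ _ _ _ _ _ _ _ _ Ct (C11_affine S 0 (- et0 0)%C).
 eapply C11_weaken; [| | |exact Ct']; auto; rewrite ?Cmod_0.
 - replace (D1*e+(D1*(2*D*e)+4*D*e)+0) with ((D1+2*(D1*D)+4*D)*e) by ring. apply Rmult_le_compat_r; [auto|]. nra.
 - replace (D1*e+(D1*(e*(4*(D*D)+1))+e*(16*(D*D)+1))+0) with ((2*D1+4*((D1*D)*D)+16*(D*D)+1)*e) by ring.
  apply Rmult_le_compat_r; [auto|]. nra.
Qed.

Lemma Xi_eq v : mXi N et v = (Lam 1 (Lf (Ln v))-Lam 1 (Lf (Ln 0)))%C.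
Proof.
 destruct Dn_pos as (_&_&HN&_). unfold mXi, et, et0. rewrite HN, RtoC_mult.
 unfold Lamb at 1 2. rewrite (rs_m1 RS). unfold Lf, Ln, Lamb. rewrite (rs_mn RS). unfold ax. rewrite !RtoC_opp. ring.
Qed.

Lemma Ln_0 : Ln 0 = RtoC (ln (p-T)).
Proof.
 unfold Ln. replace (ax 0) with (RtoC x) by (unfold ax; ring). apply (rs_Ln RS).
Qed.

Lemma rr_arg0 : (RtoC (- T)*Cexp (RtoC (-1)*Ln 0) = RtoC (- T/(p-T)))%C.
Proof.
 destruct T_q_p as (H1&H2&H3). rewrite Ln_0, <- RtoC_mult, Cexp_R, <- RtoC_mult.
 replace (-1*ln (p-T)) with (- ln (p-T)) by ring. rewrite exp_Ropp, exp_ln by lra. auto.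
Qed.

Lemma Lf_Ln_0 : Lf (Ln 0) = RtoC y.
Proof.
 destruct T_q_p as (H1&H2&H3). unfold Lf, rr. rewrite rr_arg0, Ln_0. unfold Log1m, Clog.
 replace (1-RtoC (- T/(p-T)))%C with (RtoC (p/(p-T))) by (rewrite <- RtoC_minus; f_equal; field; lra).
 rewrite Cmod_pos_R by (left; apply Rdiv_lt_0_compat; lra).
 unfold Rdiv at 1. rewrite ln_mult, ln_Rinv, ln_exp by (try apply Rinv_0_lt_compat; lra).
 apply C_ext; unfold Re, Im; simpl; [ring|]. rewrite Rdiv_0_l, atan_0. ring.
Qed.

Lemma Cexp_Lf X : lc 1%nat+g <= Re X -> Cexp (Lf X) = (RtoC T+Cexp X)%C.
Proof.
 intros H. unfold Lf. replace (1*X+0)%C with X by ring. destruct e_small as [_ He'].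
 rewrite Cexp_plus. unfold rr. rewrite Cexp_Log1m by (have := rr_arg X H; lra).
 replace (RtoC (-1)*X)%C with (- X)%C by ring. rewrite Cexp_opp, RtoC_opp. field. apply Cexp_neq0.
Qed.

Lemma th_pos : 0 < thq < 1 /\ q*thq = q-T /\ RtoC (1-thq) = RtoC (T/q).
Proof.
 destruct T_q_p as (H1&H2&H3). have := exp_pos x. unfold thq. repeat split.
 - have: T/q < 1; [|lra]. apply (proj2 (Rlt_div_l _ _ _ H)). lra.
 - have: 0 < T/q; [|lra]. apply Rdiv_lt_0_compat; lra.
 - field. lra.
 - f_equal. ring.
Qed.

(** With [ka = kaN N] all scales are powers of [ka] up to powers of [N]. The most demanding
    comparison is [lm_s4], of [ep] with [mu^2], which is of order [N^2*ka^4]; the fifth power in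
    [rs_small] leaves room for it. *)
Lemma LM : @local_model N (kaN N) (16*INR N*kaN N) (2*kaN N*(16*INR N*kaN N)) (kaN N/(4000*INR N))
  (100*(INR N*INR N)*e) MM thq et et'.
Proof.
 destruct kaN_pos as [[Hk1 Hk2] Hk3], Dn_pos as (HD&HD1&HN&HN4&HDN&HD1N). have He := rs_e RS. have Hsm := rs_small RS.
 set (ep := 100*(INR N*INR N)*e) in *. set (ka := kaN N) in *.
 have Hep0: 0 <= ep by (unfold ep; apply Rmult_le_pos; [nra|auto]). set (D := INR N) in *. set (ka2 := ka*ka).
 have Hka2: 0 < ka2 <= ka/1000000 by (unfold ka2; split; nra). have HDk: D*ka <= / 1000000/64.
 { have: 64 <= D*D*D by nra. have E: D*ka*(1000000*(D*D*D)) = 1 by (rewrite <- Hk3; ring).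
  have: 0 < D*ka by nra. have: D*ka*(1000000*64) <= 1; [|lra]. rewrite <- E. apply Rmult_le_compat_l; lra. }
 have Hep4: ep <= ka2*ka2*ka.
 { replace (ka2*ka2*ka) with (ka^5) by (unfold ka2; ring). auto. }
 have Hk4: 0 < ka2*ka2 <= ka2/1000000. { split; [nra|]. nra. }
 have Hepk: ep <= ka2*ka2/1000000. { eapply Rle_trans; [exact Hep4|]. apply Rmult_le_compat_l; lra. }
 constructor; fold D; try auto; try lra.
 - have: D*D*D*ep <= D*D*D*D*ka.
  { apply Rle_trans with (D*D*D*(D*ka)); [|right; ring]. apply Rmult_le_compat_l; [nra|].
   have: ka <= D*ka by nra. lra. }
  lra.
 - have: D*D*ka*16 <= D*D*D*D*ka; [|lra].
  replace (D*D*D*D*ka) with (D*D*ka*(D*D)) by ring. apply Rmult_le_compat_l; nra.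
 - nra.
 - replace (2*ka*(16*D*ka)*(2*ka*(16*D*ka))) with (1024*(D*D)*(ka2*ka2)) by (unfold ka2; ring).
  have: 400*D*ep <= 400*D*(ka2*ka2/1000000) by mono.
  have: D*(ka2*ka2) <= D*D*(ka2*ka2) by (apply Rmult_le_compat_r; nra).
  have: 0 <= D*(ka2*ka2) by (apply Rmult_le_pos; lra). lra.
 - nra.
 - split; [apply Rdiv_lt_0_compat; lra|]. right. field. lra.
 - replace (ka/(4000*D)*(ka/(4000*D))) with (ka2/(16000000*(D*D))) by (unfold ka2; field; lra).
  apply (proj1 (Rle_div_r _ _ _ (ltac:(nra) : 0 < 16000000*(D*D)))).
  replace (200000*(D*D)*ep*(16000000*(D*D))) with (3200000000000*(D*D*D*D)*ep) by ring.
  apply Rle_trans with (3200000000000*(D*D*D*D)*(ka2*ka2*ka)).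
  { apply Rmult_le_compat_l; [nra|auto]. }
  replace (3200000000000*(D*D*D*D)*(ka2*ka2*ka)) with (3200000*(1000000*(D*D*D*D)*ka)*(ka2*ka2)) by ring.
  rewrite Hk3. have: ka2*ka2 <= / 1000000/1000000*ka2 by mono. lra.
 - destruct MM_ge. lra.
 - apply et_C11.
 - unfold et. ring.
 - intros v k. have Hax: ax (v+turn k)%C = (ax v+turn k)%C by (unfold ax; ring).
  have HLn: Ln (v+turn k)%C = (Ln v+turn (m n*k))%C.
  { unfold Ln. rewrite Hax. unfold Lamb. rewrite (rs_per RS), mult_IZR.
   replace (iI (2*PI*(IZR (m n)*IZR k))) with (RtoC (IZR (m n))*turn k)%C
    by (unfold iI; apply C_ext; unfold Re, Im; simpl; ring). ring. }
  have Hrr: forall X j, rr (X+turn j)%C = rr X.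
  { intros X j. unfold rr. do 2 f_equal.
   replace (RtoC (-1)*(X+turn j))%C with (RtoC (-1)*X+turn (- j))%C; [apply Cexp_period|].
   rewrite opp_IZR. apply C_ext; unfold Re, Im; simpl; ring. }
  have HLf: forall X j, Lf (X+turn j)%C = (Lf X+turn j)%C.
  { intros X j. unfold Lf. rewrite Hrr. ring. }
  unfold et, et0. rewrite Hax, HLn, HLf, Hrr, !(rs_per RS). ring.
 (* This is the multiplier equation divided by [p*q]: the derivative of [Lf] at [Ln 0] contributes
    [(p-T)/p], and [thq] is [(q-T)/q]. *)
 - have Hr: (1+rr' (Ln 0) = RtoC ((p-T)/p))%C.
  { destruct T_q_p as (T1&T2&T3). unfold rr'. replace (RtoC (- T)*(Cexp (RtoC (-1)*Ln 0)*(RtoC (-1)*1)))%C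
    with (- (RtoC (- T)*Cexp (RtoC (-1)*Ln 0)))%C by ring.
   rewrite rr_arg0.
   replace (1-RtoC (- T/(p-T)))%C with (RtoC (p/(p-T))) by (rewrite <- RtoC_minus; f_equal; field; lra).
   rewrite <- RtoC_inv by (apply Rgt_not_eq, Rdiv_lt_0_compat; lra).
   rewrite <- !RtoC_opp, <- RtoC_mult, <- RtoC_plus. f_equal. field. lra. }
  destruct T_q_p as (T1&T2&T3). have Hr': rr' (Ln 0) = (RtoC ((p-T)/p)-1)%C by (rewrite <- Hr; ring).
  unfold et'. rewrite Lf_Ln_0, Hr'. replace (ax 0) with (RtoC x) by (unfold ax; ring). rewrite (rs_mn RS).
  have Hm := rs_mult RS. rewrite HN, RtoC_mult. apply (f_equal (fun z => z*RtoC (/ (q*p)))%C) in Hm.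
  rewrite <- (RtoC_mult (q*p)), Rinv_r in Hm by nra.
  rewrite <- Cmult_assoc, <- (RtoC_mult (_*_)) in Hm. etransitivity; [|exact Hm].
  replace ((q-T)*(p-T) * / (q*p)) with (thq*((p-T)/p)) by (unfold thq; field; lra).
  rewrite RtoC_mult, !RtoC_opp. ring.
Qed.

(** * The set Om and the inverse branches *)

Local Notation fm := (mf N thq et).

Definition V0 (w: C) : Prop := (mV N (kaN N)) (RtoC (exp (- x))*w)%C.
Definition V0c (w: C) : Prop := (mVc N (kaN N)) (RtoC (exp (- x))*w)%C.

Lemma qexp z : (RtoC (exp (- x))*Cexp z)%C = Cexp (z-RtoC x)%C.
Proof. rewrite Cexp_minus, Cexp_R, exp_Ropp, RtoC_inv; [field|]; try (intros E; injection E); have := exp_pos x; lra. Qed.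

Lemma n_ge : (3 <= n)%nat.
Proof. exact (rs_n RS). Qed.

Lemma strip_mono g1 g2 i z : g1 <= g2 -> strip g2 i z -> strip g1 i z.
Proof. intros H [H1 H2]. split; intros Hi; [specialize (H1 Hi)|specialize (H2 Hi)]; lra. Qed.

Lemma g_pos : 6 <= g.
Proof. exact (rs_g RS). Qed.

Lemma strip_2g i z : strip (2*g) i z -> strip g i z.
Proof. apply strip_mono. have := g_pos. lra. Qed.

Lemma V0_norm w : (RtoC (exp (- x))*(RtoC T+w) = RtoC (1-thq)+RtoC (exp (- x))*w)%C.
Proof.
 destruct th_pos as (_&_&->). rewrite exp_Ropp. unfold Rdiv. rewrite RtoC_mult. ring.
Qed.

Lemma V0_ball w : Cmod w <= q-T -> (RtoC T+w)%C <> RtoC q -> V0 (RtoC T+w)%C.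
Proof.
 intros Hw Hne. unfold V0. rewrite V0_norm. have Hq := exp_pos x. destruct th_pos as (Hth&E&_). apply (V_ball LM).
 - rewrite Cmod_mult, Cmod_pos_R by (left; apply exp_pos). rewrite exp_Ropp, Rmult_comm.
  apply (proj2 (Rle_div_l _ _ _ Hq)). lra.
 - rewrite <- V0_norm. intros H. apply Hne.
  apply (f_equal (fun z => q*z)%C) in H. rewrite Cmult_assoc, <- RtoC_mult, <- exp_plus in H.
  replace (x + - x) with 0 in H by ring. rewrite exp_0 in H.
  replace (T+w)%C with (1*(T+w))%C by ring. rewrite H. ring.
Qed.

Lemma V0_ball_lt w : Cmod w < q-T -> V0 (RtoC T+w)%C.
Proof.
 intros H. apply V0_ball; [lra|]. intros E. destruct T_q_p as (H1&H2&_).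
 have E': w = RtoC (q-T) by (rewrite RtoC_minus, <- E; ring). rewrite E', Cmod_pos_R in H by lra. lra.
Qed.

Lemma V0c_Re z : V0c (Cexp z) -> Re z <= x+1.
Proof.
 unfold V0c. rewrite qexp. intros H. apply (Vc_bounded LM) in H. rewrite Cmod_Cexp, Re_minus, re_RtoC in H.
 have := exp_1_gt_2. have: Re z-x <= 1; [|lra]. apply Rnot_lt_le. intros Hlt. apply exp_increasing in Hlt. lra.
Qed.

Lemma V0_V0c w : V0 w -> V0c w.
Proof. apply V_Vc. Qed.

(** The logarithmic radius of a round disc around 0 that is contained in the petal and still
    contains [T]. Outside it [|T/w| < 1], so [log (w-T)] has the branch [Xf]. *)
Definition lw : R := x+ln (1-3/(4*INR N)).

Lemma lw_bounds : x-1 <= lw < x /\ T*exp (- lw) < 1.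
Proof.
 destruct Dn_pos as (_&_&_&HN&_). set (D := INR N) in *. unfold lw. fold D.
 have Hi: 0 < / D <= / 4 by (split; [apply Rinv_0_lt_compat|apply Rinv_le_contravar]; lra).
 have E: 3/(4*D) = 3/4 * / D by (field; lra). rewrite E.
 set (c := 1-3/4 * / D). have Hc: 13/16 <= c < 1 by (unfold c; lra).
 have L1: ln c < 0 by (rewrite <- ln_1; apply ln_increasing; lra). have L2: -1 <= ln c.
 { rewrite <- (ln_exp (-1)). apply ln_le; [apply exp_pos|].
  have := exp_1_gt_2. replace (-1) with (Ropp 1) by ring. rewrite exp_Ropp.
  have: / exp 1 <= / 2 by (apply Rinv_le_contravar; lra). lra. }
 split; [lra|]. replace (- (x+ln c)) with (- x + - ln c) by ring. rewrite exp_plus, !exp_Ropp, exp_ln by lra.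
 have Hq := exp_pos x. have Ht := th_lower LM. fold D in Ht. replace (T*(/ q * / c)) with (T/q/c) by (field; lra).
 apply (proj2 (Rlt_div_l _ _ _ (ltac:(lra) : 0 < c))). unfold thq in Ht. have: 3/4 * / D < / (D+1); [|unfold c; lra].
 replace (3/4 * / D) with (/ (4/3*D)) by (field; lra). apply Rinv_lt_contravar; [|lra]. apply Rmult_lt_0_compat; lra.
Qed.

Lemma notV0_lower z : ~ V0 (Cexp z) -> lw <= Re z /\ q-T <= Cmod (Cexp z-RtoC T).
Proof.
 intros H. split.
 - apply Rnot_lt_le. intros Hlt. apply H. unfold V0. rewrite qexp. apply (V_small LM).
  rewrite Cmod_Cexp, Re_minus, re_RtoC. destruct Dn_pos as (_&_&_&HN&_).
  have Hi: 3/(4*INR N) < 1. { apply (proj2 (Rlt_div_l _ _ _ (ltac:(lra) : 0 < 4*INR N))). lra. }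
  rewrite <- (exp_ln (1-3/(4*INR N))) by lra. apply exp_le. unfold lw in Hlt. lra.
 - apply Rnot_lt_le. intros Hlt. apply H. replace (Cexp z) with (T+(Cexp z-T))%C by ring. apply V0_ball_lt, Hlt.
Qed.

Definition Xf (z: C) : C := (z+Log1m (RtoC T*Cexp (- z)))%C.

Lemma Xf_arg r z : r <= Re z -> Cmod (RtoC T*Cexp (- z))%C <= T*exp (- r).
Proof.
 intros H. destruct T_q_p as [H1 _]. rewrite Cmod_mult, Cmod_pos_R, Cmod_Cexp, re_opp by lra.
 apply Rmult_le_compat_l; [lra|]. apply exp_le. lra.
Qed.

Lemma Cexp_Xf z : lw <= Re z -> Cexp (Xf z) = (Cexp z-RtoC T)%C.
Proof.
 intros H. unfold Xf. rewrite Cexp_plus, Cexp_Log1m.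
 - rewrite Cexp_opp. field. apply Cexp_neq0.
 - eapply Rle_lt_trans; [apply (Xf_arg lw); exact H|apply lw_bounds].
Qed.

Lemma Xf_lip r u v : T*exp (- r) < 1 -> r <= Re u -> r <= Re v ->
 Cmod (Xf u-Xf v) <= (1+T*exp (- r)/(1-T*exp (- r)))*Cmod (u-v).
Proof.
 intros Hb Hu Hv. set (b := T*exp (- r)) in *. unfold Xf. replace (u+Log1m (T*Cexp (- u))-(v+Log1m (T*Cexp (- v))))%C
  with ((u-v)+(Log1m (T*Cexp (- u))-Log1m (T*Cexp (- v))))%C by ring.
 le_trans Cmod_triangle. rewrite Rmult_plus_distr_r, Rmult_1_l. apply Rplus_le_compat_l.
 eapply Rle_trans; [apply (Log1m_lipschitz b); [auto|apply Xf_arg; auto|apply Xf_arg; auto]|].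
 destruct T_q_p as [H1 _]. replace (T*Cexp (- u)-T*Cexp (- v))%C with (T*(Cexp (- u)-Cexp (- v)))%C by ring.
 rewrite Cmod_mult, Cmod_pos_R by lra.
 have H := Cexp_lipschitz (- r) (- u) (- v) ltac:(rewrite re_opp; lra) ltac:(rewrite re_opp; lra).
 replace (- u - - v)%C with (- (u-v))%C in H by ring. rewrite Cmod_opp in H.
 replace (b/(1-b)*Cmod (u-v)) with (/ (1-b)*(T*(exp (- r)*Cmod (u-v)))) by (unfold b; field; fold b; lra).
 apply Rmult_le_compat_l; [left; apply Rinv_0_lt_compat; lra|]. apply Rmult_le_compat_l; lra.
Qed.

Lemma Xf_shift z k : Xf (z+turn k)%C = (Xf z+turn k)%C.
Proof. unfold Xf. rewrite Cexp_opp_period. ring. Qed.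

Lemma Xf_mX v : Xf (v+RtoC x)%C = (mX thq v+RtoC x)%C.
Proof.
 unfold Xf, mX. destruct th_pos as (_&_&->). replace (T*Cexp (- (v+x)))%C with (RtoC (T/q)*Cexp (- v))%C; [ring|].
 replace (- (v+x))%C with (- v + - x)%C by ring. rewrite Cexp_plus, <- RtoC_opp, Cexp_R, exp_Ropp.
 unfold Rdiv. rewrite RtoC_mult. ring.
Qed.

Lemma Lam_shift i z k : Lam i (z+turn k)%C = (Lam i z+turn (m i*k))%C.
Proof.
 unfold Lamb. rewrite (rs_per RS), mult_IZR. replace (iI (2*PI*(IZR (m i)*IZR k))) with (RtoC (IZR (m i))*turn k)%C
  by (unfold iI; apply C_ext; unfold Re, Im; simpl; ring). ring.
Qed.

Lemma Lam_Re_diff i u v : (1 <= i <= n)%nat -> strip g i u -> strip g i v ->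
 Rabs (Re (Lam i u)-Re (Lam i v)-IZR (m i)*(Re u-Re v)) <= 2*e.
Proof.
 intros Hi Hu Hv. unfold Lamb. rewrite !re_plus, !re_scal_l. have := rs_eps RS i u Hi Hu. have := rs_eps RS i v Hi Hv.
 have := Re_le_Cmod (eps i u). have := Re_ge_Cmod (eps i u).
 have := Re_le_Cmod (eps i v). have := Re_ge_Cmod (eps i v). apply Rabs_le. lra.
Qed.

Lemma y_strip g' : g' <= 2*g+20 -> strip g' 1 (RtoC y).
Proof.
 intros Hg. split; [|congruence]. intros _. rewrite re_RtoC. have := rs_K1 RS. destruct Dn_pos. lra.
Qed.

Lemma x_strip g' : g' <= 2*g+20 -> strip g' n (RtoC x).
Proof. intros Hg. split; [congruence|]. intros _. rewrite re_RtoC. have := rs_K2 RS. lra. Qed.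

Lemma exp_lo : exp lo = q-T.
Proof. apply exp_ln. destruct T_q_p as (_&?&_). lra. Qed.

Lemma far_V0 z : y+1 <= Re z -> V0 (RtoC T+Cexp (Lam 1 z))%C.
Proof.
 intros Hz. apply V0_ball_lt. rewrite Cmod_Cexp, <- exp_lo. apply exp_increasing.
 have := rs_K1 RS. destruct Dn_pos as (Hd&Hd1&_). have := n_ge. have := g_pos.
 have HL := Lam_Re_diff 1 z (y) ltac:(lia) ltac:(split; [lra|congruence]) (y_strip g ltac:(lra)).
 rewrite (rs_L1 RS), (rs_m1 RS), !re_RtoC in HL. apply Rabs_le_between in HL. destruct e_small as [_ He].
 have: 2*1 <= INR d1*(Re z-y) by (apply Rmult_le_compat; lra). lra.
Qed.

(** The second condition removes the petal around infinity, described as the preimage of the inner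
    petal under the outermost branch. *)
Definition Om (z: C) : Prop := ~ V0 (Cexp z) /\ (lc 1%nat+2*g <= Re z -> ~ V0 (RtoC T+Cexp (Lam 1 z))%C).

Lemma Om_Re z : Om z -> lw <= Re z <= y+1.
Proof.
 intros [H1 H2]. split; [apply notV0_lower, H1|]. apply Rnot_lt_le. intros H. apply H2.
 - have := rs_K1 RS. destruct Dn_pos. lra.
 - apply far_V0. lra.
Qed.

Lemma Xf_Re z : Om z -> lo <= Re (Xf z) <= y+3.
Proof.
 intros Hz. destruct (Om_Re z Hz) as [H1 H2], Hz as [HV _].
 destruct (notV0_lower z HV) as [_ H3]. rewrite <- (Cexp_Xf z H1), Cmod_Cexp in H3.
 destruct T_q_p as (T1&T2&T3). split.
 - rewrite <- (ln_exp (Re (Xf z))). apply ln_le; lra.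
 - rewrite <- (ln_exp (Re (Xf z))), <- (ln_exp (y+3)). apply ln_le; [apply exp_pos|].
  rewrite <- Cmod_Cexp, Cexp_Xf by auto. le_trans Cmod_minus_le.
  rewrite Cmod_Cexp, Cmod_pos_R by lra. apply exp_le in H2.
  replace (y+3) with (y+1+(1+1)) by ring. rewrite (exp_plus (y+1)), (exp_plus 1 1).
  have := exp_1_gt_2. rewrite (exp_plus y 1) in *. have: p*2 <= p*exp 1 by mono.
  have: 2*2 <= exp 1*exp 1 by (apply Rmult_le_compat; lra). have: p*exp 1*(2*2) <= p*exp 1*(exp 1*exp 1) by mono. lra.
Qed.

Lemma Lam_expand i u v : (1 <= i <= n)%nat -> strip g i u -> strip g i v ->
 19/10*Cmod (u-v) <= Cmod (Lam i u-Lam i v).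
Proof.
 intros Hi Hu Hv. have H := Lam_diff i u v Hi Hu Hv. have Hm := rs_m RS i Hi.
 destruct e_small as [_ He]. have H0 := Cmod_ge_0 (u-v)%C.
 have Ht := Cmod_triangle (Lam i u-Lam i v) (- (Lam i u-Lam i v-RtoC (IZR (m i))*(u-v)))%C. rewrite Cmod_opp in Ht.
 replace (Lam i u-Lam i v + - (Lam i u-Lam i v-RtoC (IZR (m i))*(u-v)))%C
  with (RtoC (IZR (m i))*(u-v))%C in Ht by ring.
 rewrite Cmod_mult, Cmod_R in Ht. have: 2*Cmod (u-v) <= Rabs (IZR (m i))*Cmod (u-v) by mono.
 have: e*Cmod (u-v) <= / 1000000*Cmod (u-v) by mono. lra.
Qed.

Lemma strip_closed g' i z : (forall r, 0 < r -> exists w, strip g' i w /\ Cmod (w-z) < r) -> strip g' i z.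
Proof.
 intros H. split; intros Hi; apply Rnot_lt_le; intros Hlt.
 - destruct (H (lc i+g'-Re z) ltac:(lra)) as [w [[Hw _] Hd]]. specialize (Hw Hi).
  have H1 := Re_le_Cmod (w-z)%C. rewrite Re_minus in H1. lra.
 - destruct (H (Re z-(lc (i-1)%nat-g')) ltac:(lra)) as [w [[_ Hw] Hd]]. specialize (Hw Hi).
  have H1 := Re_ge_Cmod (w-z)%C. rewrite Re_minus in H1. lra.
Qed.

(** [u0] solves the affine part, and the map [f], which corrects it by the error term, is a
    contraction whose fixed point is within 1/2 of [u0]. The surplus 1/2 in the conclusion later
    places preimages strictly inside the discs [AA]. *)
Lemma Lam_solve i X : (1 <= i <= n)%nat -> (i <> 1%nat -> lo <= Re X) -> (i <> n -> Re X <= y+3) ->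
 exists z, strip (2*g+1/2) i z /\ Lam i z = X.
Proof.
 intros Hi Hlo Hhi. have H0 := rs_range RS i X Hi Hlo Hhi. set (u0 := ((X-kap i)/RtoC (IZR (m i)))%C) in *.
 have Hm := rs_m RS i Hi. destruct e_small as [_ He].
 have Hm0: RtoC (IZR (m i)) <> 0%C. { intros E. injection E. intros E'. rewrite E', Rabs_R0 in Hm. lra. }
 set (f := fun z => (u0-eps i z/RtoC (IZR (m i)))%C).
 have Hinv: / Rabs (IZR (m i)) <= / 2 by (apply Rinv_le_contravar; lra).
 have Hinv0: 0 < / Rabs (IZR (m i)) by (apply Rinv_0_lt_compat; lra).
 destruct (Cbanach (strip (2*g) i) f u0) as (z&Hz&Ez).
 - apply strip_closed.
 - apply (strip_mono _ (2*g+1)); [lra|auto].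
 - intros u Hu. have Hb := rs_eps RS i u Hi (strip_2g _ _ Hu). have Hd: Cmod (f u-u0) <= 1.
  { unfold f. replace (u0-eps i u/RtoC (IZR (m i))-u0)%C with (- (eps i u/RtoC (IZR (m i))))%C by ring.
   rewrite Cmod_opp, Cmod_div, Cmod_R by auto.
   apply Rle_trans with (1*1); [|lra]. apply Rmult_le_compat; try lra. apply Cmod_ge_0. }
  have H1 := Re_le_Cmod (f u-u0)%C. have H2 := Re_ge_Cmod (f u-u0)%C. rewrite Re_minus in H1, H2.
  destruct H0 as [H3 H4]. split; intros Hi'; [specialize (H3 Hi')|specialize (H4 Hi')]; lra.
 - intros u v Hu Hv. unfold f. replace (u0-eps i u/RtoC (IZR (m i))-(u0-eps i v/RtoC (IZR (m i))))%C
   with (- ((eps i u-eps i v)/RtoC (IZR (m i))))%C by (field; auto).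
  rewrite Cmod_opp, Cmod_div, Cmod_R by auto. rewrite Rmult_comm.
  have Hl := Lam_diff i u v Hi (strip_2g _ _ Hu) (strip_2g _ _ Hv). unfold Lamb in Hl.
  replace (RtoC (IZR (m i))*u+kap i+eps i u-(RtoC (IZR (m i))*v+kap i+eps i v)-RtoC (IZR (m i))*(u-v))%C
   with (eps i u-eps i v)%C in Hl by ring. have := Cmod_ge_0 (u-v)%C.
  apply Rmult_le_compat; try lra; [apply Cmod_ge_0|]. have: e*Cmod (u-v) <= 1*Cmod (u-v) by mono. lra.
 - exists z. split.
  + have Hb := rs_eps RS i z Hi (strip_2g _ _ Hz). have Hd: Cmod (z-u0) <= 1/2.
   { rewrite <- Ez at 1. unfold f. replace (u0-eps i z/RtoC (IZR (m i))-u0)%C with (- (eps i z/RtoC (IZR (m i))))%C by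
    ring.
    rewrite Cmod_opp, Cmod_div, Cmod_R by auto.
    apply Rle_trans with (1 * / 2); [|lra]. apply Rmult_le_compat; try lra. apply Cmod_ge_0. }
   have H1 := Re_le_Cmod (z-u0)%C. have H2 := Re_ge_Cmod (z-u0)%C. rewrite Re_minus in H1, H2.
   destruct H0 as [H3 H4]. split; intros Hi'; [specialize (H3 Hi')|specialize (H4 Hi')]; lra.
  + unfold Lamb. rewrite <- Ez at 1. unfold f, u0. field. auto.
Qed.

Definition G (i: nat) (z: C) : C := epsilon (inhabits (RtoC 0)) (fun u => strip (2*g) i u /\ Lam i u = Xf z).

Lemma G_spec i z : (1 <= i <= n)%nat -> Om z -> strip (2*g) i (G i z) /\ Lam i (G i z) = Xf z.
Proof.
 intros Hi Hz. unfold G. apply epsilon_spec. destruct (Xf_Re z Hz).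
 destruct (Lam_solve i (Xf z)) as (u&H1&H2); auto. exists u. split; [|auto].
 apply (strip_mono _ (2*g+1/2)); [lra|auto].
Qed.

Lemma G_unique i z u : (1 <= i <= n)%nat -> Om z -> strip g i u -> Lam i u = Xf z -> u = G i z.
Proof.
 intros Hi Hz Hu E. destruct (G_spec i z Hi Hz) as [Hs E'].
 have H := Lam_expand i u (G i z) Hi Hu (strip_2g _ _ Hs). rewrite E, E' in H.
 replace (Xf z-Xf z)%C with (RtoC 0) in H by ring. rewrite Cmod_0 in H. apply Cmod_zero_eq. lra.
Qed.

Lemma G_strict i z : (1 <= i <= n)%nat -> Om z -> strip (2*g+1/2) i (G i z).
Proof.
 intros Hi Hz. destruct (Xf_Re z Hz). destruct (Lam_solve i (Xf z)) as (u&H1&H2); auto.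
 rewrite <- (G_unique i z u); auto. apply (strip_mono _ (2*g+1/2)); [have := g_pos; lra|auto].
Qed.

Lemma G_F i z : (1 <= i <= n)%nat -> Om z -> F (Some (Cexp (G i z))) = Some (Cexp z).
Proof.
 intros Hi Hz. destruct (G_spec i z Hi Hz) as [Hs E]. rewrite (rs_strip RS i _ Hi (strip_2g _ _ Hs)), E.
 f_equal. rewrite Cexp_Xf by apply Om_Re, Hz. ring.
Qed.

Lemma lc_between i : (1 <= i <= n-1)%nat -> lc (n-1)%nat <= lc i <= lc 1%nat.
Proof.
 intros Hi. have := g_pos. split.
 - destruct (Nat.eq_dec i (n-1)) as [->|E]; [lra|].
  have := rs_sep RS i (n-1)%nat ltac:(lia) ltac:(lia) ltac:(lia). lra.
 - destruct (Nat.eq_dec i 1) as [->|E]; [lra|]. have := rs_sep RS 1%nat i ltac:(lia) ltac:(lia) ltac:(lia). lra.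
Qed.

Lemma strip_low i z : (1 <= i <= n)%nat -> i <> n -> strip (2*g) i z -> lc (n-1)%nat+2*g <= Re z.
Proof. intros Hi Hn [H _]. specialize (H Hn). destruct (lc_between i ltac:(lia)). lra. Qed.

Lemma strip_high i z : (1 <= i <= n)%nat -> i <> 1%nat -> strip (2*g) i z -> Re z <= lc 1%nat-2*g.
Proof. intros Hi Hn [_ H]. specialize (H Hn). destruct (lc_between (i-1) ltac:(lia)). lra. Qed.

Lemma strip_n z : Re z <= lc (n-1)%nat-g -> strip g n z.
Proof. intros H. split; [congruence|auto]. Qed.

Lemma strip_1 z : lc 1%nat+g <= Re z -> strip g 1 z.
Proof. intros H. split; [auto|congruence]. Qed.

Lemma axx z : ax (z-RtoC x)%C = z.
Proof. unfold ax. ring. Qed.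

(** The link with the local model: two steps through the strips [n] and [1] are [fm], rescaled by
    [q]. *)
Lemma two_step z : Re z <= x+MM -> let u := Lf (Lam n z) in
 F (Some (Cexp z)) = Some (Cexp u) /\ strip g 1 u /\ Re (Lam n z)-1 <= Re u /\ lc 1%nat+g+1 <= Re (Lam n z) /\
 (RtoC T+Cexp (Lam 1 u))%C = (RtoC q*fm (z-RtoC x))%C.
Proof.
 intros Hz u. have := n_ge. have Hv: Re (z-x) <= MM by (rewrite Re_minus, re_RtoC; lra).
 have ELn: Ln (z-x)%C = Lam n z by (unfold Ln; rewrite axx; auto).
 have HL := Ln_Re _ Hv. rewrite ELn in HL. destruct (Lf_strip _ HL) as [H1 H2].
 split; [|split; [auto|split; [auto|split; [auto|]]]].
 - rewrite (rs_strip RS n z); [|lia|].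
  + f_equal. symmetry. apply Cexp_Lf. lra.
  + have Ha := ax_strip _ Hv. rewrite axx in Ha. auto.
 - unfold mf. rewrite Xi_eq, ELn, Lf_Ln_0, (rs_L1 RS), Cexp_minus, Cexp_R, exp_lo.
  fold u. destruct th_pos as (_&E1&E2). rewrite E2. destruct T_q_p as (T1&T2&_).
  replace (q*(RtoC (T/q)+thq*(Cexp (Lam 1 u)/RtoC (q-T))))%C
   with (RtoC (q*(T/q))+RtoC (q*thq)*(Cexp (Lam 1 u)/RtoC (q-T)))%C by (rewrite !RtoC_mult; ring).
  rewrite E1. replace (q*(T/q)) with T by (field; lra). field. intros E. injection E. lra.
Qed.

Lemma Lam_n_Re1 z : Re z <= x+1 -> lc 1%nat+2*g+10 <= Re (Lam n z).
Proof.
 intros Hz. have := n_ge. destruct e_small as [_ He]. have := rs_K2 RS. have := rs_K1 RS.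
 have := g_pos. destruct Dn_pos as [Hd _].
 have HL := Lam_Re_diff n z (x) ltac:(lia) (strip_n z ltac:(lra)) (x_strip g ltac:(lra)).
 rewrite (rs_Ln RS), (rs_mn RS), !re_RtoC in HL. apply Rabs_le_between in HL. have := pT_ln.
 have: INR dn*(Re z-x) <= INR dn*1 by mono. lra.
Qed.

Lemma V0_scaled w : V0 (RtoC q*w)%C <-> (mV N (kaN N)) w.
Proof.
 unfold V0. rewrite Cmult_assoc, <- RtoC_mult, <- exp_plus. replace (- x+x) with 0 by ring. rewrite exp_0.
 replace (1*w)%C with w by ring. reflexivity.
Qed.

Lemma V0c_scaled w : V0c (RtoC q*w)%C <-> (mVc N (kaN N)) w.
Proof.
 unfold V0c. rewrite Cmult_assoc, <- RtoC_mult, <- exp_plus. replace (- x+x) with 0 by ring. rewrite exp_0.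
 replace (1*w)%C with w by ring. reflexivity.
Qed.

Lemma V0c_two_step z : V0c (Cexp z) -> Cexp z <> RtoC q ->
 exists u, F (Some (Cexp z)) = Some (Cexp u) /\ lc 1%nat+2*g+9 <= Re u /\ V0 (RtoC T+Cexp (Lam 1 u))%C.
Proof.
 intros HV Hne. have Hz := V0c_Re z HV. destruct MM_ge as [HM _], (two_step z ltac:(lra)) as (H1&H2&H3&_&H4).
  have := Lam_n_Re1 z Hz.
 eexists. split; [exact H1|]. split; [lra|]. rewrite H4. apply V0_scaled, (fm_Vc_V LM).
 - rewrite Re_minus, re_RtoC. lra.
 - unfold V0c in HV. rewrite qexp in HV. auto.
 - rewrite <- qexp. intros E. apply Hne. apply (f_equal (fun w => q*w)%C) in E.
  rewrite Cmult_assoc, <- RtoC_mult, <- exp_plus in E. replace (x + - x) with 0 in E by ring. rewrite exp_0 in E.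
  replace (Cexp z) with (1*Cexp z)%C by ring. rewrite E. ring.
Qed.

Lemma not_V0_q : ~ V0 (RtoC q).
Proof.
 replace (RtoC q) with (q*1)%C by ring. rewrite V0_scaled. intros H. apply V_not_1 in H. congruence.
Qed.

(** If [G i z] were in the inner petal then [i = n], since the other strips lie farther out, and its
    image [z] would be in the outer petal by [V0c_two_step]. If it were in the outer petal then
    [i = 1], and [z] would be in the inner one. *)
Lemma G_Om i z : (1 <= i <= n)%nat -> Om z -> Om (G i z).
Proof.
 intros Hi Hz. destruct (G_spec i z Hi Hz) as [Hs E]. have HF := G_F i z Hi Hz.
 set (u := G i z) in *. have HK2 := rs_K2 RS. have Hg := g_pos. split.
 - intros HV. have Hu := V0c_Re u (V0_V0c _ HV). destruct (Nat.eq_dec i n) as [->|Hin].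
  + destruct (V0c_two_step u (V0_V0c _ HV)) as (u'&H1&H2&H3).
   { intros E'. rewrite E' in HV. apply not_V0_q, HV. }
   rewrite HF in H1. apply Some_C in H1. destruct (Cexp_eq _ _ H1) as [k ->], Hz as [_ Hz]. apply Hz.
   * rewrite re_plus. simpl (Re (iI _)). lra.
   * rewrite Lam_shift, Cexp_period. auto.
  + have := strip_low i u Hi Hin Hs. lra.
 - intros Hu. destruct (Nat.eq_dec i 1) as [->|Hin].
  + rewrite E, Cexp_Xf by apply Om_Re, Hz. replace (T+(Cexp z-T))%C with (Cexp z) by ring. apply Hz.
  + have := strip_high i u Hi Hin Hs. lra.
Qed.

Lemma position_cases z : (exists i, (1 <= i <= n)%nat /\ strip (2*g) i z) \/ (exists i, (1 <= i <= n-1)%nat /\ Rabs (Re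
 z-lc i) <= 2*g).
Proof.
 have Hn := n_ge. apply NNPP. intros Hno. have Hgap: forall i, (1 <= i <= n-1)%nat -> ~ Rabs (Re z-lc i) <= 2*g.
 { intros i Hi H. apply Hno. right. exists i. auto. }
 have Hst: forall i, (1 <= i <= n)%nat -> ~ strip (2*g) i z.
 { intros i Hi H. apply Hno. left. exists i. auto. }
 have H: forall k, (1 <= k <= n-1)%nat -> Re z < lc k-2*g.
 { induction k as [|k IH]; intros Hk; [lia|]. apply Rnot_le_lt. intros Hle.
  destruct (Rle_or_lt (Re z) (lc (S k)+2*g)) as [Hu|Hu].
  - apply (Hgap (S k) Hk), Rabs_le. lra.
  - apply (Hst (S k)); [lia|]. split; [lra|]. intros Hne. replace (S k-1)%nat with k by lia.
   specialize (IH ltac:(lia)). lra. }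
 apply (Hst n); [lia|]. split; [congruence|]. intros _. specialize (H (n-1)%nat ltac:(lia)). lra.
Qed.

(* A point of [Omega] never sits in a gap whose image stays in [Omega]: gaps map deep into the two petals. *)
Lemma branch z z' : Om z' -> F (Some (Cexp z)) = Some (Cexp z') ->
 exists i z'', (1 <= i <= n)%nat /\ Om z'' /\ Cexp z'' = Cexp z' /\ z = G i z'' /\ strip (2*g) i z.
Proof.
 intros Hz' HF. destruct (position_cases z) as [[i [Hi Hs]]|[i [Hi Hg]]].
 - rewrite (rs_strip RS i z Hi (strip_2g _ _ Hs)) in HF. apply Some_C in HF.
  have HE: Cexp (Lam i z) = Cexp (Xf z') by (rewrite Cexp_Xf by apply Om_Re, Hz'; rewrite <- HF; ring).
  destruct (Cexp_eq _ _ HE) as [k Hk]. exists i, (z'+turn k)%C. have Hz'': Om (z'+turn k)%C.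
  { destruct Hz' as [H1 H2]. split.
   - rewrite Cexp_period. auto.
   - rewrite Lam_shift, Cexp_period, re_plus, Rplus_0_r. auto. }
  split; [auto|]. split; [auto|]. split; [apply Cexp_period|]. split; [|auto].
  apply G_unique; try auto; [apply strip_2g, Hs|]. rewrite Xf_shift. auto.
 - exfalso. destruct (rs_gap RS i z Hi Hg) as [[w [H1 H2]]|[H1|[w [H1 H2]]]]; rewrite H1 in HF.
  + apply Some_C in HF. destruct Hz' as [HV _]. apply HV. rewrite <- HF. apply V0_ball_lt, H2.
  + discriminate.
  + apply Some_C in HF. destruct (Om_Re z' Hz') as [_ H5], T_q_p as (T1&T2&T3). have Hw': Cmod w <= exp (y+1)+T.
   { replace w with (Cexp z'-T)%C by (rewrite <- HF; ring). le_trans Cmod_minus_le.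
    rewrite Cmod_Cexp, Cmod_pos_R by lra. apply exp_le in H5. lra. }
   replace (y+3) with (y+1+(1+1)) in H2 by ring. rewrite (exp_plus (y+1)), (exp_plus 1 1) in H2.
   have := exp_1_gt_2. have: 2*2 <= exp 1*exp 1 by (apply Rmult_le_compat; lra).
    have: p <= exp (y+1) by (apply exp_le; lra).
   have: exp (y+1)*(2*2) <= exp (y+1)*(exp 1*exp 1) by mono. lra.
Qed.

(** * Eventual contraction of the inverse branches *)

Local Notation gck := (gc G).

Lemma Lf_Xf w : lc 1%nat+2*g <= Re w -> Lf (Xf w) = w.
Proof.
 intros Hw. have := rs_K2 RS. have := lc_n1. have := g_pos. have HTx: T*exp (- (x+4)) < 1/2.
 { destruct T_q_p as (T1&T2&_). replace (- (x+4)) with (- x + - 4) by ring. rewrite exp_plus, exp_Ropp.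
  have: exp (-4) <= 1/5.
  { replace (-4) with (Ropp 4) by ring. rewrite exp_Ropp. have := exp_ineq1_le 4.
   unfold Rdiv. rewrite Rmult_1_l. apply Rinv_le_contravar; lra. }
  have := exp_pos (-4). have: T * / q < 1.
  { have Hq := exp_pos x. apply (proj2 (Rlt_div_l _ _ _ Hq)). lra. }
  nra. }
 have Ha := Xf_arg (x+4) w ltac:(lra). set (b := (T*Cexp (- w))%C) in *. have Hb: Cmod b < 1 by lra.
 have Ew: Cexp (Xf w) = (Cexp w*(1-b))%C.
 { unfold Xf. rewrite Cexp_plus, Cexp_Log1m by auto. auto. }
 unfold Lf, rr. replace (RtoC (-1)*Xf w)%C with (- Xf w)%C by ring. rewrite Cexp_opp, Ew. unfold Log1m at 1.
 have Hb0 := one_minus_neq0 b Hb. replace (1-RtoC (- T) * / (Cexp w*(1-b)))%C with (/ (1-b))%C.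
 - rewrite Clog_inv by (apply Re_1m_pos, Hb). unfold Xf. fold b. unfold Log1m. ring.
 - have Hb': RtoC T = (b*Cexp w)%C by (unfold b; rewrite Cexp_opp; field; apply Cexp_neq0).
  rewrite RtoC_opp, Hb'. field. split; [auto|apply Cexp_neq0].
Qed.

Lemma Xf_Re_le r z : lw <= Re z -> Re z <= r -> x <= r -> Re (Xf z) <= r+1.
Proof.
 intros H1 H2 H3. rewrite <- (ln_exp (Re (Xf z))), <- (ln_exp (r+1)). apply ln_le; [apply exp_pos|].
 rewrite <- Cmod_Cexp, Cexp_Xf by auto. le_trans Cmod_minus_le.
 destruct T_q_p as (T1&T2&_). rewrite Cmod_Cexp, Cmod_pos_R by lra. rewrite exp_plus.
 apply exp_le in H2. apply exp_le in H3. have := exp_1_gt_2. have: exp r*2 <= exp r*exp 1 by mono. lra.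
Qed.

Lemma Xf_Re_ge r z : lw <= Re z -> r <= Re z -> x+1 <= r -> r-1 <= Re (Xf z).
Proof.
 intros H1 H2 H3. rewrite <- (ln_exp (Re (Xf z))), <- (ln_exp (r-1)). apply ln_le; [apply exp_pos|].
 rewrite <- Cmod_Cexp, Cexp_Xf by auto. eapply Rle_trans; [|apply Cmod_reverse].
 destruct T_q_p as (T1&T2&_). rewrite Cmod_Cexp, Cmod_pos_R by lra.
 apply exp_le in H2. have := exp_1_gt_2. have E: exp r = exp (r-1)*exp 1 by (rewrite <- exp_plus; f_equal; ring).
 have: q <= exp (r-1) by (apply exp_le; lra). have: exp (r-1)*2 <= exp (r-1)*exp 1 by mono. lra.
Qed.

Definition rho (u v: C) : R := Cmod (Xf u-Xf v).
Definition bb : R := T*exp (- lw).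
Definition Lx : R := 1+bb/(1-bb).

Lemma Lx_ge_1 : 1 <= Lx /\ 0 <= bb < 1.
Proof.
 destruct lw_bounds as [_ H], T_q_p as [T1 _].
 have: 0 <= bb by (unfold bb; apply Rmult_le_pos; [lra|left; apply exp_pos]). fold bb in H. split; [|lra].
 unfold Lx. have: 0 <= bb/(1-bb); [|lra]. apply Rmult_le_pos; [lra|]. left. apply Rinv_0_lt_compat. lra.
Qed.

Lemma rho_lip u v : Om u -> Om v -> rho u v <= Lx*Cmod (u-v).
Proof.
 intros Hu Hv. apply Xf_lip; [apply lw_bounds|apply Om_Re, Hu|apply Om_Re, Hv].
Qed.

Lemma G_contract i u v : (1 <= i <= n)%nat -> Om u -> Om v -> 19/10*Cmod (G i u-G i v) <= rho u v.
Proof.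
 intros Hi Hu Hv. destruct (G_spec i u Hi Hu) as [S1 E1], (G_spec i v Hi Hv) as [S2 E2].
 have H := Lam_expand i _ _ Hi (strip_2g _ _ S1) (strip_2g _ _ S2). rewrite E1, E2 in H. exact H.
Qed.

Lemma step_any i u v : (1 <= i <= n)%nat -> Om u -> Om v -> rho (G i u) (G i v) <= Lx*rho u v.
Proof.
 intros Hi Hu Hv. eapply Rle_trans; [apply rho_lip; apply G_Om; auto|].
 have := G_contract i u v Hi Hu Hv. have := Cmod_ge_0 (G i u-G i v)%C. destruct Lx_ge_1. apply Rmult_le_compat_l; lra.
Qed.

(** Above [x+4] the passage from [log w] to [log (w-T)] distorts by at most 16/15, and each branch
    contracts by at least 19/10. Only points near the inner petal escape this estimate. *)
Lemma step_good i u v : (1 <= i <= n)%nat -> Om u -> Om v ->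
 x+4 <= Re (G i u) -> x+4 <= Re (G i v) -> rho (G i u) (G i v) <= 2/3*rho u v.
Proof.
 intros Hi Hu Hv H1 H2. set (b := T*exp (- (x+4))). have Hb: 0 <= b <= 1/16.
 { destruct T_q_p as (T1&T2&_). unfold b. split; [apply Rmult_le_pos; [lra|left; apply exp_pos]|].
  replace (- (x+4)) with (- x + - (1+1+(1+1))) by ring. rewrite exp_plus, !exp_Ropp, !exp_plus.
  have := exp_1_gt_2. set (c := exp 1) in *. have: 4 <= c*c by nra. have: 16 <= c*c*(c*c) by nra.
  have Hq := exp_pos x. replace (T*(/ q * / (c*c*(c*c)))) with (T/q * / (c*c*(c*c))) by (field; split; nra).
  have: 0 <= T/q <= 1.
  { split; [apply Rmult_le_pos; [lra|left; apply Rinv_0_lt_compat; lra]|]. apply (proj2 (Rle_div_l _ _ _ Hq)). lra. }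
  have: / (c*c*(c*c)) <= / 16 by (apply Rinv_le_contravar; lra).
  have: 0 < / (c*c*(c*c)) by (apply Rinv_0_lt_compat; lra).
  apply Rle_trans with (1 * / 16); [|lra]. apply Rmult_le_compat; lra. }
 have H := Xf_lip (x+4) (G i u) (G i v). fold b in H.
 fold (rho (G i u) (G i v)) in H. have := G_contract i u v Hi Hu Hv. have := Cmod_ge_0 (G i u-G i v)%C.
 have: b/(1-b) <= 1/15. { apply (proj2 (Rle_div_l _ _ _ (ltac:(lra) : 0 < 1-b))). lra. }
 have: (1+b/(1-b))*Cmod (G i u-G i v) <= 16/15*Cmod (G i u-G i v) by mono. lra.
Qed.

(** A branch can lead close to the inner petal only if it is the [n]-th and is applied to a point of
    the outermost strip. So letter [n] directly outside letter [1] is the only pair to be treated as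
    a block. *)
Lemma G_high i u : (1 <= i <= n)%nat -> Om u -> (i = n -> Re u <= lc 1%nat-2*g) -> x+4 <= Re (G i u).
Proof.
 intros Hi Hu H. destruct (G_spec i u Hi Hu) as [Hs E]. have K2 := rs_K2 RS. have Hg := g_pos.
 destruct (Nat.eq_dec i n) as [->|Hin].
 - specialize (H eq_refl). have K1 := rs_K1 RS. have Hl := lc_n1. apply Rnot_lt_le. intros Hlt.
  have HL := Lam_Re_diff n (G n u) (x) Hi (strip_2g _ _ Hs) (x_strip g ltac:(lra)).
  rewrite E, (rs_Ln RS), (rs_mn RS), !re_RtoC in HL. apply Rabs_le_between in HL. have := pT_ln.
  destruct e_small as [_ He], Dn_pos as [Hd _]. have := Xf_Re_le (lc 1%nat-2*g) u ltac:(apply Om_Re, Hu) H ltac:(lra).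
  have: INR dn*(Re (G n u)-x) <= INR dn*4 by mono. lra.
 - have := strip_low i _ Hi Hin Hs. lra.
Qed.

Lemma block_base u : Om u -> let a := G n (G 1 u) in
 Re a <= x+MM /\ Lf (Lam n a) = G 1 u /\ (RtoC q*mf N thq et (a-RtoC x) = Cexp u)%C /\
 (mXi N et (a-RtoC x) = Xf u-RtoC (ln (q-T)))%C.
Proof.
 intros Hu a. have Hn := n_ge. have H1n: (1 <= 1 <= n)%nat by lia. have Hnn: (1 <= n <= n)%nat by lia.
 have H1 := G_Om 1 u H1n Hu. destruct (G_spec 1 u H1n Hu) as [S1 E1], (G_spec n _ Hnn H1) as [Sn En]. fold a in Sn, En.
  set (w := G 1 u) in *. have K2 := rs_K2 RS. have Hg := g_pos. have Hl := lc_n1.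
 have Hw: lc 1%nat+2*g <= Re w by (apply S1; lia). have Ha: Re a <= x+MM.
 { apply Rnot_lt_le. intros Hlt. destruct MM_ge as [_ HM].
  have HL := Lam_Re_diff n a (x) Hnn (strip_2g _ _ Sn) (x_strip g ltac:(lra)).
  rewrite En, (rs_Ln RS), (rs_mn RS), !re_RtoC in HL. apply Rabs_le_between in HL. have := pT_ln.
  destruct e_small as [_ He], Dn_pos as [Hd _].
  have := Xf_Re_ge (lc 1%nat+2*g) w ltac:(apply Om_Re, H1) Hw ltac:(lra).
  have: INR dn*MM <= INR dn*(Re a-x) by mono. lra. }
 have EL: Lf (Lam n a) = w by (rewrite En; apply Lf_Xf, Hw).
 split; [auto|]. split; [auto|]. destruct (two_step a Ha) as (_&_&_&_&H4). rewrite EL, E1 in H4. split.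
 - rewrite <- H4, Cexp_Xf by apply Om_Re, Hu. ring.
 - rewrite Xi_eq, Lf_Ln_0, (rs_L1 RS). unfold Ln. rewrite axx, EL, E1. auto.
Qed.

Lemma block B : 0 < B -> exists c, 0 < c /\ forall u v, Om u -> Om v -> rho (G n (G 1 u)) (G n (G 1 v)) <= B ->
 rho (G n (G 1 u)) (G n (G 1 v))+c*(rho (G n (G 1 u)) (G n (G 1 v))*rho (G n (G 1 u)) (G n (G 1 v))) <= rho u v.
Proof.
 intros HB. destruct (mX_contraction LM B HB) as (c&Hc&H). exists c. split; [auto|]. intros u v Hu Hv.
 destruct (block_base u Hu) as (A1&A2&A3&A4), (block_base v Hv) as (B1&B2&B3&B4).
 have Hn := n_ge. have OA := G_Om n _ ltac:(lia) (G_Om 1 u ltac:(lia) Hu).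
 have OB := G_Om n _ ltac:(lia) (G_Om 1 v ltac:(lia) Hv). set (a := G n (G 1 u)) in *. set (b := G n (G 1 v)) in *.
 have HX: forall z, Xf z = (mX thq (z-x)+x)%C.
 { intros z. rewrite <- Xf_mX. f_equal. ring. }
 have Hr: rho a b = Cmod (mX thq (a-x)-mX thq (b-x))%C.
 { unfold rho. rewrite !HX. f_equal. ring. }
 have Hxi: rho u v = Cmod (mXi N et (a-x)-mXi N et (b-x))%C.
 { rewrite A4, B4. unfold rho. f_equal. ring. }
 rewrite Hr, Hxi. intros Hle. have HnV: forall z, Om z -> ~ mV N (kaN N) (Cexp (z-x)).
 { intros z [Hz _] HV. apply Hz. unfold V0. rewrite qexp. auto. }
 apply H; try (apply HnV; auto); try auto.
 - rewrite Re_minus, re_RtoC. lra.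
 - rewrite Re_minus, re_RtoC. lra.
 - intros HV. apply (proj2 (V0_scaled _)) in HV. rewrite A3 in HV. exact (proj1 Hu HV).
 - intros HV. apply (proj2 (V0_scaled _)) in HV. rewrite B3 in HV. exact (proj1 Hv HV).
Qed.

Lemma gck_Om k : forall (w: word) (u: C), wok n w -> Om u -> Om (gck k w u).
Proof.
 induction k as [|k IH]; intros w u Hw Hu; [auto|]. apply G_Om; [apply Hw|].
 apply IH; [apply wok_shift, Hw|auto].
Qed.

(** Letters are added at the outer end, and as long as the distance exceeds [e1] each one lowers it
    by at least [et]: a good letter by a third, and the block of letters [n] and [1] by
    [c*e1^2 >= 2*et], which pays for both of its letters. The induction therefore carries two
    consecutive lengths. The spare [et] and the factor [Lx] absorb a first letter [n] without a
    partner. *)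
Lemma rho_gc B e1 : 0 < B -> 0 < e1 -> exists et, 0 < et /\ forall k w u v, wok n w -> Om u -> Om v ->
 Lx*rho u v <= B -> rho (gck k w u) (gck k w v) <= Rmax e1 (B+et-INR k*et).
Proof.
 intros HB He1. destruct Lx_ge_1 as [HLx _], (block (Lx*(B+2*e1))) as (c&Hc&Hblock); [apply Rmult_lt_0_compat; lra|].
 set (et := Rmin (c*(e1*e1)/2) (e1/2)).
 have Het: 0 < et by (apply Rmin_glb_lt; [have: 0 < c*(e1*e1) by (apply Rmult_lt_0_compat; nra); lra|lra]).
 have Het1: 2*et <= c*(e1*e1) by (have := Rmin_l (c*(e1*e1)/2) (e1/2); fold et in H; lra).
 have Het2: et <= e1/2 by apply Rmin_r. exists et. split; [auto|]. intros k0.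
 have HP: forall k, (forall w u v, wok n w -> Om u -> Om v -> Lx*rho u v <= B ->
    rho (gck k w u) (gck k w v) <= Rmax e1 (B+et-INR k*et)) /\
   (forall w u v, wok n w -> Om u -> Om v -> Lx*rho u v <= B ->
    rho (gck (S k) w u) (gck (S k) w v) <= Rmax e1 (B+et-INR (S k)*et)); [|apply HP].
 have Hmax: forall r a, r <= Rmax e1 a -> e1 < r -> r <= a.
 { intros r a H1 H2. unfold Rmax in H1. destruct (Rle_dec e1 a); lra. }
 induction k as [|k [IH1 IH2]].
 - split; intros w u v Hw Hu Hv HLB.
  + simpl. have := Rmax_r e1 (B+et-0*et). destruct Lx_ge_1. have := Cmod_ge_0 (Xf u-Xf v)%C.
   fold (rho u v) in H2. have: 1*rho u v <= Lx*rho u v by mono. lra.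
  + simpl. have := Rmax_r e1 (B+et-1*et). have := step_any (w 0%nat) u v (Hw 0%nat) Hu Hv. lra.
 - split; [auto|]. intros w u v Hw Hu Hv HLB.
  have Hw1 := wok_shift n 1 w Hw. specialize (IH2 (wshift 1 w) u v Hw1 Hu Hv HLB).
  set (A := gck (S k) (wshift 1 w) u) in *. set (A' := gck (S k) (wshift 1 w) v) in *.
  change (gck (S (S k)) w u) with (G (w 0%nat) A). change (gck (S (S k)) w v) with (G (w 0%nat) A').
  have HA := gck_Om (S k) _ u Hw1 Hu. have HA' := gck_Om (S k) _ v Hw1 Hv.
  destruct (Rle_or_lt (rho (G (w 0%nat) A) (G (w 0%nat) A')) e1) as [Hle|Hgt].
  { eapply Rle_trans; [exact Hle|apply Rmax_l]. }
  eapply Rle_trans; [|apply Rmax_r]. rewrite !S_INR. rewrite S_INR in IH2.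
  have Hgood: rho (G (w 0%nat) A) (G (w 0%nat) A') <= 2/3*rho A A' ->
    rho (G (w 0%nat) A) (G (w 0%nat) A') <= B+et-(INR k+1+1)*et.
  { intros Hg. have := Hmax _ _ IH2 ltac:(lra). lra. }
  set (w2 := wshift 1 (wshift 1 w)) in *. have Hw2 := wok_shift n 1 _ Hw1.
  have HD := gck_Om k w2 u Hw2 Hu. have HD' := gck_Om k w2 v Hw2 Hv.
  have EA: A = G (w 1%nat) (gck k w2 u) by auto. have EA': A' = G (w 1%nat) (gck k w2 v) by auto.
  destruct (Nat.eq_dec (w 0%nat) n) as [E0|E0]; [destruct (Nat.eq_dec (w 1%nat) 1) as [E1|E1]|].
  + specialize (IH1 w2 u v Hw2 Hu Hv HLB). have Hn := n_ge. have HAA: rho A A' <= 2/3*rho (gck k w2 u) (gck k w2 v).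
   { rewrite EA, EA', E1. apply step_good; auto; [lia| |]; apply G_high; auto; lia. }
   have HrB: rho (G (w 0%nat) A) (G (w 0%nat) A') <= Lx*(B+2*e1).
   { eapply Rle_trans; [apply step_any; auto|]. apply Rmult_le_compat_l; [lra|].
    have Hk: 0 <= INR k*et by (apply Rmult_le_pos; [apply pos_INR|lra]).
    have: Rmax e1 (B+et-INR k*et) <= B+2*e1 by (apply Rmax_lub; lra). lra. }
   rewrite EA, EA', E0, E1 in *. have Hbl := Hblock _ _ HD HD' HrB. set (r := rho (G n _) (G n _)) in *.
   have: c*(e1*e1) <= c*(r*r) by (apply Rmult_le_compat_l; [lra|apply Rmult_le_compat; lra]).
   have := Hmax _ _ IH1 ltac:(lra). lra.
  + apply Hgood, step_good; auto; apply G_high; auto; intros _.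
   * apply (strip_high (w 1%nat)); auto. apply G_spec; auto.
   * apply (strip_high (w 1%nat)); auto. apply G_spec; auto.
  + apply Hgood, step_good; auto; apply G_high; auto; intros E; congruence.
Qed.

(** * Om and its branches form a circle system *)

Lemma V0_open w : V0 w -> exists r, 0 < r /\ forall w', Cmod (w'-w) < r -> V0 w'.
Proof.
 unfold V0. intros H. apply (gauge_lt_1 LM) in H. set (c := exp (- x)) in *. have Hc: 0 < c by apply exp_pos.
 set (d := 1-gauge N (kaN N) (c*w)%C). exists (d/(10*c)). split; [apply Rdiv_lt_0_compat; unfold d; lra|].
 intros w' Hw'. apply (gauge_lt_1 LM). have Hl := gauge_lip LM (c*w')%C (c*w)%C.
 replace (c*w'-c*w)%C with (c*(w'-w))%C in Hl by ring.
 rewrite Cmod_mult, Cmod_pos_R in Hl by lra. apply Rabs_le_between in Hl.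
 apply (proj2 (Rlt_div_r _ _ _ (ltac:(lra) : 0 < 10*c))) in Hw'. unfold d in Hw'. lra.
Qed.

Lemma V0c_closed w : ~ V0c w -> exists r, 0 < r /\ forall w', Cmod (w'-w) < r -> ~ V0c w'.
Proof.
 unfold V0c. intros H. set (c := exp (- x)) in *. have Hc: 0 < c by apply exp_pos.
 have Hg: 1 < gauge N (kaN N) (c*w)%C by (apply Rnot_le_lt; intros Hle; apply H, (gauge_le_1 LM), Hle).
 set (d := gauge N (kaN N) (c*w)%C-1). exists (d/(10*c)). split; [apply Rdiv_lt_0_compat; unfold d; lra|].
 intros w' Hw' Hc'. apply (gauge_le_1 LM) in Hc'. have Hl := gauge_lip LM (c*w')%C (c*w)%C.
 replace (c*w'-c*w)%C with (c*(w'-w))%C in Hl by ring.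
 rewrite Cmod_mult, Cmod_pos_R in Hl by lra. apply Rabs_le_between in Hl.
 apply (proj2 (Rlt_div_r _ _ _ (ltac:(lra) : 0 < 10*c))) in Hw'. unfold d in Hw'. lra.
Qed.

Lemma Cexp_ccont z r : 0 < r -> exists dl, 0 < dl /\ forall w, Cmod (w-z) < dl -> Cmod (Cexp w-Cexp z) < r.
Proof.
 intros Hr. destruct (Cderiv_cont _ _ _ (Cderiv_exp z) r Hr) as (dl&Hdl&H). exists dl. split; [auto|].
 intros w Hw. specialize (H _ Hw). replace (z+(w-z))%C with w in H by ring. exact H.
Qed.

Lemma Lam_lip i u v : (1 <= i <= n)%nat -> strip g i u -> strip g i v ->
 Cmod (Lam i u-Lam i v) <= (Rabs (IZR (m i))+1)*Cmod (u-v).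
Proof.
 intros Hi Hu Hv. have H := Lam_diff i u v Hi Hu Hv. destruct e_small as [_ He].
 have Ht := Cmod_triangle (Lam i u-Lam i v-RtoC (IZR (m i))*(u-v)) (RtoC (IZR (m i))*(u-v))%C.
 replace (Lam i u-Lam i v-RtoC (IZR (m i))*(u-v)+RtoC (IZR (m i))*(u-v))%C with (Lam i u-Lam i v)%C in Ht by ring.
 rewrite Cmod_mult, Cmod_R in Ht. have := Cmod_ge_0 (u-v)%C. have: e*Cmod (u-v) <= 1*Cmod (u-v) by mono. lra.
Qed.

(** The outer petal stays away from the cut-off [lc 1+2*g] in the definition of [Om], so the cut-off
    creates no boundary there and [Om] is closed. *)
Lemma V0c_far_up z : lc 1%nat+g <= Re z -> V0c (RtoC T+Cexp (Lam 1 z))%C -> lc 1%nat+2*g+15 <= Re z.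
Proof.
 intros Hz HV. apply Rnot_lt_le. intros Hlt. have K1 := rs_K1 RS. have Hn := n_ge.
 destruct Dn_pos as (Hd&Hd1&HN&HN4&_).
 have HL := Lam_Re_diff 1 z (y) ltac:(lia) (strip_1 z Hz) (y_strip g ltac:(pose proof g_pos; lra)).
 rewrite (rs_L1 RS), (rs_m1 RS), !re_RtoC in HL. apply Rabs_le_between in HL. destruct e_small as [_ He].
 have: INR d1*(20*INR dn+5) <= INR d1*(y-Re z) by mono. destruct T_q_p as (T1&T2&_).
 have HE: (q-T)*(1+20*INR N) <= exp (Re (Lam 1 z)).
 { replace (Re (Lam 1 z)) with (ln (q-T)+(Re (Lam 1 z)-ln (q-T))) by ring. rewrite exp_plus, exp_ln by lra.
  apply Rmult_le_compat_l; [lra|]. have := exp_ineq1_le (Re (Lam 1 z)-ln (q-T)). lra. }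
 have Ht := th_lower LM. destruct th_pos as (_&Eq&_). have Hm: Cmod (T+Cexp (Lam 1 z))%C <= 2*q.
 { apply (Vc_bounded LM) in HV. rewrite Cmod_mult, Cmod_pos_R, exp_Ropp in HV by (left; apply exp_pos).
  apply (Rmult_le_compat_l q) in HV; [|lra]. rewrite <- Rmult_assoc, Rinv_r in HV by lra. lra. }
 have Hr := Cmod_reverse (Cexp (Lam 1 z)) (- T)%C. rewrite Cmod_opp, Cmod_pos_R, Cmod_Cexp in Hr by lra.
 replace (Cexp (Lam 1 z) - - T)%C with (T+Cexp (Lam 1 z))%C in Hr by ring.
 rewrite <- Eq in HE. have Hth: q * / (INR N+1) <= q*thq by mono.
 have: q * / (INR N+1)*(1+20*INR N) <= q*thq*(1+20*INR N) by mono. have: q * / (INR N+1)*(1+20*INR N) >= q*4.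
 { rewrite Rmult_assoc. apply Rle_ge, Rmult_le_compat_l; [lra|]. rewrite Rmult_comm.
  apply (proj1 (Rle_div_r _ _ _ (ltac:(lra) : 0 < INR N+1))). lra. }
 lra.
Qed.

Lemma Om_closed z : (forall r, 0 < r -> exists w, Om w /\ Cmod (w-z) < r) -> Om z.
Proof.
 intros H. split.
 - intros HV. destruct (V0_open _ HV) as (r&Hr&Ho), (Cexp_ccont z r Hr) as (dl&Hdl&Hc).
  destruct (H dl Hdl) as [w [[Hw _] Hd]]. apply Hw, Ho, Hc, Hd.
 - intros Hz HV. have Hg := g_pos. have Hn := n_ge. have Hz' := V0c_far_up z ltac:(lra) (V0_V0c _ HV).
  destruct (V0_open _ HV) as (r&Hr&Ho), (Cexp_ccont (Lam 1 z) r Hr) as (dl&Hdl&Hc).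
  set (L := Rabs (IZR (m 1%nat))+1). have HL: 0 < L by (unfold L; have := Rabs_pos (IZR (m 1%nat)); lra).
  destruct (H (Rmin 1 (dl/L))) as [w [[_ Hw] Hd]]; [apply Rmin_glb_lt; [lra|apply Rdiv_lt_0_compat; lra]|].
  have Hd1 := lt_min_l Hd. have Hd2 := lt_min_r Hd. have Hre := Re_ge_Cmod (w-z)%C. rewrite Re_minus in Hre.
  apply Hw; [lra|]. apply Ho. replace (T+Cexp (Lam 1 w)-(T+Cexp (Lam 1 z)))%C with (Cexp (Lam 1 w)-Cexp (Lam 1 z))%C by
   ring.
  apply Hc. eapply Rle_lt_trans; [apply Lam_lip; [lia|apply strip_1; lra|apply strip_1; lra]|].
  apply (proj2 (Rlt_div_r _ _ _ HL)) in Hd2. fold L. lra.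
Qed.

Lemma Om_per z k : Om z -> Om (z+turn k)%C.
Proof.
 intros [H1 H2]. split.
 - rewrite Cexp_period. auto.
 - rewrite Lam_shift, Cexp_period, re_plus, Rplus_0_r. auto.
Qed.

(** Closeness of [Xf u] and [Xf v] gives closeness of [u] and [v] up to a period. A nonzero period
    would shift [Xf] by at least [2*PI], which the bounds exclude. *)
Lemma Xf_equi r : 0 < r -> exists dl, 0 < dl /\ forall u v, Om u -> Om v -> rho u v < dl -> Cmod (u-v) < r.
Proof.
 intros Hr. set (b := Rabs lw+Rabs (y+1)). destruct Lx_ge_1 as [HL _], (Cexp_close b (Rmin r (1/Lx))) as (dl&Hdl&Hc);
  [apply Rmin_glb_lt; [lra|apply Rdiv_lt_0_compat; lra]|].
 set (A := exp (y+3)). have HA: 0 < A by apply exp_pos.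
 exists (Rmin 1 (dl/A)). split; [apply Rmin_glb_lt; [lra|apply Rdiv_lt_0_compat; lra]|].
 intros u v Hu Hv Huv. have H1 := lt_min_l Huv. have H2 := lt_min_r Huv. have Hb: forall z, Om z -> Rabs (Re z) <= b.
 { intros z Hz. destruct (Om_Re z Hz) as [B1 B2]. unfold b. apply Rabs_le.
  have := Rle_abs (y+1). have := Rle_abs (- lw). rewrite Rabs_Ropp in H0.
  have := Rabs_pos (y+1). have := Rabs_pos lw. lra. }
 destruct (Hc u v (Hb u Hu) (Hb v Hv)) as [k Hk].
 { replace (Cexp u-Cexp v)%C with (Cexp (Xf u)-Cexp (Xf v))%C by (rewrite !Cexp_Xf by (apply Om_Re; auto); ring).
  eapply Rle_lt_trans; [apply (Cexp_lipschitz (y+3)); apply Xf_Re; auto|].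
  apply (proj2 (Rlt_div_r _ _ _ HA)) in H2. fold A. fold (rho u v). lra. }
 have Hk1 := lt_min_l Hk. have Hk2 := lt_min_r Hk. have: k = 0%Z.
 { apply NNPP. intros Hk0. apply Rabs_IZR_ge_1 in Hk0.
  have Hl := rho_lip _ v (Om_per u k Hu) Hv. unfold rho in Hl. rewrite (Xf_shift) in Hl.
  have HLk: Lx*Cmod (u+turn k-v) < 1.
  { apply (proj2 (Rlt_div_r _ _ _ (ltac:(lra) : 0 < Lx))) in Hk2. lra. }
  have Ht := Cmod_triangle (Xf u+turn k-Xf v)%C (- (Xf u-Xf v))%C.
  replace (Xf u+turn k-Xf v + - (Xf u-Xf v))%C with (turn k) in Ht by ring.
  rewrite Cmod_iI, Cmod_opp, !Rabs_mult, (Rabs_pos_eq 2), (Rabs_pos_eq PI) in Ht by (have := PI_RGT_0; lra).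
  fold (rho u v) in Ht. have := PI2_1. have: 2*PI*1 <= 2*PI*Rabs (IZR k) by mono. lra. }
 subst k. replace (u+turn 0-v)%C with (u-v)%C in Hk1; [auto|]. apply C_ext; unfold Re, Im; simpl; ring.
Qed.

Theorem rat_circle_sys : exists CC Rb, @circle_sys n F Om G m CC (lc 1%nat) Rb.
Proof.
 destruct (rs_kap RS) as [CK HCK]. have Hg := g_pos.
 (* [CC] adds up the imaginary parts that disturb multiplication by the degree: [PI/2] for the
    logarithm in [Xf], [CK] for the constants [kap i], and 1 for the errors. *)
 have HPI := PI_RGT_0. exists (PI/2+Rabs CK+1), (Rabs lw+Rabs (y+1)). constructor.
 - have := Rabs_pos CK. lra.
 - apply Om_closed.
 - apply Om_per.
 - intros t. have := rs_K2 RS. have := lc_n1. split.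
  + intros HV. apply (V0_V0c) in HV. apply V0c_Re in HV. change (Re (lc 1%nat, t)) with (lc 1%nat) in HV. lra.
  + change (Re (lc 1%nat, t)) with (lc 1%nat). lra.
 - intros z Hz. destruct (Om_Re z Hz) as [B1 B2]. apply Rabs_le.
  have := Rle_abs (y+1). have := Rle_abs (- lw). rewrite Rabs_Ropp in H0.
  have := Rabs_pos (y+1). have := Rabs_pos lw. lra.
 - apply (rs_m RS).
 - apply G_Om.
 - intros i z Hi Hz. destruct (G_spec i z Hi Hz) as [Hs E]. apply (f_equal Im) in E. unfold Lamb, Xf in E.
  rewrite !im_plus, im_scal_l in E. have H1 := Clog_Im_bound (1-T*Cexp (- z))%C.
  fold (Log1m (T*Cexp (- z))%C) in H1. have H2 := HCK i Hi. have H2' := Rle_abs CK.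
  have H3 := rs_eps RS i _ Hi (strip_2g _ _ Hs). have H4 := Cmod_Im_le (eps i (G i z)).
  destruct e_small as [_ He]. apply Rabs_le_between in H1, H2, H4. apply Rabs_le. lra.
 - intros i z k Hi Hz. symmetry. destruct (G_spec i z Hi Hz) as [Hs E].
  apply G_unique; [auto|apply Om_per, Hz| |].
  + destruct (strip_2g _ _ Hs) as [S1 S2]. split; rewrite re_plus; simpl (Re (iI _)); intros; [specialize (S1
   H)|specialize (S2 H)]; lra.
  + rewrite Lam_shift, E, Xf_shift. auto.
 - apply G_F.
 (* [rho_gc] is applied to all letters but the outermost, which is kept to return from [rho] to the
    Euclidean distance. *)
 - intros B r HB Hr. destruct Lx_ge_1 as [HL _], (rho_gc (Lx*(Lx*B)) r) as (eta&Heta&H);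
   [apply Rmult_lt_0_compat; [lra|apply Rmult_lt_0_compat; lra]|auto|].
  destruct (exists_INR_gt ((Lx*(Lx*B)+eta)/eta)) as [K HK]. apply (proj1 (Rlt_div_l _ _ _ Heta)) in HK.
  exists (S K). intros k w u v Hk Hw Hu Hv Huv. destruct k as [|k]; [lia|].
  have Hk': INR K <= INR k by (apply le_INR; lia). specialize (H k (wshift 1 w) u v (wok_shift n 1 w Hw) Hu Hv).
  have HB': Lx*rho u v <= Lx*(Lx*B).
  { apply Rmult_le_compat_l; [lra|]. eapply Rle_trans; [apply rho_lip; auto|]. apply Rmult_le_compat_l; lra. }
  have: INR K*eta <= INR k*eta by mono. rewrite Rmax_left in H by lra.
  have HG := G_contract (w 0%nat) (gck k (wshift 1 w) u) (gck k (wshift 1 w) v) (Hw 0%nat)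
    (gck_Om _ _ _ (wok_shift n 1 w Hw) Hu) (gck_Om _ _ _ (wok_shift n 1 w Hw) Hv).
  simpl gc. lra.
 - destruct Lx_ge_1 as [HL _]. exists Lx. split; [lra|]. intros i u v Hi Hu Hv.
  have := G_contract i u v Hi Hu Hv. have := rho_lip u v Hu Hv. have := Cmod_ge_0 (G i u-G i v)%C. lra.
 - intros r Hr. destruct (Xf_equi r Hr) as (dl&Hdl&H).
  have HD: exists D, 0 < D /\ forall i, (1 <= i <= n)%nat -> Rabs (IZR (m i))+1 <= D.
  { have Hk: forall k, exists D, 0 < D /\ forall i, (i <= k)%nat -> Rabs (IZR (m i))+1 <= D.
   { induction k as [|k [D [HD IH]]].
    - exists (Rabs (IZR (m 0%nat))+1). have := Rabs_pos (IZR (m 0%nat)). split; [lra|].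
     intros i Hi. replace i with 0%nat by lia. lra.
    - exists (Rmax D (Rabs (IZR (m (S k)))+1)). split; [eapply Rlt_le_trans; [exact HD|apply Rmax_l]|].
     intros i Hi. destruct (Nat.eq_dec i (S k)) as [->|Hne]; [apply Rmax_r|].
     eapply Rle_trans; [apply IH; lia|apply Rmax_l]. }
   destruct (Hk n) as (D&HD&HDi). exists D. split; [auto|]. intros i Hi. apply HDi. lia. }
  destruct HD as (D&HD&HDi). exists (dl/D). split; [apply Rdiv_lt_0_compat; lra|].
  intros i u v Hi Hu Hv HG. apply H; try auto. destruct (G_spec i u Hi Hu) as [S1 E1], (G_spec i v Hi Hv) as [S2 E2].
  have HL := Lam_lip i _ _ Hi (strip_2g _ _ S1) (strip_2g _ _ S2). rewrite E1, E2 in HL. fold (rho u v) in HL.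
  apply (proj2 (Rlt_div_r _ _ _ HD)) in HG. have: (Rabs (IZR (m i))+1)*Cmod (G i u-G i v) <= D*Cmod (G i u-G i v)
   by (apply Rmult_le_compat_r; [apply Cmod_ge_0|apply HDi, Hi]). lra.
 - exists 1. split; [lra|].
  have Hw: forall i j u v, (1 <= i)%nat -> (i < j)%nat -> (j <= n)%nat -> Om u -> Om v -> 1 <= Cmod (G i u-G j v).
  { intros i j u v Hi Hij Hj Hu Hv. destruct (G_spec i u ltac:(lia) Hu) as [[S1 _] _], (G_spec j v ltac:(lia) Hv) as
   [[_ S2] _].
   specialize (S1 ltac:(lia)). specialize (S2 ltac:(lia)). have Hr := Re_le_Cmod (G i u-G j v)%C. rewrite Re_minus in Hr.
   have: lc (j-1)%nat <= lc i.
   { destruct (Nat.eq_dec i (j-1)) as [->|Hne]; [lra|].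
    have := rs_sep RS i (j-1)%nat ltac:(lia) ltac:(lia) ltac:(lia). lra. }
   lra. }
  intros i j u v Hi Hj Hu Hv Hd. destruct (Nat.lt_trichotomy i j) as [H|[H|H]]; [|exact H|].
  + have := Hw i j u v ltac:(lia) H ltac:(lia) Hu Hv. lra.
  + have H1 := Hw j i v u ltac:(lia) H ltac:(lia) Hv Hu. rewrite Cmod_sym in H1. lra.
 - intros z z' _ Hz' HF. destruct (branch z z' Hz' HF) as (i&z''&H1&H2&H3&H4&_). exists i, z''. auto.
Qed.

(** * The parabolic basin, the Fatou set and the Julia set *)

Local Notation sq := (Some (RtoC (exp x)) : sphere).

Local Notation sp := (Some (RtoC (exp y)) : sphere).

Definition VV (P: sphere) : Prop := match P with Some w => V0 w | None => False end.
Definition basin (P: sphere) : Prop := exists k, VV (iter F k P).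

Lemma VV_open P : VV P -> exists r, 0 < r /\ forall Q, chordal P Q < r -> VV Q.
Proof.
 destruct P as [w|]; [|intros []]. intros H. destruct (V0_open w H) as (r&Hr&Ho), (chordal_finite_nbhd w r Hr) as
  (dl&Hdl&Hn). exists dl. split; [auto|].
 intros Q HQ. destruct (Hn Q HQ) as (w'&->&Hw'). apply Ho, Hw'.
Qed.

Lemma V0_T : V0 (RtoC T).
Proof.
 replace (RtoC T) with (T+0)%C by ring. apply V0_ball_lt. rewrite Cmod_0. destruct T_q_p as (_&?&_). lra.
Qed.

(** The real part of [1/(1-y)] with [y = w/q]. It grows by at least 1/2 with every double step, and
    a value at least [t] confines [w] to distance [q/t] from the parabolic point. *)
Definition lyap (w: C) : R := Re (/ (1-RtoC (exp (- x))*w))%C.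

Lemma VV_step w : V0 w -> exists w', F (F (Some w)) = Some w' /\ V0 w' /\ lyap w+1/2 <= lyap w'.
Proof.
 intros HV. destruct (classic (w = 0%C)) as [->|Hw].
 - exists (RtoC T). rewrite (rs_zero RS), (rs_inf RS). split; [auto|]. split; [apply V0_T|].
  unfold lyap. replace (1-RtoC (exp (- x))*0)%C with (RtoC 1) by ring. destruct th_pos as [[Ht1 Ht2] _].
  replace (1-RtoC (exp (- x))*T)%C with (RtoC thq).
  + rewrite <- !RtoC_inv, !re_RtoC by lra. have Hu := th_upper LM.
   have: 3 <= / thq; [|lra]. rewrite <- (Rinv_inv 3). apply Rinv_le_contravar; lra.
  + rewrite <- RtoC_mult, <- RtoC_minus. f_equal. unfold thq. rewrite exp_Ropp. unfold Rdiv. ring.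
 - destruct (Cexp_surj w Hw) as [z <-]. have Hz := V0c_Re z (V0_V0c _ HV).
  destruct MM_ge as [HM _], (two_step z ltac:(lra)) as (H1&H2&_&_&H4). have := n_ge.
  eexists. rewrite H1, (rs_strip RS 1 _ ltac:(lia) H2), H4. split; [auto|].
  have Hne: Cexp z <> q by (intros E; rewrite E in HV; exact (not_V0_q HV)). split.
  + destruct (V0c_two_step z (V0_V0c _ HV) Hne) as (u&E1&E2&E3). rewrite H1 in E1. apply Some_C in E1.
   destruct (Cexp_eq _ _ E1) as [k Ek]. rewrite <- H4, Ek, Lam_shift, Cexp_period. auto.
  + unfold lyap. rewrite qexp, Cmult_assoc, <- RtoC_mult, <- exp_plus. replace (- x+x) with 0 by ring.
   rewrite exp_0, Cmult_1_l.
   apply (fm_lyapunov LM); [rewrite Re_minus, re_RtoC; lra|]. unfold V0 in HV. rewrite qexp in HV. auto.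
Qed.

Lemma VV_iter w j : V0 w -> exists w', iter F (2*j) (Some w) = Some w' /\ V0 w' /\ lyap w+INR j/2 <= lyap w'.
Proof.
 intros HV. induction j as [|j [w' [E [H1 H2]]]].
 - exists w. split; [auto|]. split; [auto|]. simpl. lra.
 - destruct (VV_step w' H1) as (w''&E'&H1'&H2'). exists w''. split.
  + replace (2*S j)%nat with (S (S (2*j))) by lia. cbn [iter]. rewrite E. auto.
  + split; [auto|]. rewrite S_INR. lra.
Qed.

Lemma VV_iter2 P j : VV P -> VV (iter F (2*j) P).
Proof. destruct P as [w|]; [|intros []]. intros H. destruct (VV_iter w j H) as (w'&E&H'&_).
 match type of E with ?a = _ => change (VV a) end. rewrite E. auto. Qed.

Lemma lyap_close w t : 0 < t -> t <= lyap w -> Cmod (w-RtoC q) <= q/t.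
Proof.
 intros Ht H. unfold lyap in H. have Hq := exp_pos x. set (u := (1-RtoC (exp (- x))*w)%C) in *. have Hu: u <> 0%C.
 { intros E. rewrite E in H. have: Re (/ RtoC 0) = 0 by (unfold Re; simpl; unfold Rdiv; ring). lra. }
 have Hw: (w-q = - q*u)%C.
 { unfold u. rewrite exp_Ropp, RtoC_inv by lra. field. intros E; injection E; lra. }
 rewrite Hw, Cmod_mult, Cmod_opp, Cmod_pos_R by lra. apply Rmult_le_compat_l; [lra|].
 have Hr := Re_le_Cmod (/ u)%C. rewrite Cmod_inv in Hr by auto.
 rewrite <- (Rinv_inv (Cmod u)). apply Rinv_le_contravar; lra.
Qed.

Lemma VV_uniform P : VV P -> exists r, 0 < r /\ (forall Q, chordal P Q < r -> VV Q) /\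
 forall r1, 0 < r1 -> exists K, forall j Q, (K <= j)%nat -> chordal P Q < r -> chordal (iter F (2*j) Q) sq < r1.
Proof.
 intros HP. destruct (VV_open P HP) as (r0&Hr0&Hin), P as [w|]; [|destruct HP].
 have Hc: Ccont (fun w => / (1-RtoC (exp (- x))*w))%C w.
 { apply (Ccont_inv (fun w => 1-RtoC (exp (- x))*w)%C).
  - apply (Cderiv_cont _ _ (0+RtoC (- exp (- x))*1)%C), (Cderiv_ext (fun w => 1+RtoC (- exp (- x))*w)%C).
   + exists 1. split; [lra|]. intros h _. rewrite RtoC_opp. ring.
   + apply Cderiv_plus; [apply Cderiv_const|apply Cderiv_scal, Cderiv_id].
  - intros E. apply (V_not_1 (RtoC (exp (- x))*w)%C HP).
   replace (RtoC (exp (- x))*w)%C with (1-(1-RtoC (exp (- x))*w))%C by ring. rewrite E. ring. }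
 destruct (Hc 1 ltac:(lra)) as (dl&Hdl&Hcc), (chordal_finite_nbhd w dl Hdl) as (r2&Hr2&Hn).
 exists (Rmin r0 r2). split; [apply Rmin_glb_lt; auto|]. split.
 { intros Q HQ. apply Hin. eapply Rlt_le_trans; [exact HQ|apply Rmin_l]. }
 intros r1 Hr1. have Hq := exp_pos x.
 destruct (exists_INR_gt (2*(2*q/r1+1-lyap w+1))) as [K HK]. exists K. intros j Q Hj HQ.
 have H1 := lt_min_l HQ. have H2 := lt_min_r HQ. have HV := Hin Q H1. destruct (Hn Q H2) as (w'&->&Hw').
 specialize (Hcc (w'-w)%C Hw'). replace (w+(w'-w))%C with w' in Hcc by ring.
 have Hre := Re_ge_Cmod (/ (1-RtoC (exp (- x))*w') - / (1-RtoC (exp (- x))*w))%C.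
 rewrite Re_minus in Hre. fold (lyap w) in Hre. fold (lyap w') in Hre.
 destruct (VV_iter w' j HV) as (w''&E&_&Hly). rewrite E. apply le_INR in Hj.
 have Ht0: 0 < 2*q/r1 by (apply Rdiv_lt_0_compat; lra). have Hcl := lyap_close w'' (2*q/r1+1) ltac:(lra) ltac:(lra).
 eapply Rle_lt_trans; [apply chordal_le|]. have: q/(2*q/r1+1) < r1/2; [|lra].
 apply (proj2 (Rlt_div_l _ _ _ (ltac:(lra) : 0 < 2*q/r1+1))).
 replace (r1/2*(2*q/r1+1)) with (q+r1/2) by (field; lra). lra.
Qed.

Lemma F_q : F sq = sp.
Proof.
 have := n_ge. replace (RtoC q) with (Cexp (x)) by apply Cexp_R.
 rewrite (rs_strip RS n); [|lia|apply x_strip; have := g_pos; lra].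
 rewrite (rs_Ln RS), Cexp_R, exp_ln by (destruct T_q_p as (?&?&?); have := exp_pos x; lra).
 f_equal. rewrite <- RtoC_plus. f_equal. ring.
Qed.

Lemma F_p : F sp = sq.
Proof.
 have := n_ge. replace (RtoC p) with (Cexp (y)) by apply Cexp_R.
 rewrite (rs_strip RS 1); [|lia|apply y_strip; have := g_pos; lra].
 rewrite (rs_L1 RS), Cexp_R, exp_ln by (destruct T_q_p as (?&?&?); lra). f_equal. rewrite <- RtoC_plus. f_equal. ring.
Qed.

Lemma basin_uniform P k : VV (iter F k P) -> exists r, 0 < r /\ (forall Q, chordal P Q < r -> VV (iter F k Q)) /\
 forall r1, 0 < r1 -> exists K, forall j Q, (K <= j)%nat -> chordal P Q < r ->
  chordal (iter F (k+2*j) Q) sq < r1 /\ chordal (iter F (k+S (2*j)) Q) sp < r1.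
Proof.
 intros H. destruct (VV_uniform _ H) as (r0&Hr0&Hin&Hu), (scont_iter F k P (rs_cont RS) r0 Hr0) as (r&Hr&Hc). exists r.
  split; [auto|]. split.
 { intros Q HQ. apply Hin, Hc, HQ. }
 intros r1 Hr1. destruct (rs_cont RS sq r1 Hr1) as (r2&Hr2&Hc2), (Hu (Rmin r1 r2)) as [K HK]; [apply Rmin_glb_lt;
  auto|]. exists K. intros j Q Hj HQ.
 specialize (HK j (iter F k Q) Hj (Hc Q HQ)). rewrite <- iter_add, Nat.add_comm in HK.
 split; [eapply Rlt_le_trans; [exact HK|apply Rmin_l]|].
 rewrite Nat.add_succ_r. rewrite <- F_q, chordal_sym. apply Hc2.
 rewrite chordal_sym. eapply Rlt_le_trans; [exact HK|apply Rmin_r].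
Qed.

Lemma basin_Fatou P : basin P -> Fatou F P.
Proof.
 intros [k Hk]. destruct (basin_uniform P k Hk) as (r&Hr&_&Hu). exists r. split; [auto|].
 apply (normal_of_two_limits F _ sq sp k).
 - intros Q HQ. destruct (ball_open_nbhd P Q r HQ) as (r'&Hr'&H'). exists r'. auto.
 - apply (rs_cont RS).
 - intros r1 Hr1. destruct (Hu r1 Hr1) as [K HK]. exists K. intros j Q Hj HQ. apply HK; auto.
Qed.

(** An orbit that leaves the image of [Om] is in the inner petal, or one step away from it, or at
    infinity, which is sent to the petal point [T]. *)
Lemma basin_or_Jset P : basin P \/ Jset (F := F) (Om := Om) P.
Proof.
 destruct (classic (Jset (F := F) (Om := Om) P)) as [H|H]; [right; exact H|left].
 apply not_all_ex_not in H. destruct H as [k Hk]. have := n_ge. have := g_pos. destruct (iter F k P) as [w|] eqn:E.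
 - destruct (classic (w = RtoC 0)) as [Hw|Hw].
  + exists k. rewrite E, Hw. replace (RtoC 0) with (q*0)%C by ring. apply V0_scaled, (V_small LM). rewrite Cmod_0.
   destruct Dn_pos as (_&_&_&HN&_).
   have: 3/(4*INR N) <= 1; [|lra]. apply (proj2 (Rle_div_l _ _ _ (ltac:(lra) : 0 < 4*INR N))). lra.
  + destruct (Cexp_surj w Hw) as [z Hz]. apply NNPP. intros Hnb. apply Hk. exists z. rewrite Hz. split; [|auto]. split.
   * intros HV. apply Hnb. exists k. rewrite E, <- Hz. auto.
   * intros Hre HV. apply Hnb. exists (S k). cbn [iter]. rewrite E, <- Hz.
    have Hs: gstrip n lc g 1 z by (apply strip_1; lra).
    have E' := rs_strip RS 1 z ltac:(lia) Hs. match type of E' with ?a = _ => change (VV a) end. rewrite E'. auto.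
 - exists (S k). cbn [iter]. rewrite E, (rs_inf RS). exact V0_T.
Qed.

Lemma Jset_not_basin P : Jset (F := F) (Om := Om) P -> ~ basin P.
Proof. intros HJ [k Hk]. destruct (HJ k) as [z [[Hz _] E]]. rewrite E in Hk. exact (Hz Hk). Qed.

Lemma Jset_not_Fatou P : Jset (F := F) (Om := Om) P -> ~ Fatou F P.
Proof.
 intros HJ. destruct rat_circle_sys as (CC&Rb&CS), (HH_sensitive CS) as (e0&He0&Hs).
 apply (not_normal_of_sensitive F P e0 (rs_cont RS) He0), Hs, HJ.
Qed.

Lemma Fatou_basin P : Fatou F P <-> basin P.
Proof.
 split; [|apply basin_Fatou]. intros H. destruct (basin_or_Jset P) as [Hb|HJ]; [auto|].
 exfalso. exact (Jset_not_Fatou P HJ H).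
Qed.

Theorem Julia_cantor_circles : cantor_circles (Julia F).
Proof.
 destruct rat_circle_sys as (CC&Rb&CS). have := n_ge.
 apply (cantor_circles_ext (Jset (F := F) (Om := Om))); [|apply (circle_sys_cantor_circles CS); lia].
 intros P. unfold Julia. rewrite Fatou_basin. split; [apply Jset_not_basin|].
 intros Hn. destruct (basin_or_Jset P); tauto.
Qed.

(** * The parabolic cycle and its multiplier *)

Lemma local_deriv i a l : (1 <= i <= n)%nat ->
 (exists r, 0 < r /\ forall z, Cmod (z-RtoC a) < r -> gstrip n lc g i z) -> Cderiv (Lam i) (RtoC a) l ->
 exists f r, 0 < r /\ (forall w, Cmod w < r -> F (Some (RtoC (exp a)+w)%C) = Some (f (RtoC (exp a)+w)%C)) /\
  Cderiv f (RtoC (exp a)) (Cexp (Lam i (RtoC a))*(l*RtoC (/ exp a)))%C.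
Proof.
 intros Hi [r [Hr Hst]] Hl. have Ha := exp_pos a. set (lg := fun w => (a+Log1m (1+RtoC (- / exp a)*w))%C).
 have Harg: forall h, (1+RtoC (- / exp a)*(RtoC (exp a)+h) = RtoC (- / exp a)*h)%C.
 { intros h. rewrite RtoC_opp, RtoC_inv by lra. field. intros E; injection E; lra. }
 have Hlg0: lg (RtoC (exp a)) = a.
 { unfold lg. replace (RtoC (exp a)) with (RtoC (exp a)+0)%C by ring. rewrite Harg, Cmult_0_r, Log1m_0. ring. }
 have Hlg: Cderiv lg (RtoC (exp a)) (RtoC (/ exp a)).
 { replace (RtoC (/ exp a)) with (0 + - / (1-0)*(0+RtoC (- / exp a)*1))%C by (rewrite RtoC_opp; field; intros E;
  injection E; lra). apply Cderiv_plus; [apply Cderiv_const|].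
   apply (Cderiv_comp (fun w => 1+RtoC (- / exp a)*w)%C Log1m).
  - apply Cderiv_plus; [apply Cderiv_const|apply Cderiv_scal, Cderiv_id].
  - replace (1+RtoC (- / exp a)*RtoC (exp a))%C with (RtoC 0).
   + apply Cderiv_Log1m. rewrite Cmod_0. lra.
   + rewrite <- RtoC_mult, <- RtoC_plus. f_equal. field. lra. }
 exists (fun w => T+Cexp (Lam i (lg w)))%C. destruct (Cderiv_cont _ _ _ Hlg r Hr) as (r1&Hr1&Hc).
 exists (Rmin r1 (exp a)). split; [apply Rmin_glb_lt; auto|]. split.
 - intros w Hw. have H1 := lt_min_l Hw. have H2 := lt_min_r Hw.
  have E: (RtoC (exp a)+w)%C = Cexp (lg (RtoC (exp a)+w)%C).
  { unfold lg. rewrite Harg, Cexp_plus, Cexp_Log1m, Cexp_R.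
   - rewrite RtoC_opp, RtoC_inv by lra. field. intros E; injection E; lra.
   - rewrite RtoC_opp, Cmod_mult, Cmod_opp, Cmod_pos_R by (left; apply Rinv_0_lt_compat, Ha).
    rewrite Rmult_comm. apply (proj2 (Rlt_div_l _ _ _ Ha)). lra. }
  rewrite E at 1. apply (rs_strip RS i); [auto|]. apply Hst. specialize (Hc w H1). rewrite Hlg0 in Hc. auto.
 - replace (Cexp (Lam i (a))*(l*RtoC (/ exp a)))%C with (0+Cexp (Lam i (a))*(l*RtoC (/ exp a)))%C by ring.
  apply Cderiv_plus; [apply Cderiv_const|]. apply (Cderiv_comp (fun w => Lam i (lg w)) Cexp).
  + apply (Cderiv_comp lg (Lam i)); [auto|]. rewrite Hlg0. auto.
  + rewrite Hlg0. apply Cderiv_exp.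
Qed.

Lemma Lam_deriv i z : (1 <= i <= n)%nat -> gstrip n lc g i z -> Cderiv (Lam i) z (RtoC (IZR (m i))+eps' i z)%C.
Proof.
 intros Hi Hz. replace (RtoC (IZR (m i))+eps' i z)%C with ((RtoC (IZR (m i))*1+0)+eps' i z)%C by ring.
  apply Cderiv_plus; [apply Cderiv_plus; [apply Cderiv_scal, Cderiv_id|apply Cderiv_const]|].
 apply (rs_C11 RS i Hi), Hz.
Qed.

Lemma compose_multiplier (a b: C) (f h: C -> C) (la lb: C) (r1 r2: R) :
 F (Some a) = Some b -> F (Some b) = Some a -> 0 < r1 -> 0 < r2 ->
 (forall w, Cmod w < r1 -> F (Some (a+w)%C) = Some (f (a+w)%C)) ->
 (forall w, Cmod w < r2 -> F (Some (b+w)%C) = Some (h (b+w)%C)) ->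
 Cderiv f a la -> Cderiv h b lb -> (lb*la)%C = 1%C -> multiplier (iter F 2) (Some a) Defs.C1.
Proof.
 intros Fa Fb Hr1 Hr2 Hf Hh Df Dh Hl. split; [simpl; rewrite Fa; auto|]. have Efa: f a = b.
 { specialize (Hf 0%C ltac:(rewrite Cmod_0; auto)). replace (a+0)%C with a in Hf by ring.
  rewrite Fa in Hf. apply Some_C in Hf. auto. }
 have Ehb: h b = a.
 { specialize (Hh 0%C ltac:(rewrite Cmod_0; auto)). replace (b+0)%C with b in Hh by ring.
  rewrite Fb in Hh. apply Some_C in Hh. auto. }
 have D: Cderiv (fun w => h (f w)) a 1%C.
 { rewrite <- Hl. apply Cderiv_comp; [auto|]. rewrite Efa. auto. }
 intros r Hr. destruct (D r Hr) as (dl&Hdl&HD), (Cderiv_cont _ _ _ Df r2 Hr2) as (d3&Hd3&Hc).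
 exists (Rmin dl (Rmin d3 r1)). split; [repeat apply Rmin_glb_lt; auto|].
 intros w [_ Hw]. have H1 := lt_min_l Hw. have H2 := lt_min_r Hw. have H3 := lt_min_l H2. have H4 := lt_min_r H2.
 change (iter F 2 (chart (Some a) w)) with (F (F (Some (a+w)%C))). rewrite (Hf w H4).
 replace (f (a+w)%C) with (b+(f (a+w)-b))%C by ring.
 rewrite Hh by (rewrite <- Efa; apply Hc, H3). replace (b+(f (a+w)-b))%C with (f (a+w)%C) by ring.
 specialize (HD w H1). rewrite Efa, Ehb in HD. auto.
Qed.

Theorem multipliers : multiplier (iter F 2) sq Defs.C1 /\ multiplier (iter F 2) sp Defs.C1.
Proof.
 have Hn := n_ge. have Hg := g_pos. have K1 := rs_K1 RS. have K2 := rs_K2 RS.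
  destruct Dn_pos as [Hd _], (local_deriv n x (RtoC (IZR (m n))+eps' n (x))%C) as (f&r1&Hr1&Hf&Df); [lia| | |].
 { exists 1. split; [lra|]. intros z Hz. apply strip_n. have H := Re_le_Cmod (z-x)%C.
  rewrite Re_minus, re_RtoC in H. lra. }
 { apply Lam_deriv; [lia|]. apply x_strip. lra. }
 destruct (local_deriv 1 y (RtoC (IZR (m 1%nat))+eps' 1%nat (y))%C) as (h&r2&Hr2&Hh&Dh); [lia| | |].
 { exists 1. split; [lra|]. intros z Hz. apply strip_1. have H := Re_ge_Cmod (z-y)%C.
  rewrite Re_minus, re_RtoC in H. lra. }
 { apply Lam_deriv; [lia|]. apply y_strip. lra. }
 destruct T_q_p as (T1&T2&T3). rewrite (rs_Ln RS), (rs_mn RS), Cexp_R, exp_ln in Df by lra.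
 rewrite (rs_L1 RS), (rs_m1 RS), Cexp_R, exp_ln in Dh by lra.
 have Hm := rs_mult RS. set (A := (RtoC (- INR dn)+eps' n (x))%C) in *.
 set (B := (RtoC (- INR d1)+eps' 1%nat (y))%C) in *.
 have HAB: (RtoC (q-T)*(B*RtoC (/ p))*(RtoC (p-T)*(A*RtoC (/ q))) = 1)%C.
 { replace (RtoC (q-T)*(B*RtoC (/ p))*(RtoC (p-T)*(A*RtoC (/ q))))%C
   with (B*A*(RtoC (q-T)*RtoC (p-T))*(RtoC (/ p)*RtoC (/ q)))%C by ring.
  rewrite <- !RtoC_mult, Hm, <- RtoC_mult. apply f_equal. field. lra. }
 split.
 - exact (compose_multiplier _ _ f h _ _ r1 r2 F_q F_p Hr1 Hr2 Hf Hh Df Dh HAB).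
 - refine (compose_multiplier _ _ h f _ _ r2 r1 F_p F_q Hr2 Hr1 Hh Hf Dh Df _). rewrite <- HAB. ring.
Qed.

Theorem parabolic_orbit : parabolic_2orbit F.
Proof.
 exists sq, sp. split; [|split; [exact F_q|split; [exact F_p|apply multipliers]]].
 intros E. apply Some_C in E. injection E as E. apply exp_inv in E. have := x_lt_y. lra.
Qed.

(** * Exhausting sets and their deformations *)

Lemma F_1 z : lc 1%nat+g <= Re z -> F (Some (Cexp z)) = Some (RtoC T+Cexp (Lam 1 z))%C.
Proof. intros H. have := n_ge. apply (rs_strip RS); [lia|apply strip_1, H]. Qed.

Definition Dz (P: sphere) : Prop := match P with Some w => Cmod w < exp (lc (n-1)%nat-2*g) | None => False end.
Definition Di (P: sphere) : Prop := match P with Some w => exp (lc 1%nat+2*g) < Cmod w | None => True end.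
Definition AA (b: bool) : sphere -> Prop := if b then Di else Dz.
Definition ix (b: bool) : nat := if b then 1%nat else n.

Lemma ix_range b : (1 <= ix b <= n)%nat.
Proof. have := n_ge. destruct b; simpl; lia. Qed.

Lemma radii : exp (lc (n-1)%nat-2*g) < exp (lc 1%nat+2*g) /\ 2*q < exp (lc (n-1)%nat-2*g).
Proof.
 have := g_pos. have := lc_n1. have := rs_K2 RS. split; [apply exp_increasing; lra|].
 apply Rlt_le_trans with (exp (x+1)); [|apply exp_le; lra]. rewrite exp_plus. have := exp_1_gt_2. have := exp_pos x. nra.
Qed.

Lemma AA_disjoint b P : AA b P -> AA (negb b) P -> False.
Proof. destruct radii as [H _]. destruct b, P; simpl; intros; lra. Qed.

Lemma open_gt P r : 0 < r -> (match P with Some w => r < Cmod w | None => True end) ->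
 exists dl, 0 < dl /\ forall Q, chordal P Q < dl -> match Q with Some w => r < Cmod w | None => True end.
Proof.
 intros Hr H. destruct P as [w|].
 - destruct (chordal_finite_nbhd w (Cmod w-r)) as (dl&Hdl&Hn); [lra|]. exists dl. split; [auto|].
  intros Q HQ. destruct (Hn Q HQ) as (w'&->&Hw'). have Ht := Cmod_reverse w (w-w')%C.
  replace (w-(w-w'))%C with w' in Ht by ring. rewrite (Cmod_sym w w') in Ht. lra.
 - destruct (chordal_inf_nbhd r) as (dl&Hdl&Hn). exists dl. split; [auto|].
  intros Q HQ. destruct (Hn Q HQ) as [->|[w [-> Hw]]]; [exact I|auto].
Qed.

Lemma open_lt w r : Cmod w < r ->
 exists dl, 0 < dl /\ forall Q, chordal (Some w) Q < dl -> exists w', Q = Some w' /\ Cmod w' < r.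
Proof.
 intros H. destruct (chordal_finite_nbhd w (r-Cmod w)) as (dl&Hdl&Hn); [lra|]. exists dl. split; [auto|].
 intros Q HQ. destruct (Hn Q HQ) as (w'&->&Hw'). exists w'. split; [auto|].
 have Ht := Cmod_triangle (w'-w)%C w. replace (w'-w+w)%C with w' in Ht by ring. lra.
Qed.

Lemma AA_open b : open_set (AA b).
Proof.
 intros P HP. destruct b; [apply open_gt; [apply exp_pos|auto]|].
 destruct P as [w|]; [|destruct HP]. destruct (open_lt w _ HP) as (dl&Hdl&H). exists dl. split; [auto|].
 intros Q HQ. destruct (H Q HQ) as (w'&->&Hw'). auto.
Qed.

Lemma preimage_open S k P : open_set S -> S (iter F k P) ->
 exists r, 0 < r /\ forall Q, chordal P Q < r -> S (iter F k Q).
Proof.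
 intros HS H. destruct (HS _ H) as (r0&Hr0&Hin), (scont_iter F k P (rs_cont RS) r0 Hr0) as (r&Hr&Hc).
 exists r. split; [auto|]. intros Q HQ. apply Hin, Hc, HQ.
Qed.

Lemma AA_exp b z : AA b (Some (Cexp z)) <-> (if b then lc 1%nat+2*g < Re z else Re z < lc (n-1)%nat-2*g).
Proof.
 destruct b; simpl; rewrite Cmod_Cexp; split; intros H; try (apply exp_increasing; exact H); apply exp_lt_inv; exact H.
Qed.

Lemma AA_strip b z : AA b (Some (Cexp z)) -> strip (2*g) (ix b) z.
Proof.
 intros H. apply AA_exp in H. destruct b; split; simpl; intros; try congruence; lra.
Qed.

Lemma strip_AA b z : strip (2*g+1/2) (ix b) z -> AA b (Some (Cexp z)).
Proof.
 intros [H1 H2]. apply AA_exp. have := n_ge. destruct b; simpl in *; [specialize (H1 ltac:(lia))|specialize (H2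
  ltac:(lia))]; lra.
Qed.

Lemma strip_uniq i j z : (1 <= i <= n)%nat -> (1 <= j <= n)%nat -> strip (2*g) i z -> strip (2*g) j z -> i = j.
Proof.
 have Hw: forall i j, (1 <= i)%nat -> (i < j)%nat -> (j <= n)%nat -> strip (2*g) i z -> strip (2*g) j z -> False.
 { intros i' j' Hi Hij Hj [S1 _] [_ S2]. specialize (S1 ltac:(lia)). specialize (S2 ltac:(lia)). have := g_pos.
  destruct (Nat.eq_dec i' (j'-1)) as [E|E]; [subst i'; lra|].
  have := rs_sep RS i' (j'-1)%nat ltac:(lia) ltac:(lia) ltac:(lia). lra. }
 intros Hi Hj H1 H2. destruct (Nat.lt_trichotomy i j) as [H|[H|H]]; [|exact H|]; exfalso.
 - apply (Hw i j); auto; lia.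
 - apply (Hw j i); auto; lia.
Qed.

Lemma VV_Dz P : VV P -> Dz P.
Proof.
 destruct P as [w|]; [|intros []]. intros HV. destruct radii as [_ H]. apply V0_V0c in HV.
 apply (Vc_bounded LM) in HV. rewrite Cmod_mult, Cmod_pos_R, exp_Ropp in HV by (left; apply exp_pos). have := exp_pos x.
 apply (Rmult_le_compat_l q) in HV; [|lra]. rewrite <- Rmult_assoc, Rinv_r in HV by lra. simpl. lra.
Qed.

(** Closed, because the radial retraction ends on the boundary of the petal; without the parabolic
    point, which does not belong to the basin. *)
Definition YY0 (P: sphere) : Prop := match P with Some w => V0c w /\ w <> (RtoC q: Cx) | None => False end.

Lemma VV_YY0 P : VV P -> YY0 P.
Proof.
 destruct P as [w|]; [|intros []]. intros HV. split; [apply V0_V0c, HV|]. intros E. rewrite E in HV. exact (not_V0_q HV).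
Qed.

Lemma YY0_step P : YY0 P -> Dz P /\ Di (F P) /\ VV (F (F P)).
Proof.
 destruct (sphere_cases P) as [->|[w ->]]; [intros []|]. intros [HV Hne]. split.
 { destruct radii as [_ H]. apply (Vc_bounded LM) in HV.
  rewrite Cmod_mult, Cmod_pos_R, exp_Ropp in HV by (left; apply exp_pos). have := exp_pos x.
  apply (Rmult_le_compat_l q) in HV; [|lra]. rewrite <- Rmult_assoc, Rinv_r in HV by lra. simpl. lra. }
 destruct (classic (w = RtoC 0)) as [->|Hw].
 - rewrite (rs_zero RS), (rs_inf RS). split; [exact I|exact V0_T].
 - destruct (Cexp_surj w Hw) as [z Hz]. rewrite <- Hz in *. destruct (V0c_two_step z HV Hne) as (u&E1&E2&E3).
  have := g_pos. have E4 := F_1 u ltac:(lra).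
  split; [rewrite E1; simpl; rewrite Cmod_Cexp; apply exp_increasing; lra|]. rewrite E1, E4. auto.
Qed.

(** The complement of the image of [Om], including 0 and infinity, described without logarithms. It
    is open, and mapped into itself by [F]. *)
Definition notOm (P: sphere) : Prop := VV P \/ (Di P /\ VV (F P)).

Lemma notOm_open : open_set notOm.
Proof.
 intros P [H|[H1 H2]].
 - destruct (VV_open P H) as (r&Hr&Ho). exists r. split; [auto|]. intros Q HQ. left. apply Ho, HQ.
 - destruct (AA_open true P H1) as (r1&Hr1&Ho1), (preimage_open VV 1 P VV_open H2) as (r2&Hr2&Ho2).
  exists (Rmin r1 r2). split; [apply Rmin_glb_lt; auto|]. intros Q HQ. right.
  split; [apply Ho1|apply Ho2]; (eapply Rlt_le_trans; [exact HQ|]); [apply Rmin_l|apply Rmin_r].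
Qed.

Lemma Om_notOm z : Om z -> ~ notOm (Some (Cexp z)).
Proof.
 have := g_pos. intros [H1 H2] [HV|[HD HV]]; [exact (H1 HV)|].
 apply (AA_exp true) in HD. apply H2; [lra|]. have E := F_1 z ltac:(lra). rewrite E in HV. auto.
Qed.

Lemma notOm_log (P: sphere) : ~ notOm P -> exists z, Om z /\ P = Some (Cexp z).
Proof.
 intros H. have := g_pos. destruct (sphere_cases P) as [->|[w ->]]; [|destruct (classic (w = RtoC 0)) as [->|Hw]].
 - exfalso. apply H. right. split; [exact I|]. rewrite (rs_inf RS). exact V0_T.
 - exfalso. apply H. left. replace (RtoC 0) with (q*0)%C by ring. apply V0_scaled, (V_small LM). rewrite Cmod_0.
  destruct Dn_pos as (_&_&_&HN&_).
  have: 3/(4*INR N) <= 1; [|lra]. apply (proj2 (Rle_div_l _ _ _ (ltac:(lra) : 0 < 4*INR N))). lra.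
 - destruct (Cexp_surj w Hw) as [z Hz]. exists z. rewrite <- Hz in *. split; [|auto]. split.
  + intros HV. apply H. left. auto.
  + intros Hre HV. apply H. right. have := V0c_far_up z ltac:(lra) (V0_V0c _ HV).
   split; [apply (AA_exp true); lra|]. have E := F_1 z ltac:(lra). rewrite E. auto.
Qed.

Lemma notOm_F P : notOm P -> notOm (F P).
Proof.
 intros [H|[_ H]]; [|left; exact H]. right. destruct (YY0_step P (VV_YY0 P H)) as (_&H1&H2). split; auto.
Qed.

Definition dom (Y: sphere -> Prop) (z: C) : Prop := Om z /\ Y (Some (Cexp z)).

(* A deformation of [Y] into [Y'] rel [Y'], given in logarithmic coordinates outside the petals;
  points of the petals are not moved. *)
Record good (Y Y': sphere -> Prop) (h: R -> C -> C) : Prop := {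
 gd_sub : forall P, Y' P -> Y P;
 gd_in : forall s z, 0 <= s <= 1 -> dom Y z -> dom Y (h s z);
 gd_0 : forall z, dom Y z -> h 0 z = z;
 gd_1 : forall z, dom Y z -> Y' (Some (Cexp (h 1 z)));
 gd_fix : forall s z, 0 <= s <= 1 -> dom Y z -> Y' (Some (Cexp z)) -> h s z = z;
 gd_per : forall s z (k: Z), 0 <= s <= 1 -> dom Y z -> h s (z+turn k)%C = (h s z+turn k)%C;
 gd_cont : forall s z r, 0 <= s <= 1 -> dom Y z -> 0 < r -> exists dl, 0 < dl /\
   forall s' z', 0 <= s' <= 1 -> dom Y z' -> Rabs (s-s') < dl -> Cmod (z'-z) < dl -> Cmod (h s' z'-h s z) < r;
 gd_out : forall P, Y P -> notOm P -> Y' P;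
 gd_nbhd : forall P, Y P -> ~ Y' P -> exists r, 0 < r /\ forall Q, chordal P Q < r -> Y Q -> ~ notOm Q }.
Arguments gd_sub {_ _ _}. Arguments gd_in {_ _ _}. Arguments gd_0 {_ _ _}. Arguments gd_1 {_ _ _}.
 Arguments gd_fix {_ _ _}.
Arguments gd_per {_ _ _}. Arguments gd_cont {_ _ _}. Arguments gd_out {_ _ _}. Arguments gd_nbhd {_ _ _}.

Definition lft (b: bool) (Y: sphere -> Prop) (P: sphere) : Prop := AA b P /\ Y (F P).
Definition pre (i: nat) (z u: C) : Prop := Om u /\ z = G i u.
(** The deformation [h] conjugated by the branch [G i]; points outside the image of the branch stay
    where they are. *)
Definition lifth (i: nat) (h: R -> C -> C) (s: R) (z: C) : C :=
 if excluded_middle_informative (exists u, pre i z u) then G i (h s (epsilon (inhabits (RtoC 0)) (pre i z))) else z.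

Lemma G_inj i u v : (1 <= i <= n)%nat -> Om u -> Om v -> G i u = G i v -> u = v.
Proof.
 intros Hi Hu Hv E. destruct rat_circle_sys as (CC&Rb&CS). apply eq_of_close. intros r Hr.
 destruct (cs_equi CS r Hr) as (dl&Hdl&H). left. apply (H i); try auto.
 rewrite E. replace (G i v-G i v)%C with (RtoC 0) by ring. rewrite Cmod_0. auto.
Qed.

Lemma lifth_in i h s u : (1 <= i <= n)%nat -> Om u -> lifth i h s (G i u) = G i (h s u).
Proof.
 intros Hi Hu. unfold lifth. destruct (excluded_middle_informative _) as [H|H].
 - have [H1 H2] := epsilon_spec (inhabits (RtoC 0)) (pre i (G i u)) H. rewrite <- (G_inj i u _ Hi Hu H1 H2). auto.
 - exfalso. apply H. exists u. split; auto.
Qed.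

Lemma lft_cases b Y z : lft b Y (Some (Cexp z)) ->
 (exists u, dom Y u /\ z = G (ix b) u /\ F (Some (Cexp z)) = Some (Cexp u)) \/
 (notOm (F (Some (Cexp z))) /\ forall h s, lifth (ix b) h s z = z).
Proof.
 intros [HA HY]. have Hi := ix_range b. destruct (classic (notOm (F (Some (Cexp z))))) as [H|H].
 - right. split; [exact H|]. intros h s. unfold lifth. destruct (excluded_middle_informative _) as [[u [Hu Ez]]|_];
  [|auto].
  exfalso. rewrite Ez, (G_F _ _ Hi Hu) in H. exact (Om_notOm u Hu H).
 - left. destruct (notOm_log _ H) as (z'&Hz'&E), (branch z z' Hz' E) as (i&u&H1&H2&H3&H4&H5).
  have: i = ix b by (apply (strip_uniq i (ix b) z H1 Hi H5), AA_strip, HA). subst i.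
  exists u. split; [|split; [auto|rewrite E, H3; auto]]. split; [auto|]. rewrite H3, <- E. auto.
Qed.

(** Inside the branch image all clauses are transported by [G], which is injective and continuous
    together with its inverse. The delicate point is continuity across the edge of that image, where
    the deformation must be stationary. *)
Lemma good_lift b Y Y' h : good Y Y' h -> good (lft b Y) (lft b Y') (lifth (ix b) h).
Proof.
 intros HG. have Hi := ix_range b. destruct rat_circle_sys as (CC&Rb&CS).
 have HLin: forall u, dom Y u -> dom (lft b Y) (G (ix b) u).
 { intros u [Hu HY]. split; [apply G_Om; auto|]. split.
  - apply strip_AA, G_strict; auto.
  - rewrite (G_F _ _ Hi Hu). auto. }
 constructor.
 - intros P [H1 H2]. split; [auto|]. apply (gd_sub HG), H2.
 - intros s z Hs [Hz HL]. destruct (lft_cases b Y z HL) as [[u [Hu [-> _]]]|[_ E]].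
  + rewrite lifth_in by (try auto; apply Hu). apply HLin, (gd_in HG); auto.
  + rewrite E. split; auto.
 - intros z [Hz HL]. destruct (lft_cases b Y z HL) as [[u [Hu [-> _]]]|[_ E]].
  + rewrite lifth_in by (try auto; apply Hu). rewrite (gd_0 HG) by auto. auto.
  + apply E.
 - intros z [Hz HL]. destruct (lft_cases b Y z HL) as [[u [Hu [-> _]]]|[Hn E]].
  + rewrite lifth_in by (try auto; apply Hu). have H1 := gd_in HG 1 u ltac:(lra) Hu.
   destruct (HLin _ H1) as (_&H2&_). split; [auto|]. rewrite (G_F _ _ Hi (proj1 H1)). apply (gd_1 HG), Hu.
  + rewrite E. destruct HL as [HA HY]. split; [auto|]. apply (gd_out HG); auto.
 - intros s z Hs [Hz HL] [_ HY']. destruct (lft_cases b Y z HL) as [[u [Hu [-> EF]]]|[_ E]].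
  + rewrite lifth_in by (try auto; apply Hu). rewrite EF in HY'. rewrite (gd_fix HG) by auto. auto.
  + apply E.
 - intros s z k Hs [Hz HL]. destruct (lft_cases b Y z HL) as [[u [Hu [-> _]]]|[Hn E]].
  + rewrite <- (cs_Gper CS) by (try auto; apply Hu).
   rewrite !lifth_in; try auto; try apply Hu; [|apply Om_per, Hu].
   rewrite (gd_per HG) by auto. apply (cs_Gper CS); [auto|]. apply (gd_in HG); auto.
  + rewrite E. destruct (lft_cases b Y (z+turn k)%C) as [[u [Hu [_ EF]]]|[_ E']]; [rewrite Cexp_period; auto| |apply E'].
   exfalso. rewrite Cexp_period in EF. rewrite EF in Hn. exact (Om_notOm u (proj1 Hu) Hn).
 - intros s z r Hs [Hz HL] Hr. have HFc: forall S : sphere -> Prop, open_set S -> S (F (Some (Cexp z))) ->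
    exists dl, 0 < dl /\ forall z', Cmod (z'-z) < dl -> S (F (Some (Cexp z'))).
  { intros S HS HSz. destruct (preimage_open S 1 _ HS HSz) as (r1&Hr1&H1), (Cexp_ccont z (r1/2) ltac:(lra)) as
   (dl&Hdl&Hc).
   exists dl. split; [auto|]. intros z' Hz'. apply H1. rewrite chordal_sym. eapply Rle_lt_trans; [apply chordal_le|].
   specialize (Hc z' Hz'). lra. }
  destruct (lft_cases b Y z HL) as [[u [Hu [Ez EF]]]|[Hn E]].
  + destruct (cs_lip CS) as (L&HL0&HLip).
   destruct (gd_cont HG s u (r/L) Hs Hu ltac:(apply Rdiv_lt_0_compat; lra)) as (d2&Hd2&H2).
   destruct (cs_equi CS d2 Hd2) as (d3&Hd3&H3).
   have HA: forall s' u', 0 <= s' <= 1 -> dom Y u' -> Rabs (s-s') < d2 -> Cmod (G (ix b) u'-z)%C < d3 ->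
     Cmod (G (ix b) (h s' u')-lifth (ix b) h s z)%C < r.
   { intros s' u' Hs' Hu' Hss Hzz. rewrite Ez in Hzz |- *. rewrite lifth_in by (try auto; apply Hu).
    specialize (H3 _ _ _ Hi (proj1 Hu') (proj1 Hu) Hzz). specialize (H2 s' u' Hs' Hu' Hss H3).
    eapply Rle_lt_trans; [apply HLip; [auto|apply (gd_in HG s' u' Hs' Hu')|apply (gd_in HG s u Hs Hu)]|].
    apply (proj2 (Rlt_div_r _ _ _ HL0)) in H2. lra. }
   (* If points with image in the petals come arbitrarily close to [z], then by [gd_nbhd] the image
      of [z] already lies in [Y']. By [gd_fix] it is not moved, so the lift agrees with the identity
      at [z]. *)
   have HB: exists d4, 0 < d4 /\ forall z', Cmod (z'-z) < d4 -> lft b Y (Some (Cexp z')) ->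
     notOm (F (Some (Cexp z'))) -> lifth (ix b) h s z = z.
   { destruct (classic (Y' (Some (Cexp u)))) as [HY'|HY'].
    - exists 1. split; [lra|]. intros z' _ _ _. rewrite Ez, lifth_in by (try auto; apply Hu).
     rewrite (gd_fix HG) by auto. auto.
    - destruct (gd_nbhd HG (Some (Cexp u)) (proj2 Hu) HY') as (r0&Hr0&H0). rewrite <- EF in H0.
     destruct (HFc (ball (F (Some (Cexp z))) r0)) as (d4&Hd4&H4).
     { intros Q HQ. destruct (ball_open_nbhd _ _ _ HQ) as (r'&Hr'&Hin). exists r'. auto. }
     { unfold ball. rewrite chordal_refl. auto. }
     exists d4. split; [auto|]. intros z' Hz' [_ HY1] Hn. exfalso. exact (H0 _ (H4 z' Hz') HY1 Hn). }
   destruct HB as (d4&Hd4&HB). exists (Rmin (Rmin d2 d3) (Rmin d4 r)). split; [repeat apply Rmin_glb_lt; auto|].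
   intros s' z' Hs' [Hz' HL'] Hss Hzz. have A1 := lt_min_l Hzz. have A2 := lt_min_r Hzz.
   destruct (lft_cases b Y z' HL') as [[u' [Hu' [Ez' _]]]|[Hn E']].
   * rewrite Ez' in A1 |- *. rewrite lifth_in by (try auto; apply Hu'). apply HA; auto.
    -- eapply Rlt_le_trans; [exact Hss|]. eapply Rle_trans; [apply Rmin_l|apply Rmin_l].
    -- eapply Rlt_le_trans; [exact A1|apply Rmin_r].
   * rewrite E', (HB z' (lt_min_l A2) HL' Hn). eapply Rlt_le_trans; [exact A2|apply Rmin_r].
  + destruct (HFc notOm notOm_open Hn) as (dl&Hdl&Hd). exists (Rmin dl r). split; [apply Rmin_glb_lt; auto|].
   intros s' z' Hs' [Hz' HL'] _ Hzz. rewrite E. destruct (lft_cases b Y z' HL') as [[u [Hu [_ EF]]]|[_ E']].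
   * exfalso. specialize (Hd z' (lt_min_l Hzz)). rewrite EF in Hd. exact (Om_notOm u (proj1 Hu) Hd).
   * rewrite E'. eapply Rlt_le_trans; [exact Hzz|apply Rmin_r].
 - intros P [HA HY] Hn. split; [auto|]. apply (gd_out HG); [auto|apply notOm_F, Hn].
 - intros P [HA HY] Hn. destruct (gd_nbhd HG (F P) HY) as (r0&Hr0&H0); [intros HY'; apply Hn; split; auto|].
  destruct (rs_cont RS P r0 Hr0) as (r&Hr&Hc). exists r. split; [auto|]. intros Q HQ [_ HYQ] HnQ.
  exact (H0 (F Q) (Hc Q HQ) HYQ (notOm_F Q HnQ)).
Qed.

Definition clog (P: sphere) : C := epsilon (inhabits (RtoC 0)) (fun z => Om z /\ P = Some (Cexp z)).
(** The deformation on the sphere. By [gd_per] it does not depend on the logarithm selected by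
    [clog]. *)
Definition hs (h: R -> C -> C) (s: R) (P: sphere) : sphere :=
 if excluded_middle_informative (notOm P) then P else Some (Cexp (h s (clog P))).

Lemma hs_out h s P : notOm P -> hs h s P = P.
Proof. intros H. unfold hs. destruct (excluded_middle_informative _); [auto|contradiction]. Qed.

Lemma hs_log Y Y' h s z : good Y Y' h -> 0 <= s <= 1 -> dom Y z -> hs h s (Some (Cexp z)) = Some (Cexp (h s z)).
Proof.
 intros HG Hs Hz. unfold hs. destruct (excluded_middle_informative _) as [H|H]; [exfalso; exact (Om_notOm z (proj1 Hz)
  H)|].
 destruct (epsilon_spec (inhabits (RtoC 0)) (fun u => Om u /\ (Some (Cexp z) : sphere) = Some (Cexp u)) (notOm_log _
  H)) as [_ E].
 fold (clog (Some (Cexp z))) in E. apply Some_C in E. destruct (Cexp_eq _ _ (eq_sym E)) as [k ->].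
 rewrite (gd_per HG) by auto. rewrite Cexp_period. auto.
Qed.

Lemma hs_cont Y Y' h s P r : good Y Y' h -> 0 <= s <= 1 -> Y P -> 0 < r -> exists dl, 0 < dl /\
 forall s' Q, 0 <= s' <= 1 -> Y Q -> Rabs (s-s') < dl -> chordal P Q < dl -> chordal (hs h s P) (hs h s' Q) < r.
Proof.
 intros HG Hs HP Hr. destruct (classic (notOm P)) as [Hn|Hn].
 - destruct (notOm_open P Hn) as (r1&Hr1&Ho). exists (Rmin r1 r). split; [apply Rmin_glb_lt; auto|].
  intros s' Q Hs' HQ _ Hd. rewrite !hs_out; [eapply Rlt_le_trans; [exact Hd|apply Rmin_r]| |auto].
  apply Ho. eapply Rlt_le_trans; [exact Hd|apply Rmin_l].
 - destruct (notOm_log P Hn) as (z&Hz&->). have Hdz: dom Y z by (split; auto).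
  destruct (Cexp_ccont (h s z) (r/2) ltac:(lra)) as (d1'&Hd1&Hc1), (gd_cont HG s z d1' Hs Hdz Hd1) as (d2&Hd2&Hc2).
   set (b := Rabs lw+Rabs (y+1)).
  have Hb: forall u, Om u -> Rabs (Re u) <= b.
  { intros u Hu. destruct (Om_Re u Hu) as [B1 B2]. unfold b. apply Rabs_le.
   have := Rle_abs (y+1). have H0 := Rle_abs (- lw). rewrite Rabs_Ropp in H0.
   have := Rabs_pos (y+1). have := Rabs_pos lw. lra. }
  destruct (Cexp_close b d2 Hd2) as (d3&Hd3&Hc3), (chordal_finite_nbhd (Cexp z) d3 Hd3) as (d4&Hd4&Hc4).
  have HB: exists d5, 0 < d5 /\ forall Q, chordal (Some (Cexp z)) Q < d5 -> Y Q -> notOm Q -> h s z = z.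
  { destruct (classic (Y' (Some (Cexp z)))) as [HY'|HY'].
   - exists 1. split; [lra|]. intros Q _ _ _. apply (gd_fix HG); auto.
   - destruct (gd_nbhd HG _ HP HY') as (r0&Hr0&H0). exists r0. split; [auto|]. intros Q HQ HYQ HnQ.
    exfalso. exact (H0 Q HQ HYQ HnQ). }
  destruct HB as (d5&Hd5&HB). exists (Rmin (Rmin d2 d4) (Rmin d5 r)). split; [repeat apply Rmin_glb_lt; auto|].
  intros s' Q Hs' HQ Hss Hd. have A1 := lt_min_l Hd. have A2 := lt_min_r Hd.
  rewrite (hs_log Y Y') by auto. destruct (classic (notOm Q)) as [HnQ|HnQ].
  + rewrite hs_out by auto. rewrite (HB Q); [|eapply Rlt_le_trans; [exact A2|apply Rmin_l]|auto|auto].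
   eapply Rlt_le_trans; [exact A2|apply Rmin_r].
  + destruct (notOm_log Q HnQ) as (z'&Hz'&->), (Hc4 _ (lt_min_r A1)) as (w&E&Hw). apply Some_C in E. rewrite <- E in Hw.
   destruct (Hc3 z' z (Hb _ Hz') (Hb _ Hz) Hw) as [k Hk].
   rewrite <- (Cexp_period z' k) in HQ |- *. have Hz'' := Om_per z' k Hz'.
   set (z1 := (z'+turn k)%C) in *. rewrite (hs_log Y Y') by (try auto; split; auto).
   rewrite chordal_sym. eapply Rle_lt_trans; [apply chordal_le|].
   have Hf: Cmod (Cexp (h s' z1)-Cexp (h s z))%C < r/2; [|lra]. apply Hc1, Hc2; [auto|split; auto| |auto].
   eapply Rlt_le_trans; [exact Hss|]. eapply Rle_trans; apply Rmin_l.
Qed.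

Lemma hs_in Y Y' h s P : good Y Y' h -> 0 <= s <= 1 -> Y P -> Y (hs h s P) /\ hs h 0 P = P /\ Y' (hs h 1 P).
Proof.
 intros HG Hs HP. destruct (classic (notOm P)) as [Hn|Hn].
 - rewrite !hs_out by auto. split; [auto|]. split; [auto|]. apply (gd_out HG); auto.
 - destruct (notOm_log P Hn) as (z&Hz&->). have Hdz: dom Y z by (split; auto).
  rewrite !(hs_log Y Y') by (try auto; lra). split; [apply (gd_in HG); auto|].
  split; [rewrite (gd_0 HG) by auto; auto|apply (gd_1 HG); auto].
Qed.

Lemma contr_step U Y Y' b h : good Y Y' h -> (forall P, Y P -> U P) ->
 (forall l, loop_in Y' l -> contr U b l) -> forall l, loop_in Y l -> contr U b l.
Proof.
 intros HG HU Hc l [Hl1 [Hl2 Hl3]]. set (K := fun s t => hs h s (l t)). have HKc: homot_cont K.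
 { intros s t Hs Ht r Hr. destruct (hs_cont Y Y' h s (l t) r HG Hs (Hl1 t Ht) Hr) as (d1'&Hd1&H1), (Hl2 t Ht d1' Hd1)
  as (d2&Hd2&H2). exists (Rmin d1' d2). split; [apply Rmin_glb_lt; auto|].
  intros s' t' Hs' Ht' A B. apply H1; auto.
  - eapply Rlt_le_trans; [exact A|apply Rmin_l].
  - apply H2; [auto|]. eapply Rlt_le_trans; [exact B|apply Rmin_r]. }
 have HK1: contr U b (K 1).
 { apply Hc. split; [|split].
  - intros t Ht. apply (hs_in Y Y' h 1 (l t) HG ltac:(lra) (Hl1 t Ht)).
  - intros t Ht r Hr. destruct (HKc 1 t ltac:(lra) Ht r Hr) as (dl&Hdl&H). exists dl. split; [auto|].
   intros t' Ht' A. apply H; try lra. rewrite Rminus_diag, Rabs_R0. auto.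
  - unfold K. rewrite Hl3. auto. }
 have HK0: contr U b (K 0).
 { apply contr_concat; try auto.
  - intros s t Hs Ht. apply HU, (hs_in Y Y' h s (l t) HG Hs (Hl1 t Ht)).
  - intros s Hs. unfold K. rewrite Hl3. auto. }
 destruct HK0 as (H&H1&H2&H3&H4&H5). exists H. repeat (split; try auto).
 intros t Ht. rewrite H3 by auto. apply (hs_in Y Y' h 0 (l t) HG ltac:(lra) (Hl1 t Ht)).
Qed.

(** Points that reach the closed petal after [k] steps alternating between the two discs. The parity
    fixes the starting disc, so the sets increase in steps of two. *)
Fixpoint YY (j: nat) : sphere -> Prop := match j with O => YY0 | S k => lft (Nat.odd (S k)) (YY k) end.

Definition gz (z: C) : R := gauge N (kaN N) (Cexp (z-RtoC x)%C).
(** Division by the power [gauge^s], in logarithms a translation to the left. At [s = 1] a point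
    outside the petal arrives on its boundary. *)
Definition hbase (s: R) (z: C) : C := (z-RtoC (s*ln (gz z)))%C.

Lemma gz_ge_1 z : Om z -> 1 <= gz z.
Proof.
 intros [H _]. apply Rnot_lt_le. intros Hlt. apply H. unfold V0. rewrite qexp. apply (gauge_lt_1 LM), Hlt.
Qed.

Lemma gz_shift z t : gz (z-RtoC t)%C = exp (- t)*gz z.
Proof.
 unfold gz. replace (z-t-x)%C with (RtoC (- t)+(z-x))%C by (rewrite RtoC_opp; ring).
 rewrite Cexp_plus, Cexp_R. apply gauge_scal. left. apply exp_pos.
Qed.

Lemma fm_0 : mf N thq et 0 = 1%C.
Proof.
 unfold mf, mXi. rewrite (lm_et0 LM), Cmult_0_r, Cplus_0_l, Cexp_0, <- RtoC_mult, <- RtoC_plus. f_equal. ring.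
Qed.

Lemma YY2_fm z : YY 2 (Some (Cexp z)) -> Re z <= x+MM /\ mVc N (kaN N) (mf N thq et (z-RtoC x)%C) /\
 mf N thq et (z-RtoC x)%C <> 1%C.
Proof.
 intros [HA [HD HY]]. have Hn := n_ge. have Hg := g_pos. have K2 := rs_K2 RS. have Hl := lc_n1.
 have Hs := AA_strip false z HA. apply strip_2g in Hs. have Ha: Re z <= x+MM.
 { apply Rnot_lt_le. intros Hlt. destruct MM_ge as [_ HM].
  have HL := Lam_Re_diff n z (x) ltac:(lia) Hs (x_strip g ltac:(lra)).
  rewrite (rs_Ln RS), (rs_mn RS), !re_RtoC in HL. apply Rabs_le_between in HL. have := pT_ln.
  destruct e_small as [_ He], Dn_pos as [Hd _]. rewrite (rs_strip RS n z ltac:(lia) Hs) in HD. simpl in HD.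
  have: INR dn*MM <= INR dn*(Re z-x) by mono. have HRe: Re (Lam n z) <= lc 1%nat+2*g-1 by lra.
  have Ht := Cmod_triangle (T) (Cexp (Lam n z)). destruct T_q_p as (T1&T2&_).
  rewrite Cmod_Cexp, Cmod_pos_R in Ht by lra. apply exp_le in HRe.
  have: q <= exp (lc 1%nat+2*g-1) by (apply exp_le; lra).
  have E: exp (lc 1%nat+2*g) = exp (lc 1%nat+2*g-1)*exp 1 by (rewrite <- exp_plus; f_equal; ring). have := exp_1_gt_2.
  have: exp (lc 1%nat+2*g-1)*2 <= exp (lc 1%nat+2*g-1)*exp 1 by mono. lra. }
 split; [auto|]. destruct (two_step z Ha) as (E1&E2&_&_&E4).
 rewrite E1, (rs_strip RS 1 _ ltac:(lia) E2), E4 in HY. destruct HY as [HV Hne].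
 split; [apply V0c_scaled, HV|]. intros E. apply Hne. rewrite E. change (q*1 = q)%C. ring.
Qed.

(** The set [YY 2] is stable under radial shrinking by [fm_star]. Shrinking never meets the
    parabolic point, because [fm] avoids the value 1. *)
Lemma YY2_star z t : YY 2 (Some (Cexp z)) -> 0 <= t -> YY 2 (Some (Cexp (z-RtoC t)%C)) /\
 mf N thq et (z-RtoC t-RtoC x)%C <> 1%C.
Proof.
 intros HY Ht. have Hn := n_ge. destruct (YY2_fm z HY) as (Hz&HV&Hne), HY as [HA _].
 have Hv: Re (z-x) <= MM by (rewrite Re_minus, re_RtoC; lra). destruct (fm_star LM (z-x)%C t Hv Ht HV) as [S1 S2].
 replace (z-x-t)%C with (z-t-x)%C in S1, S2 by ring. have Hne': mf N thq et (z-t-x)%C <> 1%C.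
 { destruct (Rle_lt_or_eq_dec 0 t Ht) as [H0|H0]; [apply (V_not_1 _ (S2 H0))|].
  subst t. replace (z-RtoC 0-x)%C with (z-x)%C by ring. auto. }
 split; [|auto]. have Hz': Re (z-t) <= x+MM by (rewrite Re_minus, re_RtoC; lra).
 destruct (two_step _ Hz') as (E1&E2&_&_&E4). have HVu: V0c (T+Cexp (Lam 1 (Lf (Lam n (z-t)%C))))%C.
 { rewrite E4. apply V0c_scaled, S1. }
 have Hu: lc 1%nat+2*g+15 <= Re (Lf (Lam n (z-t)%C)).
 { apply V0c_far_up; [|auto]. apply E2. lia. }
 split.
 - apply (AA_exp false). apply (AA_exp false) in HA. rewrite Re_minus, re_RtoC. lra.
 - rewrite E1. split; [apply (AA_exp true); lra|]. rewrite (rs_strip RS 1 _ ltac:(lia) E2). split; [auto|].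
  rewrite E4. intros E. apply Hne'. apply (f_equal (fun w: C => RtoC (exp (- x))*w)%C) in E.
  rewrite Cmult_assoc, <- !RtoC_mult, <- exp_plus in E. replace (- x+x) with 0 in E by ring.
  rewrite exp_0, Cmult_1_l in E. exact E.
Qed.

Lemma ln_lip_1 a b : 1 <= a -> 1 <= b -> Rabs (ln a-ln b) <= Rabs (a-b).
Proof.
 have H: forall a b, 1 <= b -> b <= a -> 0 <= ln a-ln b <= a-b.
 { intros a' b' Hb Hab. split; [have := ln_le b' a' ltac:(lra) Hab; lra|].
  replace (ln a'-ln b') with (ln (a'/b')) by (unfold Rdiv; rewrite ln_mult, ln_Rinv by (try apply Rinv_0_lt_compat;
   lra); ring).
  have He := exp_ineq1_le (ln (a'/b')). rewrite exp_ln in He by (apply Rdiv_lt_0_compat; lra).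
  have: a'/b'-1 <= a'-b'; [|lra]. apply Rle_trans with ((a'-b')/b'); [right; field; lra|].
  apply (proj2 (Rle_div_l _ _ _ (ltac:(lra) : 0 < b'))). nra. }
 intros Ha Hb. destruct (Rle_or_lt b a) as [L|L].
 - destruct (H a b Hb L). rewrite !Rabs_pos_eq; lra.
 - destruct (H b a Ha ltac:(lra)). rewrite !Rabs_left1; lra.
Qed.

Lemma good_base : good (YY 2) (YY 0) hbase.
Proof.
 have Hlow: forall z, YY 2 (Some (Cexp z)) -> Re z < lc 1%nat+2*g.
 { intros z [HA _]. apply (AA_exp false) in HA. have := lc_n1. have := g_pos. lra. }
 have Hln: forall z, Om z -> 0 <= ln (gz z) by (intros z Hz; rewrite <- ln_1; apply ln_le; [lra|apply gz_ge_1, Hz]).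
 constructor.
 - intros P HP. destruct (YY0_step P HP) as (H1&H2&H3). split; [auto|]. split; [auto|]. apply VV_YY0, H3.
 - intros s z Hs [Hz HY]. have Hl := Hln z Hz. have Hg1 := gz_ge_1 z Hz.
  have Ht: 0 <= s*ln (gz z) by (apply Rmult_le_pos; lra).
  destruct (YY2_star z _ HY Ht) as [H1 _]. split; [|auto]. split.
  + intros HV. unfold V0, hbase in HV. rewrite qexp in HV. apply (gauge_lt_1 LM) in HV.
   fold (gz (z-RtoC (s*ln (gz z)))%C) in HV. rewrite gz_shift in HV.
   rewrite <- (exp_ln (gz z)) in HV at 2 by lra. rewrite <- exp_plus in HV.
   have Hle: exp 0 <= exp (- (s*ln (gz z))+ln (gz z)).
   { apply exp_le. have: s*ln (gz z) <= 1*ln (gz z) by mono. lra. }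
   rewrite exp_0 in Hle. lra.
  + intros Hre. have := Hlow _ H1. unfold hbase in Hre. lra.
 - intros z _. unfold hbase. rewrite Rmult_0_l. ring.
 - intros z [Hz HY]. have Hl := Hln z Hz. have Hg1 := gz_ge_1 z Hz.
  unfold hbase. rewrite Rmult_1_l. destruct (YY2_star z _ HY Hl) as [_ Hne].
  have Eg: gz (z-RtoC (ln (gz z)))%C = 1 by (rewrite gz_shift, exp_Ropp, exp_ln by lra; field; lra). split.
  + unfold V0c. rewrite qexp. apply (gauge_le_1 LM). fold (gz (z-RtoC (ln (gz z)))%C). lra.
  (* Arrival at the vertex of the petal would make [fm] equal to 1. *)
  + intros E. apply Hne. have E': Cexp (z-RtoC (ln (gz z)))%C = Cexp (x) by (rewrite Cexp_R; exact E).
   destruct (Cexp_eq _ _ E') as [k ->]. replace (x+turn k-x)%C with (0+turn k)%C by ring.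
   rewrite (fm_periodic LM). apply fm_0.
 - intros s z Hs [Hz _] [HV _]. have Hg1 := gz_ge_1 z Hz. unfold V0c in HV. rewrite qexp in HV.
  apply (gauge_le_1 LM) in HV. fold (gz z) in HV. unfold hbase. replace (gz z) with 1 by lra. rewrite ln_1, Rmult_0_r.
   ring.
 - intros s z k Hs [Hz _]. unfold hbase. have E: gz (z+turn k)%C = gz z.
  { unfold gz. f_equal. replace (z+turn k-x)%C with (z-x+turn k)%C by ring. apply Cexp_period. }
  rewrite E. ring.
 - intros s z r Hs [Hz HY] Hr. have Hg1 := gz_ge_1 z Hz. have Hl := Hln z Hz.
  destruct (Cexp_ccont (z-x)%C (r/40) ltac:(lra)) as (dl&Hdl&Hc).
  set (A := ln (gz z)+1). exists (Rmin (Rmin dl (r/4)) (r/(4*A))). have HA: 0 < 4*A by (unfold A; lra).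
  split; [repeat apply Rmin_glb_lt; try lra; apply Rdiv_lt_0_compat; lra|]. intros s' z' Hs' [Hz' HY'] Hss Hzz.
  have A1 := lt_min_l Hzz. have A2 := lt_min_l A1. have A3 := lt_min_r A1. have A4 := lt_min_r Hss.
  apply (proj2 (Rlt_div_r _ _ _ HA)) in A4.
  specialize (Hc (z'-x)%C). replace (z'-x-(z-x))%C with (z'-z)%C in Hc by ring.
  have Hgl := gauge_lip LM (Cexp (z'-x)%C) (Cexp (z-x)%C). fold (gz z) (gz z') in Hgl.
  have Hll := ln_lip_1 (gz z') (gz z) (gz_ge_1 z' Hz') Hg1. unfold hbase.
  replace (z'-RtoC (s'*ln (gz z'))-(z-RtoC (s*ln (gz z))))%C
   with ((z'-z) + - (RtoC (s'*(ln (gz z')-ln (gz z))+(s'-s)*ln (gz z))))%C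
   by (rewrite !RtoC_plus, !RtoC_mult, !RtoC_minus; ring).
  eapply Rle_lt_trans; [apply Cmod_triangle|]. rewrite Cmod_opp, Cmod_R.
  have Ht := Rabs_triang (s'*(ln (gz z')-ln (gz z))) ((s'-s)*ln (gz z)).
   rewrite !Rabs_mult, (Rabs_pos_eq s'), (Rabs_pos_eq (ln (gz z))), (Rabs_minus_sym s' s) in Ht by lra.
  have: s'*Rabs (ln (gz z')-ln (gz z)) <= 1*Rabs (ln (gz z')-ln (gz z)) by (apply Rmult_le_compat_r; [apply
   Rabs_pos|lra]).
  have: Rabs (s-s')*ln (gz z) <= Rabs (s-s')*A by (apply Rmult_le_compat_l; [apply Rabs_pos|unfold A; lra]). lra.
 - intros P [HA _] [HV|[HD _]]; [apply VV_YY0, HV|]. exfalso. exact (AA_disjoint true P HD HA).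
 (* A point of [YY 2] outside [YY0] is not even in the closed petal: the only other candidate is the
    vertex, and it is fixed by the second iterate and hence not in [YY 2]. So a neighbourhood avoids
    the petal. *)
 - intros P HY Hn. destruct (sphere_cases P) as [->|[w ->]]; [destruct HY as [[] _]|]. have HV: ~ V0c w.
  { intros HV. apply Hn. split; [auto|]. intros E. destruct HY as (_&_&HY). rewrite E, F_q, F_p in HY.
   destruct HY as [_ HY]. apply HY. auto. }
  destruct (V0c_closed w HV) as (r&Hr&Hc), (chordal_finite_nbhd w r Hr) as (dl&Hdl&Hnb).
  exists dl. split; [auto|]. intros Q HQ [HA _] [HVQ|[HD _]]; [|exact (AA_disjoint true Q HD HA)].
  destruct (Hnb Q HQ) as (w'&->&Hw'). apply (Hc w' Hw'), V0_V0c, HVQ.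
Qed.

Lemma good_YY j : exists h, good (YY (S (S j))) (YY j) h.
Proof.
 induction j as [|j [h IH]]; [exists hbase; apply good_base|].
 exists (lifth (ix (Nat.odd (S j))) h). exact (good_lift (Nat.odd (S j)) _ _ h IH).
Qed.

Lemma YY0_0 : YY0 (Some (RtoC 0)).
Proof.
 apply VV_YY0. replace (RtoC 0) with (q*0)%C by ring. apply V0_scaled, (V_small LM). rewrite Cmod_0.
  destruct Dn_pos as (_&_&_&HN&_).
 have: 3/(4*INR N) <= 1; [|lra]. apply (proj2 (Rle_div_l _ _ _ (ltac:(lra) : 0 < 4*INR N))). lra.
Qed.

Lemma YY0_scale (w: C) (s: R) : YY0 (Some w) -> 0 <= s <= 1 -> YY0 (Some (RtoC (1-s)*w)%C).
Proof.
 intros [HV Hne] Hs. destruct (Rle_lt_or_eq_dec 0 s (proj1 Hs)) as [H0|H0].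
 - apply VV_YY0. simpl. unfold V0. replace (RtoC (exp (- x))*(RtoC (1-s)*w))%C with (RtoC (1-s)*(RtoC (exp (- x))*w))%C
  by ring.
  apply (gauge_lt_1 LM). rewrite gauge_scal by lra. apply (gauge_le_1 LM) in HV.
  apply Rle_lt_trans with ((1-s)*1); [apply Rmult_le_compat_l; lra|lra].
 - subst s. replace (RtoC (1-0)*w)%C with w; [split; auto|]. rewrite Rminus_0_r. ring.
Qed.

Lemma contr_YY0 l : loop_in YY0 l -> contr YY0 (Some (RtoC 0)) l.
Proof.
 intros [H1 [H2 H3]]. set (u := fun t => match l t with Some w => (w: C) | None => RtoC 0 end).
 have Hu: forall t, 0 <= t <= 1 -> l t = Some (u t).
 { intros t Ht. unfold u. specialize (H1 t Ht). destruct (l t); [auto|destruct H1]. }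
 exists (fun s t => Some (RtoC (1-s)*u t)%C). split; [|split; [|split; [|split]]].
 - intros s t Hs Ht. apply YY0_scale; [|auto]. rewrite <- Hu by auto. apply H1, Ht.
 - apply scale_cont. intros t Ht r Hr. destruct (H2 t Ht r Hr) as (dl&Hdl&H). exists dl. split; [auto|].
  intros t' Ht' A. rewrite <- !Hu by auto. apply H; auto.
 - intros t Ht. rewrite Hu by auto. f_equal. rewrite Rminus_0_r. apply Cmult_1_l.
 - intros s Hs. unfold u. rewrite H3. auto.
 - intros t Ht. f_equal. replace (1-1) with 0 by ring. apply Cmult_0_l.
Qed.

(** Moving outwards by [t] multiplies the image, measured from [T], by about [exp (-d1*t)] with a
    tiny rotation, and [star_disc] keeps it in the petal. So [YY 1] is starlike from infinity. *)
Lemma YY1_exp z t : YY 1 (Some (Cexp z)) -> 0 <= t -> YY 1 (Some (Cexp (z+RtoC t)%C)).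
Proof.
 intros [HA HY] Ht. have Hg := g_pos. have Hn := n_ge.
 have Hz: lc 1%nat+2*g < Re z by (apply (AA_exp true) in HA; auto).
 rewrite (F_1 z) in HY by lra. destruct HY as [HV Hne].
 have Hz': Re (z+t) = Re z+t by (rewrite re_plus, re_RtoC; auto).
 split; [apply (AA_exp true); rewrite Hz'; lra|]. rewrite F_1 by (rewrite Hz'; lra).
 destruct (Rle_lt_or_eq_dec 0 t Ht) as [H0|H0]; [|subst t; replace (z+RtoC 0)%C with z by ring; split; auto].
 have S1: gstrip n lc g 1 (z+t)%C by (apply strip_1; rewrite Hz'; lra).
 have S2: gstrip n lc g 1 z by (apply strip_1; lra). have Hd := Lam_diff 1 (z+t)%C z ltac:(lia) S1 S2.
 replace (z+t-z)%C with (RtoC t) in Hd by ring. rewrite Cmod_pos_R in Hd by lra.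
 set (dl := (Lam 1 (z+t)-Lam 1 z-RtoC (IZR (m 1%nat))*t)%C) in *.
 have EL: Lam 1 (z+t)%C = (Lam 1 z+(RtoC (IZR (m 1%nat))*t+dl))%C by (unfold dl; ring).
 rewrite (rs_m1 RS) in EL. set (a := INR d1*t-Re dl). set (b := Im dl).
 have Eab: (RtoC (- INR d1)*t+dl)%C = ((- a)%R, b).
 { unfold a, b. apply C_ext; unfold Re, Im; simpl; ring. }
 destruct Dn_pos as (_&Hd1&_&HN&_), e_small as [_ He]. have He0 := rs_e RS.
 have R1 := Re_le_Cmod dl. have R3 := Cmod_Im_le dl. have Het: e*t <= / 1000000*t by mono.
 have Hdt: 2*t <= INR d1*t by mono. have Ha: t <= a by (unfold a; lra).
 destruct (star_disc LM (RtoC (exp (- x))*(T+Cexp (Lam 1 z)))%C a b ltac:(lra)) as [_ HS]; [|auto|].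
 { eapply Rle_trans; [exact R3|]. eapply Rle_trans; [exact Hd|].
  apply Rle_trans with (e*a); [apply Rmult_le_compat_l; lra|]. apply Rmult_le_compat_r; [lra|].
  have: 1*e <= 2*(100*(INR N*INR N))*e by (apply Rmult_le_compat_r; nra). lra. }
 specialize (HS ltac:(lra)). apply VV_YY0. simpl. unfold V0. rewrite V0_norm by auto.
 rewrite V0_norm in HS. rewrite EL, Cexp_plus, Eab. replace (RtoC (exp (- x))*(Cexp (Lam 1 z)*Cexp ((- a)%R, b)))%C
  with (Cexp ((- a)%R, b)*(RtoC (1-thq)+RtoC (exp (- x))*Cexp (Lam 1 z)-RtoC (1-thq)))%C by ring.
 auto.
Qed.

Lemma YY1_None : YY 1 None.
Proof. split; [exact I|]. rewrite (rs_inf RS). apply VV_YY0, V0_T. Qed.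

Lemma contr_YY1 l : loop_in (YY 1) l -> contr (YY 1) None l.
Proof.
 intros [H1 [H2 H3]]. set (u := fun t => match l t with Some w => (/ w)%C | None => RtoC 0 end).
 have Hnz: forall w : C, YY 1 (Some w) -> w <> RtoC 0.
 { intros w [HA _] E. rewrite E in HA. simpl in HA. rewrite Cmod_0 in HA. have := exp_pos (lc 1%nat+2*g). lra. }
 have Hinv0: forall w : C, w <> RtoC 0 -> (/ w)%C <> RtoC 0.
 { intros w Hw E. apply (f_equal (Cmult w)) in E. rewrite Cinv_r, Cmult_0_r in E by auto. injection E. lra. }
 have Hu: forall t, 0 <= t <= 1 -> l t = sinv (Some (u t)).
 { intros t Ht. unfold u. specialize (H1 t Ht). destruct (l t) as [w|]; [|symmetry; apply sinv_0].
  specialize (Hnz w H1). rewrite sinv_nz by (apply Hinv0, Hnz). f_equal.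
  have E: forall v : C, v <> RtoC 0 -> v = (/ / v)%C by (intros v Hv; field; auto). apply E, Hnz. }
 set (K := fun s t => (Some (RtoC (1-s)*u t)%C : sphere)). have HK: homot_cont K.
 { apply scale_cont. intros t Ht r Hr. destruct (H2 t Ht r Hr) as (dl&Hdl&H). exists dl. split; [auto|].
  intros t' Ht' A. rewrite <- chordal_sinv, <- !Hu by auto. apply H; auto. }
 exists (fun s t => sinv (K s t)). split; [|split; [|split; [|split]]].
 - intros s t Hs Ht. unfold K. destruct (classic ((RtoC (1-s)*u t)%C = RtoC 0)) as [E|E].
  + rewrite E, sinv_0. apply YY1_None.
  + rewrite sinv_nz by exact E. have HY := H1 t Ht. rewrite Hu in HY by auto.
   have Hut: u t <> RtoC 0 by (intros E'; apply E; rewrite E'; apply Cmult_0_r). rewrite sinv_nz in HY by auto.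
   have Hs1: s < 1. { destruct (Rle_lt_or_eq_dec s 1 (proj2 Hs)) as [L|L]; [exact L|]. exfalso. apply E. subst s.
    replace (1-1) with 0 by ring. apply Cmult_0_l. }
   destruct (Cexp_surj (/ u t)%C (Hinv0 _ Hut)) as [z Hz]. rewrite <- Hz in HY.
   have Hle: 0 <= - ln (1-s). { have: ln (1-s) <= ln 1 by (apply ln_le; lra). rewrite ln_1 in H. lra. }
   have HY' := YY1_exp z _ HY Hle. rewrite Cexp_plus, Cexp_R, exp_Ropp, exp_ln, Hz, RtoC_inv in HY' by lra.
   replace (/ (RtoC (1-s)*u t))%C with (/ u t * / RtoC (1-s))%C; [auto|].
   field. split; [auto|]. intros E'. injection E'. lra.
 - intros s t Hs Ht r Hr. destruct (HK s t Hs Ht r Hr) as (dl&Hdl&H). exists dl. split; [auto|].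
  intros s' t' Hs' Ht' A B. rewrite chordal_sinv. apply H; auto.
 - intros t Ht. rewrite Hu by auto. unfold K. do 2 f_equal. rewrite Rminus_0_r. apply Cmult_1_l.
 - intros s Hs. unfold K, u. rewrite H3. auto.
 - intros t Ht. unfold K. replace (1-1) with 0 by ring. rewrite Cmult_0_l. apply sinv_0.
Qed.

(** * The two periodic components *)

Definition Ub (b: bool) (P: sphere) : Prop := basin P /\ forall i, AA (xorb b (Nat.odd i)) (iter F i P).

Lemma odd_S i : Nat.odd (S i) = negb (Nat.odd i).
Proof. rewrite Nat.odd_succ, <- Nat.negb_odd. auto. Qed.

Lemma basin_F P : basin P <-> basin (F P).
Proof.
 split; intros [k Hk].
 - exists (S k). rewrite iter_comm. apply (VV_iter2 _ 1 Hk).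
 - exists (S k). cbn [iter]. rewrite <- iter_comm. auto.
Qed.

Lemma Ub_cons b P : Ub b P <-> AA b P /\ Ub (negb b) (F P).
Proof.
 split.
 - intros [HB HA]. have H0 := HA 0%nat. rewrite xorb_false_r in H0.
  split; [auto|]. split; [apply (proj1 (basin_F P)), HB|]. intros i. specialize (HA (S i)). rewrite iter_comm.
   rewrite odd_S in HA. replace (xorb (negb b) (Nat.odd i)) with (xorb b (negb (Nat.odd i))) by (destruct b, (Nat.odd
    i); auto).
  auto.
 - intros [H0 [HB HA]]. split; [apply (proj2 (basin_F P)), HB|]. intros [|i].
  + rewrite xorb_false_r. auto.
  + cbn [iter]. rewrite <- iter_comm, odd_S. specialize (HA i).
   replace (xorb b (negb (Nat.odd i))) with (xorb (negb b) (Nat.odd i)) by (destruct b, (Nat.odd i); auto). auto.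
Qed.

Lemma VV_Ub P : VV P -> Ub false P.
Proof.
 intros HV. split; [exists 0%nat; auto|]. intros i. destruct (Nat.Even_or_Odd i) as [[j ->]|[j ->]].
 - rewrite <- Nat.negb_even, (proj2 (Nat.even_spec (2*j)) (ex_intro _ j eq_refl)). apply VV_Dz, VV_iter2, HV.
 - rewrite (proj2 (Nat.odd_spec (2*j+1)) (ex_intro _ j eq_refl)). rewrite Nat.add_1_r.
  apply YY0_step, VV_YY0, VV_iter2, HV.
Qed.

Lemma YY_Ub j : forall P, YY j P -> Ub (Nat.odd j) P.
Proof.
 induction j as [|j IH]; intros P HP.
 - destruct (YY0_step P HP) as (H1&H2&H3). apply Ub_cons. split; [auto|]. apply Ub_cons. split; [auto|]. apply VV_Ub, H3.
 - destruct HP as [H1 H2]. apply Ub_cons. split; [auto|]. rewrite odd_S, negb_involutive. apply IH, H2.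
Qed.

Lemma Ub_parity b k : forall P, Ub b P -> VV (iter F k P) -> Nat.odd k = b.
Proof.
 intros P [_ HA] HV. specialize (HA k). apply VV_Dz in HV.
 destruct (Nat.odd k), b; try auto; exfalso; simpl in HA; exact (AA_disjoint true _ HA HV).
Qed.

(** With an alternating itinerary the point lies in [YY k]. A whole neighbourhood does too, because
    the petal and the discs are open and [F] is continuous; this makes [Ub] open and lets
    compactness act on loops. *)
Lemma level k : forall b P, Ub b P -> VV (iter F k P) -> Nat.odd k = b /\
 exists r, 0 < r /\ forall Q, chordal P Q < r -> YY k Q.
Proof.
 induction k as [|k IH]; intros b P HU HV.
 - split; [apply (Ub_parity b 0 P HU HV)|]. destruct (VV_open P HV) as (r&Hr&Ho). exists r. split; [auto|].
  intros Q HQ. apply VV_YY0, Ho, HQ.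
 - split; [apply (Ub_parity b (S k) P HU HV)|]. have Hb := Ub_parity b (S k) P HU HV.
  apply Ub_cons in HU. destruct HU as [HA HU]. cbn [iter] in HV. rewrite <- iter_comm in HV.
  destruct (IH _ _ HU HV) as (_&r1&Hr1&H1), (AA_open b P HA) as (r2&Hr2&H2).
  destruct (rs_cont RS P r1 Hr1) as (r3&Hr3&H3). exists (Rmin r2 r3). split; [apply Rmin_glb_lt; auto|].
  intros Q HQ. split.
  + rewrite Hb. apply H2. eapply Rlt_le_trans; [exact HQ|apply Rmin_l].
  + apply H1, H3. eapply Rlt_le_trans; [exact HQ|apply Rmin_r].
Qed.

Lemma Ub_open b : open_set (Ub b).
Proof.
 intros P HP. have [[k Hk] _] := HP. destruct (level k b P HP Hk) as (Hb&r&Hr&H). exists r. split; [auto|].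
 intros Q HQ. rewrite <- Hb. apply YY_Ub, H, HQ.
Qed.

Lemma YY_mono j k : Nat.odd j = Nat.odd k -> (j <= k)%nat -> forall P, YY j P -> YY k P.
Proof.
 intros Ho Hjk. have Hex: exists l, k = (j+2*l)%nat.
 { destruct (Nat.Even_or_Odd (k-j)) as [[l El]|[l El]]; [exists l; lia|].
  have: k = (j+S (2*l))%nat by lia. subst k. rewrite Nat.odd_add, odd_S, Nat.odd_mul in Ho.
   destruct (Nat.odd j), (Nat.odd l); discriminate. }
 destruct Hex as [l ->]. clear Ho Hjk. induction l as [|l IH]; intros P HP; [rewrite Nat.mul_0_r, Nat.add_0_r; auto|].
 replace (j+2*S l)%nat with (S (S (j+2*l))) by lia. destruct (good_YY (j+2*l)) as [h Hh]. apply (gd_sub Hh), IH, HP.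
Qed.

Lemma contr_YY j : forall l, loop_in (YY j) l -> contr (Ub (Nat.odd j)) (if Nat.odd j then None else Some (RtoC 0)) l.
Proof.
 have Hw: forall (Y U: sphere -> Prop) b l, (forall P, Y P -> U P) -> contr Y b l -> contr U b l.
 { intros Y U b l H [K [H1 H2]]. exists K. split; [intros; apply H, H1; auto|auto]. }
 have HP: forall j, (forall l, loop_in (YY j) l -> contr (Ub (Nat.odd j)) (if Nat.odd j then None else Some (RtoC 0))
  l) /\
   (forall l, loop_in (YY (S j)) l -> contr (Ub (Nat.odd (S j))) (if Nat.odd (S j) then None else Some (RtoC 0)) l);
    [|apply HP].
 clear j. induction j as [|j [IH1 IH2]].
 - split; intros l Hl.
  + apply (Hw YY0); [exact (YY_Ub 0)|apply contr_YY0, Hl].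
  + apply (Hw (YY 1)); [exact (YY_Ub 1)|apply contr_YY1, Hl].
 - split; [auto|]. destruct (good_YY j) as [h Hh]. intros l Hl.
  apply (contr_step _ _ _ _ h Hh); [exact (YY_Ub (S (S j)))|auto|auto].
Qed.

Lemma contr_Ub b l : loop_in (Ub b) l -> contr (Ub b) (if b then None else Some (RtoC 0)) l.
Proof.
 intros [H1 [H2 H3]]. set (jj := fun k => ((if b then 1 else 0)+2*k)%nat). have Hodd: forall k, Nat.odd (jj k) = b.
 { intros k. unfold jj. rewrite Nat.odd_add, Nat.odd_mul. destruct b; auto. }
 destruct (interval_compact (fun k t => YY (jj k) (l t))) as [k Hk].
 - intros i k t Hik. apply YY_mono; [rewrite !Hodd; auto|unfold jj; lia].
 - intros t Ht. have [[k Hk] _] := H1 t Ht. destruct (level k b (l t) (H1 t Ht) Hk) as (Hb&r&Hr&Hin), (H2 t Ht r Hr) as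
  (dl&Hdl&Hd). exists dl, k. split; [auto|]. intros t' Ht' Htt.
  apply (YY_mono k); [rewrite Hodd; auto|unfold jj; lia|]. apply Hin, Hd; auto.
 - have Hc := contr_YY (jj k) l. rewrite Hodd in Hc. apply Hc. split; [auto|]. split; auto.
Qed.

Theorem Ub_simply_connected b : simply_connected (Ub b).
Proof.
 split.
 - apply (contr_connected _ (if b then None else Some (RtoC 0))). intros P HP. apply contr_Ub. split; [intros; auto|].
  split; [|auto].
  intros t Ht r Hr. exists 1. split; [lra|]. intros. rewrite chordal_refl. auto.
 - intros l Hl1 Hl2 Hl3. destruct (contr_Ub b l (conj Hl1 (conj Hl2 Hl3))) as (H&H1&H2&H3&H4&H5).
  exists H. split; [auto|]. split; [auto|]. split; [auto|]. split; [auto|].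
  intros t Ht. rewrite !H5 by lra. auto.
Qed.

(* The boundary circle of each disc is mapped into a gap image, away from the other disc,
  so leaving the alternating itinerary is an open condition. *)
Lemma AA_exit b P : ~ AA b P -> exists r, 0 < r /\ forall Q, chordal P Q < r -> ~ (AA b Q /\ AA (negb b) (F Q)).
Proof.
 intros HP. have Hg := g_pos. have Hopen: (exists r, 0 < r /\ forall Q, chordal P Q < r -> ~ AA b Q) \/ AA b (F P).
 { destruct b; simpl AA in *; destruct (sphere_cases P) as [->|[w ->]].
  - exfalso. apply HP, I.
  - apply Rnot_lt_le in HP. destruct HP as [HP|HP].
   + left. destruct (open_lt w _ HP) as (dl&Hdl&H). exists dl. split; [auto|]. intros Q HQ HQ'.
    destruct (H Q HQ) as (w'&->&Hw'). simpl in HQ'. lra.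
   + right. have Hw: w <> RtoC 0 by (intros E; rewrite E, Cmod_0 in HP; have := exp_pos (lc 1%nat+2*g); lra).
    destruct (Cexp_surj w Hw) as [z Hz]. rewrite <- Hz, Cmod_Cexp in HP. apply exp_inv in HP.
    destruct (rs_gap1 RS z) as [E|[v [E Hv]]]; [rewrite HP; replace (lc 1%nat+2*g-lc 1%nat) with (2*g) by ring; rewrite
     Rabs_pos_eq; lra| |];
     rewrite Hz in E; rewrite E; [exact I|].
    simpl. have Hr := Cmod_reverse v (- T)%C. replace (v - - T)%C with (T+v)%C in Hr by ring.
    destruct T_q_p as (T1&T2&T3). rewrite Cmod_opp, Cmod_pos_R in Hr by lra.
    have := rs_K1 RS. destruct Dn_pos as [Hd _]. have: exp (lc 1%nat+2*g) <= p by (apply exp_le; lra).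
    have: p*2 <= exp (y+3). { rewrite exp_plus. apply Rmult_le_compat_l; [left; apply exp_pos|].
     have := exp_ineq1_le 3. lra. }
    lra.
  - left. destruct (open_gt None (exp (lc (n-1)%nat-2*g)) (exp_pos _) I) as (dl&Hdl&H). exists dl. split; [auto|].
   intros Q HQ HQ'. specialize (H Q HQ). destruct Q as [w|]; simpl in HQ'; [lra|auto].
  - apply Rnot_lt_le in HP. destruct HP as [HP|HP].
   + left. destruct (open_gt (Some w) (exp (lc (n-1)%nat-2*g)) (exp_pos _) HP) as (dl&Hdl&H). exists dl. split; [auto|].
    intros Q HQ HQ'. specialize (H Q HQ). destruct Q as [w'|]; simpl in HQ'; [lra|auto].
   + right. have Hw: w <> RtoC 0 by (intros E; rewrite E, Cmod_0 in HP; have := exp_pos (lc (n-1)%nat-2*g); lra).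
    destruct (Cexp_surj w Hw) as [z Hz]. rewrite <- Hz, Cmod_Cexp in HP. apply exp_inv in HP.
    destruct (rs_gapn RS z) as (v&E&Hv); [rewrite <- HP; replace (lc (n-1)%nat-2*g-lc (n-1)%nat) with (- (2*g)) by
     ring; rewrite Rabs_Ropp, Rabs_pos_eq; lra|].
    rewrite Hz in E. rewrite E. apply (VV_Dz (Some (T+v)%C)), V0_ball_lt, Hv. }
 destruct Hopen as [[r [Hr H]]|H].
 - exists r. split; [auto|]. intros Q HQ [H1 _]. exact (H Q HQ H1).
 - destruct (AA_open b _ H) as (r0&Hr0&H0), (rs_cont RS P r0 Hr0) as (r&Hr&Hc).
  exists r. split; [auto|]. intros Q HQ [_ H2]. exact (AA_disjoint b _ (H0 _ (Hc Q HQ)) H2).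
Qed.

(** Maximality: a connected Fatou set that meets [Ub b] and leaves it would be separated by [Ub b]
    and the rest of the basin. The rest is open by [AA_exit]. *)
Theorem Ub_component b : Fatou_component F (Ub b).
Proof.
 split; [|split; [|split]].
 - destruct b; [exists None; apply (YY_Ub 1), YY1_None|exists (Some (RtoC 0)); apply (YY_Ub 0), YY0_0].
 - intros P [HP _]. apply basin_Fatou, HP.
 - apply Ub_simply_connected.
 - intros A HA HF [P0 [HA0 HU0]] P HP. apply NNPP. intros HnU. apply HA.
  exists (Ub b), (fun Q => basin Q /\ ~ Ub b Q). split; [apply Ub_open|]. split.
  { intros Q [[k Hk] HnQ]. have HnI: exists i, ~ AA (xorb b (Nat.odd i)) (iter F i Q).
   { apply not_all_ex_not. intros Hall. apply HnQ. split; [exists k; auto|auto]. }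
   destruct HnI as [i Hi], (AA_exit _ _ Hi) as (r0&Hr0&H0).
   destruct (scont_iter F i Q (rs_cont RS) r0 Hr0) as (r1&Hr1&H1), (basin_uniform Q k Hk) as (r2&Hr2&H2&_).
    exists (Rmin r1 r2). split; [apply Rmin_glb_lt; auto|].
   intros Q' HQ'. split; [exists k; apply H2; eapply Rlt_le_trans; [exact HQ'|apply Rmin_r]|].
   intros [_ HI]. apply (H0 (iter F i Q')); [apply H1; eapply Rlt_le_trans; [exact HQ'|apply Rmin_l]|].
   split; [apply HI|]. specialize (HI (S i)). rewrite odd_S in HI.
   replace (negb (xorb b (Nat.odd i))) with (xorb b (negb (Nat.odd i))) by (destruct b, (Nat.odd i); auto). auto. }
  split.
  { intros Q HQ. destruct (classic (Ub b Q)) as [H|H]; [left; exact H|right]. split; [|exact H].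
   apply Fatou_basin, HF, HQ. }
  split; [exists P0; auto|]. split; [|intros Q _ H1 [_ H2]; exact (H2 H1)].
  exists P. split; [auto|]. split; [|auto]. apply Fatou_basin, HF, HP.
Qed.

(** Periodicity is stated as an equality of sets, so [F] has to map each disc onto the other one.
    Preimages come from [Lam_solve], except for those of [T] and infinity, which are infinity and
    0. *)
Lemma AA_surj b P : AA (negb b) P -> exists Q, AA b Q /\ F Q = P.
Proof.
 intros HP. destruct radii as [Hrad1 Hrad2], T_q_p as (T1&T2&T3).
 have Hg := g_pos. have K1 := rs_K1 RS. destruct Dn_pos as [Hd _].
 have Hsolve: forall w : C, w <> T -> (b = false -> q-T <= Cmod (w-T)) ->
   (b = true -> Cmod (w-T) <= exp (y+3)) -> exists Q, AA b Q /\ F Q = Some w.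
 { intros w Hw H1 H2. have Hw0: (w-T)%C <> RtoC 0.
  { intros E. apply Hw. replace w with (w-T+T)%C by ring. rewrite E. ring. }
  destruct (Cexp_surj _ Hw0) as [X HX]. rewrite <- HX, Cmod_Cexp in H1, H2.
  destruct (Lam_solve (ix b) X (ix_range b)) as (z&Hz&EL).
  - intros Hi. destruct b; [exfalso; apply Hi; auto|]. specialize (H1 eq_refl).
   rewrite <- (ln_exp (Re X)). apply ln_le; [lra|auto].
  - intros Hi. destruct b; [|exfalso; apply Hi; auto]. specialize (H2 eq_refl).
   rewrite <- (ln_exp (Re X)), <- (ln_exp (y+3)). apply ln_le; [apply exp_pos|auto].
  - exists (Some (Cexp z)). split; [apply strip_AA, Hz|].
   rewrite (rs_strip RS (ix b) z (ix_range b)); [|apply (strip_mono g (2*g+1/2)); [lra|auto]].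
   rewrite EL, HX. f_equal. ring. }
 destruct (sphere_cases P) as [->|[w ->]].
 - destruct b; [destruct HP|]. exists (Some (RtoC 0)). split; [simpl; rewrite Cmod_0; apply exp_pos|]. exact (rs_zero RS).
 - destruct (classic (w = T)) as [->|Hw].
  + destruct b.
   * exists None. split; [exact I|exact (rs_inf RS)].
   * simpl in HP. rewrite Cmod_pos_R in HP by lra. lra.
  + apply Hsolve; [auto| |]; intros ->; simpl in HP.
   * have Hr := Cmod_reverse w (T). rewrite Cmod_pos_R in Hr by lra. lra.
   * le_trans Cmod_minus_le. rewrite Cmod_pos_R by lra. have: exp (lc 1%nat+2*g) <= p by (apply exp_le; lra).
    have: p*2 <= exp (y+3). { rewrite exp_plus. apply Rmult_le_compat_l; [left; apply exp_pos|].
     have := exp_ineq1_le 3. lra. }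
    lra.
Qed.

Lemma Ub_image b : set_eq (image F (Ub b)) (Ub (negb b)).
Proof.
 intros P. split.
 - intros [Q [HQ <-]]. apply Ub_cons in HQ. apply HQ.
 - intros HP. have HP' := HP. apply Ub_cons in HP'. destruct (AA_surj b P (proj1 HP')) as (Q&HA&HF).
  exists Q. split; [|auto]. apply Ub_cons. split; [auto|]. rewrite HF. auto.
Qed.

Lemma Ub_disjoint b P : Ub b P -> Ub (negb b) P -> False.
Proof. intros H1 H2. apply Ub_cons in H1. apply Ub_cons in H2. exact (AA_disjoint b P (proj1 H1) (proj1 H2)). Qed.

Theorem Ub_period_two b : period_two_comp F (Ub b).
Proof.
 split.
 - intros P. split.
  + intros [Q [HQ <-]]. apply Ub_image in HQ. apply Ub_cons in HQ. rewrite negb_involutive in HQ. apply HQ.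
  + intros HP. rewrite <- (negb_involutive b) in HP. apply (Ub_image (negb b)) in HP. destruct HP as (Q&HQ&E).
   exists Q. split; [apply Ub_image, HQ|exact E].
 - intros E. destruct (Ub_component b) as [[P HP] _]. apply E in HP as HP'. apply Ub_image in HP'.
  exact (Ub_disjoint b P HP HP').
Qed.

Theorem Ub_parabolic b : parabolic_comp2 F (Ub b).
Proof.
 have K1 := rs_K1 RS. destruct Dn_pos as (Hd&Hd1&_). have Hl := lc_n1. have Hg := g_pos.
 have Hn := n_ge. destruct T_q_p as (T1&T2&T3), multipliers as [M1 M2].
 exists (if b then sp else sq). split; [|split; [destruct b; auto|]].
 - have Hper: forall k, iter F k sq = sq /\ iter F k sp = sp \/ iter F k sq = sp /\ iter F k sp = sq.
  { induction k as [|k [[A B]|[A B]]]; [left; split; auto| |]; cbn [iter]; rewrite A, B, F_q, F_p; auto. }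
  have HVp: ~ VV sp.
  { intros HV. apply VV_Dz in HV. simpl in HV. rewrite Cmod_pos_R in HV by (left; apply exp_pos).
   apply exp_lt_inv in HV. lra. }
  split.
  (* The parabolic cycle never enters the open petal: [q] is its vertex, and [p] lies outside the
     inner disc. *)
  + intros [[k Hk] _]. destruct b, (Hper k) as [[A B]|[A B]]; rewrite ?A, ?B in Hk; try exact (HVp Hk); exact (not_V0_q
   Hk).
  + intros r Hr. destruct b.
   * destruct (Cexp_ccont (y) (r/2) ltac:(lra)) as (dl&Hdl&Hc). set (z := (y+RtoC (dl/2))%C).
    have Ez: (z-y)%C = RtoC (dl/2) by (unfold z; ring).
    have HRe: Re z = y+dl/2 by (unfold z; rewrite re_plus, !re_RtoC; auto). exists (Some (Cexp z)). split.
    -- apply Ub_cons. split; [apply (AA_exp true); rewrite HRe; lra|]. apply VV_Ub. rewrite F_1 by (rewrite HRe; lra).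
     apply V0_ball_lt. rewrite Cmod_Cexp, <- exp_lo. apply exp_increasing.
      have S1: gstrip n lc g 1 z by (apply strip_1; rewrite HRe; lra).
      have HL := Lam_diff 1 z (y) ltac:(lia) S1 (y_strip g ltac:(lra)).
      rewrite Ez, Cmod_pos_R, (rs_L1 RS), (rs_m1 RS) in HL by lra.
       have HR := Re_le_Cmod (Lam 1 z-RtoC (ln (q-T))-RtoC (- INR d1)*RtoC (dl/2))%C.
      rewrite !Re_minus, re_scal_l, !re_RtoC in HR. destruct e_small as [_ He].
      have: e*(dl/2) <= 1*(dl/2) by mono. have: 2*(dl/2) <= INR d1*(dl/2) by mono. lra.
    -- replace (RtoC p) with (Cexp (y)) by apply Cexp_R. rewrite chordal_sym. eapply Rle_lt_trans; [apply chordal_le|].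
      specialize (Hc z). rewrite Ez, Cmod_pos_R in Hc by lra. lra.
   * set (dl := Rmin ((q-T)/2) (r/4)). have Hdl: 0 < dl by (apply Rmin_glb_lt; lra).
    have B1: dl <= (q-T)/2 by apply Rmin_l. have B2: dl <= r/4 by apply Rmin_r.
    exists (Some (T+RtoC (q-T-dl))%C). split.
    -- apply VV_Ub, V0_ball_lt. rewrite Cmod_pos_R; lra.
    -- eapply Rle_lt_trans; [apply chordal_le|].
      replace (q-(T+RtoC (q-T-dl)))%C with (RtoC dl) by (rewrite !RtoC_minus; ring). rewrite Cmod_pos_R; lra.
 - intros P HP. have [[k Hk] _] := HP. destruct (level k b P HP Hk) as (Hb&r1&Hr1&H1), (basin_uniform P k Hk) as
  (r2&Hr2&_&H2).
  exists (Rmin r1 r2). split; [apply Rmin_glb_lt; auto|]. split.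
  { intros Q HQ. rewrite <- Hb. apply YY_Ub, H1. eapply Rlt_le_trans; [exact HQ|apply Rmin_l]. }
  intros r Hr. destruct (H2 r Hr) as [K HK]. exists (k+K)%nat. intros j Hj Q HQ. have HQ2 := lt_min_r HQ.
  destruct (Nat.Even_or_Odd k) as [[l El]|[l El]].
  + have Eb: b = false. { rewrite <- Hb, El, Nat.odd_mul. auto. } rewrite Eb.
   destruct (HK (j-l)%nat Q ltac:(lia) HQ2) as [H3 _]. replace (k+2*(j-l))%nat with (2*j)%nat in H3 by lia. auto.
  + have Eb: b = true. { rewrite <- Hb, El, Nat.odd_add, Nat.odd_mul. auto. } rewrite Eb.
   destruct (HK (j-l-1)%nat Q ltac:(lia) HQ2) as [_ H3]. replace (k+S (2*(j-l-1)))%nat with (2*j)%nat in H3 by lia. auto.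
Qed.

Theorem rat_sys_conclusion : cantor_circles (Julia F) /\ parabolic_2orbit F /\
 exists U1 U2 : sphere -> Prop, ~ set_eq U1 U2 /\ Fatou_component F U1 /\ Fatou_component F U2 /\
  simply_connected U1 /\ simply_connected U2 /\ period_two_comp F U1 /\ period_two_comp F U2 /\
  parabolic_comp2 F U1 /\ parabolic_comp2 F U2.
Proof.
 split; [apply Julia_cantor_circles|]. split; [apply parabolic_orbit|]. exists (Ub false), (Ub true).
 split; [intros E; apply (Ub_disjoint false None); [apply E|]; apply (YY_Ub 1), YY1_None|].
 repeat (split; [first [apply Ub_component|apply Ub_simply_connected|apply Ub_period_two|apply Ub_parabolic]|]).
 apply Ub_parabolic.
Qed.

End RationalSystem.

Theorem theorem1p4 (n : nat) (d : nat -> nat) :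
  (3 <= n)%nat -> Nat.odd n = true ->
  (forall i, (1 <= i <= n)%nat -> (0 < d i)%nat) ->
  sum_upto (fun i => / INR (d i)) n < 1 ->
  exists s0, 0 < s0 /\
    forall s, 0 < s < s0 ->
      exists Sn Tn : Cx, Sn <> C0 /\
        cantor_circles (Julia (Rmap n d s Sn Tn)) /\
        parabolic_2orbit (Rmap n d s Sn Tn) /\
        exists U1 U2 : sphere -> Prop,
          ~ set_eq U1 U2 /\
          Fatou_component (Rmap n d s Sn Tn) U1 /\
          Fatou_component (Rmap n d s Sn Tn) U2 /\
          simply_connected U1 /\ simply_connected U2 /\
          period_two_comp (Rmap n d s Sn Tn) U1 /\
          period_two_comp (Rmap n d s Sn Tn) U2 /\
          parabolic_comp2 (Rmap n d s Sn Tn) U1 /\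
          parabolic_comp2 (Rmap n d s Sn Tn) U2.
Proof.
  intros Hn Hodd Hd Hsum.
  (* A single exponent equal to 1 would already make the sum of the reciprocals at least 1.
     Exponents of at least 2 are what makes every branch contract. *)
  assert (Hd2 : forall i, (1 <= i <= n)%nat -> (2 <= d i)%nat).
  { intros i Hi. destruct (Nat.eq_dec (d i) 1) as [E|E]; [|specialize (Hd i Hi); lia].
    exfalso. pose proof (sum_upto_bound (fun i => / INR (d i)) n i) as H. cbv beta in H.
    rewrite E, INR_1, Rinv_1 in H. assert (1 <= sum_upto (fun i => / INR (d i)) n); [|lra].
    apply H; [|exact Hi]. intros j Hj. apply Rinv_0_lt_compat, lt_0_INR, Hd, Hj. }
  destruct (rat_sys_exists n d Hn Hodd Hd2 Hsum) as [s0 [Hs0 H]]. exists s0. split; [exact Hs0|].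
  intros s Hs. destruct (H s Hs) as [S0 [T [x [y [g [HS RS]]]]]].
  exists (RtoC S0), (RtoC T). split; [|exact (rat_sys_conclusion RS)].
  intros E. injection E. lra.
Qed.
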